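(* Let $n,d\in\mathbb N$ and $R,X,Y,Z$ as in the context. There exists a $(\mathbb Z^2,\mu)$-graded-2-functor (the graded foamation 2-functor) $$\mathcal F_{n,d}\colon\mathcal{GS}_{n,d}\to\mathbf{GFoam}_d$$ from the graded 2-Schur algebra to graded $\mathfrak{gl}_2$-foams, given on objects by $\lambda\mapsto\underline\lambda$ (delete zero entries) and on generating 1- and 2-morphisms as follows. Write $c=1+\sum_{a<i}\lambda_a$ and $\Gamma_\lambda(i)=(-XY)^{\#\{j\le i\,:\,\lambda_j=1\}}$. *1-morphisms.* $\mathsf F_i1_\lambda\mapsto \mathrm{id},\ W_{c,-},\ W_{c,+},\ W_{c+1,+}W_{c,-}$ for $(\lambda_i,\lambda_{i+1})=(1,0),(2,0),(1,1),(2,1)$ respectively. $\mathsf E_i1_\lambda\mapsto\mathrm{id},\ W_{c,-},\ W_{c,+},\ W_{c,+}W_{c+1,-}$ for $(\lambda_i,\lambda_{i+1})=(0,1),(0,2),(1,1),(1,2)$ respectively. *Dots.* $x_{i,\lambda}\mapsto\Gamma_\lambda(i)$ times $d_c,\ d_{c+1}W_{c,-},\ W_{c,+}d_c,\ W_{c+1,+}d_{c+1}W_{c,-}$ for $(\lambda_i,\lambda_{i+1})=(1,0),(2,0),(1,1),(2,1)$. *Cups.* $\eta_{i,\lambda}\mapsto \mathrm{id},\ Z^{-2}\mathrm{cup}_c,\ \mathrm{zip}_c,\ Z^{-1}(W_{c,+}\mathrm{zip}_{c+1}W_{c,-})\circ\mathrm{cup}_c$ for $(\lambda_i,\lambda_{i+1})=(1,0),(2,0),(1,1),(2,1)$.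 *Caps.* $\varepsilon_{i,\lambda}\mapsto\mathrm{id},\ \mathrm{cap}_c,\ \mathrm{unzip}_c,\ \mathrm{cap}_{c+1}\circ(W_{c+1,+}\mathrm{unzip}_cW_{c+1,-})$ for $(\lambda_i,\lambda_{i+1})=(0,1),(0,2),(1,1),(1,2)$. *Crossings.* $\tau_{i,i-1,\lambda}\mapsto \mathrm{unzip}_{c-1},\ \mathrm{unzip}_{c-1}W_{c-2,-},\ W_{c,+}\mathrm{unzip}_{c-1},\ \chi\circ(W_{c,+}\mathrm{unzip}_{c-1}W_{c-2,-})$ for $(\lambda_{i-1},\lambda_i,\lambda_{i+1})=(1,1,0),(2,1,0),(1,1,1),(2,1,1)$, where $\chi\colon W_{c,+}W_{c-2,-}\to W_{c-2,-}W_{c,+}$ is the foam crossing; $\tau_{i-1,i,\lambda}\mapsto\Gamma_\lambda(i)$ times $\mathrm{zip}_{c-1},\ \mathrm{zip}_{c-1}W_{c-2,-},\ W_{c,+}\mathrm{zip}_{c-1},\ (W_{c,+}\mathrm{zip}_{c-1}W_{c-2,-})\circ\chi^{-1}$ in the same four cases; $\tau_{i,i,\lambda}\mapsto(-XY)\Gamma_\lambda(i)\,\mathrm{cup}_c\circ\mathrm{cap}_c$ (here $(\lambda_i,\lambda_{i+1})=(2,0)$); and for $|i-j|>1$, $\tau_{i,j,\lambda}$ is sent to the composite of foam crossings exchanging the words assigned to $\mathsf F_i$ and $\mathsf F_j$ (the identity if one of the words is empty). In all cases not listed the generator is zero in $\mathcal{GS}_{n,d}$.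
   Context: **Ground data.** $R$ is a commutative ring with fixed invertible elements $X,Y,Z\in R^\times$ such that $X^2=Y^2=1$, and $\mu\colon\mathbb Z^2\times\mathbb Z^2\to R^\times$ is $\mu((a,b),(c,d))=X^{ac}Y^{bd}Z^{ad-bc}$. **Graded-2-categories.** A $(\mathbb Z^2,\mu)$-graded-2-category consists of objects; 1-morphisms with an associative unital composition, written by juxtaposition ($fg$ means first $g$, then $f$); and, for parallel 1-morphisms, a $\mathbb Z^2$-graded $R$-module of 2-morphisms, with an associative, unital, $R$-bilinear, degree-additive vertical composition $\circ$, and an associative, unital, $R$-bilinear, degree-additive horizontal composition (juxtaposition) preserving identities, satisfying the graded interchange law $(\alpha\beta)\circ(\gamma\delta)=\mu(\deg\beta,\deg\gamma)\,(\alpha\circ\gamma)(\beta\circ\delta)$ for homogeneous 2-morphisms. A 1-morphism also denotes its identity 2-morphism. A $(\mathbb Z^2,\mu)$-graded-2-functor preserves all this structure strictly ($R$-linear and degree-preserving on 2-morphisms). **Weights and webs.** $\underline\Lambda_d$ is the set of finite sequences $\lambda=(\lambda_1,\dots,\lambda_k)$ ($k$ arbitrary) with entries in $\{1,2\}$ and sum $d$. The colour of the $a$-th coordinate of $\lambda$ is $1+\sum_{b<a}\lambda_b$. If $\lambda$ has a coordinate equal to $2$ of colour $i$, and $\lambda'$ is obtained by replacing it with two consecutive coordinates $1,1$ (of colours $i,i+1$), there are generating webs $W_{i,-}\colon\lambda\to\lambda'$ and $W_{i,+}\colon\lambda'\to\lambda$. A web is an identity or a composable word in generating webs. **Graded foams**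 (in their string-diagrammatic presentation). $\mathbf{GFoam}_d$ is the $(\mathbb Z^2,\mu)$-graded-2-category with objects $\underline\Lambda_d$, 1-morphisms webs (words, with no relations), and 2-morphisms generated by the following, for all weights $\lambda$ for which they make sense: - dot $d_i\colon\mathrm{id}_\lambda\to\mathrm{id}_\lambda$, when $\lambda$ has a coordinate equal to $1$ of colour $i$; degree $(1,1)$; - $\mathrm{cup}_i\colon\mathrm{id}_\lambda\to W_{i,+}W_{i,-}$, degree $(0,-1)$; $\mathrm{cap}_i\colon W_{i,+}W_{i,-}\to\mathrm{id}_\lambda$, degree $(-1,0)$; - $\mathrm{zip}_i\colon\mathrm{id}_\lambda\to W_{i,-}W_{i,+}$, degree $(1,0)$; $\mathrm{unzip}_i\colon W_{i,-}W_{i,+}\to\mathrm{id}_\lambda$, degree $(0,1)$; - crossings $W_{i,s}W_{j,t}\to W_{j,t}W_{i,s}$ for $|i-j|>1$, $s,t\in\{+,-\}$; degree $(0,0)$. The relations, imposed whenever all terms make sense, are: 1. a crossing followed by the reverse crossing is the identity; crossings satisfy the braid (Yang–Baxter) relation; crossings are compatible with $g\in\{\mathrm{cup}_j,\mathrm{cap}_j,\mathrm{zip}_j,\mathrm{unzip}_j\}$ and $W_{i,s}$, $|i-j|>1$: sliding the strand $W_{i,s}$ through $g$ (using crossings with the strands in the source and target of $g$) identifies $g\,W_{i,s}$ with $W_{i,s}\,g$, with no scalar; 2. $d_jW_{i,s}=W_{i,s}d_j$ for $j\ne i,i+1$; $d_i\circ d_i=0$; $d_iW_{i,-}=d_{i+1}W_{i,-}$;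 3. $(\mathrm{cap}_iW_{i,+})\circ(W_{i,+}\mathrm{zip}_i)=\mathrm{id}$; $(W_{i,-}\mathrm{cap}_i)\circ(\mathrm{zip}_iW_{i,-})=X\,\mathrm{id}$; $(\mathrm{unzip}_iW_{i,-})\circ(W_{i,-}\mathrm{cup}_i)=Z^2\,\mathrm{id}$; $(W_{i,+}\mathrm{unzip}_i)\circ(\mathrm{cup}_iW_{i,+})=YZ^2\,\mathrm{id}$; 4. $\mathrm{cap}_i\circ(W_{i,+}d_iW_{i,-})\circ\mathrm{cup}_i=\mathrm{id}$; $\mathrm{cap}_i\circ\mathrm{cup}_i=0$; $\mathrm{unzip}_i\circ\mathrm{zip}_i=Z\,d_i+XYZ\,d_{i+1}$; 5. $\mathrm{id}_{W_{i,+}W_{i,-}}=(W_{i,+}d_iW_{i,-})\circ\mathrm{cup}_i\circ\mathrm{cap}_i+\mathrm{cup}_i\circ\mathrm{cap}_i\circ(W_{i,+}d_iW_{i,-})$; 6. $\mathrm{id}_{W_{i,+}W_{i+1,-}W_{i+1,+}W_{i,-}}=Z^{-1}(W_{i,+}\mathrm{zip}_{i+1}W_{i,-})\circ\mathrm{cup}_i\circ\mathrm{cap}_i\circ(W_{i,+}\mathrm{unzip}_{i+1}W_{i,-})$. **The graded 2-Schur algebra $\mathcal{GS}_{n,d}$.** $\Lambda_{n,d}=\{\lambda\in\{0,1,2\}^n:\sum\lambda_i=d\}$; $\alpha_i=(0,\dots,1,-1,\dots,0)$ with $1$ in position $i$ ($1\le i\le n-1$); $\overline\lambda_i=\lambda_i-\lambda_{i+1}$;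 $p_{ij}=((\alpha_j)_{i+1},-(\alpha_j)_i)$, i.e. $p_{ij}=(0,1),(-1,-1),(1,0)$ for $j=i-1,i,i+1$ and $(0,0)$ otherwise. $\mathcal{GS}_{n,d}$ is the $(\mathbb Z^2,\mu)$-graded-2-category with objects $\Lambda_{n,d}$; 1-morphisms composable words in $\mathsf F_i1_\lambda\colon\lambda\to\lambda-\alpha_i$ and $\mathsf E_i1_\lambda\colon\lambda\to\lambda+\alpha_i$ (all weights in $\Lambda_{n,d}$; any expression involving a weight outside $\Lambda_{n,d}$ is zero: ''Schur quotient''); 2-morphisms generated by - $\eta_{i,\lambda}\colon1_\lambda\to\mathsf E_i\mathsf F_i1_\lambda$, degree $(\lambda_{i+1},-\lambda_i)+(0,1)$; $\varepsilon_{i,\lambda}\colon\mathsf F_i\mathsf E_i1_\lambda\to1_\lambda$, degree $-(\lambda_{i+1},-\lambda_i)+(1,0)$; - $x_{i,\lambda}\colon\mathsf F_i1_\lambda\to\mathsf F_i1_\lambda$, degree $(1,1)$; $\tau_{i,j,\lambda}\colon\mathsf F_i\mathsf F_j1_\lambda\to\mathsf F_j\mathsf F_i1_\lambda$, degree $p_{ij}$; subject to the following relations (weights omitted): (a) $x_i\circ x_i=0$. (b) $\tau_{ji}\circ\tau_{ij}$ equals $0$ if $i=j$; $\mathrm{id}$ if $|i-j|>1$; $-XYZ\,x_i\mathsf F_j+XYZ\,\mathsf F_ix_j$ if $j=i+1$; $YZ^2\,x_i\mathsf F_j-YZ^2\,\mathsf F_ix_j$ if $j=i-1$. (c) For $i\ne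 j$: $(x_j\mathsf F_i)\circ\tau_{ij}=\mu((1,1),p_{ij})\,\tau_{ij}\circ(\mathsf F_ix_j)$ and $\tau_{ij}\circ(x_i\mathsf F_j)=\mu(p_{ij},(1,1))\,(\mathsf F_jx_i)\circ\tau_{ij}$. (d) $(x_i\mathsf F_i)\circ\tau_{ii}-XY\,\tau_{ii}\circ(\mathsf F_ix_i)=\mathrm{id}=\tau_{ii}\circ(x_i\mathsf F_i)-XY\,(\mathsf F_ix_i)\circ\tau_{ii}$. (e) Unless $i=k$ and $|i-j|=1$: $(\tau_{jk}\mathsf F_i)\circ(\mathsf F_j\tau_{ik})\circ(\tau_{ij}\mathsf F_k)=\mu(p_{jk},p_{ij})\mu(p_{ik},p_{ij})\mu(p_{jk},p_{ik})\,(\mathsf F_k\tau_{ij})\circ(\tau_{ik}\mathsf F_j)\circ(\mathsf F_i\tau_{jk})$. (f) With $j=i+1$: $-YZ^{-2}(\tau_{ji}\mathsf F_i)\circ(\mathsf F_j\tau_{ii})\circ(\tau_{ij}\mathsf F_i)+Z^{-1}(\mathsf F_i\tau_{ij})\circ(\tau_{ii}\mathsf F_j)\circ(\mathsf F_i\tau_{ji})=\mathrm{id}_{\mathsf F_i\mathsf F_j\mathsf F_i}$. (g) With $j=i-1$: $XYZ^{-1}(\tau_{ji}\mathsf F_i)\circ(\mathsf F_j\tau_{ii})\circ(\tau_{ij}\mathsf F_i)-XZ^{-2}(\mathsf F_i\tau_{ij})\circ(\tau_{ii}\mathsf F_j)\circ(\mathsf F_i\tau_{ji})=\mathrm{id}_{\mathsf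 F_i\mathsf F_j\mathsf F_i}$. (h) $(\varepsilon_i\mathsf F_i)\circ(\mathsf F_i\eta_{i,\lambda})=\mathrm{id}_{\mathsf F_i1_\lambda}$ and $X^{1+\lambda_{i+1}}Y^{\lambda_i}(\mathsf E_i\varepsilon_{i,\lambda})\circ(\eta_{i,\lambda+\alpha_i}\mathsf E_i)=\mathrm{id}_{\mathsf E_i1_\lambda}$. (i) Invertibility: let $\sigma_{ij}=(\mathsf E_j\mathsf F_i\varepsilon_j)\circ(\mathsf E_j\tau_{ji}\mathsf E_j)\circ(\eta_j\mathsf F_i\mathsf E_j)\colon\mathsf F_i\mathsf E_j1_\lambda\to\mathsf E_j\mathsf F_i1_\lambda$. One universally adjoins (homogeneous) inverses, in the additive closure with quantum shifts, of: $\sigma_{ij}$ for $i\neq j$; if $\overline\lambda_i\ge0$, the map $\mathsf F_i\mathsf E_i1_\lambda\oplus1_\lambda^{\oplus\overline\lambda_i}\to\mathsf E_i\mathsf F_i1_\lambda$ with entries $\sigma_{ii}$ and $(\mathsf E_ix_i^m)\circ\eta_{i,\lambda}$, $0\le m\le\overline\lambda_i-1$; if $\overline\lambda_i\le0$, the map $\mathsf F_i\mathsf E_i1_\lambda\to\mathsf E_i\mathsf F_i1_\lambda\oplus1_\lambda^{\oplus-\overline\lambda_i}$ with entries $\sigma_{ii}$ and $\varepsilon_{i,\lambda}\circ(x_i^m\mathsf E_i)$, $0\le m\le-\overline\lambda_i-1$ (terms through weights outside $\Lambda_{n,d}$ are zero objects and are omitted). That is, one adds new generating 2-morphisms, the entries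 of the inverse matrices (of $\mathbb Z^2$-degree opposite to the corresponding entries), and the relations saying that these matrices are inverse. *)

(* Defs.v *)
From HB Require Import structures.
From mathcomp Require Import all_boot all_order all_algebra.
From mathcomp Require Import boolp.

Set Implicit Arguments.
Unset Strict Implicit.
Unset Printing Implicit Defensive.
Import GRing.Theory.
Local Open Scope ring_scope.

Definition Z2 : zmodType := (int * int)%type.
Definition dg (a b : int) : Z2 := (a, b).

(* [comPzRingType] is the structure of all commutative rings, the zero ring
   included; it has no unit predicate, so the inverse of Z is part of the data
   (X and Y are their own inverses). *)
Record ground (R : comPzRingType) := Ground {
  gX : R; gY : R; gZ : R; gZi : R;
  gXX : gX * gX = 1;
  gYY : gY * gY = 1;
  gZK : gZ * gZi = 1 }.

(* integer powers of a unit [u] with inverse [v] *)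
Definition zpow (R : comPzRingType) (u v : R) (m : int) : R :=
  match m with Posz k => u ^+ k | Negz k => v ^+ k.+1 end.

Definition bichar (R : comPzRingType) (K : ground R) (p q : Z2) : R :=
  zpow (gX K) (gX K) (p.1 * q.1) * zpow (gY K) (gY K) (p.2 * q.2)
  * zpow (gZ K) (gZi K) (p.1 * q.2 - p.2 * q.1).

(** * Graded-2-categories and graded-2-functors *)

(* A Z^2-graded module is given by the family of its homogeneous components.
   [comp1 f g] and [hcomp a b] are the juxtapositions fg and ab;
   [vcomp a b] is "a after b". *)
Record gr2data (R : comPzRingType) := Gr2Data {
  ob :> Type;
  hom1 : ob -> ob -> Type;
  id1 : forall a, hom1 a a;
  comp1 : forall a b c, hom1 b c -> hom1 a b -> hom1 a c;
  hom2 : forall a b, hom1 a b -> hom1 a b -> Z2 -> lmodType R;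
  vid : forall a b (f : hom1 a b), hom2 f f 0;
  vcomp : forall a b (f g h : hom1 a b) (p q : Z2),
    hom2 g h p -> hom2 f g q -> hom2 f h (p + q);
  hcomp : forall a b c (f g : hom1 b c) (f' g' : hom1 a b) (p q : Z2),
    hom2 f g p -> hom2 f' g' q -> hom2 (comp1 f f') (comp1 g g') (p + q) }.

(* Equality of 2-morphisms whose sources, targets and degrees are equal but
   not convertible: equality in the total space of all 2-morphisms. *)
Definition tot2 (R : comPzRingType) (C : gr2data R) (a b : C) : Type :=
  {k : hom1 a b * hom1 a b * Z2 & hom2 k.1.1 k.1.2 k.2}.

Definition arr2 (R : comPzRingType) (C : gr2data R) (a b : C)
    (f g : hom1 a b) (p : Z2) (x : hom2 f g p) : tot2 a b :=
  existT (fun k : hom1 a b * hom1 a b * Z2 => hom2 k.1.1 k.1.2 k.2 : Type)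
         (f, g, p) x.

Notation "x =~ y" := (arr2 x = arr2 y) (at level 70, no associativity).

Record gr2laws (R : comPzRingType) (mu : Z2 -> Z2 -> R) (C : gr2data R) : Prop :=
  Gr2Laws {
  comp1A : forall (a b c e : C) (f : hom1 c e) (g : hom1 b c) (h : hom1 a b),
    comp1 f (comp1 g h) = comp1 (comp1 f g) h;
  comp1l : forall (a b : C) (f : hom1 a b), comp1 (id1 b) f = f;
  comp1r : forall (a b : C) (f : hom1 a b), comp1 f (id1 a) = f;
  vcompA : forall (a b : C) (f g h k : hom1 a b) (p q r : Z2)
      (x : hom2 h k p) (y : hom2 g h q) (z : hom2 f g r),
    vcomp x (vcomp y z) =~ vcomp (vcomp x y) z;
  vcompl : forall (a b : C) (f g : hom1 a b) (p : Z2) (x : hom2 f g p),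
    vcomp (vid g) x =~ x;
  vcompr : forall (a b : C) (f g : hom1 a b) (p : Z2) (x : hom2 f g p),
    vcomp x (vid f) =~ x;
  vcomp_linl : forall (a b : C) (f g h : hom1 a b) (p q : Z2) (r : R)
      (x x' : hom2 g h p) (y : hom2 f g q),
    vcomp (r *: x + x') y = r *: vcomp x y + vcomp x' y;
  vcomp_linr : forall (a b : C) (f g h : hom1 a b) (p q : Z2) (r : R)
      (x : hom2 g h p) (y y' : hom2 f g q),
    vcomp x (r *: y + y') = r *: vcomp x y + vcomp x y';
  hcompA : forall (a b c e : C) (f g : hom1 c e) (f' g' : hom1 b c)
      (f'' g'' : hom1 a b) (p q r : Z2)
      (x : hom2 f g p) (y : hom2 f' g' q) (z : hom2 f'' g'' r),
    hcomp x (hcomp y z) =~ hcomp (hcomp x y) z;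
  hcompl : forall (a b : C) (f g : hom1 a b) (p : Z2) (x : hom2 f g p),
    hcomp (vid (id1 b)) x =~ x;
  hcompr : forall (a b : C) (f g : hom1 a b) (p : Z2) (x : hom2 f g p),
    hcomp x (vid (id1 a)) =~ x;
  hcomp_linl : forall (a b c : C) (f g : hom1 b c) (f' g' : hom1 a b)
      (p q : Z2) (r : R) (x x' : hom2 f g p) (y : hom2 f' g' q),
    hcomp (r *: x + x') y = r *: hcomp x y + hcomp x' y;
  hcomp_linr : forall (a b c : C) (f g : hom1 b c) (f' g' : hom1 a b)
      (p q : Z2) (r : R) (x : hom2 f g p) (y y' : hom2 f' g' q),
    hcomp x (r *: y + y') = r *: hcomp x y + hcomp x y';
  hcomp_vid : forall (a b c : C) (f : hom1 b c) (g : hom1 a b),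
    hcomp (vid f) (vid g) =~ vid (comp1 f g);
  interchange : forall (a b c : C) (f g h : hom1 b c) (f' g' h' : hom1 a b)
      (p q r s : Z2) (x : hom2 g h p) (y : hom2 g' h' q)
      (z : hom2 f g r) (t : hom2 f' g' s),
    vcomp (hcomp x y) (hcomp z t) =~ mu q r *: hcomp (vcomp x z) (vcomp y t) }.

Record gr2cat (R : comPzRingType) (mu : Z2 -> Z2 -> R) := Gr2Cat {
  gr2_data :> gr2data R;
  gr2_laws : gr2laws mu gr2_data }.

Record gr2functor (R : comPzRingType) (mu : Z2 -> Z2 -> R) (C D : gr2cat mu) :=
  Gr2Functor {
  fob :> C -> D;
  fhom1 : forall a b : C, hom1 a b -> hom1 (fob a) (fob b);
  fhom2 : forall (a b : C) (f g : hom1 a b) (p : Z2),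
    hom2 f g p -> hom2 (fhom1 f) (fhom1 g) p;
  fhom1_id : forall a : C, fhom1 (id1 a) = id1 (fob a);
  fhom1_comp : forall (a b c : C) (f : hom1 b c) (g : hom1 a b),
    fhom1 (comp1 f g) = comp1 (fhom1 f) (fhom1 g);
  fhom2_lin : forall (a b : C) (f g : hom1 a b) (p : Z2) (r : R)
      (x y : hom2 f g p),
    fhom2 (r *: x + y) = r *: fhom2 x + fhom2 y;
  fhom2_vid : forall (a b : C) (f : hom1 a b), fhom2 (vid f) = vid (fhom1 f);
  fhom2_vcomp : forall (a b : C) (f g h : hom1 a b) (p q : Z2)
      (x : hom2 g h p) (y : hom2 f g q),
    fhom2 (vcomp x y) = vcomp (fhom2 x) (fhom2 y);
  fhom2_hcomp : forall (a b c : C) (f g : hom1 b c) (f' g' : hom1 a b)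
      (p q : Z2) (x : hom2 f g p) (y : hom2 f' g' q),
    fhom2 (hcomp x y) =~ hcomp (fhom2 x) (fhom2 y) }.

(** * Graded-2-categories given by generators and relations *)

(* [step l a b]: the letter [l] is a generating 1-morphism from [a] to [b];
   in all signatures below, [b] is determined by [l] and [a].
   [gbd x a u v p]: the generating 2-morphism [x], taken at the source object
   [a], goes from the word [u] to the word [v] and has degree [p]. *)
Record signature := Signature {
  sob : Type;
  lett : Type;
  step : lett -> sob -> sob -> Prop;
  gen : Type;
  gbd : gen -> sob -> seq lett -> seq lett -> Z2 -> Prop }.

(* Words are read from right to left, as composites are. *)
Fixpoint wpath (S : signature) (w : seq (lett S)) (a b : sob S) : Prop :=
  if w is l :: w' then exists2 c, wpath w' a c & step l c b else a = b.

Inductive raw (R : Type) (S : signature) :=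
| Gen of gen S
| Id of seq (lett S)
| Vc of raw R S & raw R S
| Hc of raw R S & raw R S
| Zero
| Add of raw R S & raw R S
| Scale of R & raw R S.

Arguments Gen {R S} _.
Arguments Id {R S} _.
Arguments Zero {R S}.

Notation "a \v b" := (Vc a b) (at level 42, left associativity).
Notation "a \h b" := (Hc a b) (at level 39, left associativity).

(* [typed a b u v p t]: [t] is a homogeneous 2-morphism of degree [p] from
   [u] to [v], which are words from [a] to [b]. *)
Inductive typed (R : Type) (S : signature) :
    sob S -> sob S -> seq (lett S) -> seq (lett S) -> Z2 -> raw R S -> Prop :=
| typed_gen a b u v p x :
    gbd x a u v p -> wpath u a b -> wpath v a b -> typed a b u v p (Gen x)
| typed_id a b u : wpath u a b -> typed a b u u 0 (Id u)
| typed_vc a b u v w p q s t :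
    typed a b v w p s -> typed a b u v q t -> typed a b u w (p + q) (s \v t)
| typed_hc a b c u v u' v' p q s t :
    typed b c u v p s -> typed a b u' v' q t ->
    typed a c (u ++ u') (v ++ v') (p + q) (s \h t)
| typed_zero a b u v p : wpath u a b -> wpath v a b -> typed a b u v p Zero
| typed_add a b u v p s t :
    typed a b u v p s -> typed a b u v p t -> typed a b u v p (Add s t)
| typed_scale a b u v p r t :
    typed a b u v p t -> typed a b u v p (Scale r t).

(* The laws of a graded-2-category other than interchange. *)
Inductive law (R : comPzRingType) (S : signature) : raw R S -> raw R S -> Prop :=
| law_addA s t u : law (Add s (Add t u)) (Add (Add s t) u)
| law_addC s t : law (Add s t) (Add t s)
| law_add0 t : law (Add Zero t) t
| law_addN t : law (Add (Scale (-1) t) t) Zero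
| law_scaleA r r' t : law (Scale r (Scale r' t)) (Scale (r * r') t)
| law_scale1 t : law (Scale 1 t) t
| law_scaleDr r s t : law (Scale r (Add s t)) (Add (Scale r s) (Scale r t))
| law_scaleDl r r' t : law (Scale (r + r') t) (Add (Scale r t) (Scale r' t))
| law_vcA s t u : law (s \v (t \v u)) (s \v t \v u)
| law_vc1l w t : law (Id w \v t) t
| law_vc1r w t : law (t \v Id w) t
| law_vcDl s s' t : law (Add s s' \v t) (Add (s \v t) (s' \v t))
| law_vcDr s t t' : law (s \v Add t t') (Add (s \v t) (s \v t'))
| law_vcZl r s t : law (Scale r s \v t) (Scale r (s \v t))
| law_vcZr r s t : law (s \v Scale r t) (Scale r (s \v t))
| law_hcA s t u : law (s \h (t \h u)) (s \h t \h u)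
| law_hc1l t : law (Id [::] \h t) t
| law_hc1r t : law (t \h Id [::]) t
| law_hcDl s s' t : law (Add s s' \h t) (Add (s \h t) (s' \h t))
| law_hcDr s t t' : law (s \h Add t t') (Add (s \h t) (s \h t'))
| law_hcZl r s t : law (Scale r s \h t) (Scale r (s \h t))
| law_hcZr r s t : law (s \h Scale r t) (Scale r (s \h t))
| law_hcI u v : law (Id u \h Id v) (Id (u ++ v)).

(* [rels a s t]: the relation s = t is imposed on 2-morphisms between
   1-morphisms with source [a], provided that both sides make sense. *)
Record presentation (R : comPzRingType) := Presentation {
  psig :> signature;
  rels : sob psig -> raw R psig -> raw R psig -> Prop }.

Inductive eqv (R : comPzRingType) (mu : Z2 -> Z2 -> R) (P : presentation R) :
    sob P -> sob P -> seq (lett P) -> seq (lett P) -> Z2 ->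
    raw R P -> raw R P -> Prop :=
| eqv_refl a b u v p t : typed a b u v p t -> eqv mu a b u v p t t
| eqv_sym a b u v p s t : eqv mu a b u v p s t -> eqv mu a b u v p t s
| eqv_trans a b u v p s t t' :
    eqv mu a b u v p s t -> eqv mu a b u v p t t' -> eqv mu a b u v p s t'
| eqv_vc a b u v w p q s s' t t' :
    eqv mu a b v w p s s' -> eqv mu a b u v q t t' ->
    eqv mu a b u w (p + q) (s \v t) (s' \v t')
| eqv_hc a b c u v u' v' p q s s' t t' :
    eqv mu b c u v p s s' -> eqv mu a b u' v' q t t' ->
    eqv mu a c (u ++ u') (v ++ v') (p + q) (s \h t) (s' \h t')
| eqv_add a b u v p s s' t t' :
    eqv mu a b u v p s s' -> eqv mu a b u v p t t' ->
    eqv mu a b u v p (Add s t) (Add s' t')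
| eqv_scale a b u v p r t t' :
    eqv mu a b u v p t t' -> eqv mu a b u v p (Scale r t) (Scale r t')
| eqv_law a b u v p s t :
    law s t -> typed a b u v p s -> typed a b u v p t -> eqv mu a b u v p s t
| eqv_interchange a b c u v w u' v' w' p q r s x y z t :
    typed b c v w p x -> typed a b v' w' q y ->
    typed b c u v r z -> typed a b u' v' s t ->
    eqv mu a c (u ++ u') (w ++ w') (p + q + (r + s))
      ((x \h y) \v (z \h t)) (Scale (mu q r) ((x \v z) \h (y \v t)))
| eqv_rel a b u v p s t :
    rels a s t -> typed a b u v p s -> typed a b u v p t ->
    eqv mu a b u v p s t.

Section Presented.
Variables (R : comPzRingType) (mu : Z2 -> Z2 -> R) (P : presentation R).
Implicit Types (a b c : sob P) (u v w : seq (lett P)) (p q : Z2) (t : raw R P).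

Lemma wpath_cat w w' a b c : wpath w b c -> wpath w' a b -> wpath (w ++ w') a c.
Proof.
elim: w c => [|l w IH] z /=; first by move=> ->.
by move=> [e we se] w'e; exists e => //; apply: IH.
Qed.

Lemma typed_wpath a b u v p t :
  typed a b u v p t -> wpath u a b /\ wpath v a b.
Proof.
elim=> {a b u v p t} //.
- by move=> a b u v w p q s t _ [_ ?] _ [? _].
- move=> a b c u v u' v' p q s t _ [? ?] _ [? ?].
  by split; apply: wpath_cat; eassumption.
Qed.

Lemma eqv_typed a b u v p s t :
  eqv mu a b u v p s t -> typed a b u v p s /\ typed a b u v p t.
Proof.
elim=> {a b u v p s t}.
- by [].
- by move=> a b u v p s t _ [].
- by move=> a b u v p s t t' _ [? _] _ [_ ?].
- move=> a b u v w p q s s' t t' _ [? ?] _ [? ?].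
  by split; apply: typed_vc; eassumption.
- move=> a b c u v u' v' p q s s' t t' _ [? ?] _ [? ?].
  by split; apply: typed_hc; eassumption.
- by move=> a b u v p s s' t t' _ [? ?] _ [? ?]; split; apply: typed_add.
- by move=> a b u v p r t t' _ [? ?]; split; apply: typed_scale.
- by move=> a b u v p s t _ ? ?; split.
- move=> a b c u v w u' v' w' p q r s x y z t tx ty tz tt; split.
    by apply: typed_vc; apply: typed_hc; eassumption.
  rewrite addrACA; apply: typed_scale.
  by apply: typed_hc; apply: typed_vc; eassumption.
- by move=> a b u v p s t _ ? ?; split.
Qed.

(* The 2-morphisms from [u] to [v] of degree [p]: equivalence classes of
   well-typed terms, represented as predicates. *)
Definition qhom a b u v p : Type :=
  {S : raw R P -> Prop | exists2 t, typed a b u v p t & S = eqv mu a b u v p t}.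

Definition cls a b u v p t (tt : typed a b u v p t) : qhom a b u v p :=
  exist _ (eqv mu a b u v p t) (ex_intro2 _ _ t tt erefl).

Definition rep a b u v p (x : qhom a b u v p) : raw R P := s2val (cid2 (proj2_sig x)).

Lemma rep_typed a b u v p (x : qhom a b u v p) : typed a b u v p (rep x).
Proof. exact: (s2valP (cid2 (proj2_sig x))). Qed.

Lemma repE a b u v p (x : qhom a b u v p) : sval x = eqv mu a b u v p (rep x).
Proof. exact: (s2valP' (cid2 (proj2_sig x))). Qed.

Lemma qhom_eq a b u v p (x y : qhom a b u v p) : sval x = sval y -> x = y.
Proof. by case: x y => [S hS] [S' hS'] /= e; subst S'; congr exist. Qed.

Lemma eqv_class a b u v p s t :
  eqv mu a b u v p s t -> eqv mu a b u v p s = eqv mu a b u v p t.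
Proof.
move=> e; apply/funext => t'; apply/propext; split; apply: eqv_trans => //.
exact: eqv_sym.
Qed.

Lemma cls_eq a b u v p s t (ts : typed a b u v p s) (tt : typed a b u v p t) :
  eqv mu a b u v p s t -> cls ts = cls tt.
Proof. by move=> e; apply: qhom_eq; apply: eqv_class. Qed.

Lemma clsK a b u v p (x : qhom a b u v p) : cls (rep_typed x) = x.
Proof. by apply: qhom_eq; rewrite /= -repE. Qed.

Lemma rep_cls a b u v p t (tt : typed a b u v p t) : eqv mu a b u v p (rep (cls tt)) t.
Proof. by rewrite -repE /=; apply: eqv_refl. Qed.

Definition qadd a b u v p (x y : qhom a b u v p) : qhom a b u v p :=
  cls (typed_add (rep_typed x) (rep_typed y)).
Definition qscale a b u v p (r : R) (x : qhom a b u v p) : qhom a b u v p :=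
  cls (typed_scale r (rep_typed x)).
Definition qvc a b u v w p q (x : qhom a b v w p) (y : qhom a b u v q) :
  qhom a b u w (p + q) := cls (typed_vc (rep_typed x) (rep_typed y)).
Definition qhc a b c u v u' v' p q (x : qhom b c u v p) (y : qhom a b u' v' q) :
  qhom a c (u ++ u') (v ++ v') (p + q) := cls (typed_hc (rep_typed x) (rep_typed y)).


Section Module.
Variables (a b : sob P) (u v : seq (lett P)) (p : Z2).
Hypotheses (pu : wpath u a b) (pv : wpath v a b).

(* The wrapper lets the instances depend on the proofs [pu] and [pv], needed
   for the zero 2-morphism to exist. *)
Definition qmod (_ : wpath u a b) (_ : wpath v a b) : Type := qhom a b u v p.
Local Notation Q := (qmod pu pv).

HB.instance Definition _ := gen_eqMixin Q.
HB.instance Definition _ := gen_choiceMixin Q.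

Definition qzero : Q := cls (typed_zero R p pu pv).
Definition qopp (x : Q) : Q := qscale (-1) x.

Let eqv_radd (x y : qhom a b u v p) :
  eqv mu a b u v p (rep (qadd x y)) (Add (rep x) (rep y)).
Proof. exact: rep_cls. Qed.

Let eqv_rscale r (x : qhom a b u v p) :
  eqv mu a b u v p (rep (qscale r x)) (Scale r (rep x)).
Proof. exact: rep_cls. Qed.

Let rrefl (x : qhom a b u v p) : eqv mu a b u v p (rep x) (rep x).
Proof. exact/eqv_refl/rep_typed. Qed.

Let toeq (x y : qhom a b u v p) : eqv mu a b u v p (rep x) (rep y) -> x = y.
Proof. by move=> e; rewrite -[x]clsK -[y]clsK; apply: cls_eq. Qed.

Let via (x y : qhom a b u v p) s t :
  eqv mu a b u v p (rep x) s -> eqv mu a b u v p (rep y) t -> law s t -> x = y.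
Proof.
move=> hx hy l; apply: toeq; apply: eqv_trans (hx) _.
apply: eqv_trans (eqv_sym hy); apply: eqv_law => //.
  by case: (eqv_typed hx).
by case: (eqv_typed hy).
Qed.

Lemma qaddA : associative (@qadd a b u v p).
Proof.
move=> x y z; apply: via (law_addA _ _ _).
  exact: eqv_trans (eqv_radd _ _) (eqv_add (rrefl _) (eqv_radd _ _)).
exact: eqv_trans (eqv_radd _ _) (eqv_add (eqv_radd _ _) (rrefl _)).
Qed.

Lemma qaddC : commutative (@qadd a b u v p).
Proof. by move=> x y; apply: via (eqv_radd _ _) (eqv_radd _ _) (law_addC _ _). Qed.

Lemma qadd0 : left_id qzero (@qadd a b u v p).
Proof.
move=> x; apply: via (rrefl x) (law_add0 _).
exact: eqv_trans (eqv_radd _ _) (eqv_add (rep_cls _) (rrefl _)).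
Qed.

Lemma qaddN : left_inverse qzero qopp (@qadd a b u v p).
Proof.
move=> x; apply: via (rep_cls _) (law_addN _).
exact: eqv_trans (eqv_radd _ _) (eqv_add (eqv_rscale _ _) (rrefl _)).
Qed.

HB.instance Definition _ := GRing.isZmodule.Build Q qaddA qaddC qadd0 qaddN.

Lemma qscaleA r s (x : Q) : qscale r (qscale s x) = qscale (r * s) x.
Proof.
apply: via (eqv_rscale _ _) (law_scaleA _ _ _).
exact: eqv_trans (eqv_rscale _ _) (eqv_scale _ (eqv_rscale _ _)).
Qed.

Lemma qscale1 : left_id 1 (@qscale a b u v p).
Proof. by move=> x; apply: via (eqv_rscale _ _) (rrefl _) (law_scale1 _). Qed.

Lemma qscaleDr : right_distributive (@qscale a b u v p) (@qadd a b u v p).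
Proof.
move=> r x y; apply: via (law_scaleDr _ _ _).
  exact: eqv_trans (eqv_rscale _ _) (eqv_scale _ (eqv_radd _ _)).
exact: eqv_trans (eqv_radd _ _) (eqv_add (eqv_rscale _ _) (eqv_rscale _ _)).
Qed.

Lemma qscaleDl (x : Q) r s : qscale (r + s) x = qadd (qscale r x) (qscale s x).
Proof.
apply: via (eqv_rscale _ _) _ (law_scaleDl _ _ _).
exact: eqv_trans (eqv_radd _ _) (eqv_add (eqv_rscale _ _) (eqv_rscale _ _)).
Qed.

HB.instance Definition _ := GRing.Zmodule_isLmodule.Build R Q
  qscaleA qscale1 qscaleDr qscaleDl.

End Module.

(* 1-morphisms from [a] to [b]: the words from [a] to [b]. *)
Definition phom1 a b : Type := {w : seq (lett P) | wpath w a b}.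

Definition pid1 a : phom1 a a := exist (fun w => wpath w a a) [::] erefl.

Definition pcomp1 a b c (f : phom1 b c) (g : phom1 a b) : phom1 a c :=
  exist (fun w => wpath w a c) (sval f ++ sval g)
        (wpath_cat (proj2_sig f) (proj2_sig g)).

Definition phom2 a b (f g : phom1 a b) p : lmodType R :=
  qmod p (proj2_sig f) (proj2_sig g).

Definition pvid a b (f : phom1 a b) : phom2 f f 0 :=
  cls (typed_id R (proj2_sig f)).

Definition pvcomp a b (f g h : phom1 a b) p q (x : phom2 g h p) (y : phom2 f g q) :
  phom2 f h (p + q) := qvc x y.

Definition phcomp a b c (f g : phom1 b c) (f' g' : phom1 a b) p q
    (x : phom2 f g p) (y : phom2 f' g' q) :
  phom2 (pcomp1 f f') (pcomp1 g g') (p + q) := qhc x y.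

Definition presented_data : gr2data R :=
  {| ob := sob P; hom1 := phom1; id1 := pid1; comp1 := pcomp1; hom2 := phom2;
     vid := pvid; vcomp := pvcomp; hcomp := phcomp |}.

Lemma phom1_eq a b (f g : phom1 a b) : sval f = sval g -> f = g.
Proof. by case: f g => [w h] [w' h'] /= e; subst w'; congr exist. Qed.

Lemma parr2_eqv a b (f g f' g' : phom1 a b) p p' (x : phom2 f g p)
    (y : phom2 f' g' p') s t :
  sval f = sval f' -> sval g = sval g' -> p = p' ->
  eqv mu a b (sval f) (sval g) p (rep x) s ->
  eqv mu a b (sval f') (sval g') p' (rep y) t ->
  (typed a b (sval f') (sval g') p' s -> typed a b (sval f') (sval g') p' t ->
   eqv mu a b (sval f') (sval g') p' s t) ->
  arr2 (C := presented_data) x = arr2 (C := presented_data) y.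
Proof.
move=> /phom1_eq ef /phom1_eq eg ep; subst f' g' p' => hx hy hst.
congr arr2; rewrite -[x]clsK -[y]clsK; apply: cls_eq.
apply: eqv_trans (hx) (eqv_trans _ (eqv_sym hy)); apply: hst.
  by case: (eqv_typed hx).
by case: (eqv_typed hy).
Qed.

Lemma parr2_law a b (f g f' g' : phom1 a b) p p' (x : phom2 f g p)
    (y : phom2 f' g' p') s t :
  law s t -> sval f = sval f' -> sval g = sval g' -> p = p' ->
  eqv mu a b (sval f) (sval g) p (rep x) s ->
  eqv mu a b (sval f') (sval g') p' (rep y) t ->
  arr2 (C := presented_data) x = arr2 (C := presented_data) y.
Proof.
move=> l ef eg ep hx hy; apply: parr2_eqv ef eg ep hx hy _.
exact: eqv_law.
Qed.

Lemma rep_refl a b u v p (x : qhom a b u v p) :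
  eqv mu a b u v p (rep x) (rep x).
Proof. exact/eqv_refl/rep_typed. Qed.

Lemma rep_eq a b u v p (x y : qhom a b u v p) s :
  eqv mu a b u v p (rep x) s -> eqv mu a b u v p (rep y) s -> x = y.
Proof.
move=> hx hy; rewrite -[x]clsK -[y]clsK; apply: cls_eq.
exact: eqv_trans hx (eqv_sym hy).
Qed.

Lemma rep_vc a b u v w p q (x : qhom a b v w p) (y : qhom a b u v q) s t :
  eqv mu a b v w p (rep x) s -> eqv mu a b u v q (rep y) t ->
  eqv mu a b u w (p + q) (rep (qvc x y)) (s \v t).
Proof. by move=> hx hy; apply: eqv_trans (rep_cls _) (eqv_vc hx hy). Qed.

Lemma rep_hc a b c u v u' v' p q (x : qhom b c u v p) (y : qhom a b u' v' q) s t :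
  eqv mu b c u v p (rep x) s -> eqv mu a b u' v' q (rep y) t ->
  eqv mu a c (u ++ u') (v ++ v') (p + q) (rep (qhc x y)) (s \h t).
Proof. by move=> hx hy; apply: eqv_trans (rep_cls _) (eqv_hc hx hy). Qed.

Lemma rep_lin a b (f g : phom1 a b) p r (x y : phom2 f g p) s t :
  eqv mu a b (sval f) (sval g) p (rep x) s ->
  eqv mu a b (sval f) (sval g) p (rep y) t ->
  eqv mu a b (sval f) (sval g) p (rep (r *: x + y)) (Add (Scale r s) t).
Proof.
move=> hx hy; apply: eqv_trans (rep_cls _) (eqv_add _ hy).
exact: eqv_trans (rep_cls _) (eqv_scale _ hx).
Qed.

Lemma eqv_linl a b u v p (op : raw R P -> raw R P) r s s' :
  law (op (Add (Scale r s) s')) (Add (op (Scale r s)) (op s')) ->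
  law (op (Scale r s)) (Scale r (op s)) ->
  typed a b u v p (op s) -> typed a b u v p (op s') ->
  typed a b u v p (op (Scale r s)) -> typed a b u v p (op (Add (Scale r s) s')) ->
  eqv mu a b u v p (op (Add (Scale r s) s')) (Add (Scale r (op s)) (op s')).
Proof.
move=> l1 l2 t1 t2 t3 t4; apply: eqv_trans (eqv_law _ l1 t4 _) _.
  exact: typed_add.
apply: eqv_add (eqv_refl _ t2); apply: eqv_law => //; exact: typed_scale.
Qed.

Lemma presented_laws : gr2laws mu presented_data.
Proof.
split=> /=.
- by move=> a b c e f g h; apply: phom1_eq; rewrite /= catA.
- by move=> a b f; apply: phom1_eq.
- by move=> a b f; apply: phom1_eq; rewrite /= cats0.
- move=> a b f g h k p q r x y z.
  apply: (parr2_law (law_vcA (rep x) (rep y) (rep z))) => //; first by rewrite addrA.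
    by apply: rep_vc; [apply: rep_refl|apply: rep_cls].
  by apply: rep_vc; [apply: rep_cls|apply: rep_refl].
- move=> a b f g p x; apply: (parr2_law (law_vc1l (sval g) (rep x))) => //.
  + by rewrite add0r.
  + by apply: rep_vc; [apply: rep_cls|apply: rep_refl].
  + exact: rep_refl.
- move=> a b f g p x; apply: (parr2_law (law_vc1r (sval f) (rep x))) => //.
  + by rewrite addr0.
  + by apply: rep_vc; [apply: rep_refl|apply: rep_cls].
  + exact: rep_refl.
- move=> a b f g h p q r x x' y.
  apply: rep_eq (rep_lin r (rep_cls _) (rep_cls _)).
  have tx := rep_typed x; have tx' := rep_typed x'; have ty := rep_typed y.
  apply: eqv_trans (rep_vc (rep_lin r (rep_refl x) (rep_refl x')) (rep_refl y)) _.
  apply: (eqv_linl (op := fun t => t \v rep y)); first exact: law_vcDl.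
  + exact: law_vcZl.
  + exact: typed_vc tx ty.
  + exact: typed_vc tx' ty.
  + exact: typed_vc (typed_scale r tx) ty.
  + exact: typed_vc (typed_add (typed_scale r tx) tx') ty.
- move=> a b f g h p q r y x x'.
  apply: rep_eq (rep_lin r (rep_cls _) (rep_cls _)).
  have tx := rep_typed x; have tx' := rep_typed x'; have ty := rep_typed y.
  apply: eqv_trans (rep_vc (rep_refl y) (rep_lin r (rep_refl x) (rep_refl x'))) _.
  apply: (eqv_linl (op := fun t => rep y \v t)); first exact: law_vcDr.
  + exact: law_vcZr.
  + exact: typed_vc ty tx.
  + exact: typed_vc ty tx'.
  + exact: typed_vc ty (typed_scale r tx).
  + exact: typed_vc ty (typed_add (typed_scale r tx) tx').
- move=> a b c e f g f' g' f'' g'' p q r x y z.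
  apply: (parr2_law (law_hcA (rep x) (rep y) (rep z))) => /=.
  + by rewrite catA.
  + by rewrite catA.
  + by rewrite addrA.
  + by apply: rep_hc; [apply: rep_refl|apply: rep_cls].
  + by apply: rep_hc; [apply: rep_cls|apply: rep_refl].
- move=> a b f g p x; apply: (parr2_law (law_hc1l (rep x))) => //.
  + by rewrite add0r.
  + exact: (rep_hc (rep_cls _) (rep_refl x)).
  + exact: rep_refl.
- move=> a b f g p x; apply: (parr2_law (law_hc1r (rep x))) => //=.
  + by rewrite cats0.
  + by rewrite cats0.
  + by rewrite addr0.
  + exact: (rep_hc (rep_refl x) (rep_cls _)).
  + exact: rep_refl.
- move=> a b c f g f' g' p q r x x' y.
  apply: rep_eq (rep_lin (f := pcomp1 f f') (g := pcomp1 g g') r (rep_cls _) (rep_cls _)).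
  have tx := rep_typed x; have tx' := rep_typed x'; have ty := rep_typed y.
  apply: eqv_trans (rep_hc (rep_lin r (rep_refl x) (rep_refl x')) (rep_refl y)) _.
  apply: (eqv_linl (op := fun t => t \h rep y)); first exact: law_hcDl.
  + exact: law_hcZl.
  + exact: typed_hc tx ty.
  + exact: typed_hc tx' ty.
  + exact: typed_hc (typed_scale r tx) ty.
  + exact: typed_hc (typed_add (typed_scale r tx) tx') ty.
- move=> a b c f g f' g' p q r y x x'.
  apply: rep_eq (rep_lin (f := pcomp1 f f') (g := pcomp1 g g') r (rep_cls _) (rep_cls _)).
  have tx := rep_typed x; have tx' := rep_typed x'; have ty := rep_typed y.
  apply: eqv_trans (rep_hc (rep_refl y) (rep_lin r (rep_refl x) (rep_refl x'))) _.
  apply: (eqv_linl (op := fun t => rep y \h t)); first exact: law_hcDr.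
  + exact: law_hcZr.
  + exact: typed_hc ty tx.
  + exact: typed_hc ty tx'.
  + exact: typed_hc ty (typed_scale r tx).
  + exact: typed_hc ty (typed_add (typed_scale r tx) tx').
- move=> a b c f g; apply: (parr2_law (x := phcomp (pvid f) (pvid g))
    (y := pvid (pcomp1 f g)) (law_hcI R (sval f) (sval g))) => //.
    by apply: rep_hc; apply: rep_cls.
  exact: rep_cls.
- move=> a b c f g h f' g' h' p q r s x y z t.
  have hx := rep_typed x; have hy := rep_typed y.
  have hz := rep_typed z; have ht := rep_typed t.
  have e : p + q + (r + s) = p + r + (q + s) by rewrite addrACA.
  apply: (parr2_eqv (s := (rep x \h rep y) \v (rep z \h rep t))
    (t := Scale (mu q r) ((rep x \v rep z) \h (rep y \v rep t)))) => //.
  + by apply: rep_vc; apply: rep_cls.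
  + apply: eqv_trans (rep_cls _) (eqv_scale _ _).
    exact: (rep_hc (rep_cls _) (rep_cls _)).
  + move=> _ _; rewrite -e; exact: (eqv_interchange _ hx hy hz ht).
Qed.

Definition presented : gr2cat mu := Gr2Cat presented_laws.

(* The 2-morphism [x] is the class of the term [t]. *)
Definition represents (a b : presented) (f g : hom1 a b) (p : Z2)
    (x : hom2 f g p) (t : raw R P) : Prop := sval (x : phom2 f g p) t.

End Presented.


(** * Graded gl_2-foams *)

Definition flam (d : nat) : Type :=
  {l : seq nat | all (fun a => (a == 1%N) || (a == 2%N)) l && (sumn l == d)}.

(* [Wm i] is W_{i,-} and [Wp i] is W_{i,+}. *)
Inductive wlet := Wm of nat | Wp of nat.

Definition wcol (l : wlet) : nat := match l with Wm i | Wp i => i end.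

Definition far (i j : nat) : bool := (i.+1 < j)%N || (j.+1 < i)%N.

(* [b] is obtained from [a] by replacing a coordinate 2 of colour [i] by 1, 1 *)
Definition splits (i : nat) (a b : seq nat) : Prop :=
  exists l1 l2 : seq nat,
    [/\ a = l1 ++ 2%N :: l2, b = l1 ++ [:: 1%N, 1%N & l2] & i = (1 + sumn l1)%N].

Definition has_one (i : nat) (a : seq nat) : Prop :=
  exists l1 l2 : seq nat, a = l1 ++ 1%N :: l2 /\ i = (1 + sumn l1)%N.

Definition foam_step (d : nat) (l : wlet) (a b : flam d) : Prop :=
  match l with
  | Wm i => splits i (sval a) (sval b)
  | Wp i => splits i (sval b) (sval a)
  end.

(* [FCross k l] is the crossing k l -> l k. *)
Inductive fgen :=
| FDot of nat | FCup of nat | FCap of nat | FZip of nat | FUnzip of nat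
| FCross of wlet & wlet.

Inductive foam_gbd (d : nat) :
    fgen -> flam d -> seq wlet -> seq wlet -> Z2 -> Prop :=
| foam_dot i a : has_one i (sval a) ->
    foam_gbd (FDot i) a [::] [::] (dg 1 1)
| foam_cup i a : foam_gbd (FCup i) a [::] [:: Wp i; Wm i] (dg 0 (-1))
| foam_cap i a : foam_gbd (FCap i) a [:: Wp i; Wm i] [::] (dg (-1) 0)
| foam_zip i a : foam_gbd (FZip i) a [::] [:: Wm i; Wp i] (dg 1 0)
| foam_unzip i a : foam_gbd (FUnzip i) a [:: Wm i; Wp i] [::] (dg 0 1)
| foam_cross k l a : far (wcol k) (wcol l) ->
    foam_gbd (FCross k l) a [:: k; l] [:: l; k] (dg 0 0).

Definition foam_sig (d : nat) : signature :=
  {| sob := flam d; lett := wlet; step := @foam_step d;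
     gen := fgen; gbd := @foam_gbd d |}.

Section Foam.
Variables (R : comPzRingType) (K : ground R) (d : nat).
Local Notation X := (gX K).
Local Notation Y := (gY K).
Local Notation Z := (gZ K).
Local Notation Zi := (gZi K).
Local Notation fraw := (raw R (foam_sig d)).

Definition fdot i : fraw := @Gen R (foam_sig d) (FDot i).
Definition fcup i : fraw := @Gen R (foam_sig d) (FCup i).
Definition fcap i : fraw := @Gen R (foam_sig d) (FCap i).
Definition fzip i : fraw := @Gen R (foam_sig d) (FZip i).
Definition funzip i : fraw := @Gen R (foam_sig d) (FUnzip i).
Definition fcross k l : fraw := @Gen R (foam_sig d) (FCross k l).
Definition fid (w : seq wlet) : fraw := @Id R (foam_sig d) w.

(* the composite of crossings k w -> w k *)
Fixpoint fslide (k : wlet) (w : seq wlet) : fraw :=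
  if w is l :: w' then
    (fid [:: l] \h fslide k w') \v (fcross k l \h fid w')
  else fid [:: k].

(* the composite of crossings u v -> v u *)
Fixpoint fexchange (u v : seq wlet) : fraw :=
  if u is k :: u' then
    (fslide k v \h fid u') \v (fid [:: k] \h fexchange u' v)
  else fid v.

(* [fvertex j g u v]: [g] is one of cup_j, cap_j, zip_j, unzip_j and goes from
   [u] to [v]. *)
Inductive fvertex (j : nat) : fraw -> seq wlet -> seq wlet -> Prop :=
| fvertex_cup : fvertex j (fcup j) [::] [:: Wp j; Wm j]
| fvertex_cap : fvertex j (fcap j) [:: Wp j; Wm j] [::]
| fvertex_zip : fvertex j (fzip j) [::] [:: Wm j; Wp j]
| fvertex_unzip : fvertex j (funzip j) [:: Wm j; Wp j] [::].

Inductive foam_rel : fraw -> fraw -> Prop :=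
| frel_cross_inv k l :
    far (wcol k) (wcol l) ->
    foam_rel (fcross l k \v fcross k l) (fid [:: k; l])
| frel_braid k l m :
    far (wcol k) (wcol l) -> far (wcol k) (wcol m) -> far (wcol l) (wcol m) ->
    foam_rel
      ((fcross l m \h fid [:: k]) \v (fid [:: l] \h fcross k m)
         \v (fcross k l \h fid [:: m]))
      ((fid [:: m] \h fcross k l) \v (fcross k m \h fid [:: l])
         \v (fid [:: k] \h fcross l m))
| frel_slide k j g u v :
    far (wcol k) j -> fvertex j g u v ->
    foam_rel (fslide k v \v (fid [:: k] \h g)) ((g \h fid [:: k]) \v fslide k u)
| frel_dot_slide j k :
    j != wcol k -> j != (wcol k).+1 ->
    foam_rel (fdot j \h fid [:: k]) (fid [:: k] \h fdot j)
| frel_dot2 i : foam_rel (fdot i \v fdot i) Zero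
| frel_dot_move i :
    foam_rel (fdot i \h fid [:: Wm i]) (fdot i.+1 \h fid [:: Wm i])
| frel_zigzag1 i :
    foam_rel ((fcap i \h fid [:: Wp i]) \v (fid [:: Wp i] \h fzip i))
             (fid [:: Wp i])
| frel_zigzag2 i :
    foam_rel ((fid [:: Wm i] \h fcap i) \v (fzip i \h fid [:: Wm i]))
             (Scale X (fid [:: Wm i]))
| frel_zigzag3 i :
    foam_rel ((funzip i \h fid [:: Wm i]) \v (fid [:: Wm i] \h fcup i))
             (Scale (Z ^+ 2) (fid [:: Wm i]))
| frel_zigzag4 i :
    foam_rel ((fid [:: Wp i] \h funzip i) \v (fcup i \h fid [:: Wp i]))
             (Scale (Y * Z ^+ 2) (fid [:: Wp i]))
| frel_bubble1 i :
    foam_rel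
      (fcap i \v (fid [:: Wp i] \h fdot i \h fid [:: Wm i]) \v fcup i)
      (fid [::])
| frel_bubble0 i : foam_rel (fcap i \v fcup i) Zero
| frel_unzip_zip i :
    foam_rel (funzip i \v fzip i)
             (Add (Scale Z (fdot i)) (Scale (X * Y * Z) (fdot i.+1)))
| frel_neck i :
    foam_rel (fid [:: Wp i; Wm i])
      (Add ((fid [:: Wp i] \h fdot i \h fid [:: Wm i]) \v fcup i \v fcap i)
           (fcup i \v fcap i \v (fid [:: Wp i] \h fdot i \h fid [:: Wm i])))
| frel_squeeze i :
    foam_rel (fid [:: Wp i; Wm i.+1; Wp i.+1; Wm i])
      (Scale Zi
        ((fid [:: Wp i] \h fzip i.+1 \h fid [:: Wm i]) \v fcup i \v fcap i
           \v (fid [:: Wp i] \h funzip i.+1 \h fid [:: Wm i]))).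

Definition foam_pres : presentation R :=
  {| psig := foam_sig d; rels := fun _ => foam_rel |}.

Definition GFoam : gr2cat (bichar K) := presented (bichar K) foam_pres.

End Foam.

(** * The graded 2-Schur algebra *)

Definition lam (n d : nat) : Type :=
  {l : seq nat | [&& size l == n, all (fun a => (a <= 2)%N) l & sumn l == d]}.

(* the coordinate lambda_i, for i >= 1 *)
Definition wt (n d : nat) (a : lam n d) (i : nat) : nat := nth 0%N (0%N :: sval a) i.

(* [alpha i k] is the k-th coordinate of alpha_i *)
Definition alpha (i k : nat) : int := (k == i)%:Z - (k == i.+1)%:Z.

Inductive slet := Fl of nat | El of nat.

(* [b] = [a] - alpha_i *)
Definition lowers (n d : nat) (i : nat) (a b : lam n d) : Prop :=
  (0 < i < n)%N /\ forall k : nat, (wt b k)%:Z = (wt a k)%:Z - alpha i k.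

Definition schur_step (n d : nat) (l : slet) (a b : lam n d) : Prop :=
  match l with
  | Fl i => lowers i a b
  | El i => lowers i b a
  end.

(* The last three constructors are the entries of the adjoined inverses:
   [SInv i j : E_j F_i -> F_i E_j] corresponds to sigma_ij,
   [PInv i m : E_i F_i -> 1] to (E_i x_i^m) eta_i, and
   [NInv i m : 1 -> F_i E_i] to eps_i (x_i^m E_i). *)
Inductive sgen :=
| SEta of nat | SEps of nat | SDot of nat | STau of nat & nat
| SInv of nat & nat | PInv of nat & nat | NInv of nat & nat.

Definition tau_deg (i j : nat) : Z2 := dg (alpha j i.+1) (- alpha j i).

Definition eta_deg (n d : nat) (a : lam n d) (i : nat) : Z2 :=
  dg (wt a i.+1)%:Z (- (wt a i)%:Z) + dg 0 1.

Definition eps_deg (n d : nat) (a : lam n d) (i : nat) : Z2 :=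
  - dg (wt a i.+1)%:Z (- (wt a i)%:Z) + dg 1 0.

(* sigma_ij has degree 0: the contributions of eta_j, tau_ji and eps_j cancel. *)
Inductive schur_gbd (n d : nat) :
    sgen -> lam n d -> seq slet -> seq slet -> Z2 -> Prop :=
| schur_eta i a :
    schur_gbd (SEta i) a [::] [:: El i; Fl i] (eta_deg a i)
| schur_eps i a :
    schur_gbd (SEps i) a [:: Fl i; El i] [::] (eps_deg a i)
| schur_dot i a :
    schur_gbd (SDot i) a [:: Fl i] [:: Fl i] (dg 1 1)
| schur_tau i j a :
    schur_gbd (STau i j) a [:: Fl i; Fl j] [:: Fl j; Fl i] (tau_deg i j)
| schur_sinv i j a :
    schur_gbd (SInv i j) a [:: El j; Fl i] [:: Fl i; El j] 0
| schur_pinv i m a : (m < wt a i - wt a i.+1)%N ->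
    schur_gbd (PInv i m) a [:: El i; Fl i] [::] (- (dg 1 1 *+ m + eta_deg a i))
| schur_ninv i m a : (m < wt a i.+1 - wt a i)%N ->
    schur_gbd (NInv i m) a [::] [:: Fl i; El i] (- (eps_deg a i + dg 1 1 *+ m)).

Definition schur_sig (n d : nat) : signature :=
  {| sob := lam n d; lett := slet; step := @schur_step n d;
     gen := sgen; gbd := @schur_gbd n d |}.

Section Schur.
Variables (R : comPzRingType) (K : ground R) (n d : nat).
Local Notation X := (gX K).
Local Notation Y := (gY K).
Local Notation Z := (gZ K).
Local Notation Zi := (gZi K).
Local Notation mu := (bichar K).
Local Notation sraw := (raw R (schur_sig n d)).

Definition seta i : sraw := @Gen R (schur_sig n d) (SEta i).
Definition seps i : sraw := @Gen R (schur_sig n d) (SEps i).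
Definition sdot i : sraw := @Gen R (schur_sig n d) (SDot i).
Definition stau i j : sraw := @Gen R (schur_sig n d) (STau i j).
Definition sinv i j : sraw := @Gen R (schur_sig n d) (SInv i j).
Definition pinv i m : sraw := @Gen R (schur_sig n d) (PInv i m).
Definition ninv i m : sraw := @Gen R (schur_sig n d) (NInv i m).
Definition sid (w : seq slet) : sraw := @Id R (schur_sig n d) w.
Local Notation F i := (sid [:: Fl i]).
Local Notation E i := (sid [:: El i]).

Definition sigma i j : sraw :=
  (sid [:: El j; Fl i] \h seps j) \v (E j \h stau j i \h E j)
    \v (seta j \h sid [:: Fl i; El j]).

Definition sdotX i m : sraw := iter m (fun t => sdot i \v t) (F i).

Definition eta_dots i m : sraw := (E i \h sdotX i m) \v seta i.
Definition eps_dots i m : sraw := seps i \v (sdotX i m \h E i).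

Definition ssum (k : nat) (t : nat -> sraw) : sraw :=
  foldr (fun m => Add (t m)) Zero (iota 0 k).

Definition adjacent (i j : nat) : bool := (j == i.+1) || (i == j.+1).

(* [schur_rel a s t]: the relation s = t, for expressions with source weight
   [a]; some of the terms may go through weights outside Lambda_{n,d}. *)
Inductive schur_rel (a : lam n d) : sraw -> sraw -> Prop :=
| srel_dot2 i : schur_rel a (sdot i \v sdot i) Zero
| srel_tau2_eq i : schur_rel a (stau i i \v stau i i) Zero
| srel_tau2_far i j : far i j ->
    schur_rel a (stau j i \v stau i j) (sid [:: Fl i; Fl j])
| srel_tau2_succ i j : j = i.+1 ->
    schur_rel a (stau j i \v stau i j)
      (Add (Scale (- (X * Y * Z)) (sdot i \h F j))
           (Scale (X * Y * Z) (F i \h sdot j)))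
| srel_tau2_pred i j : i = j.+1 ->
    schur_rel a (stau j i \v stau i j)
      (Add (Scale (Y * Z ^+ 2) (sdot i \h F j))
           (Scale (- (Y * Z ^+ 2)) (F i \h sdot j)))
| srel_dot_tau_l i j : i != j ->
    schur_rel a ((sdot j \h F i) \v stau i j)
      (Scale (mu (dg 1 1) (tau_deg i j)) (stau i j \v (F i \h sdot j)))
| srel_dot_tau_r i j : i != j ->
    schur_rel a (stau i j \v (sdot i \h F j))
      (Scale (mu (tau_deg i j) (dg 1 1)) ((F j \h sdot i) \v stau i j))
| srel_nil_l i :
    schur_rel a
      (Add ((sdot i \h F i) \v stau i i)
           (Scale (- (X * Y)) (stau i i \v (F i \h sdot i))))
      (sid [:: Fl i; Fl i])
| srel_nil_r i :
    schur_rel a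
      (Add (stau i i \v (sdot i \h F i))
           (Scale (- (X * Y)) ((F i \h sdot i) \v stau i i)))
      (sid [:: Fl i; Fl i])
| srel_braid i j k : ~~ ((i == k) && adjacent i j) ->
    schur_rel a
      ((stau j k \h F i) \v (F j \h stau i k) \v (stau i j \h F k))
      (Scale (mu (tau_deg j k) (tau_deg i j) * mu (tau_deg i k) (tau_deg i j)
              * mu (tau_deg j k) (tau_deg i k))
        ((F k \h stau i j) \v (stau i k \h F j) \v (F i \h stau j k)))
| srel_serre_succ i j : j = i.+1 ->
    schur_rel a
      (Add (Scale (- (Y * Zi ^+ 2))
             ((stau j i \h F i) \v (F j \h stau i i) \v (stau i j \h F i)))
           (Scale Zi
             ((F i \h stau i j) \v (stau i i \h F j) \v (F i \h stau j i))))
      (sid [:: Fl i; Fl j; Fl i])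
| srel_serre_pred i j : i = j.+1 ->
    schur_rel a
      (Add (Scale (X * Y * Zi)
             ((stau j i \h F i) \v (F j \h stau i i) \v (stau i j \h F i)))
           (Scale (- (X * Zi ^+ 2))
             ((F i \h stau i j) \v (stau i i \h F j) \v (F i \h stau j i))))
      (sid [:: Fl i; Fl j; Fl i])
| srel_adj_F i :
    schur_rel a ((seps i \h F i) \v (F i \h seta i)) (F i)
| srel_adj_E i :
    schur_rel a
      (Scale (X ^+ (1 + wt a i.+1) * Y ^+ wt a i)
        ((E i \h seps i) \v (seta i \h E i)))
      (E i)
| srel_sinv_l i j : i != j ->
    schur_rel a (sinv i j \v sigma i j) (sid [:: Fl i; El j])
| srel_sinv_r i j : i != j ->
    schur_rel a (sigma i j \v sinv i j) (sid [:: El j; Fl i])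
| srel_pos_r i : (0 < i < n)%N -> (wt a i.+1 <= wt a i)%N ->
    schur_rel a
      (Add (sigma i i \v sinv i i)
           (ssum (wt a i - wt a i.+1) (fun m => eta_dots i m \v pinv i m)))
      (sid [:: El i; Fl i])
| srel_pos_l i : (0 < i < n)%N -> (wt a i.+1 <= wt a i)%N ->
    schur_rel a (sinv i i \v sigma i i) (sid [:: Fl i; El i])
| srel_pos_l_dots i m : (0 < i < n)%N -> (m < wt a i - wt a i.+1)%N ->
    schur_rel a (sinv i i \v eta_dots i m) Zero
| srel_pos_dots_l i m : (0 < i < n)%N -> (m < wt a i - wt a i.+1)%N ->
    schur_rel a (pinv i m \v sigma i i) Zero
| srel_pos_dots i m m' : (0 < i < n)%N ->
    (m < wt a i - wt a i.+1)%N -> (m' < wt a i - wt a i.+1)%N ->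
    schur_rel a (pinv i m \v eta_dots i m') (if m == m' then sid [::] else Zero)
| srel_neg_l i : (0 < i < n)%N -> (wt a i <= wt a i.+1)%N ->
    schur_rel a
      (Add (sinv i i \v sigma i i)
           (ssum (wt a i.+1 - wt a i) (fun m => ninv i m \v eps_dots i m)))
      (sid [:: Fl i; El i])
| srel_neg_r i : (0 < i < n)%N -> (wt a i <= wt a i.+1)%N ->
    schur_rel a (sigma i i \v sinv i i) (sid [:: El i; Fl i])
| srel_neg_dots_r i m : (0 < i < n)%N -> (m < wt a i.+1 - wt a i)%N ->
    schur_rel a (eps_dots i m \v sinv i i) Zero
| srel_neg_r_dots i m : (0 < i < n)%N -> (m < wt a i.+1 - wt a i)%N ->
    schur_rel a (sigma i i \v ninv i m) Zero
| srel_neg_dots i m m' : (0 < i < n)%N ->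
    (m < wt a i.+1 - wt a i)%N -> (m' < wt a i.+1 - wt a i)%N ->
    schur_rel a (eps_dots i m \v ninv i m') (if m == m' then sid [::] else Zero).

(* The Schur quotient: in a linear combination, the terms going through a
   weight outside Lambda_{n,d}, which are not typed at [a], are zero. *)
Fixpoint prune (a : lam n d) (t : sraw) : sraw :=
  match t with
  | Add t1 t2 => Add (prune a t1) (prune a t2)
  | Scale r t' => Scale r (prune a t')
  | _ => if `[< exists b u v p, typed (S := schur_sig n d) a b u v p t >]
         then t else Zero
  end.

Definition schur_pres : presentation R :=
  {| psig := schur_sig n d;
     rels := fun a s t =>
       exists s' t', [/\ schur_rel a s' t', s = prune a s' & t = prune a t'] |}.

Definition GSchur : gr2cat (bichar K) := presented (bichar K) schur_pres.

End Schur.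

(** * The values of the foamation 2-functor on generators *)

Lemma underline_proof (n d : nat) (a : lam n d) (l := [seq x <- sval a | x != 0%N]) :
  all (fun x => (x == 1%N) || (x == 2%N)) l && (sumn l == d).
Proof.
case: a @l => s /= /and3P[_ h /eqP <-]; apply/andP; split.
  apply/allP => x; rewrite mem_filter => /andP[x0 /(allP h)].
  by case: x x0 => [|[|[|]]].
by apply/eqP; elim: s {h} => //= -[|x] s /= ->.
Qed.

Definition underline (n d : nat) (a : lam n d) : flam d :=
  exist (fun l : seq nat => all (fun x => (x == 1%N) || (x == 2%N)) l && (sumn l == d))
    [seq x <- sval a | x != 0%N] (underline_proof a).

Section Foamation.
Variables (R : comPzRingType) (K : ground R) (n d : nat) (a : lam n d).
Local Notation X := (gX K).
Local Notation Y := (gY K).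
Local Notation Zi := (gZi K).
Local Notation id := (fid R d).
Local Notation dot := (fdot R d).
Local Notation cup := (fcup R d).
Local Notation cap := (fcap R d).
Local Notation zip := (fzip R d).
Local Notation unzip := (funzip R d).
Local Notation cross := (fcross R d).

Definition col (i : nat) : nat := (1 + sumn (take i.-1 (sval a)))%N.

Definition Gam (i : nat) : R :=
  (- (X * Y)) ^+ count (fun x => x == 1%N) (take i (sval a)).

Definition wt2 (i : nat) : nat * nat := (wt a i, wt a i.+1).
Definition wt3 (i : nat) : nat * nat * nat := (wt a i.-1, wt a i, wt a i.+1).

Inductive foam_web : slet -> seq wlet -> Prop :=
| web_F10 i : wt2 i = (1, 0)%N -> foam_web (Fl i) [::]
| web_F20 i : wt2 i = (2, 0)%N -> foam_web (Fl i) [:: Wm (col i)]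
| web_F11 i : wt2 i = (1, 1)%N -> foam_web (Fl i) [:: Wp (col i)]
| web_F21 i : wt2 i = (2, 1)%N ->
    foam_web (Fl i) [:: Wp (col i).+1; Wm (col i)]
| web_E01 i : wt2 i = (0, 1)%N -> foam_web (El i) [::]
| web_E02 i : wt2 i = (0, 2)%N -> foam_web (El i) [:: Wm (col i)]
| web_E11 i : wt2 i = (1, 1)%N -> foam_web (El i) [:: Wp (col i)]
| web_E12 i : wt2 i = (1, 2)%N ->
    foam_web (El i) [:: Wp (col i); Wm (col i).+1].

(* In [img_tau_far], applying F_j first does not change the web assigned to
   F_i, so that both webs can be read off at the weight [a]. *)
Inductive foam_image : sgen -> raw R (foam_sig d) -> Prop :=
| img_dot10 i (c := col i) : wt2 i = (1, 0)%N ->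
    foam_image (SDot i) (Scale (Gam i) (dot c))
| img_dot20 i (c := col i) : wt2 i = (2, 0)%N ->
    foam_image (SDot i) (Scale (Gam i) (dot c.+1 \h id [:: Wm c]))
| img_dot11 i (c := col i) : wt2 i = (1, 1)%N ->
    foam_image (SDot i) (Scale (Gam i) (id [:: Wp c] \h dot c))
| img_dot21 i (c := col i) : wt2 i = (2, 1)%N ->
    foam_image (SDot i)
      (Scale (Gam i) (id [:: Wp c.+1] \h dot c.+1 \h id [:: Wm c]))
| img_eta10 i : wt2 i = (1, 0)%N -> foam_image (SEta i) (id [::])
| img_eta20 i (c := col i) : wt2 i = (2, 0)%N ->
    foam_image (SEta i) (Scale (Zi ^+ 2) (cup c))
| img_eta11 i (c := col i) : wt2 i = (1, 1)%N -> foam_image (SEta i) (zip c)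
| img_eta21 i (c := col i) : wt2 i = (2, 1)%N ->
    foam_image (SEta i)
      (Scale Zi ((id [:: Wp c] \h zip c.+1 \h id [:: Wm c]) \v cup c))
| img_eps01 i : wt2 i = (0, 1)%N -> foam_image (SEps i) (id [::])
| img_eps02 i (c := col i) : wt2 i = (0, 2)%N -> foam_image (SEps i) (cap c)
| img_eps11 i (c := col i) : wt2 i = (1, 1)%N -> foam_image (SEps i) (unzip c)
| img_eps12 i (c := col i) : wt2 i = (1, 2)%N ->
    foam_image (SEps i)
      (cap c.+1 \v (id [:: Wp c.+1] \h unzip c \h id [:: Wm c.+1]))
| img_tau_pred110 i (c := col i) : wt3 i = (1, 1, 0)%N ->
    foam_image (STau i i.-1) (unzip c.-1)
| img_tau_pred210 i (c := col i) : wt3 i = (2, 1, 0)%N ->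
    foam_image (STau i i.-1) (unzip c.-1 \h id [:: Wm c.-2])
| img_tau_pred111 i (c := col i) : wt3 i = (1, 1, 1)%N ->
    foam_image (STau i i.-1) (id [:: Wp c] \h unzip c.-1)
| img_tau_pred211 i (c := col i) : wt3 i = (2, 1, 1)%N ->
    foam_image (STau i i.-1)
      (cross (Wp c) (Wm c.-2)
         \v (id [:: Wp c] \h unzip c.-1 \h id [:: Wm c.-2]))
| img_tau_succ110 i (c := col i) : wt3 i = (1, 1, 0)%N ->
    foam_image (STau i.-1 i) (Scale (Gam i) (zip c.-1))
| img_tau_succ210 i (c := col i) : wt3 i = (2, 1, 0)%N ->
    foam_image (STau i.-1 i) (Scale (Gam i) (zip c.-1 \h id [:: Wm c.-2]))
| img_tau_succ111 i (c := col i) : wt3 i = (1, 1, 1)%N ->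
    foam_image (STau i.-1 i) (Scale (Gam i) (id [:: Wp c] \h zip c.-1))
| img_tau_succ211 i (c := col i) : wt3 i = (2, 1, 1)%N ->
    foam_image (STau i.-1 i)
      (Scale (Gam i)
        ((id [:: Wp c] \h zip c.-1 \h id [:: Wm c.-2])
           \v cross (Wm c.-2) (Wp c)))
| img_tau_eq i (c := col i) : wt2 i = (2, 0)%N ->
    foam_image (STau i i) (Scale (- (X * Y) * Gam i) (cup c \v cap c))
| img_tau_far i j u v : far i j -> foam_web (Fl i) u -> foam_web (Fl j) v ->
    foam_image (STau i j) (fexchange R d u v).

End Foamation.

(* Main.v *)
From HB Require Import structures.
From mathcomp Require Import all_boot all_order all_algebra.
From mathcomp Require Import boolp zify ring.
Require Import Defs.
Set Implicit Arguments.
Unset Strict Implicit.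
Unset Printing Implicit Defensive.
Import GRing.Theory.
Local Open Scope ring_scope.

(* The images of the generators determine a translation of 2-Schur expressions
   into foams, and it descends to a 2-functor as soon as the defining relations
   hold between translations.  A foam expression is flattened to a scalar times
   a list of generators, each with the number of strands on its left, and a
   certificate rewrites one such list into another by distant exchanges and the
   foam relations.  The images of a relation depend only on the few coordinates
   on which its letters act, up to a translation of the colours and the parity
   of the number of earlier coordinates equal to 1; so a relation whose indices
   are close to each other reduces to finitely many certificates, checked by
   computation, while one with distant indices follows from the naturality of
   the crossings with respect to foams on distant strands. *)

(** Over an arbitrary ring no normal form of foams is at hand, and heights matter: exchanging two
    layers costs a value of [mu]. This is why identities are proved by explicit derivations, and why
    scalars are kept as monomials (-1)^s X^x Y^y Z^p Z^-n: every coefficient of a rule or of a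
    relation has this form, so that the bookkeeping runs without computing in the ring. A relation
    is written as a linear combination that has to vanish, and a derivation ends when the terms
    cancel in pairs. The coordinates are 0, 1 or 2, and indices close to each other act on at most
    four of them: at most 81 windows remain, each taken with both parities, and the Schur quotient
    removes most of the terms. The adjoined inverses need values as well. Wherever its source and
    target exist, sigma is sent to a unit multiple of an identity or of a composite of crossings.
    For equal indices this happens only at (1,1); at the other weights the inverse matrix consists
    of an identity or comes from the neck-cutting or the squeeze relation, read as a decomposition
    of an identity. *)

Module Functors.

(** * Zero terms in a presented graded-2-category *)

Section Presented.
Variables (R : comPzRingType) (mu : Z2 -> Z2 -> R) (P : presentation R).
Implicit Types (a b c : sob P) (u v w : seq (lett P)) (p q : Z2) (t : raw R P).

Lemma wpath_catP w w' a c :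
  wpath (w ++ w') a c -> exists2 b, wpath w' a b & wpath w b c.
Proof.
elim: w c => [|l w IH] c /=; first by exists c.
case=> e /IH[b pw' pw] le; exists b => //; by exists e.
Qed.

Lemma eqv_deg a b u v p q s t :
  p = q -> eqv mu a b u v p s t -> eqv mu a b u v q s t.
Proof. by move=> <-. Qed.

Lemma typed_deg a b u v p q t :
  p = q -> typed a b u v p t -> typed a b u v q t.
Proof. by move=> <-. Qed.

Lemma eqv_typedl a b u v p s t : eqv mu a b u v p s t -> typed a b u v p s.
Proof. by case/eqv_typed. Qed.

Lemma eqv_typedr a b u v p s t : eqv mu a b u v p s t -> typed a b u v p t.
Proof. by case/eqv_typed. Qed.

Lemma eqv_lawl a b u v p s t :
  law s t -> typed a b u v p s -> (typed a b u v p s -> typed a b u v p t) ->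
  eqv mu a b u v p s t.
Proof. by move=> l ts h; apply: eqv_law => //; apply: h. Qed.

(** No law mentions the scalar 0: it is split as -1 + 1, and [law_addN] cancels the two parts. *)
Lemma eqv_scale0 a b u v p t :
  typed a b u v p t -> eqv mu a b u v p (Scale 0 t) Zero.
Proof.
move=> tt; have e := eqv_refl mu tt.
have t1 := typed_scale 1 tt; have tN := typed_scale (-1) tt.
apply: eqv_trans (eqv_law mu (law_addN t) (typed_add tN tt) _).
  rewrite -[X in Scale X _](addNr 1).
  apply: eqv_trans (eqv_law mu (law_scaleDl (-1) 1 t) _ (typed_add tN t1)) _.
    exact: typed_scale.
  by apply: eqv_add (eqv_refl mu tN) (eqv_law mu (law_scale1 t) t1 tt).
by case: (typed_wpath tt) => pu pv; apply: typed_zero.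
Qed.

Lemma eqv_scaleZero a b u v p r :
  wpath u a b -> wpath v a b -> eqv mu a b u v p (Scale r Zero) Zero.
Proof.
move=> pu pv; have t0 := typed_zero R p pu pv.
have e := eqv_sym (eqv_scale0 t0).
apply: eqv_trans (eqv_scale r e) _.
apply: eqv_trans (eqv_law mu (law_scaleA r 0 Zero) _ _) _.
- by do 2!apply: typed_scale.
- exact: typed_scale.
by rewrite mulr0; apply: eqv_scale0.
Qed.

Lemma eqv_add0 a b u v p s t :
  eqv mu a b u v p s Zero -> eqv mu a b u v p t Zero ->
  eqv mu a b u v p (Add s t) Zero.
Proof.
move=> hs ht; apply: eqv_trans (eqv_add hs ht) _.
have tz := eqv_typedr hs.
exact: eqv_law (law_add0 _) (typed_add tz tz) tz.
Qed.

Lemma eqv_scaleK a b u v p r t :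
  eqv mu a b u v p t Zero -> eqv mu a b u v p (Scale r t) Zero.
Proof.
move=> ht; apply: eqv_trans (eqv_scale r ht) _.
by case: (typed_wpath (eqv_typedr ht)) => ? ?; apply: eqv_scaleZero.
Qed.

(* The laws only give bilinearity on sums and scalar multiples, whence the
   detour through Scale 0. *)
Lemma eqv_vc0l a b u v w p q s t :
  eqv mu a b v w p s Zero -> typed a b u v q t ->
  eqv mu a b u w (p + q) (s \v t) Zero.
Proof.
move=> hs tt; have tz := eqv_typedr hs.
have e0 := eqv_trans hs (eqv_sym (eqv_scale0 tz)).
apply: eqv_trans (eqv_vc e0 (eqv_refl mu tt)) _.
have tzt := typed_vc tz tt.
apply: eqv_trans (eqv_law mu (law_vcZl 0 Zero t) _ (typed_scale 0 tzt)) _.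
  by apply: typed_vc tt; apply: typed_scale.
exact: eqv_scale0.
Qed.

Lemma eqv_vc0r a b u v w p q s t :
  typed a b v w p s -> eqv mu a b u v q t Zero ->
  eqv mu a b u w (p + q) (s \v t) Zero.
Proof.
move=> ts ht; have tz := eqv_typedr ht.
have e0 := eqv_trans ht (eqv_sym (eqv_scale0 tz)).
apply: eqv_trans (eqv_vc (eqv_refl mu ts) e0) _.
have tst := typed_vc ts tz.
apply: eqv_trans (eqv_law mu (law_vcZr 0 s Zero) _ (typed_scale 0 tst)) _.
  by apply: typed_vc ts _; apply: typed_scale.
exact: eqv_scale0.
Qed.

Lemma eqv_hc0l a b c u v u' v' p q s t :
  eqv mu b c u v p s Zero -> typed a b u' v' q t ->
  eqv mu a c (u ++ u') (v ++ v') (p + q) (s \h t) Zero.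
Proof.
move=> hs tt; have tz := eqv_typedr hs.
have e0 := eqv_trans hs (eqv_sym (eqv_scale0 tz)).
apply: eqv_trans (eqv_hc e0 (eqv_refl mu tt)) _.
have tzt := typed_hc tz tt.
apply: eqv_trans (eqv_law mu (law_hcZl 0 Zero t) _ (typed_scale 0 tzt)) _.
  by apply: typed_hc tt; apply: typed_scale.
exact: eqv_scale0.
Qed.

Lemma eqv_hc0r a b c u v u' v' p q s t :
  typed b c u v p s -> eqv mu a b u' v' q t Zero ->
  eqv mu a c (u ++ u') (v ++ v') (p + q) (s \h t) Zero.
Proof.
move=> ts ht; have tz := eqv_typedr ht.
have e0 := eqv_trans ht (eqv_sym (eqv_scale0 tz)).
apply: eqv_trans (eqv_hc (eqv_refl mu ts) e0) _.
have tst := typed_hc ts tz.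
apply: eqv_trans (eqv_law mu (law_hcZr 0 s Zero) _ (typed_scale 0 tst)) _.
  by apply: typed_hc ts _; apply: typed_scale.
exact: eqv_scale0.
Qed.

End Presented.

Lemma representsE (R : comPzRingType) (mu : Z2 -> Z2 -> R) (P : presentation R)
    (a b : presented mu P) (f g : hom1 a b) p (x : hom2 f g p) t :
  represents x t <->
  eqv mu a b (sval f) (sval g) p (rep (x : phom2 mu f g p)) t.
Proof. by rewrite /represents repE. Qed.

(** * Graded-2-functors out of a presented graded-2-category *)

Section Extension.
Variables (R : comPzRingType) (mu : Z2 -> Z2 -> R) (P Q : presentation R).
Variables (fO : sob P -> sob Q) (fW : sob P -> seq (lett P) -> seq (lett Q)).
Variable fG : sob P -> gen P -> raw R Q.
Hypothesis step_fun : forall (l : lett P) a b b', step l a b -> step l a b' -> b = b'.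
Hypothesis gbd_fun : forall (x : gen P) a u v p u' v' p',
  gbd x a u v p -> gbd x a u' v' p' -> [/\ u = u', v = v' & p = p'].
Hypothesis fW_nil : forall a, fW a [::] = [::].
Hypothesis fW_cat : forall a b u v, wpath v a b -> fW a (u ++ v) = fW b u ++ fW a v.
Hypothesis fW_path : forall a b u, wpath u a b -> wpath (fW a u) (fO a) (fO b).
Hypothesis fG_typed : forall (x : gen P) a b u v p,
  gbd x a u v p -> wpath u a b -> wpath v a b ->
  typed (fO a) (fO b) (fW a u) (fW a v) p (fG a x).

(* [tr a b u v p t t']: [t'] is a translation of [t], typed as indicated.  The
   image of a generator depends on the object at which it is taken, which is
   not part of [t]; moreover [Zero] has many types, so that this is a relation
   and not a function of [t]. *)
Inductive tr : sob P -> sob P -> seq (lett P) -> seq (lett P) -> Z2 ->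
    raw R P -> raw R Q -> Prop :=
| tr_gen a b u v p x : gbd x a u v p -> wpath u a b -> wpath v a b ->
    tr a b u v p (Gen x) (fG a x)
| tr_id a b u : wpath u a b -> tr a b u u 0 (Id u) (Id (fW a u))
| tr_vc a b u v w p q s t s' t' :
    tr a b v w p s s' -> tr a b u v q t t' ->
    tr a b u w (p + q) (s \v t) (s' \v t')
| tr_hc a b c u v u' v' p q s t s' t' :
    tr b c u v p s s' -> tr a b u' v' q t t' ->
    tr a c (u ++ u') (v ++ v') (p + q) (s \h t) (s' \h t')
| tr_zero a b u v p : wpath u a b -> wpath v a b ->
    tr a b u v p Zero Zero
| tr_add a b u v p s t s' t' :
    tr a b u v p s s' -> tr a b u v p t t' ->
    tr a b u v p (Add s t) (Add s' t')
| tr_scale a b u v p r t t' :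
    tr a b u v p t t' -> tr a b u v p (Scale r t) (Scale r t').

Local Notation ftyped a b u v p := (typed (fO a) (fO b) (fW a u) (fW a v) p).
Local Notation feqv a b u v p := (eqv mu (fO a) (fO b) (fW a u) (fW a v) p).

Lemma wpath_fun (a : sob P) u b b' : wpath u a b -> wpath u a b' -> b = b'.
Proof.
elim: u b b' => [|l u IH] b b' /=; first by move=> <-.
by case=> c pc lc [c' pc' lc']; have := IH _ _ pc pc' => cE; subst c'; apply: step_fun lc lc'.
Qed.

(** Inversion stated by a match on the term, with the indices turned into equations, so that no
    dependent elimination is required later. *)
Lemma tr_inv a b u v p t t' : tr a b u v p t t' ->
  match t with
  | Gen x => [/\ gbd x a u v p, wpath u a b, wpath v a b & t' = fG a x]
  | Id w => [/\ u = w, v = w, p = 0, wpath w a b & t' = Id (fW a w)]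
  | t1 \v t2 => exists w q r t1' t2',
      [/\ tr a b w v q t1 t1', tr a b u w r t2 t2', p = q + r & t' = t1' \v t2']
  | t1 \h t2 => exists c u1 v1 u2 v2, exists q r t1' t2',
      [/\ tr c b u1 v1 q t1 t1', tr a c u2 v2 r t2 t2',
         [/\ u = u1 ++ u2, v = v1 ++ v2 & p = q + r] & t' = t1' \h t2']
  | Zero => [/\ wpath u a b, wpath v a b & t' = Zero]
  | Add t1 t2 => exists t1' t2',
      [/\ tr a b u v p t1 t1', tr a b u v p t2 t2' & t' = Add t1' t2']
  | Scale r t1 => exists2 t1', tr a b u v p t1 t1' & t' = Scale r t1'
  end.
Proof.
case=> {a b u v p t t'}.
- by [].
- by [].
- by move=> a b u v w p q s t s' t' hs ht; exists v, p, q, s', t'.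
- move=> a b c u v u' v' p q s t s' t' hs ht.
  by exists b, u, v, u', v', p, q, s', t'.
- by [].
- by move=> a b u v p s t s' t' hs ht; exists s', t'.
- by move=> a b u v p r t t' ht; exists t'.
Qed.

Lemma tr_exists a b u v p t : typed a b u v p t -> exists t', tr a b u v p t t'.
Proof.
elim=> {a b u v p t}.
- by move=> a b u v p x *; exists (fG a x); apply: tr_gen.
- by move=> a b u *; exists (Id (fW a u)); apply: tr_id.
- by move=> a b u v w p q s t _ [s' hs] _ [t' ht]; exists (s' \v t'); apply: tr_vc hs ht.
- by move=> a b c u v u' v' p q s t _ [s' hs] _ [t' ht]; exists (s' \h t'); apply: tr_hc hs ht.
- by move=> *; exists Zero; apply: tr_zero.
- by move=> a b u v p s t _ [s' hs] _ [t' ht]; exists (Add s' t'); apply: tr_add.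
- by move=> a b u v p r t _ [t' ht]; exists (Scale r t'); apply: tr_scale.
Qed.

Lemma tr_typedl a b u v p t t' : tr a b u v p t t' -> typed a b u v p t.
Proof.
elim=> {a b u v p t t'} *.
- exact: typed_gen.
- exact: typed_id.
- by apply: typed_vc; eassumption.
- by apply: typed_hc; eassumption.
- exact: typed_zero.
- exact: typed_add.
- exact: typed_scale.
Qed.

Lemma tr_typed a b u v p t t' : tr a b u v p t t' -> ftyped a b u v p t'.
Proof.
elim=> {a b u v p t t'}.
- by move=> *; apply: fG_typed.
- by move=> *; apply/typed_id/fW_path.
- by move=> *; apply: typed_vc; eassumption.
- move=> a b c u v u' v' p q s t s' t' _ hs ht' ht.
  have [pu pv] := typed_wpath (tr_typedl ht').
  by rewrite (fW_cat _ pu) (fW_cat _ pv); apply: typed_hc hs ht.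
- by move=> *; apply: typed_zero; apply: fW_path.
- by move=> *; apply: typed_add.
- by move=> *; apply: typed_scale.
Qed.

Lemma tr_refl a b u v p t t' : tr a b u v p t t' -> feqv a b u v p t' t'.
Proof. by move=> h; apply/eqv_refl/(tr_typed h). Qed.

Let same a (k1 k2 : sob P * seq (lett P) * seq (lett P) * Z2) (t1 t2 : raw R Q) :=
  (k1 = k2 /\ feqv a k1.1.1.1 k1.1.1.2 k1.1.2 k1.2 t1 t2) \/
  (feqv a k1.1.1.1 k1.1.1.2 k1.1.2 k1.2 t1 Zero /\
   feqv a k2.1.1.1 k2.1.1.2 k2.1.2 k2.2 t2 Zero).

(* A term that can be typed in two ways is made zero by some occurrence of
   [Zero], and so are its translations. *)
Lemma tr_same a b u v p t t1 b' u' v' p' t2 :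
  tr a b u v p t t1 -> tr a b' u' v' p' t t2 ->
  same a (b, u, v, p) (b', u', v', p') t1 t2.
Proof.
move=> h; elim: h b' u' v' p' t2 => {a b u v p t t1}.
- move=> a b u v p x gx pu pv b' u' v' p' t2 /tr_inv[gx' pu' pv' ->].
  case: (gbd_fun gx gx') => ? ? ?; subst.
  have e := wpath_fun pu pu'; subst; left; split=> //=.
  exact/eqv_refl/fG_typed.
- move=> a b u pu b' u' v' p' t2 /tr_inv[? ? ? pu' ?]; subst.
  have e := wpath_fun pu pu'; subst; left; split=> //=.
  exact/eqv_refl/typed_id/fW_path.
- move=> a b u v w p q s t s' t' hs IHs ht IHt b' u' v' p' t2 /tr_inv.
  move=> [w' [q' [r' [s2 [t2' [hs2 ht2 ? ?]]]]]]; subst.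
  have [[[? ? ? ?] et]|[e1 e2]] := IHt _ _ _ _ _ ht2.
    subst; have [[[? ?] es]|[e1 e2]] := IHs _ _ _ _ _ hs2.
      by subst; left; split=> //=; apply: eqv_vc es et.
    right; split=> /=; first exact: eqv_vc0l e1 (tr_typed ht).
    exact: eqv_vc0l e2 (tr_typed ht2).
  right; split=> /=; first exact: eqv_vc0r (tr_typed hs) e1.
  exact: eqv_vc0r (tr_typed hs2) e2.
- move=> a b c u v u' v' p q s t s' t' hs IHs ht IHt b' u2 v2 p' t2 /tr_inv.
  move=> [c2 [u3 [v3 [u4 [v4 [q' [r' [s2 [t2' [hs2 ht2 [? ? ?] ?]]]]]]]]]]; subst.
  have [pu pv] := typed_wpath (tr_typedl ht).
  have [pu' pv'] := typed_wpath (tr_typedl ht2).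
  have [[[? ? ? ?] et]|[e1 e2]] := IHt _ _ _ _ _ ht2.
    subst; have [[[? ? ? ?] es]|[e1 e2]] := IHs _ _ _ _ _ hs2.
      subst; left; split=> //=; rewrite (fW_cat _ pu) (fW_cat _ pv).
      exact: eqv_hc es et.
    right; rewrite /= !(fW_cat _ pu) !(fW_cat _ pv).
    split; first exact: eqv_hc0l e1 (tr_typed ht).
    exact: eqv_hc0l e2 (tr_typed ht2).
  right; rewrite /= (fW_cat _ pu) (fW_cat _ pv) (fW_cat _ pu') (fW_cat _ pv').
  split; first exact: eqv_hc0r (tr_typed hs) e1.
  exact: eqv_hc0r (tr_typed hs2) e2.
- move=> a b u v p pu pv b' u' v' p' t2 /tr_inv[pu' pv' ->]; right.
  by split=> /=; apply/eqv_refl/typed_zero; apply: fW_path.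
- move=> a b u v p s t s' t' hs IHs ht IHt b' u' v' p' t2 /tr_inv.
  move=> [s2 [t2' [hs2 ht2 ->]]].
  have [[[? ? ? ?] et]|[e1 e2]] := IHt _ _ _ _ _ ht2.
    subst; have [[_ es]|[e1 e2]] := IHs _ _ _ _ _ hs2.
      by left; split=> //=; apply: eqv_add.
    (* The summand [t] already fixes the type, and at that type two translations of [s] that are
       zero agree. *)
    left; split=> //=; apply: eqv_add et; exact: eqv_trans e1 (eqv_sym e2).
  have [[[? ? ? ?] es]|[e3 e4]] := IHs _ _ _ _ _ hs2.
    subst; left; split=> //=; apply: (eqv_add es).
    exact: eqv_trans e1 (eqv_sym e2).
  by right; split; apply: eqv_add0.
- move=> a b u v p r t t' ht IHt b' u' v' p' t2 /tr_inv[t2' ht2 ->].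
  have [[[? ? ? ?] et]|[e1 e2]] := IHt _ _ _ _ _ ht2.
    by subst; left; split=> //=; apply: eqv_scale.
  by right; split; apply: eqv_scaleK.
Qed.

Lemma tr_uniq a b u v p t t1 t2 :
  tr a b u v p t t1 -> tr a b u v p t t2 -> feqv a b u v p t1 t2.
Proof.
by move=> h1 h2; case: (tr_same h1 h2) => [[]|[e1 e2]] //; apply: eqv_trans e1 (eqv_sym e2).
Qed.

Hypothesis fG_rel : forall a b u v p s t s' t',
  rels a s t -> tr a b u v p s s' -> tr a b u v p t t' -> feqv a b u v p s' t'.

Lemma tr_cast a b u v p u' v' p' t t' :
  tr a b u v p t t' -> u = u' -> v = v' -> p = p' -> tr a b u' v' p' t t'.
Proof. by move=> h <- <- <-. Qed.

(** Transport from left to right is enough for [tr_eqv]: the translation of the right side obtained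
    here agrees with any other one by [tr_uniq]. *)
Lemma tr_law a b u v p s t s' : law s t -> tr a b u v p s s' ->
  exists2 t', tr a b u v p t t' & feqv a b u v p s' t'.
Proof.
move=> l h.
have via s2 t' : feqv a b u v p s' s2 -> law s2 t' -> tr a b u v p t t' ->
    exists2 t', tr a b u v p t t' & feqv a b u v p s' t'.
  move=> e l' ht'; exists t' => //; apply: eqv_trans (e) _.
  exact: eqv_law l' (eqv_typedr e) (tr_typed ht').
have via0 t' : law s' t' -> tr a b u v p t t' -> _ := via s' t' (tr_refl h).
case: l h via via0 => {s t}.
- move=> s t x /tr_inv[s1 [y [hs /tr_inv[t1 [x1 [ht hx ->]]] ->]]] _ via.
  apply: via (law_addA _ _ _) _; by apply: tr_add => //; apply: tr_add.
- move=> s t /tr_inv[s1 [t1 [hs ht ->]]] _ via.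
  by apply: via (law_addC _ _) _; apply: tr_add.
- move=> t /tr_inv[s1 [t1 [/tr_inv[_ _ ->] ht ->]]] _ via.
  exact: via (law_add0 _) _.
(* The two copies of [t] may have been translated differently; [tr_uniq] identifies the results
   before they are cancelled. *)
- move=> t /tr_inv[s1 [t1 [/tr_inv[t2 ht2 ->] ht ->]]] via _.
  apply: via (law_addN t1) _.
    by apply: eqv_add (tr_refl ht); apply: eqv_scale; apply: tr_uniq ht2 ht.
  by have [] := typed_wpath (tr_typedl ht); apply: tr_zero.
- move=> r r' t /tr_inv[s1 /tr_inv[t1 ht ->] ->] _ via.
  by apply: via (law_scaleA _ _ _) _; apply: tr_scale.
- move=> t /tr_inv[t1 ht ->] _ via; exact: via (law_scale1 _) _.
- move=> r s t /tr_inv[x /tr_inv[s1 [t1 [hs ht ->]]] ->] _ via.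
  by apply: via (law_scaleDr _ _ _) _; apply: tr_add; apply: tr_scale.
- move=> r r' t /tr_inv[t1 ht ->] _ via.
  by apply: via (law_scaleDl _ _ _) _; apply: tr_add; apply: tr_scale.
- move=> s t x /tr_inv[w [q [r [s1 [y [hs hy -> ->]]]]]] _ via.
  move: hy via => /tr_inv[w' [q' [r' [t1 [x1 [ht hx -> ->]]]]]] via.
  apply: via (law_vcA _ _ _) _.
  by apply: tr_cast (tr_vc (tr_vc hs ht) hx) _ _ _ => //; rewrite addrA.
- move=> w t /tr_inv[w' [q [r [s1 [t1 [/tr_inv[? ? ? pw ?] ht ? ?]]]]]] _ via; subst.
  by apply: via (law_vc1l _ _) _; apply: tr_cast ht _ _ _ => //; rewrite add0r.
- move=> w t /tr_inv[w' [q [r [t1 [s1 [ht /tr_inv[? ? ? pw ?] ? ?]]]]]] _ via; subst.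
  by apply: via (law_vc1r _ _) _; apply: tr_cast ht _ _ _ => //; rewrite addr0.
- move=> s s2 t /tr_inv[w [q [r [x [t1 [/tr_inv[s1 [s3 [hs hs2 ->]]] ht -> ->]]]]]] _ via.
  by apply: via (law_vcDl _ _ _) _; apply: tr_add; apply: tr_vc; eassumption.
- move=> s t t2 /tr_inv[w [q [r [s1 [x [hs /tr_inv[t1 [t3 [ht ht2 ->]]] -> ->]]]]]] _ via.
  by apply: via (law_vcDr _ _ _) _; apply: tr_add; apply: tr_vc; eassumption.
- move=> r0 s t /tr_inv[w [q [r [x [t1 [/tr_inv[s1 hs ->] ht -> ->]]]]]] _ via.
  by apply: via (law_vcZl _ _ _) _; apply: tr_scale; apply: tr_vc; eassumption.
- move=> r0 s t /tr_inv[w [q [r [s1 [x [hs /tr_inv[t1 ht ->] -> ->]]]]]] _ via.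
  by apply: via (law_vcZr _ _ _) _; apply: tr_scale; apply: tr_vc; eassumption.
- move=> s t x /tr_inv[c [u1 [v1 [u2 [v2 [q [r [s1 [y [hs hy [-> -> ->] ->]]]]]]]]]] _ via.
  move: hy via => /tr_inv[c' [u3 [v3 [u4 [v4 [q' [r' [t1 [x1 [ht hx [-> -> ->] ->]]]]]]]]]] via.
  apply: via (law_hcA _ _ _) _.
  by apply: tr_cast (tr_hc (tr_hc hs ht) hx) _ _ _; rewrite ?catA ?addrA.
- move=> t /tr_inv[c [u1 [v1 [u2 [v2 [q [r [s1 [t1 [hs ht [? ? ?] ?]]]]]]]]]] _ via.
  move: hs => /tr_inv[? ? ? /= pc ?]; subst; rewrite fW_nil in via *.
  by apply: via (law_hc1l _) _; apply: tr_cast ht _ _ _ => //; rewrite add0r.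
- move=> t /tr_inv[c [u1 [v1 [u2 [v2 [q [r [t1 [s1 [ht hs [? ? ?] ?]]]]]]]]]] _ via.
  move: hs => /tr_inv[? ? ? /= pc ?]; subst; rewrite fW_nil in via *.
  by apply: via (law_hc1r _) _; apply: tr_cast ht _ _ _; rewrite ?cats0 ?addr0.
- move=> s s2 t /tr_inv[c [u1 [v1 [u2 [v2 [q [r [x [t1 [hs ht [-> -> ->] ->]]]]]]]]]] _ via.
  move: hs via => /tr_inv[s1 [s3 [hs hs2 ->]]] via.
  by apply: via (law_hcDl _ _ _) _; apply: tr_add; apply: tr_hc; eassumption.
- move=> s t t2 /tr_inv[c [u1 [v1 [u2 [v2 [q [r [s1 [x [hs ht [-> -> ->] ->]]]]]]]]]] _ via.
  move: ht via => /tr_inv[t1 [t3 [ht ht2 ->]]] via.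
  by apply: via (law_hcDr _ _ _) _; apply: tr_add; apply: tr_hc; eassumption.
- move=> r0 s t /tr_inv[c [u1 [v1 [u2 [v2 [q [r [x [t1 [hs ht [-> -> ->] ->]]]]]]]]]] _ via.
  move: hs via => /tr_inv[s1 hs ->] via.
  by apply: via (law_hcZl _ _ _) _; apply: tr_scale; apply: tr_hc; eassumption.
- move=> r0 s t /tr_inv[c [u1 [v1 [u2 [v2 [q [r [s1 [x [hs ht [-> -> ->] ->]]]]]]]]]] _ via.
  move: ht via => /tr_inv[t1 ht ->] via.
  by apply: via (law_hcZr _ _ _) _; apply: tr_scale; apply: tr_hc; eassumption.
- move=> w w' /tr_inv[c [u1 [v1 [u2 [v2 [q [r [s1 [t1 [hs ht [-> -> ->] ->]]]]]]]]]] _ via.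
  move: hs ht => /tr_inv[? ? ? pw ?] /tr_inv[? ? ? pw' ?]; subst.
  apply: via (law_hcI _ _ _) _; rewrite -(fW_cat _ pw').
  apply: tr_cast (tr_id _) _ _ _; rewrite ?addr0 //.
  exact: wpath_cat pw pw'.
Qed.

Lemma tr_eqv a b u v p s t : eqv mu a b u v p s t -> forall s' t',
  tr a b u v p s s' -> tr a b u v p t t' -> feqv a b u v p s' t'.
Proof.
elim=> {a b u v p s t}.
- by move=> a b u v p t _ s' t'; apply: tr_uniq.
- by move=> a b u v p s t _ IH s' t' hs ht; apply/eqv_sym/IH.
- move=> a b u v p s t t1 h1 IH1 _ IH2 s' t' hs ht.
  have [x hx] := tr_exists (eqv_typedr h1).
  exact: eqv_trans (IH1 _ _ hs hx) (IH2 _ _ hx ht).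
- move=> a b u v w p q s s2 t t2 h1 IH1 h2 IH2 x y hx hy.
  have [s' hs] := tr_exists (eqv_typedl h1); have [s2' hs2] := tr_exists (eqv_typedr h1).
  have [t' ht] := tr_exists (eqv_typedl h2); have [t2' ht2] := tr_exists (eqv_typedr h2).
  apply: eqv_trans (tr_uniq hx (tr_vc hs ht)) _.
  apply: eqv_trans (eqv_sym (tr_uniq hy (tr_vc hs2 ht2))).
  by apply: eqv_vc; [apply: IH1|apply: IH2].
- move=> a b c u v u' v' p q s s2 t t2 h1 IH1 h2 IH2 x y hx hy.
  have [s' hs] := tr_exists (eqv_typedl h1); have [s2' hs2] := tr_exists (eqv_typedr h1).
  have [t' ht] := tr_exists (eqv_typedl h2); have [t2' ht2] := tr_exists (eqv_typedr h2).
  apply: eqv_trans (tr_uniq hx (tr_hc hs ht)) _.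
  apply: eqv_trans (eqv_sym (tr_uniq hy (tr_hc hs2 ht2))).
  have [pu pv] := typed_wpath (eqv_typedl h2); rewrite (fW_cat _ pu) (fW_cat _ pv).
  by apply: eqv_hc; [apply: IH1|apply: IH2].
- move=> a b u v p s s2 t t2 _ IH1 _ IH2 x y.
  move=> /tr_inv[s' [t' [hs ht ->]]] /tr_inv[s2' [t2' [hs2 ht2 ->]]].
  by apply: eqv_add; [apply: IH1|apply: IH2].
- move=> a b u v p r t t2 _ IH x y /tr_inv[t' ht ->] /tr_inv[t2' ht2 ->].
  by apply: eqv_scale; apply: IH.
- move=> a b u v p s t l ts tt s' t' hs ht.
  have [t2 ht2 e] := tr_law l hs; exact: eqv_trans e (tr_uniq ht2 ht).
- move=> a b c u v w u' v' w' p q r s x y z t tx ty tz tt x' y' hx hy.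
  have [x1 hx1] := tr_exists tx; have [y1 hy1] := tr_exists ty.
  have [z1 hz1] := tr_exists tz; have [t1 ht1] := tr_exists tt.
  apply: eqv_trans (tr_uniq hx (tr_vc (tr_hc hx1 hy1) (tr_hc hz1 ht1))) _.
  have h2 := tr_scale (mu q r) (tr_hc (tr_vc hx1 hz1) (tr_vc hy1 ht1)).
  (* The two sides of the interchange law have their degrees summed in different orders. *)
  rewrite (addrACA p) in hy *.
  apply: eqv_trans (eqv_sym (tr_uniq hy h2)); rewrite -(addrACA p).
  have [pu _] := typed_wpath tt; have [pv pw] := typed_wpath ty.
  have hX := tr_typed hx1; have hY := tr_typed hy1.
  rewrite (fW_cat _ pu) (fW_cat _ pw).
  exact: eqv_interchange (tr_typed hx1) (tr_typed hy1) (tr_typed hz1) (tr_typed ht1).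
- move=> a b u v p s t st ts tt s' t' hs ht; exact: fG_rel st hs ht.
Qed.

Definition ext1 (a b : presented mu P) (f : hom1 a b) :
    hom1 (fO a : presented mu Q) (fO b) :=
  exist (fun w => wpath w (fO a) (fO b)) (fW a (sval f)) (fW_path (proj2_sig f)).

(** A representative and one of its translations are chosen; by [tr_eqv] the resulting class depends
    on neither choice. *)
Definition ext2 (a b : presented mu P) (f g : hom1 a b) p (x : hom2 f g p) :
    hom2 (ext1 f) (ext1 g) p :=
  cls mu (tr_typed (proj2_sig (cid (tr_exists (rep_typed x))))).

Lemma ext2P (a b : presented mu P) (f g : hom1 a b) p (x : hom2 f g p) t t' :
  represents x t -> tr a b (sval f) (sval g) p t t' -> represents (ext2 x) t'.
Proof.
rewrite /represents repE => xt ht.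
by apply: tr_eqv xt _ _ _ ht; case: (cid _).
Qed.

Lemma represents_rep (a b : presented mu P) (f g : hom1 a b) p (x : hom2 f g p) :
  represents x (rep (x : phom2 mu f g p)).
Proof. by rewrite /represents repE; apply: rep_refl. Qed.

Lemma represents_eq (a b : presented mu Q) (f g : hom1 a b) p (x y : hom2 f g p) t :
  represents x t -> represents y t -> x = y.
Proof. by rewrite /represents !repE; apply: rep_eq. Qed.

Lemma represents_typed (a b : presented mu P) (f g : hom1 a b) p (x : hom2 f g p) t :
  represents x t -> typed a b (sval f) (sval g) p t.
Proof. by rewrite /represents repE => /eqv_typedr. Qed.

(** The last clause accepts every term equivalent to a translation: the values prescribed for the
    generators are only equivalent to the terms [fG] from which the functor is built. *)
Lemma extension : exists F : gr2functor (presented mu P) (presented mu Q),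
  [/\ forall a, F a = fO a :> presented mu Q,
      forall (a b : presented mu P) (f : hom1 a b), sval (fhom1 F f) = fW a (sval f)
    & forall (a b : presented mu P) (f g : hom1 a b) p (x : hom2 f g p) t t' t'',
        represents x t -> tr a b (sval f) (sval g) p t t' ->
        feqv a b (sval f) (sval g) p t' t'' ->
        represents (fhom2 F x) t''].
Proof.
have image (a b : presented mu P) (f g : hom1 a b) p (x : hom2 f g p) :
    exists2 t, represents x t & exists2 t', tr a b (sval f) (sval g) p t t' &
      represents (ext2 x) t'.
  exists (rep (x : phom2 mu f g p)); first exact: represents_rep.
  have [t' ht] := tr_exists (rep_typed (x : phom2 mu f g p)).
  by exists t' => //; apply: ext2P ht; apply: represents_rep.
unshelve eexists (@Gr2Functor R mu (presented mu P) (presented mu Q) fO ext1 ext2 _ _ _ _ _ _).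
- by move=> a; apply: phom1_eq; rewrite /= fW_nil.
- by move=> a b c f g; apply: phom1_eq; rewrite /= (fW_cat _ (proj2_sig g)).
- move=> a b f g p r x y.
  have [s xs [s' hs xs']] := image _ _ _ _ _ x; have [t yt [t' ht yt']] := image _ _ _ _ _ y.
  apply: (@represents_eq _ _ _ _ _ _ _ (Add (Scale r s') t')).
    apply: (@ext2P _ _ _ _ _ _ (Add (Scale r s) t)).
      by apply/representsE; apply: rep_lin; apply/representsE.
    by apply: tr_add => //; apply: tr_scale.
  by apply/representsE; apply: rep_lin; apply/representsE.
- move=> a b f; apply: (@represents_eq _ _ _ _ _ _ _ (Id (fW a (sval f)))).
    apply: (@ext2P _ _ _ _ _ _ (Id (sval f))); first by apply/representsE; apply: rep_cls.
    exact: tr_id (proj2_sig f).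
  by apply/representsE; apply: rep_cls.
- move=> a b f g h p q x y.
  have [s xs [s' hs xs']] := image _ _ _ _ _ x; have [t yt [t' ht yt']] := image _ _ _ _ _ y.
  apply: (@represents_eq _ _ _ _ _ _ _ (s' \v t')).
    apply: (@ext2P _ _ _ _ _ _ (s \v t)); last exact: tr_vc hs ht.
    by apply/representsE; apply: rep_vc; apply/representsE.
  by apply/representsE; apply: rep_vc; apply/representsE.
- move=> a b c f g f' g' p q x y.
  have [s xs [s' hs xs']] := image _ _ _ _ _ x; have [t yt [t' ht yt']] := image _ _ _ _ _ y.
  apply: (@parr2_eqv _ _ _ _ _ _ _ _ _ _ _ _ _ (s' \h t') (s' \h t')) => //.
  + by rewrite /= (fW_cat _ (proj2_sig f')).
  + by rewrite /= (fW_cat _ (proj2_sig g')).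
  + apply/representsE; apply: (@ext2P _ _ _ _ _ _ (s \h t)); last exact: tr_hc hs ht.
    by apply/representsE; apply: rep_hc; apply/representsE.
  + by apply: rep_hc; apply/representsE.
  + by move=> ? _; apply: eqv_refl.
- split=> // a b f g p x t t' t'' xt ht h.
  suff : represents (ext2 x) t'' by [].
  have := ext2P xt ht; rewrite /represents !repE => e; exact: eqv_trans e h.
Qed.

End Extension.

End Functors.
Import Functors.

Module Layers.

(** * Foams as sequences of layers *)

Definition fsrc (g : fgen) : seq wlet :=
  match g with
  | FDot _ | FCup _ | FZip _ => [::]
  | FCap i => [:: Wp i; Wm i]
  | FUnzip i => [:: Wm i; Wp i]
  | FCross k l => [:: k; l]
  end.

Definition ftgt (g : fgen) : seq wlet :=
  match g with
  | FDot _ | FCap _ | FUnzip _ => [::]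
  | FCup i => [:: Wp i; Wm i]
  | FZip i => [:: Wm i; Wp i]
  | FCross k l => [:: l; k]
  end.

Definition fdeg (g : fgen) : Z2 :=
  match g with
  | FDot _ => dg 1 1
  | FCup _ => dg 0 (-1)
  | FCap _ => dg (-1) 0
  | FZip _ => dg 1 0
  | FUnzip _ => dg 0 1
  | FCross _ _ => dg 0 0
  end.

Definition fgood d (g : fgen) (a : flam d) : Prop :=
  match g with
  | FDot i => has_one i (sval a)
  | FCross k l => far (wcol k) (wcol l)
  | _ => True
  end.

Lemma foam_gbdP d g (a : flam d) u v p :
  foam_gbd g a u v p <-> [/\ fgood g a, u = fsrc g, v = ftgt g & p = fdeg g].
Proof.
split; first by case.
by case: g => [i|i|i|i|i|k l] /= [? -> -> ->]; constructor.
Qed.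

(* The layer [(k, g)] is the generator [g] with [k] identity strands on its
   left; the first layer of a list is the source one. *)
Definition layer : Type := (nat * fgen)%type.
Definition diag : Type := seq layer.

Definition wapp (w : seq wlet) (L : layer) : seq wlet :=
  take L.1 w ++ ftgt L.2 ++ drop (L.1 + size (fsrc L.2)) w.

Definition wrun (w : seq wlet) (D : diag) : seq wlet := foldl wapp w D.

(** Later layers contribute on the left, as in the degree of a vertical composite. *)
Fixpoint ddeg (D : diag) : Z2 := if D is L :: D' then ddeg D' + fdeg L.2 else 0.

Definition shl (k : nat) (D : diag) : diag := [seq ((k + L.1)%N, L.2) | L <- D].

(** Only words are matched here; weights, and with them the existence of dots, enter in [valid]. *)
Fixpoint fits (w : seq wlet) (D : diag) : Prop :=
  if D is L :: D' then
    (exists l r, w = l ++ fsrc L.2 ++ r /\ size l = L.1) /\ fits (wapp w L) D'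
  else True.

Lemma ddeg_cat D E : ddeg (D ++ E) = ddeg E + ddeg D.
Proof. by elim: D => [|L D IH] /=; rewrite ?addr0 // IH addrA. Qed.

Lemma ddeg_shl k D : ddeg (shl k D) = ddeg D.
Proof. by elim: D => //= L D ->. Qed.

Lemma wrun_cat w D E : wrun w (D ++ E) = wrun (wrun w D) E.
Proof. by rewrite /wrun foldl_cat. Qed.

Lemma shl_cat k D E : shl k (D ++ E) = shl k D ++ shl k E.
Proof. by rewrite /shl map_cat. Qed.

Lemma shl_shl k k' D : shl k (shl k' D) = shl (k + k') D.
Proof. by rewrite /shl -map_comp; apply: eq_map => L /=; rewrite addnA. Qed.

Lemma shl0 D : shl 0 D = D.
Proof. by rewrite /shl -[RHS]map_id; apply: eq_map => -[]. Qed.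

Lemma wappE l r g k : size l = k -> wapp (l ++ fsrc g ++ r) (k, g) = l ++ ftgt g ++ r.
Proof.
move=> <-; rewrite /wapp /= take_size_cat //.
by rewrite addnC -drop_drop drop_size_cat // drop_size_cat.
Qed.

Lemma fits_cat w D E : fits w (D ++ E) <-> fits w D /\ fits (wrun w D) E.
Proof.
elim: D w => [|L D IH] w /=; first by split=> // -[].
by split=> [[h /IH[]]|[[h h1] h2]] //; split=> //; apply/IH.
Qed.

Lemma wapp_whisk l u r k g : fits u [:: (k, g)] ->
  wapp (l ++ u ++ r) ((size l + k)%N, g) = l ++ wapp u (k, g) ++ r.
Proof.
case=> -[l' [r' [-> /= lk]]] _.
rewrite (wappE _ _ lk) [in LHS](_ : _ ++ _ = (l ++ l') ++ fsrc g ++ (r' ++ r)).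
  by rewrite wappE ?size_cat ?lk // !catA.
by rewrite !catA.
Qed.

Lemma wrun_whisk l u r D : fits u D ->
  wrun (l ++ u ++ r) (shl (size l) D) = l ++ wrun u D ++ r.
Proof.
elim: D u => //= -[k g] D IH u [fu fD]; rewrite wapp_whisk; first exact: IH.
by split.
Qed.

(** * Executable paths of webs *)

(** [c] is the colour of the head of [o]. Being a partial function, it makes paths of webs
    deterministic. *)
Fixpoint ostep (c : nat) (k : wlet) (o : seq nat) : option (seq nat) :=
  if o is x :: o' then
    if c == wcol k then
      match k, x, o' with
      | Wm _, 2, _ => Some [:: 1, 1 & o']%N
      | Wp _, 1, 1 :: o'' => Some (2 :: o'')%N
      | _, _, _ => None
      end
    else omap (cons x) (ostep (c + x) k o')
  else None.

Fixpoint opath (w : seq wlet) (o : seq nat) : option (seq nat) :=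
  if w is k :: w' then obind (ostep 1 k) (opath w' o) else Some o.

Definition ones_twos (o : seq nat) : bool := all (fun x => (x == 1%N) || (x == 2%N)) o.

Definition osplits (k : wlet) (o o' : seq nat) : Prop :=
  match k with Wm i => splits i o o' | Wp i => splits i o' o end.

Lemma ostep_prefix c k l o : ones_twos l -> (c + sumn l)%N = wcol k ->
  ostep c k (l ++ o) = omap (cat l) (ostep (wcol k) k o).
Proof.
elim: l c => [|x l IH] c /=.
  by move=> _; rewrite addn0 => ->; case: (ostep _ _ _).
case/andP=> hx hl ek; rewrite ifN; last by move: hx; lia.
by rewrite IH // ?(ostep _ _ _) //; [case: (ostep _ _ _)|lia].
Qed.

(** All entries being positive, colours increase strictly along the sequence: a coordinate is
    determined by its colour, and the scan finds the only candidate. *)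
Lemma ostepP k o o' : ones_twos o -> ones_twos o' ->
  osplits k o o' <-> ostep 1 k o = Some o'.
Proof.
move=> ho ho'; split.
  case: k => i [l1 [l2 [eo eo' ei]]]; subst.
    rewrite ostep_prefix /= ?eqxx //=.
    by move: ho; rewrite /ones_twos all_cat => /andP[].
  rewrite ostep_prefix /= ?eqxx //=.
  by move: ho; rewrite /ones_twos all_cat => /andP[].
suff h c : ostep c k o = Some o' -> (c <= wcol k)%N /\
  exists l l2, (c + sumn l)%N = wcol k /\
    (o, o') = if k is Wm _ then (l ++ 2 :: l2, l ++ [:: 1, 1 & l2])%N
              else (l ++ [:: 1, 1 & l2], l ++ 2 :: l2)%N.
  move=> /h[_ [l [l2 [e]]]]; case: k h e => i /= _ e [-> ->]; exists l, l2; by split.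
elim: o c o' {ho ho'} => //= x o IH c o'; case: eqP => [ec|nec].
  case: k ec {IH} => i /= ec.
    case: x => [|[|[|]]] // [<-]; split; first by lia.
    by exists [::], o; split=> //=; lia.
  case: x => [|[|]] //; case: o => [|[|[|]] o] // [<-]; split; first by lia.
  by exists [::], o; split=> //=; lia.
case e: (ostep _ _ _) => [o1|] //= [<-]; case/IH: e => h [l [l2 [e1 e2]]].
split; first by lia.
exists (x :: l), l2; split; first by rewrite /= addnA.
by case: k {IH nec h e1} e2 => i [-> ->].
Qed.

Lemma ostep_ok c k o o' : ostep c k o = Some o' ->
  ones_twos o -> ones_twos o' /\ sumn o' = sumn o.
Proof.
elim: o c o' => //= x o IH c o'; case: eqP => _.
  case: k {IH} => i.
    by case: x => [|[|[|]]] // [<-] /=; split=> //; lia.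
  by case: x => [|[|]] //; case: o => [|[|[|]] o] // [<-] /=; split=> //; lia.
case e: (ostep _ _ _) => [o1|] //= [<-] /andP[hx /(IH _ _ e)[h1 h2]] /=.
by rewrite hx h1 h2.
Qed.

Lemma opath_ok w o o' : opath w o = Some o' ->
  ones_twos o -> ones_twos o' /\ sumn o' = sumn o.
Proof.
elim: w o' => [|k w IH] o' /=; first by case=> <-.
case e: (opath _ _) => [o1|] //= /ostep_ok h /(IH _ e)[h1 h2].
by case/h: h1 => ? ?; split=> //; lia.
Qed.

Lemma opath_cat u w o : opath (u ++ w) o = obind (opath u) (opath w o).
Proof.
elim: u => [|k u IH] /=; first by case: (opath _ _).
by rewrite IH; case: (opath w o).
Qed.

Section Objects.
Variable d : nat.
Implicit Types (A B : flam d) (u v w l r : seq wlet) (D E : diag).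
Local Notation fpath := (@wpath (foam_sig d)).

Lemma flam_ones A : ones_twos (sval A).
Proof. by case: A => l /= /andP[]. Qed.

Lemma flam_sum A : sumn (sval A) = d.
Proof. by case: A => l /= /andP[_ /eqP]. Qed.

Lemma flam_eq A B : sval A = sval B -> A = B.
Proof.
case: A B => [l h] [l' h'] /= e; subst l'; congr exist; exact: bool_irrelevance.
Qed.

Lemma flam_exists o : ones_twos o -> sumn o = d -> exists A, sval A = o.
Proof.
by move=> h /eqP e; unshelve eexists (exist _ o _) => //=; apply/andP.
Qed.

Lemma foam_stepP k A B : foam_step k A B <-> ostep 1 k (sval A) = Some (sval B).
Proof. by rewrite -(ostepP _ (flam_ones A) (flam_ones B)); case: k. Qed.

(** Steps preserve the sum and keep the entries in {1, 2}, so that the intermediate sequences of a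
    computation are again objects. *)
Lemma fpathP w A B : fpath w A B <-> opath w (sval A) = Some (sval B).
Proof.
elim: w B => [|k w IH] B /=; first by split=> [->//|[/flam_eq]].
split=> [[C /IH -> /foam_stepP //]|].
case e: (opath _ _) => [o|] //= h.
have [h1 h2] := opath_ok e (flam_ones A).
have [|C eC] := flam_exists h1; first by rewrite h2 flam_sum.
by exists C; [apply/IH; rewrite eC|apply/foam_stepP; rewrite eC].
Qed.

Lemma fpath_exists w A o : opath w (sval A) = Some o ->
  exists2 B, fpath w A B & sval B = o.
Proof.
move=> h; have [h1 h2] := opath_ok h (flam_ones A).
have [|B eB] := flam_exists h1; first by rewrite h2 flam_sum.
by exists B => //; apply/fpathP; rewrite eB.
Qed.

Lemma fpath_fun w A B B' : fpath w A B -> fpath w A B' -> B = B'.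
Proof. by move=> /fpathP e /fpathP; rewrite e => -[/flam_eq]. Qed.

Lemma path_cat w w' a b c : fpath w b c -> fpath w' a b -> fpath (w ++ w') a c.
Proof.
by move=> /fpathP h1 /fpathP h2; apply/fpathP; rewrite opath_cat h2.
Qed.

Lemma path_catP w w' a c :
  fpath (w ++ w') a c -> exists2 b, fpath w' a b & fpath w b c.
Proof.
move/fpathP; rewrite opath_cat; case e: (opath w' _) => [o|] //= h.
have [b pb eb] := fpath_exists e; exists b => //; apply/fpathP; by rewrite eb.
Qed.

Lemma cat_inj_size (T : Type) (l l' r r' : seq T) :
  size l = size l' -> l ++ r = l' ++ r' -> l = l' /\ r = r'.
Proof.
by elim: l l' => [|x l IH] [|y l'] //= [e] [-> /(IH _ e)[-> ->]].
Qed.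

Definition lvalid A B w (L : layer) : Prop := exists l r A' B',
  [/\ w = l ++ fsrc L.2 ++ r, size l = L.1, fpath r A A' &
   [/\ fgood L.2 A', fpath (fsrc L.2) A' B', fpath (ftgt L.2) A' B' & fpath l B' B]].

Fixpoint valid A B w D : Prop :=
  if D is L :: D' then lvalid A B w L /\ valid A B (wapp w L) D' else fpath w A B.

Lemma lvalid_path A B w L : lvalid A B w L -> fpath w A B /\ fpath (wapp w L) A B.
Proof.
case: L => k g [l [r [A' [B' [-> lk pr [hg ps pt pl]]]]]].
by rewrite (wappE _ _ lk) /=; split; apply: path_cat pl (path_cat _ pr).
Qed.

Lemma valid_path A B w D : valid A B w D -> fpath w A B.
Proof. by case: D => [|L D] //= [/lvalid_path[]]. Qed.

Lemma valid_pathr A B w D : valid A B w D -> fpath (wrun w D) A B.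
Proof. by elim: D w => [|L D IH] w //= [_ /IH]. Qed.

Lemma valid_fits A B w D : valid A B w D -> fits w D.
Proof.
elim: D w => [|L D IH] w //= [[l [r [A' [B' [-> lk _ _]]]]] /IH]; split=> //.
by exists l, r.
Qed.

Lemma valid_cat A B w D E :
  valid A B w (D ++ E) <-> valid A B w D /\ valid A B (wrun w D) E.
Proof.
elim: D w => [|L D IH] w /=; first by split=> [h|[]//]; split=> //; apply: valid_path h.
split=> [[h /IH[]]|[[h h1] h2]]; first by split.
by split=> //; apply/IH.
Qed.

Lemma valid_whisk A A' B' B l u r D :
  fpath r A A' -> fpath l B' B -> valid A' B' u D ->
  valid A B (l ++ u ++ r) (shl (size l) D).
Proof.
move=> pr pl; elim: D u => [|[k g] D IH] u /=.
  by move=> pu; apply: path_cat pl (path_cat pu pr).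
case=> hL hD; split.
  case: hL => l' [r' [A1 [B1 [-> lk pr' [hg ps pt pl']]]]].
  exists (l ++ l'), (r' ++ r), A1, B1; split=> /=.
  - by rewrite -!catA.
  - by rewrite size_cat lk.
  - exact: path_cat pr' pr.
  - by split=> //; apply: path_cat pl pl'.
rewrite wapp_whisk; first exact: IH.
by case: hL => l' [r' [A1 [B1 [-> lk _ _]]]]; split=> //; exists l', r'.
Qed.

(** A web and its source determine its target, so the weights met in the whiskered diagram are those
    of the bare one; [fits] keeps the layers from reaching into [l] or [r]. *)
Lemma valid_unwhisk A A' B l u r D :
  fpath r A A' -> valid A B (l ++ u ++ r) (shl (size l) D) -> fits u D ->
  exists2 B', valid A' B' u D & fpath l B' B.
Proof.
move=> pr; elim: D u => [|[k g] D IH] u.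
  move=> /= /path_catP[B' /path_catP[A1 pr' pu] pl] _.
  by rewrite -(fpath_fun pr pr') in pu; exists B'.
move=> /= [hL hD] [[l' [r' [eu lk]]] fD]; subst u.
rewrite wapp_whisk in hD; last by split=> //; exists l', r'.
have [B' vD pl] := IH _ hD fD; exists B' => //; split=> //.
case: hL => l1 [r1 [A1 [B1 [/= e lk1 pr1 [hg ps pt pl1]]]]].
have {}e : (l ++ l') ++ fsrc g ++ r' ++ r = l1 ++ fsrc g ++ r1 by rewrite -e -!catA.
have [|? {}e] := cat_inj_size _ e; first by rewrite size_cat lk1 lk.
have [//|_ ?] := cat_inj_size _ e; subst l1 r1.
case/path_catP: pr1 => A2 pA2 pr'; rewrite (fpath_fun pA2 pr) in pr'.
case/path_catP: pl1 => B2 pl' pB2.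
have pB : fpath (wapp (l' ++ fsrc g ++ r') (k, g)) A' B2.
  by rewrite (wappE _ _ lk); apply: path_cat pl' (path_cat pt pr').
have pD := valid_path vD; rewrite (fpath_fun pB pD) in pl'.
by exists l', r', A1, B1; split.
Qed.

End Objects.

Section Denotation.
Variables (R : comPzRingType) (K : ground R) (d : nat).
Local Notation mu := (bichar K).
Local Notation fraw := (raw R (foam_sig d)).
Canonical fpr : presentation R := foam_pres K d.
Implicit Types (A B C : flam d) (u v w l r : seq wlet) (D E : diag).

Lemma mu0r p : mu p 0 = 1.
Proof. by rewrite /bichar /= !mulr0 subrr /= !expr0 !mulr1. Qed.

Lemma mu0l p : mu 0 p = 1.
Proof. by rewrite /bichar /= !mul0r subrr /= !expr0 !mulr1. Qed.

Definition lterm w (L : layer) : fraw :=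
  fid R d (take L.1 w) \h @Gen R (foam_sig d) L.2
    \h fid R d (drop (L.1 + size (fsrc L.2)) w).

Fixpoint den w D : fraw :=
  if D is L :: D' then den (wapp w L) D' \v lterm w L else fid R d w.

Local Notation fpath := (@wpath (foam_sig d)).
Local Notation feq := (@eqv R mu fpr).
Local Notation ftyped := (@typed R (foam_sig d)).

Lemma ltermE l r g k : size l = k ->
  lterm (l ++ fsrc g ++ r) (k, g) = fid R d l \h @Gen R (foam_sig d) g \h fid R d r.
Proof.
move=> <-; rewrite /lterm /= take_size_cat //.
by rewrite addnC -drop_drop drop_size_cat // drop_size_cat.
Qed.

Lemma lvalid_typed A B w L : lvalid A B w L ->
  ftyped A B w (wapp w L) (fdeg L.2) (lterm w L).
Proof.
case: L => k g [l [r [A' [B' [-> lk pr [hg ps pt pl]]]]]].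
rewrite (wappE _ _ lk) (ltermE _ _ lk) /= !catA.
apply: (@typed_deg _ fpr _ _ _ _ (0 + fdeg g + 0)); first by rewrite add0r addr0.
apply: typed_hc (typed_id _ pr); apply: typed_hc (typed_id _ pl) _.
by apply: typed_gen => //; apply/foam_gbdP.
Qed.

Lemma valid_typed A B w D : valid A B w D ->
  ftyped A B w (wrun w D) (ddeg D) (den w D).
Proof.
elim: D w => [|L D IH] w /=; first exact: typed_id.
by case=> /lvalid_typed hL /IH hD; apply: typed_vc hD hL.
Qed.

(* whiskering distributes over vertical composition *)
Lemma vc_whiskr A B C w u u' u'' p q s t : fpath w A B ->
  ftyped B C u' u'' p s -> ftyped B C u u' q t ->
  feq A C (u ++ w) (u'' ++ w) (p + q) ((s \v t) \h fid R d w)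
    ((s \h fid R d w) \v (t \h fid R d w)).
Proof.
move=> pw ts tt; have ti := @typed_id R fpr _ _ _ pw.
apply: eqv_sym.
have e := eqv_interchange mu ts ti tt ti.
rewrite !addr0 mu0l in e; apply: eqv_trans (e) _.
have tst := typed_hc (typed_vc ts tt) (typed_vc ti ti).
rewrite !addr0 in tst.
apply: eqv_trans (eqv_law mu (law_scale1 _) (typed_scale 1 tst) tst) _.
apply: (@eqv_deg _ _ fpr _ _ _ _ (p + q + 0)); first by rewrite addr0.
apply: eqv_hc; first exact/eqv_refl/typed_vc/tt.
apply: (eqv_law mu (law_vc1l _ _) _ ti); apply: typed_deg (typed_vc ti ti).
by rewrite addr0.
Qed.

Lemma vc_whiskl A B C w u u' u'' p q s t : fpath w B C ->
  ftyped A B u' u'' p s -> ftyped A B u u' q t ->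
  feq A C (w ++ u) (w ++ u'') (p + q) (fid R d w \h (s \v t))
    ((fid R d w \h s) \v (fid R d w \h t)).
Proof.
move=> pw ts tt; have ti := @typed_id R fpr _ _ _ pw.
apply: eqv_sym.
have e := eqv_interchange mu ti ts ti tt.
rewrite !add0r mu0r in e; apply: eqv_trans (e) _.
have tst := typed_hc (typed_vc ti ti) (typed_vc ts tt).
rewrite !add0r in tst.
apply: eqv_trans (eqv_law mu (law_scale1 _) (typed_scale 1 tst) tst) _.
apply: (@eqv_deg _ _ fpr _ _ _ _ (0 + (p + q))); first by rewrite add0r.
apply: eqv_hc; last exact/eqv_refl/typed_vc/tt.
apply: (eqv_law mu (law_vc1l _ _) _ ti); apply: typed_deg (typed_vc ti ti).
by rewrite addr0.
Qed.

Lemma valid_refl A B w D : valid A B w D ->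
  feq A B w (wrun w D) (ddeg D) (den w D) (den w D).
Proof. by move/valid_typed/eqv_refl. Qed.

Lemma den_cat A B w D E : valid A B w (D ++ E) ->
  feq A B w (wrun w (D ++ E)) (ddeg (D ++ E)) (den w (D ++ E))
    (den (wrun w D) E \v den w D).
Proof.
elim: D w => [|L D IH] w /=.
  move=> hE; have pw := valid_path hE; apply: eqv_sym.
  apply: (eqv_law mu (law_vc1r _ _) _ (valid_typed hE)).
  by apply: typed_deg (typed_vc (valid_typed hE) (typed_id _ pw)); rewrite addr0.
case=> hL hDE; have [hD hE] := (valid_cat _ _ _ _ _).1 hDE.
have tL := lvalid_typed hL.
apply: eqv_trans (eqv_vc (IH _ hDE) (eqv_refl _ tL)) _.
apply: eqv_sym; rewrite wrun_cat.
have tE := valid_typed hE; have tD := valid_typed hD.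
have t3 := typed_vc (typed_vc tE tD) tL.
rewrite ddeg_cat; apply: eqv_law (law_vcA _ _ _) _ t3.
by apply: typed_deg (typed_vc tE (typed_vc tD tL)); rewrite addrA.
Qed.

(** Identities have degree 0, so interchange distributes the whiskers over the layers without a
    scalar; the rest is associativity and the merging of identities. *)
Lemma den_whisk A A' B' B l u r D :
  fpath r A A' -> fpath l B' B -> valid A' B' u D ->
  feq A B (l ++ u ++ r) (l ++ wrun u D ++ r) (ddeg D)
    (den (l ++ u ++ r) (shl (size l) D))
    (fid R d l \h (den u D \h fid R d r)).
Proof.
move=> pr pl; elim: D u => [|[k g] D IH] u.
  move=> /= pu; have ir := @typed_id R fpr _ _ _ pr.
  have il := @typed_id R fpr _ _ _ pl; have iu := @typed_id R fpr _ _ _ pu.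
  have tur := typed_hc iu ir; have tlur := typed_hc il tur.
  have tur' := @typed_id R fpr _ _ _ (path_cat pu pr).
  apply: eqv_sym; apply: (@eqv_trans _ _ _ _ _ _ _ _ _ (fid R d l \h fid R d (u ++ r))).
    apply: (@eqv_deg _ _ fpr _ _ _ _ (0 + 0)); first by rewrite addr0.
    apply: eqv_hc (eqv_refl _ il) _.
    by apply: eqv_law (law_hcI _ _ _) _ tur'; apply: typed_deg tur; rewrite addr0.
  apply: eqv_law (law_hcI _ _ _) _ _; last exact: typed_id (path_cat pl (path_cat pu pr)).
  by apply: typed_deg (typed_hc il tur'); rewrite addr0.
case=> hL hD; have hLD : valid A' B' u ((k, g) :: D) by [].
have hf : fits u [:: (k, g)].
  by case: hL => l' [r' [A1 [B1 [-> lk _ _]]]]; split=> //; exists l', r'.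
have tD := valid_typed hD; have tL := lvalid_typed hL.
have il := @typed_id R fpr _ _ _ pl; have ir := @typed_id R fpr _ _ _ pr.
rewrite /= wapp_whisk //.
have e2 := vc_whiskr pr tD tL.
have e3 := eqv_hc (eqv_refl mu il) e2.
have tDr := typed_hc tD ir; have tLr := typed_hc tL ir; rewrite !addr0 in tDr tLr.
have e4 := vc_whiskl pl tDr tLr.
rewrite add0r in e3; apply: eqv_sym; apply: eqv_trans e3 (eqv_trans e4 _).
apply: eqv_vc; first exact/eqv_sym/IH.
(* One layer is left, whose whiskers are regrouped as [l ++ l'] and [r' ++ r]. *)
case: hL hf {e2 e4} tL tLr => l' [r' [A1 [B1 [-> /= lk pr' [hg ps pt pl']]]]] hf tL tLr.
rewrite (wappE _ _ lk) in tL tLr *.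
have -> : l ++ (l' ++ fsrc g ++ r') ++ r = (l ++ l') ++ fsrc g ++ (r' ++ r) by rewrite !catA.
rewrite !ltermE ?size_cat ?lk //.
have il' := @typed_id R fpr _ _ _ pl'; have ir' := @typed_id R fpr _ _ _ pr'.
have tg : ftyped A1 B1 (fsrc g) (ftgt g) (fdeg g) (@Gen R (foam_sig d) g).
  by apply: typed_gen => //; apply/foam_gbdP.
have ill := typed_hc il il'; have irr := typed_hc ir' ir; rewrite !addr0 in ill irr.
have ell := eqv_law mu (@law_hcI R (foam_sig d) l l') ill (typed_id _ (path_cat pl pl')).
have err := eqv_law mu (@law_hcI R (foam_sig d) r' r) irr (typed_id _ (path_cat pr' pr)).
have tlg := typed_hc il' tg; rewrite add0r in tlg.
have tlgr := typed_hc tlg ir'; rewrite addr0 in tlgr.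
have h1 := typed_hc tlg irr; have h2 := typed_hc tlgr ir.
have h3 := typed_hc ill tg; rewrite add0r in h3.
rewrite !addr0 in h1 h2; rewrite -!catA in h1 h2 h3.
have eA := eqv_law mu (law_hcA (fid R d l' \h @Gen R (foam_sig d) g) (fid R d r') (fid R d r)) h1 h2.
have eB := eqv_hc (eqv_refl mu il) (eqv_sym eA); rewrite add0r in eB.
rewrite -!catA; apply: eqv_trans eB _.
have h4 := typed_hc il h1; have h5 := typed_hc (typed_hc il tlg) irr.
rewrite !add0r !addr0 -!catA in h4 h5.
apply: eqv_trans (eqv_law mu (law_hcA _ _ _) h4 h5) _.
have h6 := typed_hc il tlg; rewrite !add0r in h6.
have h7 := h3.
have eC := eqv_law mu (law_hcA (fid R d l) (fid R d l') (@Gen R (foam_sig d) g)) h6 h7.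
have eE := eqv_hc ell (eqv_refl mu tg).
rewrite ?add0r -?catA in eE.
have := eqv_hc (eqv_trans eC eE) err; rewrite ?addr0 -?catA; exact.
Qed.

Definition dsumf (f : diag -> fraw) (S : seq (R * diag)) : fraw :=
  foldr (fun cD t => Add (Scale cD.1 (f cD.2)) t) Zero S.

Definition dsum w := dsumf (den w).

Local Notation in_terms S D := (List.In D [seq cD.2 | cD <- S]).

Lemma dsumf_typed A B u v p f S : fpath u A B -> fpath v A B ->
  (forall D, in_terms S D -> ftyped A B u v p (f D)) ->
  ftyped A B u v p (dsumf f S).
Proof.
move=> pu pv; elim: S => [|[c D] S IH] h /=; first exact: typed_zero.
apply: typed_add; first by apply: typed_scale; apply: h; left.
by apply: IH => E hE; apply: h; right.
Qed.

Lemma dsumf_eqv A B u v p f g S : fpath u A B -> fpath v A B ->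
  (forall D, in_terms S D -> feq A B u v p (f D) (g D)) ->
  feq A B u v p (dsumf f S) (dsumf g S).
Proof.
move=> pu pv; elim: S => [|[c D] S IH] h /=; first exact/eqv_refl/typed_zero.
apply: eqv_add; first by apply: eqv_scale; apply: h; left.
by apply: IH => E hE; apply: h; right.
Qed.

(* [op] is additive and homogeneous, in the syntactic form given by the laws *)
Lemma dsumf_op A B A' B' u v p u' v' p' (op : fraw -> fraw) f S :
  fpath u' A' B' -> fpath v' A' B' ->
  (forall t, ftyped A' B' u' v' p' t -> ftyped A B u v p (op t)) ->
  feq A B u v p (op Zero) Zero ->
  (forall s t, law (op (Add s t)) (Add (op s) (op t))) ->
  (forall c t, law (op (Scale c t)) (Scale c (op t))) ->
  (forall D, in_terms S D -> ftyped A' B' u' v' p' (f D)) ->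
  feq A B u v p (op (dsumf f S)) (dsumf (fun D => op (f D)) S).
Proof.
move=> pu pv top op0 opD opZ; elim: S => [//|[c D] S IH] h /=.
have hD : ftyped A' B' u' v' p' (f D) by apply: h; left.
have hS : forall E, in_terms S E -> ftyped A' B' u' v' p' (f E).
  by move=> E hE; apply: h; right.
have tS := dsumf_typed pu pv hS; have tcD := typed_scale c hD.
apply: eqv_trans (eqv_law mu (opD _ _) (top _ (typed_add tcD tS)) _) _.
  exact: typed_add (top _ tcD) (top _ tS).
apply: eqv_add; last exact: IH.
exact: eqv_law (opZ _ _) (top _ tcD) (typed_scale c (top _ hD)).
Qed.

Definition good A B w v p D : Prop :=
  [/\ valid A B w D, wrun w D = v & ddeg D = p].

Lemma good_typed A B w v p D : good A B w v p D -> ftyped A B w v p (den w D).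
Proof. by case=> /valid_typed h <- <-. Qed.

Lemma good_path A B w v p D : good A B w v p D -> fpath w A B /\ fpath v A B.
Proof. by move/good_typed/typed_wpath. Qed.

(* one rewriting step, from a diagram to a linear combination of diagrams *)
Definition rewrites A B w v p D S : Prop :=
  [/\ good A B w v p D, forall E, in_terms S E -> good A B w v p E &
      feq A B w v p (den w D) (dsum w S)].

Lemma good_context A A' B' B w l u r v' p' D1 D D2 :
  fpath r A A' -> fpath l B' B -> valid A B w D1 -> wrun w D1 = l ++ u ++ r ->
  good A' B' u v' p' D -> valid A B (l ++ v' ++ r) D2 ->
  good A B w (wrun (l ++ v' ++ r) D2) (ddeg D2 + p' + ddeg D1)
       (D1 ++ shl (size l) D ++ D2).
Proof.
move=> pr pl h1 e1 [hD <- <-] h2.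
have fD := valid_fits hD.
split.
- apply/valid_cat; split=> //; rewrite e1; apply/valid_cat; split.
  exact: (valid_whisk pr pl).
  by rewrite wrun_whisk.
- by rewrite !wrun_cat e1 wrun_whisk.
- by rewrite !ddeg_cat ddeg_shl.
Qed.

Lemma den_context A A' B' B w l u r v' p' D1 D D2 :
  fpath r A A' -> fpath l B' B -> valid A B w D1 -> wrun w D1 = l ++ u ++ r ->
  good A' B' u v' p' D -> valid A B (l ++ v' ++ r) D2 ->
  feq A B w (wrun (l ++ v' ++ r) D2) (ddeg D2 + p' + ddeg D1)
    (den w (D1 ++ shl (size l) D ++ D2))
    (den (l ++ v' ++ r) D2 \v (fid R d l \h (den u D \h fid R d r)) \v den w D1).
Proof.
move=> pr pl h1 e1 hD h2; have [hv <- <-] := good_context pr pl h1 e1 hD h2.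
case: (hD) => vD e _; have fD := valid_fits vD.
apply: eqv_trans (den_cat hv) _.
rewrite ddeg_cat wrun_cat e1 in hv *.
apply: eqv_vc (valid_refl h1).
have h12 : valid A B (l ++ u ++ r) (shl (size l) D ++ D2).
  by case/valid_cat: hv; rewrite e1.
rewrite e1; apply: eqv_trans (den_cat h12) _; rewrite ddeg_cat wrun_cat.
rewrite wrun_whisk // e; apply: eqv_vc; first exact: (valid_refl h2).
rewrite ddeg_shl -e; exact: (den_whisk pr pl vD).
Qed.

(** The context is a composite of four operations on terms, two whiskerings and two vertical
    compositions, each of them linear. *)
Lemma rewrites_context A A' B' B w l u r v' p' D1 D D2 S :
  fpath r A A' -> fpath l B' B -> valid A B w D1 -> wrun w D1 = l ++ u ++ r ->
  valid A B (l ++ v' ++ r) D2 -> rewrites A' B' u v' p' D S ->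
  rewrites A B w (wrun (l ++ v' ++ r) D2) (ddeg D2 + p' + ddeg D1)
    (D1 ++ shl (size l) D ++ D2)
    [seq (cE.1, D1 ++ shl (size l) cE.2 ++ D2) | cE <- S].
Proof.
move=> pr pl h1 e1 h2 [gD gS eDS].
have gS' E : in_terms [seq (cE.1, D1 ++ shl (size l) cE.2 ++ D2) | cE <- S] E ->
    exists2 E', in_terms S E' & E = D1 ++ shl (size l) E' ++ D2.
  elim: S {gS eDS} => //= -[c E'] S IH [<-|/IH[E2 h ->]]; first by exists E' => //; left.
  by exists E2 => //; right.
split; first exact: (good_context pr pl h1 e1 gD h2).
  by move=> E /gS'[E' hE' ->]; apply: (good_context pr pl h1 e1 (gS _ hE') h2).
have [pu pv] := good_path gD.
have ir := @typed_id R fpr _ _ _ pr; have il := @typed_id R fpr _ _ _ pl.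
have t1 := valid_typed h1; have t2 := valid_typed h2.
apply: eqv_trans (den_context pr pl h1 e1 gD h2) _.
have tS := dsumf_typed pu pv (fun E hE => good_typed (gS E hE)).
have w1 t : ftyped A' B' u v' p' t ->
    ftyped A B' (u ++ r) (v' ++ r) p' (t \h fid R d r).
  by move=> tt; apply: (@typed_deg _ fpr _ _ _ _ (p' + 0)); [rewrite addr0|exact: (typed_hc tt ir)].
have w2 t : ftyped A B' (u ++ r) (v' ++ r) p' t ->
    ftyped A B (l ++ u ++ r) (l ++ v' ++ r) p' (fid R d l \h t).
  by move=> tt; apply: (@typed_deg _ fpr _ _ _ _ (0 + p')); [rewrite add0r|exact: (typed_hc il tt)].
rewrite -e1 in w2 *.
have w3 t : ftyped A B (wrun w D1) (l ++ v' ++ r) p' t ->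
    ftyped A B (wrun w D1) (wrun (l ++ v' ++ r) D2) (ddeg D2 + p')
      (den (l ++ v' ++ r) D2 \v t) by apply: typed_vc.
have w4 t : ftyped A B (wrun w D1) (wrun (l ++ v' ++ r) D2) (ddeg D2 + p') t ->
    ftyped A B w (wrun (l ++ v' ++ r) D2) (ddeg D2 + p' + ddeg D1)
      (t \v den w D1) by move=> tt; apply: typed_vc tt t1.
pose X t := den (l ++ v' ++ r) D2 \v (fid R d l \h (t \h fid R d r)) \v den w D1.
have eX s t : feq A' B' u v' p' s t ->
    feq A B w (wrun (l ++ v' ++ r) D2) (ddeg D2 + p' + ddeg D1) (X s) (X t).
  move=> e; apply: eqv_vc (valid_refl h1); apply: eqv_vc; first exact: (valid_refl h2).
  apply: (@eqv_deg _ _ fpr _ _ _ _ (0 + (p' + 0))); first by rewrite addr0 add0r.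
  rewrite e1; apply: eqv_hc; first exact: (eqv_refl mu il).
  exact: eqv_hc e (eqv_refl _ ir).
apply: eqv_trans (eX _ _ eDS) _.
have pw1 := path_cat pu pr; have pv1 := path_cat pv pr.
have pw2 : fpath (wrun w D1) A B by rewrite e1; apply: path_cat pl pw1.
have pv2 := path_cat pl pv1.
have [pw0 pv3] := good_path (good_context pr pl h1 e1 gD h2).
have tD E : in_terms S E -> ftyped A' B' u v' p' (den u E).
  by move=> hE; apply/good_typed/gS.
(* The sum is pulled out of one operation at a time: right whisker, left whisker, postcomposition by
   [D2], precomposition by [D1]. *)
have d1 := dsumf_op pu pv w1 _ _ _ tD.
have {d1} d1 : feq A B' (u ++ r) (v' ++ r) p' (dsumf (den u) S \h fid R d r)
    (dsumf (fun E => den u E \h fid R d r) S).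
  apply: d1 => [|*|*]; [|exact: law_hcDl|exact: law_hcZl].
  apply: (@eqv_deg _ _ fpr _ _ _ _ (p' + 0)); first by rewrite addr0.
  by apply: eqv_hc0l ir; apply: eqv_refl; apply: typed_zero.
have d2 := dsumf_op pw1 pv1 w2 _ _ _ (fun E hE => w1 _ (tD E hE)).
have {d2} d2 : feq A B (wrun w D1) (l ++ v' ++ r) p'
    (fid R d l \h dsumf (fun E => den u E \h fid R d r) S)
    (dsumf (fun E => fid R d l \h (den u E \h fid R d r)) S).
  apply: d2 => [|*|*]; [|exact: law_hcDr|exact: law_hcZr].
  rewrite e1; apply: (@eqv_deg _ _ fpr _ _ _ _ (0 + p')); first by rewrite add0r.
  by apply: eqv_hc0r il _; apply: eqv_refl; apply: typed_zero.
have d3 := dsumf_op pw2 pv2 w3 _ _ _ (fun E hE => w2 _ (w1 _ (tD E hE))).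
have {d3} d3 : feq A B (wrun w D1) (wrun (l ++ v' ++ r) D2) (ddeg D2 + p')
    (den (l ++ v' ++ r) D2 \v dsumf (fun E => fid R d l \h (den u E \h fid R d r)) S)
    (dsumf (fun E => den (l ++ v' ++ r) D2 \v (fid R d l \h (den u E \h fid R d r))) S).
  apply: d3 => [|*|*]; [|exact: law_vcDr|exact: law_vcZr].
  by apply: eqv_vc0r t2 _; apply: eqv_refl; apply: typed_zero.
have d4 := dsumf_op pw2 pv3 w4 _ _ _ (fun E hE => w3 _ (w2 _ (w1 _ (tD E hE)))).
have {d4} d4 : feq A B w (wrun (l ++ v' ++ r) D2) (ddeg D2 + p' + ddeg D1)
    (dsumf (fun E => den (l ++ v' ++ r) D2 \v (fid R d l \h (den u E \h fid R d r))) S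
      \v den w D1) (dsumf (fun E => X (den u E)) S).
  apply: d4 => [|*|*]; [|exact: law_vcDl|exact: law_vcZl].
  by apply: eqv_vc0l t1; apply: eqv_refl; apply: typed_zero.
apply: eqv_trans (eqv_trans d4 _).
  apply: eqv_vc (valid_refl h1); apply: eqv_trans (eqv_trans d3 (eqv_refl _ _)).
    apply: eqv_vc; first exact: (valid_refl h2).
    apply: eqv_trans (eqv_trans d2 (eqv_refl _ _)).
      rewrite e1; apply: (@eqv_deg _ _ fpr _ _ _ _ (0 + p')); first by rewrite add0r.
      exact: eqv_hc (eqv_refl _ il) d1.
    exact: eqv_typedr d2.
  exact: eqv_typedr d3.
have tX E : in_terms S E -> feq A B w (wrun (l ++ v' ++ r) D2) (ddeg D2 + p' + ddeg D1)
    (X (den u E)) (den w (D1 ++ shl (size l) E ++ D2)).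
  by move=> hE; apply: eqv_sym; apply: (den_context pr pl h1 e1 (gS _ hE) h2).
have := dsumf_eqv pw0 pv3 tX; congr eqv.
by elim: S {gS gS' eDS tS tD d1 d2 d3 d4 tX} => //= -[c E] S ->.
Qed.

End Denotation.

End Layers.
Import Layers.

(** * Juxtaposition and exchange of diagrams *)

Module LayersTheory.

Section Blocks.
Variables (R : comPzRingType) (K : ground R) (d : nat).
Local Notation mu := (bichar K).
Local Notation fraw := (raw R (foam_sig d)).
Local Notation fpr := (fpr K d).
Local Notation feq := (@eqv R mu fpr).
Local Notation ftyped := (@typed R (foam_sig d)).
Local Notation fpath := (@wpath (foam_sig d)).
Local Notation den := (@den R d).
Local Notation dsum := (@dsum R d).
Local Notation in_terms S D := (List.In D [seq cD.2 | cD <- S]).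
Implicit Types (A B C : flam d) (u v w l r : seq wlet) (D E : diag).

Lemma den_whiskl A B' B u v p l D :
  fpath l B' B -> good A B' u v p D ->
  feq A B (l ++ u) (l ++ v) p (den (l ++ u) (shl (size l) D)) (fid R d l \h den u D).
Proof.
move=> pl [vD ev ep].
have pr : fpath [::] A A by [].
have := den_whisk K pr pl vD; rewrite !cats0 ev ep => e; apply: eqv_trans e _.
have tD := valid_typed K vD; rewrite ev ep in tD.
apply: (@eqv_deg _ _ fpr _ _ _ _ (0 + p)); first by rewrite add0r.
apply: eqv_hc; first exact: (eqv_refl mu (@typed_id R fpr _ _ _ pl)).
have t2 := typed_hc tD (typed_id R pr); rewrite !cats0 addr0 in t2.
exact: eqv_law (law_hc1r _) t2 tD.
Qed.

Lemma den_whiskr A A' B u v p r D :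
  fpath r A A' -> good A' B u v p D ->
  feq A B (u ++ r) (v ++ r) p (den (u ++ r) D) (den u D \h fid R d r).
Proof.
move=> pr [vD ev ep].
have pl : fpath [::] B B by [].
have := den_whisk K pr pl vD; rewrite /= shl0 ev ep => e; apply: eqv_trans e _.
have tD := valid_typed K vD; rewrite ev ep in tD.
have t2 := typed_hc tD (typed_id R pr); rewrite addr0 in t2.
have t3 := typed_hc (typed_id R pl) t2; rewrite add0r in t3.
exact: (eqv_law mu (law_hc1l _) t3 t2).
Qed.

Lemma good_whisk A A' B' B u v p l r D :
  fpath r A A' -> fpath l B' B -> good A' B' u v p D ->
  good A B (l ++ u ++ r) (l ++ v ++ r) p (shl (size l) D).
Proof.
move=> pr pl [vD <- <-]; split; first exact: valid_whisk pr pl vD.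
  by rewrite wrun_whisk //; apply: valid_fits vD.
by rewrite ddeg_shl.
Qed.

Lemma good_whiskl A B' B u v p l D :
  fpath l B' B -> good A B' u v p D -> good A B (l ++ u) (l ++ v) p (shl (size l) D).
Proof.
move=> pl g; have pr : fpath [::] A A by [].
by have := good_whisk pr pl g; rewrite !cats0.
Qed.

Lemma good_whiskr A A' B u v p r D :
  fpath r A A' -> good A' B u v p D -> good A B (u ++ r) (v ++ r) p D.
Proof.
move=> pr g; have pl : fpath [::] B B by [].
by have := good_whisk pr pl g; rewrite /= shl0.
Qed.

Lemma good_cat A B u v w p q D E :
  good A B u v p D -> good A B v w q E -> good A B u w (q + p) (D ++ E).
Proof.
move=> [vD eD pD] [vE eE pE]; split.
- by apply/valid_cat; rewrite eD.
- by rewrite wrun_cat eD.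
- by rewrite ddeg_cat pD pE.
Qed.

Lemma good_catP A B u w p D E : good A B u w p (D ++ E) ->
  exists v q q', [/\ good A B u v q D, good A B v w q' E & p = q' + q].
Proof.
case=> /valid_cat[vD vE]; rewrite wrun_cat ddeg_cat => ew <-.
by exists (wrun u D), (ddeg D), (ddeg E); split.
Qed.

Lemma good_refl A B u : fpath u A B -> good A B u u 0 [::].
Proof. by []. Qed.

Lemma den_cat' A B u v w p q D E :
  good A B u v p D -> good A B v w q E ->
  feq A B u w (q + p) (den u (D ++ E)) (den v E \v den u D).
Proof.
move=> gD gE; have [v1 e1 e2] := good_cat gD gE; case: gD => vD eD pD.
by have := den_cat K v1; rewrite e1 e2 eD.
Qed.

(* both orders of two juxtaposed diagrams *)
Lemma den_juxt A B' B u u' w w' p q D E :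
  good B' B u u' p D -> good A B' w w' q E ->
  feq A B (u ++ w) (u' ++ w') (p + q) (den (u ++ w) (shl (size u) E ++ D))
    (den u D \h den w E) /\
  feq A B (u ++ w) (u' ++ w') (p + q) (den (u ++ w) (D ++ shl (size u') E))
    (Scale (mu q p) (den u D \h den w E)).
Proof.
move=> gD gE; have [pu pu'] := good_path K gD; have [pw pw'] := good_path K gE.
have tD := good_typed K gD; have tE := good_typed K gE.
have iu := @typed_id R fpr _ _ _ pu; have iu' := @typed_id R fpr _ _ _ pu'.
have iw := @typed_id R fpr _ _ _ pw; have iw' := @typed_id R fpr _ _ _ pw'.
have h1 : feq B' B u u' p (den u D \v fid R d u) (den u D).
  by apply: (@eqv_law R mu fpr _ _ _ _ _ _ _ (law_vc1r _ _) _ tD); have := typed_vc tD iu; rewrite addr0.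
have h2 : feq B' B u u' p (fid R d u' \v den u D) (den u D).
  by apply: (@eqv_law R mu fpr _ _ _ _ _ _ _ (law_vc1l _ _) _ tD); have := typed_vc iu' tD; rewrite add0r.
have h3 : feq A B' w w' q (den w E \v fid R d w) (den w E).
  by apply: (@eqv_law R mu fpr _ _ _ _ _ _ _ (law_vc1r _ _) _ tE); have := typed_vc tE iw; rewrite addr0.
have h4 : feq A B' w w' q (fid R d w' \v den w E) (den w E).
  by apply: (@eqv_law R mu fpr _ _ _ _ _ _ _ (law_vc1l _ _) _ tE); have := typed_vc iw' tE; rewrite add0r.
have tDE := typed_hc tD tE.
split.
  have e0 := den_cat' (good_whiskl pu gE) (good_whiskr pw' gD).
  apply: eqv_trans e0 _.
  apply: eqv_trans (eqv_vc (den_whiskr pw' gD) (den_whiskl pu gE)) _.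
  have := eqv_interchange mu tD iw' iu tE; rewrite addr0 add0r mu0r => e.
  apply: eqv_trans (e) _; apply: eqv_trans (eqv_scale 1 (eqv_hc h1 h4)) _.
  exact: eqv_law (law_scale1 _) (typed_scale 1 tDE) tDE.
(* Now [E], of degree [q], lies above [D], of degree [p]; interchange moves one past the other and
   yields [mu q p]. *)
have e0 := den_cat' (good_whiskr pw gD) (good_whiskl pu' gE).
rewrite addrC; apply: eqv_trans e0 _.
apply: eqv_trans (eqv_vc (den_whiskl pu' gE) (den_whiskr pw gD)) _.
have := eqv_interchange mu iu' tE tD iw; rewrite addr0 add0r => e.
apply: eqv_trans (e) _; rewrite addrC; exact: eqv_scale (eqv_hc h2 h3).
Qed.

Lemma dsum1 A B u v p c D : good A B u v p D ->
  feq A B u v p (dsum u [:: (c, D)]) (Scale c (den u D)).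
Proof.
move=> gD; have tD := good_typed K gD; have [pu pv] := good_path K gD.
have tz := @typed_zero R fpr _ _ _ _ p pu pv.
have tc := typed_scale c tD.
apply: eqv_trans (eqv_law mu (law_addC _ _) (typed_add tc tz) (typed_add tz tc)) _.
exact: eqv_law (law_add0 _) (typed_add tz tc) tc.
Qed.

Definition conv A B u v p c D E : Prop := rewrites K A B u v p D [:: (c, E)].

Lemma convP A B u v p c D E : conv A B u v p c D E <->
  [/\ good A B u v p D, good A B u v p E & feq A B u v p (den u D) (Scale c (den u E))].
Proof.
split=> [[gD gE e]|[gD gE e]].
  have gE' : good A B u v p E by apply: gE; left.
  by split=> //; apply: eqv_trans e (dsum1 _ gE').
split=> //; first by move=> E0 [<-|[]].
exact: eqv_trans e (eqv_sym (dsum1 c gE)).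
Qed.

Lemma conv_refl A B u v p D : good A B u v p D -> conv A B u v p 1 D D.
Proof.
move=> g; apply/convP; split=> //; have t := good_typed K g.
exact/eqv_sym/(eqv_law mu (law_scale1 _) (typed_scale 1 t) t).
Qed.

Lemma conv_trans A B u v p c c' D E F : conv A B u v p c D E ->
  conv A B u v p c' E F -> conv A B u v p (c * c') D F.
Proof.
move=> /convP[gD gE e] /convP[_ gF e']; apply/convP; split=> //.
apply: eqv_trans e (eqv_trans (eqv_scale c e') _).
have t := good_typed K gF.
exact: eqv_law (law_scaleA _ _ _) (typed_scale c (typed_scale c' t)) (typed_scale _ t).
Qed.

Lemma conv_sym A B u v p c c' D E : c' * c = 1 -> conv A B u v p c D E ->
  conv A B u v p c' E D.
Proof.
move=> ec /convP[gD gE e]; apply/convP; split=> //.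
apply: eqv_sym; apply: eqv_trans (eqv_scale c' e) _.
have t := good_typed K gE.
apply: eqv_trans (eqv_law mu (law_scaleA _ _ _) (typed_scale c' (typed_scale c t)) (typed_scale _ t)) _.
rewrite ec; exact: eqv_law (law_scale1 _) (typed_scale 1 t) t.
Qed.

(** The exponents of X and Y are symmetric in [p] and [q], with X^2 = Y^2 = 1, while that of Z is
    antisymmetric. Exchanges in the two directions thus have inverse scalars. *)
Lemma mu_inv p q : mu p q * mu q p = 1.
Proof.
have zX m : zpow (gX K) (gX K) m * zpow (gX K) (gX K) m = 1.
  case: m => k /=; rewrite -exprMn gXX expr1n //.
have zY m : zpow (gY K) (gY K) m * zpow (gY K) (gY K) m = 1.
  case: m => k /=; rewrite -exprMn gYY expr1n //.
have zZ m : zpow (gZ K) (gZi K) m * zpow (gZ K) (gZi K) (- m) = 1.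
  case: m => [[|k]|k] /=; first by rewrite !expr0 mulr1.
    by rewrite -exprMn gZK expr1n.
  by rewrite -exprMn mulrC gZK expr1n.
have -> : mu q p = zpow (gX K) (gX K) (p.1 * q.1) * zpow (gY K) (gY K) (p.2 * q.2)
    * zpow (gZ K) (gZi K) (- (p.1 * q.2 - p.2 * q.1)).
  by rewrite /bichar opprB [q.1 * p.1]mulrC [q.2 * p.2]mulrC [q.1 * _]mulrC [q.2 * _]mulrC.
by rewrite /bichar mulrACA [X in X * _]mulrACA zX zY zZ !mulr1.
Qed.

(** Both orders of height denote the same horizontal composite up to the scalar of [den_juxt]. *)
Lemma block_swap A B' B u u' w w' p q D E :
  good B' B u u' p D -> good A B' w w' q E ->
  conv A B (u ++ w) (u' ++ w') (p + q) (mu q p)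
    (D ++ shl (size u') E) (shl (size u) E ++ D).
Proof.
move=> gD gE; have [e1 e2] := den_juxt gD gE; apply/convP.
have [pu pu'] := good_path K gD; have [pw pw'] := good_path K gE.
split; last exact: eqv_trans e2 (eqv_scale _ (eqv_sym e1)).
  by rewrite addrC; exact: good_cat (good_whiskr pw gD) (good_whiskl pu' gE).
exact: good_cat (good_whiskl pu gE) (good_whiskr pw' gD).
Qed.

Lemma conv_context A A' B' B l u v r p c D E :
  fpath r A A' -> fpath l B' B -> conv A' B' u v p c D E ->
  conv A B (l ++ u ++ r) (l ++ v ++ r) p c (shl (size l) D) (shl (size l) E).
Proof.
move=> pr pl h; have [gD gE _] := (convP _ _ _ _ _ _ _ _).1 h.
have [pu pv] := good_path K gD.
have p1 := path_cat pl (path_cat pu pr); have p2 := path_cat pl (path_cat pv pr).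
have := @rewrites_context _ K _ _ _ _ _ (l ++ u ++ r) l u r v p [::] D [::] _ pr pl p1 erefl p2 h.
by rewrite /= !cats0 add0r addr0.
Qed.

Lemma conv_cat A B u v w p q c c' D D' E E' :
  conv A B u v p c D D' -> conv A B v w q c' E E' ->
  conv A B u w (q + p) (c' * c) (D ++ E) (D' ++ E').
Proof.
move=> /convP[gD gD' eD] /convP[gE gE' eE]; apply/convP; split.
- exact: good_cat gD gE.
- exact: good_cat gD' gE'.
apply: eqv_trans (den_cat' gD gE) (eqv_trans (eqv_vc eE eD) _).
have tD := good_typed K gD'; have tE := good_typed K gE'.
have t1 := typed_vc tE tD.
apply: eqv_trans (eqv_law mu (law_vcZl _ _ _) (typed_vc (typed_scale c' tE) (typed_scale c tD))
  (typed_scale c' (typed_vc tE (typed_scale c tD)))) _.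
apply: eqv_trans (eqv_scale c' (eqv_law mu (law_vcZr _ _ _)
  (typed_vc tE (typed_scale c tD)) (typed_scale c t1))) _.
apply: eqv_trans (eqv_law mu (law_scaleA _ _ _) (typed_scale c' (typed_scale c t1))
  (typed_scale _ t1)) _.
exact: eqv_scale (eqv_sym (den_cat' gD' gE')).
Qed.

End Blocks.

End LayersTheory.
Import LayersTheory.

Module Flattening.

(** * Flattening of foam expressions *)

Definition wlet_code (k : wlet) : bool * nat :=
  match k with Wm i => (false, i) | Wp i => (true, i) end.
Definition wlet_decode (c : bool * nat) : wlet := if c.1 then Wp c.2 else Wm c.2.
Lemma wlet_codeK : cancel wlet_code wlet_decode. Proof. by case. Qed.
HB.instance Definition _ := Equality.copy wlet (can_type wlet_codeK).

Definition fgen_code (g : fgen) : nat * (wlet * wlet) :=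
  match g with
  | FDot i => (0%N, (Wm i, Wm 0)) | FCup i => (1%N, (Wm i, Wm 0))
  | FCap i => (2%N, (Wm i, Wm 0)) | FZip i => (3%N, (Wm i, Wm 0))
  | FUnzip i => (4%N, (Wm i, Wm 0)) | FCross k l => (5%N, (k, l))
  end.
Definition fgen_decode (c : nat * (wlet * wlet)) : fgen :=
  let i := wcol c.2.1 in
  match c.1 with
  | 0 => FDot i | 1 => FCup i | 2 => FCap i | 3 => FZip i | 4 => FUnzip i
  | _ => FCross c.2.1 c.2.2
  end.
Lemma fgen_codeK : cancel fgen_code fgen_decode. Proof. by case. Qed.
HB.instance Definition _ := Equality.copy fgen (can_type fgen_codeK).

Section Flat.
Variables (R : comPzRingType) (d : nat).
Local Notation fraw := (raw R (foam_sig d)).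

Fixpoint rsrc (t : fraw) : seq wlet :=
  match t with
  | Gen g => fsrc g | Id w => w | _ \v t => rsrc t | s \h t => rsrc s ++ rsrc t
  | _ => [::]
  end.

Fixpoint rtgt (t : fraw) : seq wlet :=
  match t with
  | Gen g => ftgt g | Id w => w | s \v _ => rtgt s | s \h t => rtgt s ++ rtgt t
  | _ => [::]
  end.

(** In a horizontal composite the right factor comes first: of the two orders in [den_juxt], this is
    the one without a scalar. *)
Fixpoint flat (t : fraw) : diag :=
  match t with
  | Gen g => [:: (0%N, g)]
  | s \v t => flat t ++ flat s
  | s \h t => shl (size (rsrc s)) (flat t) ++ flat s
  | _ => [::]
  end.

(* composites of generators and identities, with matching words *)
Fixpoint wf (t : fraw) : Prop :=
  match t with
  | Gen _ | Id _ => True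
  | s \v t => [/\ wf s, wf t & rsrc s = rtgt t]
  | s \h t => wf s /\ wf t
  | _ => False
  end.

Fixpoint mono (t : fraw) : bool :=
  match t with
  | Gen _ | Id _ => true
  | s \v t | s \h t => mono s && mono t
  | _ => false
  end.

Fixpoint lflat (t : fraw) : seq (R * diag) :=
  match t with
  | Zero => [::]
  | Add s t => lflat s ++ lflat t
  | Scale c t => [seq (c * cD.1, cD.2) | cD <- lflat t]
  | _ => [:: (1, flat t)]
  end.

(** The source word is a parameter because [Zero] carries none. *)
Fixpoint lwf (u : seq wlet) (t : fraw) : Prop :=
  match t with
  | Zero => True
  | Add s t => lwf u s /\ lwf u t
  | Scale c t => lwf u t
  | _ => wf t /\ rsrc t = u
  end.

Lemma wf_mono t : wf t -> mono t.
Proof. by elim: t => //= s IHs t IHt [] => [/IHs-> /IHt->|/IHs-> /IHt->]. Qed.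

Lemma wf_fits t : wf t -> fits (rsrc t) (flat t) /\ wrun (rsrc t) (flat t) = rtgt t.
Proof.
elim: t => //= [g _|s IHs t IHt [/IHs[fs es] /IHt[ft et] e]|s IHs t IHt [/IHs[fs es] /IHt[ft et]]].
- split; first by split=> //; exists [::], [::]; rewrite cats0.
  by rewrite -[X in wapp X]cats0 (@wappE [::]) //= cats0.
- by rewrite wrun_cat et -e; split=> //; apply/fits_cat; rewrite et -e.
have e1 : wrun (rsrc s ++ rsrc t) (shl (size (rsrc s)) (flat t)) = rsrc s ++ rtgt t.
  by have := wrun_whisk (rsrc s) [::] ft; rewrite !cats0 et.
have e2 : wrun (rsrc s ++ rtgt t) (flat s) = rtgt s ++ rtgt t.
  by have := wrun_whisk [::] (rtgt t) fs; rewrite /= shl0 es.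
have whisk l u r D : fits u D -> fits (l ++ u ++ r) (shl (size l) D).
  elim: D u => //= -[k g] D IH u [fg fD]; split; last first.
    by rewrite wapp_whisk; [apply: IH|split].
  case: fg => l' [r' [-> /= lk]]; exists (l ++ l'), (r' ++ r).
  by rewrite size_cat lk -!catA.
split; last by rewrite wrun_cat e1 e2.
apply/fits_cat; rewrite e1; split.
  by have := whisk (rsrc s) _ [::] _ ft; rewrite cats0.
by have := whisk [::] _ (rtgt t) _ fs; rewrite /= shl0.
Qed.

End Flat.

Section FlatSound.
Variables (R : comPzRingType) (K : ground R) (d : nat).
Local Notation mu := (bichar K).
Local Notation fraw := (raw R (foam_sig d)).
Local Notation fpr := (fpr K d).
Local Notation feq := (@eqv R mu fpr).
Local Notation ftyped := (@typed R (foam_sig d)).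
Local Notation fpath := (@wpath (foam_sig d)).
Local Notation den := (@den R d).
Local Notation dsum := (@dsum R d).
Local Notation in_terms S D := (List.In D [seq cD.2 | cD <- S]).
Implicit Types (A B C : flam d) (u v w l r : seq wlet) (D E : diag) (t : fraw).

Lemma ftyped_path A B u v p t : ftyped A B u v p t -> fpath u A B /\ fpath v A B.
Proof. exact: (@typed_wpath R fpr). Qed.

Lemma good_gen A B g : fpath (fsrc g) A B -> fpath (ftgt g) A B -> fgood g A ->
  good A B (fsrc g) (ftgt g) (fdeg g) [:: (0%N, g)].
Proof.
move=> ps pt hg; split=> /=; last by rewrite add0r.
  split; first by exists [::], [::], A, B; rewrite cats0.
  by rewrite -[X in wapp X]cats0 (@wappE [::]) //= cats0.
by rewrite -[X in wapp X]cats0 (@wappE [::]) //= cats0.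
Qed.

Lemma good_genP A B g v p : good A B (fsrc g) v p [:: (0%N, g)] ->
  [/\ v = ftgt g, p = fdeg g, fpath (fsrc g) A B, fpath (ftgt g) A B & fgood g A].
Proof.
case=> /= -[hL pv] ev <-.
rewrite -[X in wapp X]cats0 (@wappE [::]) //= cats0 in pv ev.
case: hL => l [r [A' [B' [/= e /eqP/nilP ? pr [hg ps pt pl]]]]]; subst l.
have r0 : r = [::].
  by apply: size0nil; have := congr1 size e; rewrite /= size_cat; lia.
subst r; rewrite /= in pr pl; subst A' B'; split=> //; by rewrite add0r.
Qed.

(** No coefficient appears, since [flat] follows the order of heights that costs nothing. *)
Lemma flat_sound A B u v p t : ftyped A B u v p t -> mono t ->
  [/\ u = rsrc t, v = rtgt t, wf t, good A B u v p (flat t) &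
      feq A B u v p t (den u (flat t))].
Proof.
elim=> {A B u v p t} //=.
- move=> A B u v p g /foam_gbdP[hg -> -> ->] ps pt _.
  have gg := good_gen ps pt hg; split=> //.
  have tg : ftyped A B (fsrc g) (ftgt g) (fdeg g) (@Gen R (foam_sig d) g).
    by apply: typed_gen => //; apply/foam_gbdP.
  have tI : ftyped A B (ftgt g) (ftgt g) 0 (fid R d (ftgt g)) by apply: typed_id.
  have tA : ftyped A A [::] [::] 0 (fid R d [::]) by apply: typed_id.
  have tB : ftyped B B [::] [::] 0 (fid R d [::]) by apply: typed_id.
  have t1 := typed_hc tB tg; rewrite add0r in t1.
  have t2 := typed_hc t1 tA; rewrite addr0 /= !cats0 in t2.
  have eL : lterm R d (fsrc g) (0%N, g) = fid R d [::] \h @Gen R (foam_sig d) g \h fid R d [::].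
    by rewrite -[X in lterm _ _ X]cats0 (@ltermE R d [::] [::]).
  have eW : wapp (fsrc g) (0%N, g) = ftgt g.
    by rewrite -[X in wapp X]cats0 (@wappE [::]) //= cats0.
  rewrite /= eL eW.
  have t3 := typed_vc tI t2; rewrite add0r in t3.
  apply: eqv_sym; apply: eqv_trans (eqv_law mu (law_vc1l _ _) t3 t2) _.
  apply: eqv_trans (eqv_law mu (law_hc1r _) t2 t1) _.
  exact: (eqv_law mu (law_hc1l _) t1 tg).
- move=> A B u pu _; split=> //; exact: (eqv_refl mu (@typed_id R fpr _ _ _ pu)).
- move=> A B u v w p q s t ts IHs tt IHt /andP[/IHs[es1 es2 ws gs es] /IHt[et1 et2 wt gt et]].
  split=> //; first by split=> //; rewrite -es1.
    exact: good_cat gt gs.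
  exact: eqv_trans (eqv_vc es et) (eqv_sym (den_cat' K gt gs)).
- move=> A B C u v u' v' p q s t ts IHs tt IHt /andP[/IHs[es1 es2 ws gs es] /IHt[et1 et2 wt gt et]].
  have [pu pv] := ftyped_path ts; have [pu' pv'] := ftyped_path tt.
  split; rewrite -?es1 -?es2 -?et1 -?et2 //.
exact: good_cat (good_whiskl pu gt) (good_whiskr pv' gs).
  have [e1 _] := den_juxt K gs gt.
  exact: eqv_trans (eqv_hc es et) (eqv_sym e1).
Qed.

(** Converse to [flat_sound]: a relation of the presentation holds only between typed terms, while
    derivations manipulate diagrams, so typings must be recovered from diagrams. *)
Lemma wf_typed A B v p t : wf t -> good A B (rsrc t) v p (flat t) ->
  v = rtgt t /\ ftyped A B (rsrc t) v p t.
Proof.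
elim: t A B v p => //=.
- move=> g A B v p _ /good_genP[-> -> ps pt hg]; split=> //.
  by apply: typed_gen => //; apply/foam_gbdP.
- by move=> w A B v p _ [/= pw <- <-]; split=> //; apply: typed_id.
- move=> s IHs t IHt A B v p [ws wt e] /good_catP[v' [q [q' [gt gs ->]]]].
  have [? tt] := IHt _ _ _ _ wt gt; subst v'; rewrite -e in gs tt.
  have [-> ts] := IHs _ _ _ _ ws gs; split=> //.
  exact: typed_vc ts tt.
move=> s IHs t IHt A B v p [ws wt] /good_catP[v' [q [q' [[v1 e1 p1] gs ->]]]].
have [ft et] := wf_fits wt; have [fs es] := wf_fits ws.
have := wrun_whisk (rsrc s) [::] ft; rewrite !cats0 et => e1'.
rewrite e1' in e1; subst v'.
(* The object between the two factors is not part of the diagram; it is recovered as the end of the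
   path of the right factor. *)
have [|B' v2 pl] := @valid_unwhisk d A A B (rsrc s) (rsrc t) [::] (flat t) erefl _ ft.
  by rewrite cats0.
have gt : good A B' (rsrc t) (rtgt t) q (flat t).
  by split=> //; rewrite -p1 ddeg_shl.
have [_ tt] := IHt _ _ _ _ wt gt; have [_ pt] := ftyped_path tt.
case: gs => v3 e3 p3; have := wrun_whisk [::] (rtgt t) fs; rewrite /= shl0 es => e3'.
rewrite e3' in e3; subst v.
have [|B'' v4 pl'] := @valid_unwhisk d A B' B [::] (rsrc s) (rtgt t) (flat s) pt _ fs.
  by rewrite /= shl0.
rewrite /= in pl'; subst B''.
have gs : good B' B (rsrc s) (rtgt s) q' (flat s) by [].
have [_ ts] := IHs _ _ _ _ ws gs.
split=> //.
exact: typed_hc ts tt.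
Qed.

Lemma lwf_typed A B u v p t : lwf u t -> fpath u A B -> fpath v A B ->
  (forall E, in_terms (lflat t) E -> good A B u v p E) -> ftyped A B u v p t.
Proof.
move=> h pu pv; elim: t h => //=.
- by move=> g [w <-] h; case: (@wf_typed A B v p (@Gen R (foam_sig d) g) w (h _ (or_introl erefl))).
- by move=> w [i <-] h; case: (@wf_typed A B v p (@Id R (foam_sig d) w) i (h _ (or_introl erefl))).
- by move=> s _ t _ [w <-] h; case: (@wf_typed A B v p (s \v t) w (h _ (or_introl erefl))).
- by move=> s _ t _ [w <-] h; case: (@wf_typed A B v p (s \h t) w (h _ (or_introl erefl))).
- by move=> *; apply: typed_zero.
- move=> s IHs t IHt [hs ht] h; apply: typed_add; [apply: IHs|apply: IHt] => // E hE; apply: h.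
    by rewrite map_cat; apply/List.in_or_app; left.
  by rewrite map_cat; apply/List.in_or_app; right.
- move=> c t IH ht h; apply: typed_scale; apply: IH => // E hE; apply: h.
  by rewrite -map_comp; congr List.In: hE; apply: eq_map.
Qed.

Lemma dsum_cat A B u v p S S' : fpath u A B -> fpath v A B ->
  (forall E, in_terms (S ++ S') E -> good A B u v p E) ->
  feq A B u v p (dsum u (S ++ S')) (Add (dsum u S) (dsum u S')).
Proof.
move=> pu pv; elim: S => [|[c D] S IH] /= h.
  have tS : ftyped A B u v p (dsum u S').
    by apply: (dsumf_typed pu pv) => E hE; apply/(good_typed K)/h.
  have tz := @typed_zero R fpr _ _ _ _ p pu pv.
  exact: eqv_sym (eqv_law mu (law_add0 _) (typed_add tz tS) tS).
have tc : ftyped A B u v p (Scale c (den u D)).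
  by apply/typed_scale/(good_typed K)/h; left.
have gS E : in_terms S E -> good A B u v p E.
  by move=> hE; apply: h; right; rewrite map_cat; apply/List.in_or_app; left.
have gS' E : in_terms S' E -> good A B u v p E.
  by move=> hE; apply: h; right; rewrite map_cat; apply/List.in_or_app; right.
have tS : ftyped A B u v p (dsum u S).
  by apply: (dsumf_typed pu pv) => E hE; apply/(good_typed K)/gS.
have tS' : ftyped A B u v p (dsum u S').
  by apply: (dsumf_typed pu pv) => E hE; apply/(good_typed K)/gS'.
have e := IH (fun E hE => h E (or_intror hE)).
apply: eqv_trans (eqv_add (eqv_refl mu tc) e) _.
exact: eqv_law (law_addA _ _ _) (typed_add tc (typed_add tS tS'))
  (typed_add (typed_add tc tS) tS').
Qed.

Lemma dsum_scale A B u v p c S : fpath u A B -> fpath v A B ->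
  (forall E, in_terms S E -> good A B u v p E) ->
  feq A B u v p (dsum u [seq (c * cD.1, cD.2) | cD <- S]) (Scale c (dsum u S)).
Proof.
move=> pu pv; elim: S => [|[c' D] S IH] /= h.
  exact/eqv_sym/eqv_scaleZero.
have tD : ftyped A B u v p (den u D) by apply/(good_typed K)/h; left.
have tS : ftyped A B u v p (dsum u S).
  by apply: (dsumf_typed pu pv) => E hE; apply/(good_typed K)/h; right.
have e := IH (fun E hE => h E (or_intror hE)).
apply: eqv_sym; apply: eqv_trans (eqv_law mu (law_scaleDr c (Scale c' (den u D)) (dsum u S))
  (typed_scale _ (typed_add (typed_scale _ tD) tS))
  (typed_add (typed_scale _ (typed_scale _ tD)) (typed_scale _ tS))) _.
apply: eqv_add (eqv_sym e).
exact: (eqv_law mu (law_scaleA _ _ _) (typed_scale _ (typed_scale _ tD)) (typed_scale _ tD)).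
Qed.

Lemma lflat_sound A B u v p t : ftyped A B u v p t -> lwf u t ->
  (forall E, in_terms (lflat t) E -> good A B u v p E) /\
  feq A B u v p t (dsum u (lflat t)).
Proof.
have base A' B' u' v' p' t' : ftyped A' B' u' v' p' t' -> mono t' ->
    (forall E, in_terms [:: (1 : R, flat t')] E -> good A' B' u' v' p' E) /\
    feq A' B' u' v' p' t' (dsum u' [:: (1, flat t')]).
  move=> tt m; have [_ _ _ g e] := flat_sound tt m; split.
    by move=> E0 [<-|[]].
  apply: eqv_trans e _; apply: eqv_sym; apply: (eqv_trans (dsum1 K 1 g) _).
  have t1 := good_typed K g.
  exact: (eqv_law mu (law_scale1 _) (typed_scale 1 t1) t1).
elim: t => [g|w|s _ t _|s _ t _||s IHs t IHt|c t IH] tt.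
- by move=> _; apply: base.
- by move=> _; apply: base.
- by case=> /wf_mono m _; apply: base.
- by case=> /wf_mono m _; apply: base.
- by move=> _; split=> //; apply: eqv_refl.
- case=> ws wt; have [pu pv] := ftyped_path tt.
  have [ts tt'] : ftyped A B u v p s /\ ftyped A B u v p t by inversion tt.
  have [gs es] := IHs ts ws; have [gt et] := IHt tt' wt.
  have g E : in_terms (lflat s ++ lflat t) E -> good A B u v p E.
    rewrite map_cat => hE; case: (List.in_app_or _ _ _ hE) => {}hE; first exact: gs.
    exact: gt.
  split=> //; apply: eqv_trans (eqv_add es et) _.
  exact: eqv_sym (dsum_cat pu pv g).
move=> wt; have [pu pv] := ftyped_path tt.
have tt' : ftyped A B u v p t by inversion tt.
have [gt et] := IH tt' wt; split.
  by move=> E; rewrite /= -map_comp => hE; apply: gt; congr List.In: hE; apply: eq_map.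
apply: eqv_trans (eqv_scale c et) _.
exact: eqv_sym (dsum_scale c pu pv gt).
Qed.

(** Goodness of the flattened sides supplies the two typings under which the relation is imposed. *)
Lemma rel_rewrites A B v p s t : foam_rel K s t -> wf s -> lwf (rsrc s) t ->
  good A B (rsrc s) v p (flat s) ->
  (forall E, in_terms (lflat t) E -> good A B (rsrc s) v p E) ->
  rewrites K A B (rsrc s) v p (flat s) (lflat t).
Proof.
move=> st ws wt gs gt; split=> //.
have [_ ts] := wf_typed ws gs; have [pu pv] := good_path K gs.
have tt := lwf_typed wt pu pv gt.
have [_ _ _ _ es] := flat_sound ts (wf_mono ws).
have [_ et] := lflat_sound tt wt.
apply: eqv_trans (eqv_sym es) (eqv_trans _ et).
exact: (@eqv_rel R mu fpr A B _ _ _ _ _ st ts tt).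
Qed.

End FlatSound.

End Flattening.
Import Flattening.

Module Certificates.

(** * Scalar monomials *)

(* [MSc s x y p n] stands for (-1)^s X^x Y^y Z^p Z^-n. *)
Record mscal := MSc { ms : bool; mx : bool; my : bool; mp : nat; mn : nat }.

Definition sone := MSc false false false 0 0.
Definition sneg (c : mscal) := MSc (~~ ms c) (mx c) (my c) (mp c) (mn c).
Definition smul (c c' : mscal) :=
  MSc (ms c (+) ms c') (mx c (+) mx c') (my c (+) my c') (mp c + mp c') (mn c + mn c').
Definition sinvs (c : mscal) := MSc (ms c) (mx c) (my c) (mn c) (mp c).
(** As Z Z^-1 = 1, only the difference of the two exponents of Z is compared. *)
Definition seqs (c c' : mscal) : bool :=
  [&& ms c == ms c', mx c == mx c', my c == my c' & (mp c + mn c' == mp c' + mn c)%N].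

Definition smu (p q : Z2) : mscal :=
  let z := p.1 * q.2 - p.2 * q.1 in
  MSc false (odd `|p.1 * q.1|) (odd `|p.2 * q.2|)
    (if z is Posz k then k else 0) (if z is Negz k then k.+1 else 0).

Section Scalars.
Variables (R : comPzRingType) (K : ground R).

Definition sval_ (c : mscal) : R :=
  (-1) ^+ ms c * gX K ^+ mx c * gY K ^+ my c * (gZ K ^+ mp c * gZi K ^+ mn c).

Lemma pow_addb (x : R) (b b' : bool) : x * x = 1 -> x ^+ (b (+) b') = x ^+ b * x ^+ b'.
Proof. by move=> xx; case: b b' => [] [] /=; rewrite ?expr0 ?mul1r ?mulr1. Qed.

Lemma sval_mul c c' : sval_ (smul c c') = sval_ c * sval_ c'.
Proof.
rewrite /sval_ /= !pow_addb ?gXX ?gYY ?mulrNN ?mulr1 // !exprD; ring.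
Qed.

Lemma sval_one : sval_ sone = 1.
Proof. by rewrite /sval_ /= !mulr1. Qed.

Lemma sval_neg c : sval_ (sneg c) = - sval_ c.
Proof. by rewrite /sval_ /=; case: (ms c); rewrite /= ?expr0 ?expr1 -!mulrA ?mulN1r ?opprK ?mul1r. Qed.

Lemma pow_ZK k : gZ K ^+ k * gZi K ^+ k = 1.
Proof. by rewrite -exprMn gZK expr1n. Qed.

Lemma sval_eq c c' : seqs c c' -> sval_ c = sval_ c'.
Proof.
case/and4P => /eqP e1 /eqP e2 /eqP e3 /eqP e4; rewrite /sval_ e1 e2 e3; congr (_ * _).
rewrite -[LHS]mulr1 -(pow_ZK (mn c')) mulrACA -!exprD e4 -[in RHS](mulr1 (_ * gZi K ^+ mn c')).
by rewrite -(pow_ZK (mn c)) [in RHS]mulrACA -!exprD [(mn c' + _)%N]addnC.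
Qed.

Lemma sval_inv c : sval_ (sinvs c) * sval_ c = 1.
Proof.
rewrite -sval_mul -sval_one; apply: sval_eq.
by rewrite /seqs /= !addbb !eqxx /= !addn0 add0n addnC.
Qed.

Lemma zpow_odd (x : R) m : x * x = 1 -> zpow x x m = x ^+ odd `|m|.
Proof.
move=> xx; have h k : x ^+ k = x ^+ odd k.
  by rewrite -[in LHS](odd_double_half k) exprD -mul2n exprM expr2 xx expr1n mulr1.
by case: m => k; rewrite /= h.
Qed.

Lemma sval_mu p q : bichar K p q = sval_ (smu p q).
Proof.
rewrite /bichar /sval_ /= expr0 mul1r !zpow_odd ?gXX ?gYY //; congr (_ * _).
by case: (_ - _) => k /=; rewrite ?expr0 ?mulr1 ?mul1r.
Qed.

End Scalars.

(** * Certified rewriting of foams *)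

(** The last three names are consequences of the others: a dot changing colour beside a merge, the
    expansion of a zip after an unzip, and the mirror image of the squeeze relation. *)
Inductive rname :=
| RInv of wlet & wlet | RBraid of wlet & wlet & wlet | RSlide of wlet & fgen
| RDotSlide of nat & wlet | RDot2 of nat | RDotM of nat
| RZig1 of nat | RZig2 of nat | RZig3 of nat | RZig4 of nat
| RBub1 of nat | RBub0 of nat | RUZ of nat | RNeck of nat | RSq of nat
| RDotP of nat | RZU of nat | RSq2 of nat.

Record equation := Equation {
  e_src : seq wlet; e_lhs : diag; e_rhs : seq (mscal * diag) }.

Fixpoint slide (k : wlet) (w : seq wlet) : diag :=
  if w is l :: w' then (0%N, FCross k l) :: shl 1 (slide k w') else [::].

Definition is_vertex (g : fgen) : bool :=
  match g with FCup _ | FCap _ | FZip _ | FUnzip _ => true | _ => false end.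

Definition gcol (g : fgen) : nat :=
  match g with
  | FDot i | FCup i | FCap i | FZip i | FUnzip i => i | FCross k _ => wcol k
  end.

Definition rule_eq (r : rname) : equation :=
  match r with
  | RInv k l => Equation [:: k; l] [:: (0%N, FCross k l); (0%N, FCross l k)]
                  [:: (sone, [::])]
  | RBraid k l m => Equation [:: k; l; m]
      [:: (0%N, FCross k l); (1%N, FCross k m); (0%N, FCross l m)]
      [:: (sone, [:: (1%N, FCross l m); (0%N, FCross k m); (1%N, FCross k l)])]
  | RSlide k g => Equation (k :: fsrc g) ((1%N, g) :: slide k (ftgt g))
      [:: (sone, rcons (slide k (fsrc g)) (0%N, g))]
  | RDotSlide j k => Equation [:: k] [:: (0%N, FDot j)] [:: (sone, [:: (1%N, FDot j)])]
  | RDot2 i => Equation [::] [:: (0%N, FDot i); (0%N, FDot i)] [::]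
  | RDotM i => Equation [:: Wm i] [:: (0%N, FDot i)] [:: (sone, [:: (0%N, FDot i.+1)])]
  | RZig1 i => Equation [:: Wp i] [:: (1%N, FZip i); (0%N, FCap i)] [:: (sone, [::])]
  | RZig2 i => Equation [:: Wm i] [:: (0%N, FZip i); (1%N, FCap i)]
                 [:: (MSc false true false 0 0, [::])]
  | RZig3 i => Equation [:: Wm i] [:: (1%N, FCup i); (0%N, FUnzip i)]
                 [:: (MSc false false false 2 0, [::])]
  | RZig4 i => Equation [:: Wp i] [:: (0%N, FCup i); (1%N, FUnzip i)]
                 [:: (MSc false false true 2 0, [::])]
  | RBub1 i => Equation [::] [:: (0%N, FCup i); (1%N, FDot i); (0%N, FCap i)]
                 [:: (sone, [::])]
  | RBub0 i => Equation [::] [:: (0%N, FCup i); (0%N, FCap i)] [::]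
  | RUZ i => Equation [::] [:: (0%N, FZip i); (0%N, FUnzip i)]
               [:: (MSc false false false 1 0, [:: (0%N, FDot i)]);
                   (MSc false true true 1 0, [:: (0%N, FDot i.+1)])]
  | RNeck i => Equation [:: Wp i; Wm i] [::]
               [:: (sone, [:: (0%N, FCap i); (0%N, FCup i); (1%N, FDot i)]);
                   (sone, [:: (1%N, FDot i); (0%N, FCap i); (0%N, FCup i)])]
  | RSq i => Equation [:: Wp i; Wm i.+1; Wp i.+1; Wm i] [::]
      [:: (MSc false false false 0 1,
           [:: (1%N, FUnzip i.+1); (0%N, FCap i); (0%N, FCup i); (1%N, FZip i.+1)])]
  | RDotP i => Equation [:: Wp i] [:: (1%N, FDot i)] [:: (sone, [:: (1%N, FDot i.+1)])]
  | RZU i => Equation [:: Wm i; Wp i] [:: (0%N, FUnzip i); (0%N, FZip i)]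
      [:: (MSc false false true 2 0, [:: (0%N, FDot i.+1)]);
          (MSc false true false 2 0, [:: (2%N, FDot i)])]
  | RSq2 i => Equation [:: Wp i.+1; Wm i; Wp i; Wm i.+1] [::]
      [:: (MSc false true true 0 1,
           [:: (1%N, FUnzip i); (0%N, FCap i.+1); (0%N, FCup i.+1); (1%N, FZip i)])]
  end.

Definition rcond (r : rname) : bool :=
  match r with
  | RInv k l => far (wcol k) (wcol l)
  | RBraid k l m => [&& far (wcol k) (wcol l), far (wcol k) (wcol m)
                      & far (wcol l) (wcol m)]
  | RSlide k g => is_vertex g && far (wcol k) (gcol g)
  | RDotSlide j k => (j != wcol k) && (j != (wcol k).+1)
  | _ => true
  end.

Definition basic (r : rname) : bool :=
  match r with RDotP _ | RZU _ | RSq2 _ => false | _ => true end.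

Section RuleSound.
Variables (R : comPzRingType) (K : ground R) (d : nat).
Local Notation in_terms S D := (List.In D [seq cD.2 | cD <- S]).

Definition isc (S : seq (mscal * diag)) : seq (R * diag) :=
  [seq (sval_ K cD.1, cD.2) | cD <- S].

Definition rule_sound (r : rname) : Prop :=
  forall (A B : flam d) v p (e := rule_eq r), rcond r ->
  good A B (e_src e) v p (e_lhs e) ->
  (forall E, in_terms (e_rhs e) E -> good A B (e_src e) v p E) ->
  rewrites K A B (e_src e) v p (e_lhs e) (isc (e_rhs e)).

Lemma in_isc S D : in_terms (isc S) D = in_terms S D.
Proof. by congr List.In; rewrite /isc -map_comp; apply: eq_map. Qed.

Lemma basic_sound r : basic r -> rule_sound r.
Proof.
have main (e : equation) (s t : raw R (foam_sig d)) (A B : flam d) v p : foam_rel K s t -> wf s -> lwf (rsrc s) t ->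
    e_src e = rsrc s -> e_lhs e = flat s -> isc (e_rhs e) = lflat t ->
    good A B (e_src e) v p (e_lhs e) ->
    (forall E, in_terms (e_rhs e) E -> good A B (e_src e) v p E) ->
    rewrites K A B (e_src e) v p (e_lhs e) (isc (e_rhs e)).
  move=> st ws wt e1 e2 e3 gL gR; rewrite e1 e2 e3 in gL gR *.
  by apply: (rel_rewrites st ws wt gL) => E; rewrite -e3 in_isc; apply: gR.
have coefs : (sval_ K sone = 1) * (sval_ K (MSc false true false 0 0) = gX K)
    * (sval_ K (MSc false false false 2 0) = gZ K ^+ 2)
    * (sval_ K (MSc false false true 2 0) = gY K * gZ K ^+ 2)
    * (sval_ K (MSc false false false 1 0) = gZ K)
    * (sval_ K (MSc false true true 1 0) = gX K * gY K * gZ K)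
    * (sval_ K (MSc false false false 0 1) = gZi K).
  by do !split; rewrite /sval_ /= ?expr0 ?expr1 ?mulr1 ?mul1r.
case: r => // [k l|k l m|k g|j k|i|i|i|i|i|i|i|i|i|i|i] _ A B v p e h gL gR.
- apply: (main e _ _ _ _ _ _ (frel_cross_inv K d h) _ _ _ _ _ gL gR) => //.
  by rewrite /isc /= coefs.
- case/and3P: (h) => h1 h2 h3.
  apply: (main e _ _ _ _ _ _ (frel_braid K d h1 h2 h3) _ _ _ _ _ gL gR) => //.
  by rewrite /isc /= coefs.
- case/andP: (h) => vg h1.
  have hv : fvertex (gcol g) (@Gen R (foam_sig d) g) (fsrc g) (ftgt g).
    by case: g vg {e h gL gR h1} => //; constructor.
  apply: (main e _ _ _ _ _ _ (frel_slide K h1 hv) _ _ _ _ _ gL gR);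
    rewrite /e; clear e gL gR; case: g vg {h h1 hv} => //= i _; by rewrite /isc /= ?coefs.
- case/andP: (h) => h1 h2.
  apply: (main e _ _ _ _ _ _ (frel_dot_slide K d h1 h2) _ _ _ _ _ gL gR) => //.
  by rewrite /isc /= coefs.
- exact: (main e _ _ _ _ _ _ (frel_dot2 K d i) _ _ _ _ _ gL gR).
- apply: (main e _ _ _ _ _ _ (frel_dot_move K d i) _ _ _ _ _ gL gR) => //.
  by rewrite /isc /= coefs.
- apply: (main e _ _ _ _ _ _ (frel_zigzag1 K d i) _ _ _ _ _ gL gR) => //.
  by rewrite /isc /= coefs.
- apply: (main e _ _ _ _ _ _ (frel_zigzag2 K d i) _ _ _ _ _ gL gR) => //.
  by rewrite /isc /= coefs mulr1.
- apply: (main e _ _ _ _ _ _ (frel_zigzag3 K d i) _ _ _ _ _ gL gR) => //.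
  by rewrite /isc /= coefs mulr1.
- apply: (main e _ _ _ _ _ _ (frel_zigzag4 K d i) _ _ _ _ _ gL gR) => //.
  by rewrite /isc /= coefs mulr1.
- apply: (main e _ _ _ _ _ _ (frel_bubble1 K d i) _ _ _ _ _ gL gR) => //.
  by rewrite /isc /= coefs.
- exact: (main e _ _ _ _ _ _ (frel_bubble0 K d i) _ _ _ _ _ gL gR).
- apply: (main e _ _ _ _ _ _ (frel_unzip_zip K d i) _ _ _ _ _ gL gR) => //.
  by rewrite /isc /= !coefs !mulr1.
- apply: (main e _ _ _ _ _ _ (frel_neck K d i) _ _ _ _ _ gL gR) => //.
  by rewrite /isc /= !coefs.
- apply: (main e _ _ _ _ _ _ (frel_squeeze K d i) _ _ _ _ _ gL gR) => //.
  by rewrite /isc /= coefs mulr1.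
Qed.
End RuleSound.

End Certificates.
Import Certificates.

(** * Moves on diagrams, their soundness, and translation of colours *)

Module Recolouring.

(* [MSwap t b] exchanges the layers [t] and [t.+1]; [b] tells whether the upper
   one is on the left.  [MRule r b t k] applies the rule [r] ([b]: from right
   to left) from the layer [t] on, with [k] strands on its left. *)
Inductive move := MSwap of nat & bool | MRule of rname & bool & nat & nat.

Definition at_context D1 k D2 (S : seq (mscal * diag)) : seq (mscal * diag) :=
  [seq (cE.1, D1 ++ shl k cE.2 ++ D2) | cE <- S].

(** A rule is read backwards only when its right side is a single term, whose coefficient is then
    inverted. *)
Definition rsides (r : rname) (b : bool) : option (seq wlet * diag * seq (mscal * diag)) :=
  let e := rule_eq r in
  if b then
    if e_rhs e is [:: (c, E)] then Some (e_src e, E, [:: (sinvs c, e_lhs e)]) else None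
  else Some (e_src e, e_lhs e, e_rhs e).

Fixpoint fitsb (w : seq wlet) (D : diag) : bool :=
  if D is L :: D' then
    [&& (L.1 + size (fsrc L.2) <= size w)%N,
        take (size (fsrc L.2)) (drop L.1 w) == fsrc L.2 & fitsb (wapp w L) D']
  else true.

Lemma fitsP w D : fitsb w D -> fits w D.
Proof.
elim: D w => //= -[k g] D IH w /= /and3P[h /eqP e /IH fD]; split=> //.
exists (take k w), (drop (k + size (fsrc g)) w); split; last by rewrite /= size_takel; lia.
by rewrite -{1}e addnC -drop_drop !cat_take_drop.
Qed.

Definition similar (u : seq wlet) (L E : diag) : bool :=
  [&& fitsb u E, wrun u E == wrun u L & ddeg E == ddeg L].

Section Moves.
Variable ok : pred rname.

Definition apply_move (w : seq wlet) (D : diag) (m : move) : option (seq (mscal * diag)) :=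
  match m with
  | MSwap t b =>
    if drop t D is (i, g) :: (j, h) :: D2 then
      let c := smu (fdeg h) (fdeg g) in
      if b then
        if (j + size (fsrc h) <= i)%N then
          Some [:: (c, take t D ++ [:: (j, h), ((i - size (fsrc h) + size (ftgt h))%N, g) & D2])]
        else None
      else if (i + size (ftgt g) <= j)%N then
        Some [:: (c, take t D ++ [:: ((j - size (ftgt g) + size (fsrc g))%N, h), (i, g) & D2])]
      else None
    else None
  | MRule r b t k =>
    if rsides r b is Some (u, L, T) then
      let D1 := take t D in let D2 := drop (t + size L) D in
      if [&& ok r && rcond r, similar u L L, all (fun cE => similar u L cE.2) T,
             D == D1 ++ shl k L ++ D2
           & wrun w D1 == take k (wrun w D1) ++ u ++ drop (k + size u) (wrun w D1)]
         && (size (take k (wrun w D1)) == k)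
      then Some (at_context D1 k D2 T) else None
    else None
  end.

(** The moves in terms of decompositions of the word and of the diagram, a form in which soundness
    and stability under recolouring can be proved. *)
Inductive move_spec (w : seq wlet) : diag -> seq (mscal * diag) -> Prop :=
| spec_rule r b l r' u L S D1 D2 : ok r -> rcond r -> rsides r b = Some (u, L, S) ->
    similar u L L -> all (fun cE => similar u L cE.2) S ->
    wrun w D1 = l ++ u ++ r' ->
    move_spec w (D1 ++ shl (size l) L ++ D2) (at_context D1 (size l) D2 S)
| spec_swapr D1 D2 i g j h : (i + size (ftgt g) <= j)%N ->
    move_spec w (D1 ++ [:: (i, g), (j, h) & D2])
      [:: (smu (fdeg h) (fdeg g),
           D1 ++ [:: ((j - size (ftgt g) + size (fsrc g))%N, h), (i, g) & D2])]
| spec_swapl D1 D2 i g j h : (j + size (fsrc h) <= i)%N ->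
    move_spec w (D1 ++ [:: (i, g), (j, h) & D2])
      [:: (smu (fdeg h) (fdeg g),
           D1 ++ [:: (j, h), ((i - size (fsrc h) + size (ftgt h))%N, g) & D2])].

Lemma apply_moveP w D m S : apply_move w D m = Some S -> move_spec w D S.
Proof.
case: m => [t b|r b t k] /=.
  rewrite -[in move_spec _ D](cat_take_drop t D).
  case: (drop t D) => [|[i g] [|[j h] D2]] //.
  case: b; case: ifP => // hh [<-]; [exact: spec_swapl|exact: spec_swapr].
case e: (rsides r b) => [[[u L] S']|] //; case: ifP => // /andP[/and5P[/andP[hok hr] hL hS /eqP e1 /eqP e2] /eqP e3] [<-].
by rewrite [in move_spec _ D]e1 -{1 2}e3; apply: spec_rule e hL hS e2.
Qed.

End Moves.

Section MoveSound.
Variables (R : comPzRingType) (K : ground R) (d : nat).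
Local Notation fpath := (@wpath (foam_sig d)).
Local Notation in_terms S D := (List.In D [seq cD.2 | cD <- S]).
Implicit Types (A B : flam d).

Lemma cat_prefix (T : Type) (l l' s s' : seq T) : l ++ s = l' ++ s' ->
  (size l <= size l')%N -> exists2 m, l' = l ++ m & s = m ++ s'.
Proof.
elim: l l' => [|x l IH] [|y l'] //=; [by exists [::]|by exists (y :: l')|].
by case=> -> /IH h /h[m -> ->]; exists m.
Qed.

Lemma good_layer A B g : fpath (fsrc g) A B -> fpath (ftgt g) A B -> fgood g A ->
  good A B (fsrc g) (ftgt g) (fdeg g) [:: (0%N, g)].
Proof. exact: good_gen. Qed.

(** The second layer only meets strands to the right of the first generator. The word thus splits as
    [l0], the first generator, [m], the second generator, [r1], and two blocks are exchanged. *)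
Lemma swap_inner A B u i j g h : (i + size (ftgt g) <= j)%N ->
  valid A B u [:: (i, g); (j, h)] ->
  conv K A B u (wrun u [:: (i, g); (j, h)]) (fdeg g + fdeg h) (bichar K (fdeg h) (fdeg g))
    [:: (i, g); (j, h)] [:: ((j - size (ftgt g) + size (fsrc g))%N, h); (i, g)].
Proof.
move=> hij [hL1 [hL2 _]].
case: hL1 => l0 [r0 [A1 [B1 [/= eu li pr0 [hg ps pt pl0]]]]]; subst u i.
move: hL2; rewrite wappE // => -[l1 [r1 [A2 [B2 [/= e1 lj pr1 [hh ps' pt' pl1]]]]]].
have e1' : (l0 ++ ftgt g) ++ r0 = l1 ++ (fsrc h ++ r1) by rewrite -catA.
have [|m e2 e3] := cat_prefix e1'; first by rewrite size_cat lj.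
subst l1 r0 j; case/path_catP: pr0 => C1 /path_catP[C2 p1 p2] p3.
rewrite (fpath_fun p1 pr1) in p2; rewrite (fpath_fun p2 ps') in p3.
have gg : good B2 B1 (fsrc g ++ m) (ftgt g ++ m) (fdeg g) [:: (0%N, g)].
  by apply: good_whiskr p3 _; apply: good_layer.
have gh : good A2 B2 (fsrc h) (ftgt h) (fdeg h) [:: (0%N, h)] by apply: good_layer.
have := conv_context pr1 pl0 (block_swap K gg gh).
rewrite /= /shl /= !size_cat !addn0.
have -> : (size l0 + (size (ftgt g) + size m) = size l0 + size (ftgt g) + size m)%N by lia.
have -> : (size l0 + size (ftgt g) + size m - size (ftgt g) + size (fsrc g) =
  size l0 + (size (fsrc g) + size m))%N by lia.
have -> : l0 ++ ftgt g ++ m ++ fsrc h ++ r1 = (l0 ++ ftgt g ++ m) ++ fsrc h ++ r1.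
  by rewrite -!catA.
by rewrite wappE ?size_cat ?addnA // -!catA.
Qed.

Lemma swap_inner_l A B u i j g h : (j + size (fsrc h) <= i)%N ->
  valid A B u [:: (i, g); (j, h)] ->
  conv K A B u (wrun u [:: (i, g); (j, h)]) (fdeg h + fdeg g) (bichar K (fdeg h) (fdeg g))
    [:: (i, g); (j, h)] [:: (j, h); ((i - size (fsrc h) + size (ftgt h))%N, g)].
Proof.
move=> hij [hL1 [hL2 _]].
case: hL1 => l0 [r0 [A1 [B1 [/= eu li pr0 [hg ps pt pl0]]]]]; subst u i.
move: hL2; rewrite wappE // => -[l1 [r1 [A2 [B2 [/= e1 lj pr1 [hh ps' pt' pl1]]]]]].
have e1' : (l1 ++ fsrc h) ++ r1 = l0 ++ (ftgt g ++ r0) by rewrite -catA.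
have [|m e2 e3] := cat_prefix e1'; first by rewrite size_cat lj.
subst l0 r1 j; case/path_catP: pl0 => C1 p1 pl1'.
case/path_catP: pr1 => D1 /path_catP[D2 p4 p5] p6; have p3 := p1.
have {}p4 := fpath_fun p4 pr0; subst D2; have {}p5 := fpath_fun p5 pt; subst D1.
have {}p1 := fpath_fun p1 p6; subst C1.
case/path_catP: pl1' => C2 p7 p8; have {}p7 := fpath_fun p7 ps'; subst C2.
have gh : good B1 B2 (fsrc h ++ m) (ftgt h ++ m) (fdeg h) [:: (0%N, h)].
  by apply: good_whiskr p6 _; apply: good_layer.
have gg : good A1 B1 (fsrc g) (ftgt g) (fdeg g) [:: (0%N, g)] by apply: good_layer.
(* Here [block_swap] is read backwards; by [mu_inv] the inverse scalar is [mu (fdeg h) (fdeg g)],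
   the upper degree first, exactly as for the other direction. *)
have := conv_context pr0 p8 (conv_sym (mu_inv K _ _) (block_swap K gh gg)).
rewrite /= /shl /= !size_cat !addn0.
have -> : (size l1 + (size (fsrc h) + size m) = size l1 + size (fsrc h) + size m)%N by lia.
have -> : (size l1 + size (fsrc h) + size m - size (fsrc h) + size (ftgt h) =
  size l1 + (size (ftgt h) + size m))%N by lia.
by rewrite -!catA wappE.
Qed.

Lemma conv_inner A B A' B' w l u r v p c D1 D D' D2 :
  fpath r A A' -> fpath l B' B -> valid A B w D1 -> wrun w D1 = l ++ u ++ r ->
  valid A B (l ++ v ++ r) D2 -> conv K A' B' u v p c D D' ->
  conv K A B w (wrun (l ++ v ++ r) D2) (ddeg D2 + p + ddeg D1) c
    (D1 ++ shl (size l) D ++ D2) (D1 ++ shl (size l) D' ++ D2).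
Proof. by move=> pr pl h1 e1 h2 h; have := rewrites_context pr pl h1 e1 h2 h. Qed.

Lemma rewrites_rev A B u v p c c' D E : c' * c = 1 ->
  rewrites K A B u v p D [:: (c, E)] -> rewrites K A B u v p E [:: (c', D)].
Proof. exact: conv_sym. Qed.

Lemma in_at_context D1 k D2 S E :
  in_terms (at_context D1 k D2 S) E <-> exists2 F, in_terms S F & E = D1 ++ shl k F ++ D2.
Proof.
rewrite /at_context; elim: S E => [|[c G] S IH] E /=; first by split=> // -[].
split=> [[<-|h]|[F [<-|h] ->]].
- by exists G => //; left.
- by have [F h' ->] := (IH _).1 h; exists F => //; right.
- by left.
by right; apply: (IH _).2; exists F.
Qed.

Lemma swap_context A B w v p D1 D2 i g j h q D' :
  (forall B', valid A B' (wrun w D1) [:: (i, g); (j, h)] ->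
    conv K A B' (wrun w D1) (wrun (wrun w D1) [:: (i, g); (j, h)]) q
      (bichar K (fdeg h) (fdeg g)) [:: (i, g); (j, h)] D') ->
  good A B w v p (D1 ++ [:: (i, g), (j, h) & D2]) ->
  rewrites K A B w v p (D1 ++ [:: (i, g), (j, h) & D2])
    (isc K [:: (smu (fdeg h) (fdeg g), D1 ++ D' ++ D2)]).
Proof.
rewrite -[[:: (i, g), (j, h) & D2]]/([:: (i, g); (j, h)] ++ D2).
set L := [:: (i, g); (j, h)] => hconv [/valid_cat[v1 /valid_cat[vL v2]] <- <-].
have c := hconv _ vL; have [gL _ _] := (convP _ _ _ _ _ _ _ _ _).1 c.
have pr : fpath [::] A A by []; have pl : fpath [::] B B by [].
have e1 : wrun w D1 = [::] ++ wrun w D1 ++ [::] by rewrite cats0.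
have v2' : valid A B ([::] ++ wrun (wrun w D1) L ++ [::]) D2 by rewrite cats0.
have := conv_inner pr pl v1 e1 v2' c.
rewrite /= !shl0 cats0 !wrun_cat !ddeg_cat sval_mu.
have e2 : ddeg [:: (i, g), (j, h) & D2] = ddeg D2 + ddeg L by rewrite /= add0r addrA.
by case: gL => _ _ <-; rewrite e2.
Qed.

(** Goodness is known for whole diagrams only; [valid_unwhisk] restricts it to the place where the
    rule acts, and [rewrites_context] puts the result back. *)
Lemma spec_sound (ok : pred rname) A B w v p D S :
  (forall r, ok r -> rule_sound K d r) -> move_spec ok w D S ->
  good A B w v p D -> (forall E, in_terms S E -> good A B w v p E) ->
  rewrites K A B w v p D (isc K S).
Proof.
move=> rs; case=> {D S}.
- move=> r b l r' u L S D1 D2 hok hr hb /and3P[/fitsP fL _ _] hS e1 gD gS.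
  have [vD ev ep] := gD.
  case/valid_cat: vD => v1; rewrite e1 => /valid_cat[vL v2].
  rewrite (wrun_whisk _ _ fL) in v2.
  have /path_catP[A' pr _] := valid_path v2.
  have {pr} pr : exists A', fpath r' A A' by have := valid_pathr v1; rewrite e1 => /path_catP[? /path_catP[A2 p2 _] _]; exists A2.
  case: pr => A2 pr; have [B' gL' pl] := valid_unwhisk pr vL fL.
  have gL : good A2 B' u (wrun u L) (ddeg L) L by [].
  have gE E : in_terms S E -> good A2 B' u (wrun u L) (ddeg L) E.
    move=> hE; have : similar u L E.
      elim: S {hb gS} hS hE => //= -[c F] S IH /andP[hF hS] [<-//|]; exact: IH.
    case/and3P=> /fitsP fE /eqP eE /eqP pE.
    have : good A B w v p (D1 ++ shl (size l) E ++ D2).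
      by apply: gS; apply/in_at_context; exists E.
    case=> /valid_cat[_]; rewrite e1 => /valid_cat[vE _] _ _.
    have [B2 vE' _] := valid_unwhisk pr vE fE; split=> //.
    by rewrite (fpath_fun (valid_path gL') (valid_path vE')).
  have rL : rewrites K A2 B' u (wrun u L) (ddeg L) L (isc K S).
    case: b hb => /=; last first.
      case=> e2 e3 e4; rewrite -{}e2 -{}e3 -{}e4 in gL gE *; exact: rs.
    case e: (e_rhs _) => [|[c E] [|]] // [e2 e3 e4].
    have gE' : good A2 B' u (wrun u L) (ddeg L) (e_lhs (rule_eq r)).
      by apply: gE; rewrite -e4; left.
    rewrite -e4; apply: (rewrites_rev (sval_inv K c)).
    have := rs r hok A2 B' (wrun u L) (ddeg L) hr; rewrite e2 e e3; apply=> //.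
    by move=> ? [<-|[]].
  have := rewrites_context pr pl v1 e1 v2 rL.
  rewrite !wrun_cat e1 (wrun_whisk _ _ fL) in ev.
  rewrite !ddeg_cat ddeg_shl in ep; rewrite ev ep.
  by congr rewrites; rewrite /isc /at_context -!map_comp; apply: eq_map.
- move=> D1 D2 i g j h hij gD _.
  exact: swap_context (fun B' => @swap_inner A B' _ _ _ _ _ hij) gD.
move=> D1 D2 i g j h hij gD _.
exact: swap_context (fun B' => @swap_inner_l A B' _ _ _ _ _ hij) gD.
Qed.

End MoveSound.

(** * Foams with recoloured strands *)

Definition shk (s : nat) (k : wlet) : wlet :=
  match k with Wm i => Wm (s + i) | Wp i => Wp (s + i) end.

Definition shg (s : nat) (g : fgen) : fgen :=
  match g with
  | FDot i => FDot (s + i) | FCup i => FCup (s + i) | FCap i => FCap (s + i)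
  | FZip i => FZip (s + i) | FUnzip i => FUnzip (s + i)
  | FCross k l => FCross (shk s k) (shk s l)
  end.

Definition shd (s : nat) (D : diag) : diag := [seq (L.1, shg s L.2) | L <- D].

Definition shS (s : nat) (S : seq (mscal * diag)) : seq (mscal * diag) :=
  [seq (cD.1, shd s cD.2) | cD <- S].

Definition shr (s : nat) (r : rname) : rname :=
  match r with
  | RInv k l => RInv (shk s k) (shk s l)
  | RBraid k l m => RBraid (shk s k) (shk s l) (shk s m)
  | RSlide k g => RSlide (shk s k) (shg s g)
  | RDotSlide j k => RDotSlide (s + j) (shk s k)
  | RDot2 i => RDot2 (s + i) | RDotM i => RDotM (s + i)
  | RZig1 i => RZig1 (s + i) | RZig2 i => RZig2 (s + i)
  | RZig3 i => RZig3 (s + i) | RZig4 i => RZig4 (s + i)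
  | RBub1 i => RBub1 (s + i) | RBub0 i => RBub0 (s + i)
  | RUZ i => RUZ (s + i) | RNeck i => RNeck (s + i) | RSq i => RSq (s + i)
  | RDotP i => RDotP (s + i) | RZU i => RZU (s + i) | RSq2 i => RSq2 (s + i)
  end.

Notation shw s := (map (shk s)).

Section Shift.
Variable s : nat.

Lemma wcol_shk k : wcol (shk s k) = (s + wcol k)%N.
Proof. by case: k. Qed.

Lemma far_shk i j : far (s + i) (s + j) = far i j.
Proof. by rewrite /far; lia. Qed.

Lemma fsrc_shg g : fsrc (shg s g) = shw s (fsrc g).
Proof. by case: g. Qed.

Lemma ftgt_shg g : ftgt (shg s g) = shw s (ftgt g).
Proof. by case: g. Qed.

Lemma fdeg_shg g : fdeg (shg s g) = fdeg g.
Proof. by case: g. Qed.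

Lemma shd_cat D E : shd s (D ++ E) = shd s D ++ shd s E.
Proof. exact: map_cat. Qed.

Lemma shd_shl k D : shd s (shl k D) = shl k (shd s D).
Proof. by rewrite /shd /shl -!map_comp. Qed.

Lemma ddeg_shd D : ddeg (shd s D) = ddeg D.
Proof. by elim: D => //= L D ->; rewrite fdeg_shg. Qed.

Lemma wapp_sh w L : wapp (shw s w) (L.1, shg s L.2) = shw s (wapp w L).
Proof. by rewrite /wapp /= ftgt_shg fsrc_shg size_map !map_cat map_take map_drop. Qed.

Lemma wrun_sh w D : wrun (shw s w) (shd s D) = shw s (wrun w D).
Proof. by elim: D w => //= L D IH w; rewrite wapp_sh IH. Qed.

Lemma fitsb_sh w D : fitsb w D -> fitsb (shw s w) (shd s D).
Proof.
elim: D w => //= L D IH w /and3P[h /eqP e /IH]; rewrite -wapp_sh => ->.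
by rewrite fsrc_shg !size_map h -map_drop -map_take e eqxx.
Qed.

Lemma similar_sh u L E : similar u L E -> similar (shw s u) (shd s L) (shd s E).
Proof.
case/and3P=> /fitsb_sh h /eqP e /eqP e'.
by rewrite /similar h !wrun_sh !ddeg_shd e e' !eqxx.
Qed.

Definition she (e : equation) : equation :=
  Equation (shw s (e_src e)) (shd s (e_lhs e)) (shS s (e_rhs e)).

Lemma rule_eq_sh r : rcond r -> rule_eq (shr s r) = she (rule_eq r).
Proof.
case: r => //= [k g /andP[vg _]|i _|i _|i _|i _|i _|i _]; rewrite /she /=.
- by case: g vg.
all: by rewrite ?addnS.
Qed.

Lemma rcond_sh r : rcond (shr s r) = rcond r.
Proof.
have gcol_shg g : gcol (shg s g) = (s + gcol g)%N by case: g => //= *; apply: wcol_shk.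
have vertex_shg g : is_vertex (shg s g) = is_vertex g by case: g.
case: r => //= *; rewrite ?vertex_shg ?gcol_shg ?wcol_shk ?far_shk //.
by rewrite -addnS !eqn_add2l.
Qed.

(** Rules are uniform in the colours, so a derivation carried out at small colours can be replayed
    at translated ones. *)
Lemma move_spec_sh (ok : pred rname) w D S : (forall r, ok r -> ok (shr s r)) ->
  move_spec ok w D S -> move_spec ok (shw s w) (shd s D) (shS s S).
Proof.
move=> hs; case=> {D S}.
- move=> r b l r' u L S D1 D2 hok hr hb hL hS e.
  have hb' : rsides (shr s r) b = Some (shw s u, shd s L, shS s S).
    rewrite /rsides rule_eq_sh //; case: b hb; rewrite /rsides /=.
      by case: (e_rhs _) => [|[c E] [|]] //= [<- <- <-].
    by case=> <- <- <-.
  rewrite !shd_cat shd_shl -(size_map (shk s)).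
  have -> : shS s (at_context D1 (size (shw s l)) D2 S) =
      at_context (shd s D1) (size (shw s l)) (shd s D2) (shS s S).
    by rewrite /shS /at_context -!map_comp; apply: eq_map => cE /=; rewrite !shd_cat shd_shl.
  apply: (spec_rule _ (hs _ hok) _ hb'); rewrite ?rcond_sh //.
  + exact: similar_sh.
  + by elim: S {hb hb'} hS => //= cE S IH /andP[h /IH ->]; rewrite similar_sh.
  + by rewrite wrun_sh e !map_cat.
- move=> D1 D2 i g j h hij; rewrite /shS /= !shd_cat /=.
  have := @spec_swapr ok (shw s w) (shd s D1) (shd s D2) i (shg s g) j (shg s h).
  by rewrite !fsrc_shg !ftgt_shg !size_map !fdeg_shg; apply.
move=> D1 D2 i g j h hij; rewrite /shS /= !shd_cat /=.
have := @spec_swapl ok (shw s w) (shd s D1) (shd s D2) i (shg s g) j (shg s h).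
by rewrite !fsrc_shg !ftgt_shg !size_map !fdeg_shg; apply.
Qed.

End Shift.

(** * Checking foam computations at an explicit weight *)

Fixpoint ohas (c i : nat) (o : seq nat) : bool :=
  if o is x :: o' then if c == i then x == 1%N else ohas (c + x) i o' else false.

Definition fgoodb (g : fgen) (o : seq nat) : bool :=
  match g with
  | FDot i => ohas 1 i o
  | FCross k l => far (wcol k) (wcol l)
  | _ => true
  end.

Definition lchk (o : seq nat) (w : seq wlet) (L : layer) : bool :=
  let: (k, g) := L in
  [&& (k + size (fsrc g) <= size w)%N, take (size (fsrc g)) (drop k w) == fsrc g &
    if opath (drop (k + size (fsrc g)) w) o is Some o1 then
      if opath (fsrc g) o1 is Some o2 then
        [&& fgoodb g o1, opath (ftgt g) o1 == Some o2 & opath (take k w) o2 != None]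
      else false
    else false].

Fixpoint dchk (o : seq nat) (w : seq wlet) (D : diag) : bool :=
  if D is L :: D' then lchk o w L && dchk o (wapp w L) D' else opath w o != None.

Section Context.
Variables (l1 l2 : seq nat).
Hypothesis ones_l1 : ones_twos l1.
Let s := sumn l1.

Lemma ostep_shift c k o : ostep (s + c) (shk s k) o = ostep c k o.
Proof.
elim: o c => //= x o IH c; rewrite wcol_shk eqn_add2l -addnA IH.
by case: k {IH}.
Qed.

Lemma ostep_lt c k o o' : ostep c k o = Some o' -> (c <= wcol k)%N.
Proof.
elim: o c o' => //= x o IH c o'; case: eqP => [->//|_].
by case e: (ostep _ _ _) => [o1|] // _; move/IH: e; lia.
Qed.

Lemma ostep_before c k l o : ones_twos l -> (c + sumn l <= wcol k)%N ->
  ostep c k (l ++ o) = omap (cat l) (ostep (c + sumn l) k o).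
Proof.
elim: l c => [|x l IH] c /=; first by rewrite addn0; case: (ostep _ _ _).
case/andP=> hx hl ek; rewrite ifN; last by move: hx; lia.
rewrite IH //; last by lia.
by rewrite addnA; case: (ostep _ _ _).
Qed.

Lemma ostep_after c k o o' : ostep c k o = Some o' ->
  ostep c k (o ++ l2) = Some (o' ++ l2).
Proof.
elim: o c o' => //= x o IH c o'; case: eqP => _.
  case: k {IH} => i; first by case: x => [|[|[|]]] // [<-].
  by case: x => [|[|]] //; case: o => [|[|[|]] o] // [<-].
by case e: (ostep _ _ _) => [o1|] //= [<-]; rewrite (IH _ _ e).
Qed.

(** The coordinates to the left of the window translate the colours by their sum, and the scan stops
    before it meets those to the right. *)
Lemma ostep_context k o o' : ostep 1 k o = Some o' ->
  ostep 1 (shk s k) (l1 ++ o ++ l2) = Some (l1 ++ o' ++ l2).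
Proof.
move=> e; have h := ostep_lt e; rewrite ostep_before //; last by rewrite wcol_shk /s; lia.
by rewrite addnC ostep_shift (ostep_after e).
Qed.

Lemma opath_context w o o' : opath w o = Some o' ->
  opath (shw s w) (l1 ++ o ++ l2) = Some (l1 ++ o' ++ l2).
Proof.
elim: w o' => [|k w IH] o' /=; first by case=> ->.
by case e: (opath w o) => [o1|] //= /ostep_context; rewrite (IH _ e).
Qed.

Lemma ohasP i o : ohas 1 i o -> has_one (s + i) (l1 ++ o ++ l2).
Proof.
suff h c : ohas c i o -> exists a b, o = a ++ 1%N :: b /\ i = (c + sumn a)%N.
  move=> /h[a [b [-> ->]]]; exists (l1 ++ a), (b ++ l2); rewrite sumn_cat -!catA.
  by split=> //; rewrite /s; lia.
elim: o c => //= x o IH c; case: eqP => [->|_].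
  by move/eqP->; exists [::], o; split=> //; rewrite /= addn0.
by case/IH=> a [b [-> ->]]; exists (x :: a), b; split=> //=; rewrite addnA.
Qed.

Variable d : nat.
Implicit Types A B : flam d.
Local Notation fpath := (@wpath (foam_sig d)).

Lemma fpath_context A B w o o' : opath w o = Some o' ->
  sval A = l1 ++ o ++ l2 -> sval B = l1 ++ o' ++ l2 -> fpath (shw s w) A B.
Proof. by move=> /opath_context e eA eB; apply/fpathP; rewrite eA eB. Qed.

Lemma fpath_context_exists A w o o' : opath w o = Some o' ->
  sval A = l1 ++ o ++ l2 -> exists2 B, fpath (shw s w) A B & sval B = l1 ++ o' ++ l2.
Proof. by move=> /opath_context e eA; apply: fpath_exists; rewrite eA. Qed.

Lemma lchkP A B w L o : lchk o w L -> sval A = l1 ++ o ++ l2 ->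
  fpath (shw s w) A B -> lvalid A B (shw s w) (L.1, shg s L.2).
Proof.
case: L => k g /and3P[hk /eqP hg]; case e1: (opath _ o) => [o1|] //.
case e2: (opath _ o1) => [o2|] // /and3P[h1 /eqP h2 h3] eA.
case e3: (opath _ o2) h3 => [o3|] // _ pB.
have [A1 pr eA1] := fpath_context_exists e1 eA.
have [B1 ps eB1] := fpath_context_exists e2 eA1.
have [B2 pl eB2] := fpath_context_exists e3 eB1.
have ew : w = take k w ++ fsrc g ++ drop (k + size (fsrc g)) w.
  by rewrite -{1}hg addnC -drop_drop !cat_take_drop.
have {pB} eB : B = B2.
  apply: fpath_fun pB _; rewrite ew !map_cat; apply: path_cat pl _.
  exact: path_cat ps pr.
exists (shw s (take k w)), (shw s (drop (k + size (fsrc g)) w)), A1, B1; split=> //=.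
- by rewrite fsrc_shg -!map_cat -ew.
- by rewrite size_map size_takel //; lia.
split; rewrite ?fsrc_shg ?ftgt_shg //.
- by case: g h1 {hk hg e1 e2 h2 ew pr ps} => //= [i|k' l']; rewrite ?eA1;
    [apply: ohasP|rewrite !wcol_shk far_shk].
- exact: fpath_context h2 eA1 eB1.
by rewrite eB.
Qed.

(** A diagram checked at the window [o] only touches the coordinates of that window, hence is valid
    at every weight containing it. *)
Lemma dchkP A B w D o : dchk o w D -> sval A = l1 ++ o ++ l2 ->
  fpath (shw s w) A B -> valid A B (shw s w) (shd s D).
Proof.
move=> hD eA; elim: D w hD => //= L D IH w /andP[hL hD] pB.
have vL := lchkP hL eA pB; split=> //; rewrite wapp_sh; apply: IH => //.
by rewrite -wapp_sh; case: (lvalid_path vL).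
Qed.

End Context.

End Recolouring.
Import Recolouring.

(** * Certified vanishing of linear combinations of foams *)

Module Checks.

Definition lincomb := seq (mscal * diag).

Definition okd (o : seq nat) (w v : seq wlet) (p : Z2) (D : diag) : bool :=
  [&& dchk o w D, wrun w D == v & ddeg D == p].

(* [(i, m)] applies the move [m] to the [i]-th term *)
Definition script := seq (nat * move).

Fixpoint run_moves (ok : pred rname) o w v p (S : lincomb) (l : script) : option lincomb :=
  if l is (i, m) :: l' then
    if drop i S is (c, D) :: S2 then
      if apply_move ok w D m is Some T then
        if all (fun cE => okd o w v p cE.2) T then
          run_moves ok o w v p (take i S ++ [seq (smul c cE.1, cE.2) | cE <- T] ++ S2) l'
        else None
      else None
    else None
  else Some S.

Definition opposite (cD cE : mscal * diag) : bool :=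
  (cE.2 == cD.2) && seqs cD.1 (sneg cE.1).

(** [n] is fuel, initially the number of terms: every call removes the head together with one
    opposite term. *)
Fixpoint cancels (n : nat) (S : lincomb) : bool :=
  match n, S with
  | _, [::] => true
  | n'.+1, cD :: S' =>
      let i := find (opposite cD) S' in
      has (opposite cD) S' && cancels n' (take i S' ++ drop i.+1 S')
  | _, _ => false
  end.

(* the linear combination [S] of diagrams [w -> v] of degree [p] vanishes *)
Definition vanish (ok : pred rname) o w v p (S : lincomb) (l : script) : bool :=
  all (fun cE => okd o w v p cE.2) S &&
  (if run_moves ok o w v p S l is Some S' then cancels (size S') S' else false).

Section Vanish.
Variables (R : comPzRingType) (K : ground R) (d : nat).
Local Notation mu := (bichar K).
Local Notation fpr := (fpr K d).
Local Notation feq := (@eqv R mu fpr).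
Local Notation fraw := (raw R (foam_sig d)).
Local Notation ftyped := (@typed R (foam_sig d)).
Local Notation fpath := (@wpath (foam_sig d)).
Local Notation den := (@den R d).
Local Notation dsum := (@dsum R d).
Local Notation in_terms S D := (List.In D [seq cD.2 | cD <- S]).
Implicit Types (A B : flam d) (u v w : seq wlet) (t : fraw).

Lemma add_swap A B u v p a b c e : ftyped A B u v p a -> ftyped A B u v p b ->
  ftyped A B u v p c -> ftyped A B u v p e ->
  feq A B u v p (Add a (Add b (Add c e))) (Add (Add a c) (Add b e)).
Proof.
move=> ta tb tc te.
have h1 := @eqv_law R mu fpr _ _ _ _ _ _ _ (law_addA b c e) (typed_add tb (typed_add tc te)) (typed_add (typed_add tb tc) te).
have h2 := @eqv_law R mu fpr _ _ _ _ _ _ _ (law_addC b c) (typed_add tb tc) (typed_add tc tb).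
have h3 := @eqv_law R mu fpr _ _ _ _ _ _ _ (law_addA c b e) (typed_add tc (typed_add tb te)) (typed_add (typed_add tc tb) te).
have h4 := @eqv_law R mu fpr _ _ _ _ _ _ _ (law_addA a c (Add b e)) (typed_add ta (typed_add tc (typed_add tb te)))
  (typed_add (typed_add ta tc) (typed_add tb te)).
apply: eqv_trans _ h4; apply: eqv_add (@eqv_refl R mu fpr _ _ _ _ _ _ ta) _.
apply: eqv_trans h1 (eqv_trans (eqv_add h2 (@eqv_refl R mu fpr _ _ _ _ _ _ te)) (eqv_sym h3)).
Qed.

Lemma add_opp A B u v p c t : ftyped A B u v p t ->
  feq A B u v p (Add (Scale (- c) t) (Scale c t)) Zero.
Proof.
move=> tt; have t1 := typed_scale (- c) tt; have t2 := typed_scale c tt.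
have e := @eqv_law R mu fpr _ _ _ _ _ _ _ (law_scaleDl (- c) c t) (typed_scale _ tt) (typed_add t1 t2).
by apply: eqv_trans (eqv_sym e) _; rewrite addNr; apply: eqv_scale0.
Qed.

Definition allgood A B w v p (S : seq (R * diag)) : Prop :=
  forall E, in_terms S E -> good A B w v p E.

Lemma allgood_cat A B w v p S S' :
  allgood A B w v p (S ++ S') <-> allgood A B w v p S /\ allgood A B w v p S'.
Proof.
rewrite /allgood map_cat; split=> [h|[h h'] E /(List.in_app_or _ _ _)[/h|/h'] //].
by split=> E hE; apply: h; apply: List.in_or_app; [left|right].
Qed.

Lemma allgood_scale A B w v p c S :
  allgood A B w v p S -> allgood A B w v p [seq (c * cD.1, cD.2) | cD <- S].
Proof. by move=> h E; rewrite -map_comp => hE; apply: h; congr List.In: hE; apply: eq_map. Qed.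

Lemma dsum_rewrite A B w v p c D S1 S2 T : fpath w A B -> fpath v A B ->
  allgood A B w v p (S1 ++ (c, D) :: S2) -> rewrites K A B w v p D T ->
  let S' := S1 ++ [seq (c * cE.1, cE.2) | cE <- T] ++ S2 in
  allgood A B w v p S' /\
  feq A B w v p (dsum w (S1 ++ (c, D) :: S2)) (dsum w S').
Proof.
move=> pw pv gS [gD gT e] S'.
case/allgood_cat: (gS) => g1 gDS; have g2 : allgood A B w v p S2.
  by move=> E hE; apply: gDS; right.
have gcT : allgood A B w v p [seq (c * cE.1, cE.2) | cE <- T] by apply: allgood_scale.
have gT2 : allgood A B w v p ([seq (c * cE.1, cE.2) | cE <- T] ++ S2).
  by apply/allgood_cat.
have gS' : allgood A B w v p S' by apply/allgood_cat.
split=> //; have typ S : allgood A B w v p S -> ftyped A B w v p (dsum w S).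
  by move=> g; apply: (dsumf_typed pw pv) => E /g /(good_typed K).
apply: eqv_trans (dsum_cat K pw pv gS) (eqv_trans _ (eqv_sym (dsum_cat K pw pv gS'))).
apply: eqv_add (@eqv_refl R mu fpr _ _ _ _ _ _ (typ _ g1)) _.
apply: eqv_trans (eqv_sym (dsum_cat K pw pv gT2)).
apply: eqv_add (@eqv_refl R mu fpr _ _ _ _ _ _ (typ _ g2)).
exact: eqv_trans (eqv_scale c e) (eqv_sym (dsum_scale K c pw pv gT)).
Qed.

Lemma dsum_cancel A B w v p c D S1 S2 : fpath w A B -> fpath v A B ->
  allgood A B w v p ((- c, D) :: S1 ++ (c, D) :: S2) ->
  feq A B w v p (dsum w (S1 ++ S2)) Zero ->
  feq A B w v p (dsum w ((- c, D) :: S1 ++ (c, D) :: S2)) Zero.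
Proof.
move=> pw pv gS e; have gD : good A B w v p D by apply: gS; left.
have gS' : allgood A B w v p (S1 ++ (c, D) :: S2) by move=> E hE; apply: gS; right.
case/allgood_cat: (gS') => g1 gDS; have g2 : allgood A B w v p S2.
  by move=> E hE; apply: gDS; right.
have typ S : allgood A B w v p S -> ftyped A B w v p (dsum w S).
  by move=> g; apply: (dsumf_typed pw pv) => E /g /(good_typed K).
have tD := good_typed K gD.
apply: eqv_trans (eqv_add (@eqv_refl R mu fpr _ _ _ _ _ _ (typed_scale (- c) tD)) (dsum_cat K pw pv gS')) _.
apply: eqv_trans (add_swap (typed_scale (- c) tD) (typ _ g1) (typed_scale c tD) (typ _ g2)) _.
apply: eqv_add0; first exact: add_opp.
have g12 : allgood A B w v p (S1 ++ S2) by apply/allgood_cat.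
exact: eqv_trans (eqv_sym (dsum_cat K pw pv g12)) e.
Qed.

Lemma isc_cat S S' : isc K (S ++ S') = isc K S ++ isc K S'.
Proof. exact: map_cat. Qed.

Lemma isc_scale c S : isc K [seq (smul c cE.1, cE.2) | cE <- S] =
  [seq (sval_ K c * cE.1, cE.2) | cE <- isc K S].
Proof. by rewrite /isc -!map_comp; apply: eq_map => cE /=; rewrite sval_mul. Qed.

Variables (l1 l2 : seq nat).
Hypothesis ones_l1 : ones_twos l1.
Local Notation s := (sumn l1).

Lemma okd_good A B o w v p D : okd o w v p D -> sval A = l1 ++ o ++ l2 ->
  fpath (shw s w) A B -> good A B (shw s w) (shw s v) p (shd s D).
Proof.
case/and3P => hD /eqP <- /eqP <- eA pB; split; last exact: ddeg_shd.
  exact: dchkP hD eA pB.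
exact: wrun_sh.
Qed.

Lemma all_okd_good A B o w v p S : all (fun cE => okd o w v p cE.2) S ->
  sval A = l1 ++ o ++ l2 -> fpath (shw s w) A B ->
  allgood A B (shw s w) (shw s v) p (isc K (shS s S)).
Proof.
move=> hS eA pB E; rewrite in_isc; elim: S hS => //= -[c D] S IH /andP[hD hS] [<-|].
  exact: okd_good hD eA pB.
exact: IH.
Qed.

Lemma run_moves_sound (ok : pred rname) A B o w v p S l S' :
  (forall r, ok r -> ok (shr s r)) -> (forall r, ok r -> rule_sound K d r) ->
  sval A = l1 ++ o ++ l2 -> fpath (shw s w) A B -> fpath (shw s v) A B ->
  run_moves ok o w v p S l = Some S' ->
  allgood A B (shw s w) (shw s v) p (isc K (shS s S)) ->
  allgood A B (shw s w) (shw s v) p (isc K (shS s S')) /\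
  feq A B (shw s w) (shw s v) p (dsum (shw s w) (isc K (shS s S)))
    (dsum (shw s w) (isc K (shS s S'))).
Proof.
move=> oks okr eA pw pv; elim: l S => [|[i m] l IH] S /=.
  case=> <- gS; split=> //; apply/eqv_refl/(dsumf_typed pw pv) => E /gS.
  exact: good_typed.
have eS := cat_take_drop i S; move: eS; case: (drop i S) => [|[c D] S2] // eS.
case em: apply_move => [T|] //; case: ifP => // hT /IH{}IH.
rewrite -{1 2}eS /shS map_cat /= -/(shS s _) -/(shS s _) isc_cat /= => gS.
have sp := move_spec_sh oks (apply_moveP em).
have gT := all_okd_good hT eA pw.
have gD : good A B (shw s w) (shw s v) p (shd s D).
  by apply: gS; rewrite map_cat; apply/List.in_or_app; right; left.
have rT : rewrites K A B (shw s w) (shw s v) p (shd s D) (isc K (shS s T)).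
  by apply: (spec_sound okr sp gD) => E hE; apply: gT; rewrite in_isc.
have [gS' e] := dsum_rewrite pw pv gS rT.
have eS' : isc K (shS s (take i S ++ [seq (smul c cE.1, cE.2) | cE <- T] ++ S2)) =
    isc K (shS s (take i S)) ++ [seq (sval_ K c * cE.1, cE.2) | cE <- isc K (shS s T)]
      ++ isc K (shS s S2).
  by rewrite -isc_scale -!isc_cat /shS !map_cat -!map_comp.
rewrite eS' in IH; have [g1 e1] := IH gS'.
by split=> //; apply: eqv_trans e e1.
Qed.

Lemma shS_cat S S' : shS s (S ++ S') = shS s S ++ shS s S'.
Proof. exact: map_cat. Qed.

Lemma cancels_sound A B w v p n S : fpath w A B -> fpath v A B ->
  allgood A B w v p (isc K (shS s S)) -> cancels n S ->
  feq A B w v p (dsum w (isc K (shS s S))) Zero.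
Proof.
move=> pw pv; elim: n S => [|n IH] [|[c D] S] //= gS.
- by move=> _; apply/eqv_refl/typed_zero.
- by move=> _; apply/eqv_refl/typed_zero.
case/andP=> hS hc; have hi := hS; rewrite has_find in hi.
set i := find _ _ in hi hc *.
have := nth_find (c, D) hS; rewrite -/i.
have eS := drop_nth (c, D) hi; move: eS; case: (nth _ S i) => [c' D'] eS /andP[/= /eqP eD hcc].
subst D'; have {}hcc := sval_eq K hcc; rewrite sval_neg in hcc.
have eS' : S = take i S ++ (c', D) :: drop i.+1 S by rewrite -eS cat_take_drop.
rewrite eS' shS_cat isc_cat /= hcc in gS *.
have := @dsum_cancel A B w v p (sval_ K c') (shd s D) (isc K (shS s (take i S)))
  (isc K (shS s (drop i.+1 S))) pw pv gS.
apply; rewrite -isc_cat -shS_cat; apply: IH hc; rewrite shS_cat isc_cat.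
have /allgood_cat[g1 g2] : allgood A B w v p
    (isc K (shS s (take i S)) ++ (sval_ K c', shd s D) :: isc K (shS s (drop i.+1 S))).
  by move=> E hE; apply: gS; right.
by apply/allgood_cat; split=> // E hE; apply: g2; right.
Qed.

(** A single computation at the window [o] settles all weights of the form [l1 ++ o ++ l2], with the
    colours translated by the sum of [l1]. *)
Lemma vanish_sound (ok : pred rname) A B o w v p S l :
  (forall r, ok r -> ok (shr s r)) -> (forall r, ok r -> rule_sound K d r) ->
  sval A = l1 ++ o ++ l2 -> fpath (shw s w) A B -> fpath (shw s v) A B ->
  vanish ok o w v p S l ->
  allgood A B (shw s w) (shw s v) p (isc K (shS s S)) /\
  feq A B (shw s w) (shw s v) p (dsum (shw s w) (isc K (shS s S))) Zero.
Proof.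
move=> oks okr eA pw pv /andP[hS]; case er: run_moves => [S'|] // hc.
have gS := all_okd_good hS eA pw; split=> //.
have [gS' e] := run_moves_sound oks okr eA pw pv er gS.
exact: eqv_trans e (cancels_sound pw pv gS' hc).
Qed.

End Vanish.

End Checks.
Import Checks.

(** * Derived foam relations *)

Module ChecksTheory.

Definition opp_lc (S : lincomb) : lincomb := [seq (sneg cE.1, cE.2) | cE <- S].

(* the linear combination expressing a rule, and the degree of its terms *)
Definition rule_lc (r : rname) : lincomb :=
  let e := rule_eq r in (sone, e_lhs e) :: opp_lc (e_rhs e).

(** The script may only use [basic] rules, so that the derived ones rest on the presentation
    alone. *)
Definition rule_vanish (o : seq nat) (r : rname) (l : script) : bool :=
  let e := rule_eq r in
  vanish basic o (e_src e) (wrun (e_src e) (e_lhs e)) (ddeg (e_lhs e)) (rule_lc r) l.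

(** A zigzag inserted after the dot and then slid before it puts a strand [Wm 1] to the right of the
    dot, which changes colour there by [RDotM]. The other term receives a zigzag too, and the two
    cancel. *)
Definition dotp_script : script :=
  [:: (0, MRule (RZig1 1) true 1 0); (0, MSwap 0 false);
      (0, MRule (RDotM 1) false 1 1); (1, MRule (RZig1 1) true 1 0);
      (1, MSwap 0 false)]%N.

(** Performed before the unzip and to its left, the zip leaves [Wp 1, Wm 1] in the middle of the
    word. Neck-cutting applies there, and zigzags straighten both resulting terms. *)
Definition zu_script : script :=
  [:: (0, MSwap 0 true); (0, MRule (RNeck 1) false 1 1);
      (2, MRule (RDotM 1) true 0 0); (1, MSwap 0 false);
      (1, MRule (RZig2 1) false 1 0); (1, MRule (RZig4 1) false 1 1);
      (0, MSwap 3 false); (0, MRule (RZig2 1) false 0 0);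
      (0, MRule (RZig4 1) false 0 1)]%N.

(** Once cup and zip precede unzip and cap, the middle of the word is the source of [RSq 1]. With
    the foam of that relation inserted, zigzags straighten everything to the identity. *)
Definition sq2_script : script :=
  [:: (1, MSwap 1 true); (1, MSwap 2 true); (1, MSwap 0 true); (1, MSwap 1 true);
      (1, MRule (RSq 1) false 2 2); (1, MSwap 1 false); (1, MSwap 5 false);
      (1, MRule (RZig2 1) false 2 1); (1, MRule (RZig4 1) false 2 2);
      (1, MRule (RZig2 2) false 2 3); (1, MRule (RZig4 2) false 0 0)]%N.

Section Derived.
Variables (R : comPzRingType) (K : ground R) (d : nat).
Local Notation mu := (bichar K).
Local Notation fpr := (fpr K d).
Local Notation feq := (@eqv R mu fpr).
Local Notation ftyped := (@typed R (foam_sig d)).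
Local Notation fpath := (@wpath (foam_sig d)).
Local Notation den := (@den R d).
Local Notation dsum := (@dsum R d).
Implicit Types (A B : flam d) (u v w : seq wlet).

Lemma sub_eqv A B u v p s t t' : ftyped A B u v p t ->
  feq A B u v p (Add s t') Zero -> feq A B u v p t' (Scale (-1) t) ->
  ftyped A B u v p s -> feq A B u v p s t.
Proof.
move=> tt e e' ts; have tn := typed_scale (-1) tt; have [pu pv] := ftyped_path K tt.
have tz := @typed_zero R fpr _ _ _ _ p pu pv.
have e1 : feq A B u v p (Add (Add s (Scale (-1) t)) t) (Add Zero t).
  apply: eqv_add (@eqv_refl R mu fpr _ _ _ _ _ _ tt).
  exact: eqv_trans (eqv_add (@eqv_refl R mu fpr _ _ _ _ _ _ ts) (eqv_sym e')) e.
have e2 := @eqv_law R mu fpr _ _ _ _ _ _ _ (law_add0 t) (typed_add tz tt) tt.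
have e3 := @eqv_law R mu fpr _ _ _ _ _ _ _ (law_addA s (Scale (-1) t) t)
  (typed_add ts (typed_add tn tt)) (typed_add (typed_add ts tn) tt).
have e4 := @eqv_law R mu fpr _ _ _ _ _ _ _ (law_addN t) (typed_add tn tt) tz.
have e5 := @eqv_law R mu fpr _ _ _ _ _ _ _ (law_addC s Zero) (typed_add ts tz) (typed_add tz ts).
have e6 := @eqv_law R mu fpr _ _ _ _ _ _ _ (law_add0 s) (typed_add tz ts) ts.
apply: eqv_trans (eqv_sym (eqv_trans e5 e6)) _.
apply: eqv_trans (eqv_add (@eqv_refl R mu fpr _ _ _ _ _ _ ts) (eqv_sym e4)) _.
exact: eqv_trans e3 (eqv_trans e1 e2).
Qed.

Lemma isc_opp S : isc K (opp_lc S) = [seq (-1 * cE.1, cE.2) | cE <- isc K S].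
Proof.
by rewrite /isc /opp_lc -!map_comp; apply: eq_map => cE /=; rewrite sval_neg mulN1r.
Qed.

Lemma dsum_sub A B w v p S T : fpath w A B -> fpath v A B ->
  allgood A B w v p (isc K (S ++ opp_lc T)) ->
  feq A B w v p (dsum w (isc K (S ++ opp_lc T))) Zero ->
  feq A B w v p (dsum w (isc K S)) (dsum w (isc K T)).
Proof.
move=> pw pv gS e; rewrite isc_cat in gS e.
have [gS1 gS2] := (allgood_cat _ _ _ _ _ _ _).1 gS.
have gT : allgood A B w v p (isc K T).
  move=> E hE; apply: gS2; rewrite isc_opp -map_comp.
  by congr List.In: hE; apply: eq_map.
have typ S' : allgood A B w v p S' -> ftyped A B w v p (dsum w S').
  by move=> g; apply: (dsumf_typed pw pv) => E /g /(good_typed K).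
apply: (sub_eqv (typ _ gT) _ _ (typ _ gS1)).
  exact: eqv_trans (eqv_sym (dsum_cat K pw pv gS)) e.
by rewrite isc_opp; apply: (dsum_scale K).
Qed.

(** Two prefixes of the same sequence are comparable, and as the entries are 1 or 2, a difference of
    1 between the sums is a single entry 1. *)
Lemma cat_split (m1 m2 r1 r2 : seq nat) : ones_twos m1 -> ones_twos r1 ->
  m1 ++ m2 = r1 ++ r2 -> sumn r1 = (sumn m1).+1 -> r1 = rcons m1 1%N.
Proof.
move=> h1 h2 e es; have [hl|hl] := leqP (size m1) (size r1).
  have [m em _] := cat_prefix e hl; subst r1.
  move: es h2; rewrite sumn_cat /ones_twos all_cat => es /andP[_].
  case: m es {e hl} => [|x [|y m]] /=; rewrite -?cats1; first lia; last by lia.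
  by rewrite addn0 andbT => es /orP[]/eqP ex; subst x => //; lia.
have [m em _] := cat_prefix (esym e) (ltnW hl); subst m1.
by move: es; rewrite sumn_cat; lia.
Qed.

(* Rules are invariant under recolouring, so that they can be checked with the
   smallest possible colours. *)
Lemma derived_sound r s0 o l : rcond r -> rule_vanish o r l ->
  (forall A B, fpath (shw s0 (e_src (rule_eq r))) A B ->
    exists l1 l2, [/\ ones_twos l1, s0 = sumn l1 & sval A = l1 ++ o ++ l2]) ->
  rule_sound K d (shr s0 r).
Proof.
move=> hr hv hA A B v p e; rewrite /e rule_eq_sh // => _ gL gR.
have pw : fpath (shw s0 (e_src (rule_eq r))) A B by case: (good_path K gL).
have [l1 [l2 [h1 es eA]]] := hA A B pw; subst s0.
have [vL ev ep] := gL; rewrite /= wrun_sh ddeg_shd in ev ep; subst v p.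
have pv := valid_pathr vL; rewrite wrun_sh in pv.
have oks r' : basic r' -> basic (shr (sumn l1) r') by case: r'.
have [g e0] := vanish_sound h1 oks (@basic_sound R K d) eA pw pv hv.
split=> //; first by move=> E; rewrite in_isc; apply: gR.
have eS : isc K (shS (sumn l1) (rule_lc r)) =
  isc K ([:: (sone, shd (sumn l1) (e_lhs (rule_eq r)))] ++
    opp_lc (shS (sumn l1) (e_rhs (rule_eq r)))).
  by rewrite /rule_lc /= /isc /shS /opp_lc -!map_comp.
rewrite eS in g e0; have e1 := dsum_sub pw pv g e0.
apply: eqv_trans e1; apply: eqv_sym.
apply: eqv_trans (dsum1 K _ gL) _; rewrite sval_one.
have t := good_typed K gL.
exact: (@eqv_law R mu fpr _ _ _ _ _ _ _ (law_scale1 _) (typed_scale 1 t) t).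
Qed.

Lemma step_split k A B : foam_step k A B -> exists l1 l2, [/\ ones_twos l1,
  wcol k = (1 + sumn l1)%N & (sval A, sval B) =
    if k is Wm _ then (l1 ++ 2 :: l2, l1 ++ [:: 1, 1 & l2])%N
    else (l1 ++ [:: 1, 1 & l2], l1 ++ 2 :: l2)%N].
Proof.
by case: k => i [l1 [l2 [e1 e2 e3]]]; exists l1, l2; split; rewrite ?e1 ?e2 //;
  have := flam_ones A; have := flam_ones B; rewrite e1 e2 /ones_twos !all_cat => /andP[].
Qed.

Lemma rules_sound r : rule_sound K d r.
Proof.
have [/basic_sound//|] := boolP (basic r).
(* Colours start at 1: a rule at colour 0 has no typed instance, and every other one is a translate
   of the rule at colour 1. *)
have no0 A B w v p D : has (fun k => wcol k == 0%N) w -> ~ good A B w v p D.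
  move=> h /(good_path K)[pw _]; elim: w B pw h {v p D} => //= k w IH B [C pw].
  by case/step_split=> [l1 [l2 [_ -> _]]] /=; apply: IH pw.
case: r => // -[|i] _.
- by move=> A B v p e hr g; have := no0 _ _ _ _ _ _ _ g.
- rewrite (_ : RDotP i.+1 = shr i (RDotP 1)); last by rewrite /= addn1.
  apply: (@derived_sound _ _ [:: 1; 1]%N dotp_script) => //.
  move=> A B [C <- /step_split[l1 [l2 [h1 h2 [eA _]]]]].
  by exists l1, l2; split=> //; move: h2; rewrite /=; lia.
- by move=> A B v p e hr g; have := no0 _ _ _ _ _ _ _ g.
- rewrite (_ : RZU i.+1 = shr i (RZU 1)); last by rewrite /= addn1.
  apply: (@derived_sound _ _ [:: 1; 1]%N zu_script) => //.
  move=> A B [C [C1 <- /step_split[l1 [l2 [h1 h2 [eA _]]]]] _].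
  by exists l1, l2; split=> //; move: h2; rewrite /=; lia.
- by move=> A B v p e hr g; have := no0 _ _ _ _ _ _ _ g.
rewrite (_ : RSq2 i.+1 = shr i (RSq2 1)); last by rewrite /= addn1.
apply: (@derived_sound _ _ [:: 1; 2]%N sq2_script) => //.
move=> A B [C3 [C2 [C1 [C <- /step_split[l1 [l2 [h1 h2 [eA eC]]]]]]]].
move=> /step_split[r1 [r2 [h3 h4 [eC' _]]]] _ _.
(* [Wm] splits the 2 after [l1], then [Wp] merges the pair after [r1]. Their colours differ by 1, so
   [l1] is [r1] followed by a 1, and the window 1, 2 begins after [r1]. *)
exists r1, l2; split=> //; first by move: h4; rewrite /=; lia.
have := cat_split h3 h1 _ _; rewrite eC in eC'.
move=> -/(_ _ _ (esym eC')) el1.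
by rewrite eA el1 /= ?cat_rcons //; move: h2 h4; rewrite /=; lia.
Qed.

End Derived.

End ChecksTheory.
Import ChecksTheory.

Module DistantWebs.

(** * Crossings of distant strands *)

Fixpoint exch (u v : seq wlet) : diag :=
  if u is k :: u' then shl 1 (exch u' v) ++ slide k v else [::].

(* the strand [k] can be moved across the generator [g] *)
Definition apart (k : wlet) (g : fgen) : bool :=
  match g with
  | FDot j => (j != wcol k) && (j != (wcol k).+1)
  | FCross l m => [&& far (wcol k) (wcol l), far (wcol k) (wcol m) & far (wcol l) (wcol m)]
  | _ => far (wcol k) (gcol g)
  end.

Definition farw (u v : seq wlet) : bool := all (fun k => all (fun l => far (wcol k) (wcol l)) v) u.

Definition farD (u : seq wlet) (D : diag) : bool := all (fun k => all (fun L => apart k L.2) D) u.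

Lemma farC i j : far i j = far j i.
Proof. by rewrite /far orbC. Qed.

Lemma far_neq i j : far i j -> i != j.
Proof. by rewrite /far; lia. Qed.

Lemma farwC u v : farw u v = farw v u.
Proof.
by rewrite /farw -/(allrel _ _ _) allrelC; apply: eq_allrel => k l; rewrite farC.
Qed.

Lemma exch_cat u u' v : exch (u ++ u') v = shl (size u) (exch u' v) ++ exch u v.
Proof.
elim: u => [|k u IH] /=; first by rewrite shl0 cats0.
by rewrite IH shl_cat shl_shl add1n catA.
Qed.

Lemma slide_cat k v v' : slide k (v ++ v') = slide k v ++ shl (size v) (slide k v').
Proof.
by elim: v => [|l v IH] /=; rewrite ?shl0 // IH shl_cat shl_shl add1n.
Qed.

Lemma exch_nilr u : exch u [::] = [::].
Proof. by elim: u => //= k u ->. Qed.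

(** A step of colour i only replaces the coordinates occupying the colours i and i+1 and leaves the
    colours of all others unchanged; distant steps therefore act on disjoint places. *)
Lemma ostep_far c k l o o1 o2 : far (wcol k) (wcol l) ->
  ostep c l o = Some o1 -> ostep c k o1 = Some o2 ->
  exists2 o1', ostep c k o = Some o1' & ostep c l o1' = Some o2.
Proof.
move=> hf; elim: o c o1 o2 => //= x o IH c o1 o2.
case: eqP => [el|nel].
  have nk : (c == wcol k) = false by move: hf; rewrite /far; lia.
  have nk1 : ((c + 1)%N == wcol k) = false by move: hf; rewrite /far; lia.
  case: l el {IH hf} => i /= el.
    case: x => [|[|[|x]]] // [<-] /=; rewrite nk nk1 /= -addnA.
    case e: (ostep _ _ _) => [o'|] //= [<-]; exists (2 :: o')%N => //=.
    by rewrite el eqxx.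
  case: x => [|[|x]] //; case: o => [|[|[|y]] o] // [<-] /=; rewrite nk /= ?nk1 -addnA.
  case e: (ostep _ _ _) => [o'|] //= [<-]; exists [:: 1, 1 & o']%N => //=.
  by rewrite /= el eqxx.
case e: (ostep _ _ _) => [o'|] //= [<-] /=.
case: eqP => [ek|nek].
  have nl1 : ((c + 1)%N == wcol l) = false by move: hf; rewrite /far; lia.
  have nl : (c == wcol l) = false by apply/eqP.
  case: k ek {IH hf} => i /= ek.
    case: x e => [|[|[|x]]] // e [<-]; exists [:: 1, 1 & o]%N => //=.
    by rewrite nl nl1 /= -addnA e.
  case: x e => [|[|x]] //; case: o => [|y o] //= ; rewrite nl1.
  case e: (ostep _ _ _) => [o''|] //= [<-]; case: y e => [|[|y]] // e [<-].
  by exists (2 :: o)%N => //=; rewrite nl -addnA in e * ; rewrite e.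
case e2: (ostep _ _ _) => [o''|] //= [<-].
have [o1' e3 e4] := IH _ _ _ e e2; exists (x :: o1'); first by rewrite e3.
by rewrite /= e4; case: eqP.
Qed.

Section Far.
Variables (R : comPzRingType) (K : ground R) (d : nat).
Local Notation mu := (bichar K).
Local Notation fpath := (@wpath (foam_sig d)).
Implicit Types (A B : flam d) (u v w : seq wlet) (D E : diag).

Lemma path_far A B k l : far (wcol k) (wcol l) ->
  fpath [:: k; l] A B -> fpath [:: l; k] A B.
Proof.
move=> hf p; apply/fpathP; have {p} := (fpathP _ _ _).1 p.
rewrite /=; case e: (ostep 1 l _) => [o1|] //= e1.
by have [o1' /= -> /= ->] := ostep_far hf e e1.
Qed.

Lemma slide_good A B k v : fpath (k :: v) A B -> all (fun l => far (wcol k) (wcol l)) v ->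
  good A B (k :: v) (rcons v k) 0 (slide k v).
Proof.
elim: v B => [|l v IH] B; first by move=> p _; split.
rewrite -[k :: _]/([:: k; l] ++ v) => /path_catP[C pv pkl] /= /andP[hf hv].
have plk := path_far hf pkl.
have g1 : good C B [:: k; l] [:: l; k] 0 [:: (0%N, FCross k l)].
  by exact: (@good_gen d C B (FCross k l)).
have g1' := good_whiskr pv g1.
case: (plk) => C1 pk plC.
have pkv : fpath (k :: v) A C1 by apply: (@path_cat d [:: k]) pk pv.
have g2 := @good_whiskl d A C1 B _ _ _ [:: l] _ _ (IH _ pkv hv).
have := good_cat g1' (g2 _); rewrite addr0; apply.
by exists C1.
Qed.

Lemma exch_good A B u v : fpath (u ++ v) A B -> farw u v ->
  good A B (u ++ v) (v ++ u) 0 (exch u v).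
Proof.
elim: u B => [|k u IH] B; first by rewrite cats0 => p _; split.
case=> C puv pk /= /andP[hk hu].
have g1 := @good_whiskl d A C B _ _ _ [:: k] _ _ (IH _ puv hu).
have {}g1 := g1 (ex_intro2 _ _ C erefl pk).
have [_ pvu] := good_path K g1.
case: (pvu) => C' /path_catP[C2 pu pv] pk'.
have pkv : fpath (k :: v) C2 B by exists C'.
have := good_cat g1 (good_whiskr pu (slide_good pkv hk)).
by rewrite addr0 cat_rcons.
Qed.

(** Crossings have degree 0, so that moving them past any foam costs no scalar. *)
Definition cv A B u v p D E : Prop := conv K A B u v p 1 D E.

Lemma cv_refl A B u v p D : good A B u v p D -> cv A B u v p D D.
Proof. exact: conv_refl. Qed.

Lemma cv_sym A B u v p D E : cv A B u v p D E -> cv A B u v p E D.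
Proof. by apply: conv_sym; rewrite mulr1. Qed.

Lemma cv_trans A B u v p D E F : cv A B u v p D E -> cv A B u v p E F -> cv A B u v p D F.
Proof. by move=> h h'; have := conv_trans h h'; rewrite mulr1. Qed.

Lemma cv_good A B u v p D E : cv A B u v p D E -> good A B u v p D /\ good A B u v p E.
Proof. by case/convP. Qed.

Lemma cv_cat A B u v w p q D D' E E' :
  cv A B u v p D D' -> cv A B v w q E E' -> cv A B u w (q + p) (D ++ E) (D' ++ E').
Proof. by move=> h h'; have := conv_cat h h'; rewrite mulr1. Qed.

Lemma cv_cat0 A B u v w p D D' E E' :
  cv A B u v p D D' -> cv A B v w 0 E E' -> cv A B u w p (D ++ E) (D' ++ E').
Proof. by move=> h h'; have := cv_cat h h'; rewrite add0r. Qed.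

Lemma cv_0cat A B u v w p D D' E E' :
  cv A B u v 0 D D' -> cv A B v w p E E' -> cv A B u w p (D ++ E) (D' ++ E').
Proof. by move=> h h'; have := cv_cat h h'; rewrite addr0. Qed.

Lemma cv_whiskl A B' B l u v p D E : fpath l B' B -> cv A B' u v p D E ->
  cv A B (l ++ u) (l ++ v) p (shl (size l) D) (shl (size l) E).
Proof.
move=> pl h; have pr : fpath [::] A A by [].
by have := conv_context pr pl h; rewrite !cats0.
Qed.

Lemma cv_whiskr A A' B u v r p D E : fpath r A A' -> cv A' B u v p D E ->
  cv A B (u ++ r) (v ++ r) p D E.
Proof.
move=> pr h; have pl : fpath [::] B B by [].
by have := conv_context pr pl h; rewrite /= !shl0.
Qed.

Lemma cv_swapl A B' B u u' w w' q D E :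
  good B' B u u' 0 D -> good A B' w w' q E ->
  cv A B (u ++ w) (u' ++ w') q (D ++ shl (size u') E) (shl (size u) E ++ D).
Proof. by move=> gD gE; have := block_swap K gD gE; rewrite mu0r add0r. Qed.

Lemma cv_swapr A B' B u u' w w' p D E :
  good B' B u u' p D -> good A B' w w' 0 E ->
  cv A B (u ++ w) (u' ++ w') p (D ++ shl (size u') E) (shl (size u) E ++ D).
Proof. by move=> gD gE; have := block_swap K gD gE; rewrite mu0l addr0. Qed.

Lemma cv_rule r A B v p (e := rule_eq r) D : rcond r ->
  e_rhs e = [:: (sone, D)] -> good A B (e_src e) v p (e_lhs e) ->
  good A B (e_src e) v p D -> cv A B (e_src e) v p (e_lhs e) D.
Proof.
move=> hr eD gL gD; have := @rules_sound R K d r A B v p hr gL.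
rewrite -/e eD /isc /= sval_one; apply.
by move=> E [<-|[]].
Qed.

Lemma ohas_step c k o o' j : ostep c k o = Some o' -> j != wcol k ->
  j != (wcol k).+1 -> ohas c j o' = ohas c j o.
Proof.
move=> + h1 h2; elim: o c o' => //= x o IH c o'; case: eqP => [ec|_].
  have n1 : (c == j) = false by apply/eqP; lia.
  have n2 : ((c + 1)%N == j) = false by apply/eqP; lia.
  case: k h1 h2 {IH} ec => i /= h1 h2 ec.
    by case: x => [|[|[|x]]] // [<-] /=; rewrite n1 n2 -addnA.
  by case: x => [|[|x]] //; case: o => [|[|[|y]] o] // [<-] /=; rewrite n1 n2 -addnA.
by case e: (ostep _ _ _) => [o1|] //= [<-] /=; rewrite (IH _ _ e).
Qed.

Lemma has_oneP j A : has_one j (sval A) <-> ohas 1 j (sval A).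
Proof.
split; last by move=> h; have := @ohasP [::] [::] isT _ _ h; rewrite /= cats0.
have ho := flam_ones A; case=> l1 [l2 [eA ->]]; rewrite eA in ho *.
suff h c : ones_twos (l1 ++ 1%N :: l2) -> ohas c (c + sumn l1) (l1 ++ 1%N :: l2) by apply: h ho.
elim: l1 c {eA ho} => [|x l1 IH] c /=; first by rewrite addn0 eqxx.
case/andP=> hx /(IH (c + x)%N); rewrite addnA.
by case: ifP => // /eqP; move: hx; lia.
Qed.

Lemma fgood_step k g A B : apart k g -> foam_step k A B -> fgood g A -> fgood g B.
Proof.
case: g => //= j /andP[h1 h2] /foam_stepP e /has_oneP h.
by apply/has_oneP; rewrite (ohas_step e).
Qed.

(** Each generator has its own defining relation: dot slide, vertex slide, or the braid relation
    when the generator is itself a crossing. *)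
Lemma slide_gen A C B k g : apart k g -> all (fun l => far (wcol k) (wcol l)) (fsrc g) ->
  all (fun l => far (wcol k) (wcol l)) (ftgt g) ->
  fpath (fsrc g) A C -> fpath (ftgt g) A C -> fgood g A -> foam_step k C B ->
  cv A B (k :: fsrc g) (rcons (ftgt g) k) (fdeg g)
    ((1%N, g) :: slide k (ftgt g)) (slide k (fsrc g) ++ [:: (0%N, g)]).
Proof.
move=> ha hs ht ps pt hg st.
have pks : fpath (k :: fsrc g) A B by exists C.
have pkt : fpath (k :: ftgt g) A B by exists C.
have gs := slide_good pks hs; have gt := slide_good pkt ht.
have pk : fpath [:: k] C B by exists C.
have gL : good A B (k :: fsrc g) (rcons (ftgt g) k) (fdeg g) ((1%N, g) :: slide k (ftgt g)).
  have := good_cat (good_whiskl pk (good_gen ps pt hg)) gt; by rewrite add0r.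
have gR : good A B (k :: fsrc g) (rcons (ftgt g) k) (fdeg g) (slide k (fsrc g) ++ [:: (0%N, g)]).
  have [_] := good_path K gs; rewrite -cats1 => /path_catP[A' [A0 <- sk] ps'].
  have [_] := good_path K gt; rewrite -cats1 => /path_catP[A1 pk1 pt'].
  have eA : A' = A1 by apply: fpath_fun pk1; exists A.
  rewrite -{A1}eA in pk1 pt'.
  have g1 := good_whiskr pk1 (good_gen ps' pt' (fgood_step ha sk hg)).
  by have := good_cat gs (_ : good A B (rcons (fsrc g) k) (rcons (ftgt g) k) (fdeg g) [:: (0%N, g)]); rewrite addr0 -!cats1; apply.
case: g ha hs ht ps pt hg pks pkt gs gt gL gR => [j|i|i|i|i|l m] ha hs ht ps pt hg pks pkt gs gt gL gR.
- exact: cv_sym (@cv_rule (RDotSlide j k) _ _ _ _ _ ha erefl gR gL).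
- exact: (@cv_rule (RSlide k (FCup i)) _ _ _ _ _ ha erefl gL gR).
- exact: (@cv_rule (RSlide k (FCap i)) _ _ _ _ _ ha erefl gL gR).
- exact: (@cv_rule (RSlide k (FZip i)) _ _ _ _ _ ha erefl gL gR).
- exact: (@cv_rule (RSlide k (FUnzip i)) _ _ _ _ _ ha erefl gL gR).
- exact: cv_sym (@cv_rule (RBraid k l m) _ _ _ _ _ ha erefl gR gL).
Qed.

Lemma apart_src k g : apart k g -> all (fun l => far (wcol k) (wcol l)) (fsrc g).
Proof. by case: g => //= [i ->|i ->|l m /and3P[-> ->]]. Qed.

Lemma apart_tgt k g : apart k g -> all (fun l => far (wcol k) (wcol l)) (ftgt g).
Proof. by case: g => //= [i ->|i ->|l m /and3P[-> ->]]. Qed.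

(** The strand [k] crosses [l], then the generator, then [r]. The outer crossings are disjoint from
    the generator, and only the middle ones use a relation. *)
Lemma slide_layer A C B k u L : apart k L.2 ->
  all (fun l => far (wcol k) (wcol l)) u -> lvalid A C u L -> foam_step k C B ->
  cv A B (k :: u) (rcons (wapp u L) k) (fdeg L.2)
    (shl 1 [:: L] ++ slide k (wapp u L)) (slide k u ++ [:: L]).
Proof.
case: L => i g /= ha hu [l [r [A1 [B1 [/= eu <- pr [hg ps pt pl]]]]]] st; subst u.
move: hu; rewrite wappE // !all_cat => /and3P[hl hs hr].
have ht := apart_tgt ha.
have pkl : fpath (k :: l) B1 B by exists C.
have gl := slide_good pkl hl.
have [_] := good_path K gl; rewrite -cats1 => /path_catP[C1 [B2 <- sk] pl'].
have mid := slide_gen ha hs ht ps pt hg sk.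
have [gm1 gm2] := cv_good mid; have [pks pst] := good_path K gm1.
have [_] := good_path K gm2; rewrite -cats1 => /path_catP[A2 [A3 <- sk'] pt'].
have pkr : fpath (k :: r) A A2 by exists A1.
have gr := slide_good pkr hr.
have [_] := good_path K gr; rewrite -cats1 => /path_catP[A4 [A5 <- sk''] pr'].
have ps' : fpath (fsrc g) A2 C1.
  have [_] := good_path K (slide_good pks hs); rewrite -cats1 => /path_catP[A6 [A7 <- sk3] ps'].
  by rewrite (fpath_fun (_ : fpath [:: k] A1 A6) (_ : fpath [:: k] A1 A2)) in ps' => //; exists A1.
have gg := good_gen ps pt hg.
have gg' := good_gen ps' pt' (fgood_step ha sk' hg).
rewrite !slide_cat; set sl := slide k l.
(* The generator rises through the crossings of [k] with [l] ([c1]), with its own strands ([c2]) and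
   with [r] ([c3]). *)
have c1 : cv A B ((k :: l) ++ fsrc g ++ r) (rcons l k ++ ftgt g ++ r) (fdeg g)
    ([:: (1 + size l, g)%N] ++ sl) (sl ++ [:: (1 + size l, g)%N]).
  have := cv_sym (cv_swapl gl (good_whiskr pr gg)).
  by rewrite size_rcons /= addn0.
have pkr2 : fpath r A A1 := pr.
have c2 : cv A B (rcons l k ++ fsrc g ++ r) (l ++ rcons (ftgt g) k ++ r) (fdeg g)
    ([:: (1 + size l, g)%N] ++ shl (size l) (slide k (ftgt g)))
    (shl (size l) (slide k (fsrc g) ++ [:: (0%N, g)])).
  have := cv_whiskl pl' (cv_whiskr pr mid).
  by rewrite -!cats1 -!catA /= addn1.
have c3 : cv A B ((l ++ fsrc g) ++ k :: r) ((l ++ ftgt g) ++ rcons r k) (fdeg g)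
    ([:: (size l, g)] ++ shl (size l + size (ftgt g)) (slide k r))
    (shl (size l + size (fsrc g)) (slide k r) ++ [:: (size l, g)]).
  have gl' := good_whiskl pl' gg'.
  have := cv_swapr gl' gr; by rewrite !size_cat /= addn0.
have g1 : good A B (l ++ rcons (ftgt g) k ++ r) ((l ++ ftgt g) ++ rcons r k) 0
    (shl (size l + size (ftgt g)) (slide k r)).
  have := good_whiskl (path_cat pl' pt') gr.
  by rewrite size_cat -!cats1 -!catA.
have g2 : good A B (rcons l k ++ fsrc g ++ r) ((l ++ fsrc g) ++ k :: r) 0
    (shl (size l) (slide k (fsrc g))).
  have := good_whiskl pl' (good_whiskr pr (slide_good pks hs)).
  by rewrite -!cats1 -!catA.
have pst' : fpath (k :: ftgt g) A1 C1 by exists B1.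
have g3 : good A B (rcons l k ++ ftgt g ++ r) (l ++ rcons (ftgt g) k ++ r) 0
    (shl (size l) (slide k (ftgt g))).
  have := good_whiskl pl' (good_whiskr pr (slide_good pst' ht)).
  by rewrite -!cats1 -!catA.
have g0 : good A B ((k :: l) ++ fsrc g ++ r) (rcons l k ++ fsrc g ++ r) 0 sl.
  exact: good_whiskr (path_cat ps pr) gl.
have e1 := cv_cat0 c1 (cv_refl (good_cat g3 g1)).
have e2 := cv_0cat (cv_refl g0) (cv_cat0 c2 (cv_refl g1)).
have e3 := cv_0cat (cv_refl (good_cat g0 g2)) c3.
have eqs : [:: (size l, g)] = shl (size l) [:: (0%N, g)] by rewrite /shl /= addn0.
rewrite !rcons_cat; move: e1 e2 e3; rewrite eqs !shl_cat !shl_shl -!catA => e1 e2 e3.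
exact: cv_trans e1 (cv_trans e2 e3).
Qed.

Lemma all_wapp (P : pred wlet) u L : all P u -> all P (ftgt L.2) -> all P (wapp u L).
Proof.
move=> hu ht; rewrite /wapp !all_cat ht; have := hu; rewrite -[u in all P u](cat_take_drop L.1) all_cat.
case/andP=> -> _ /=; have := hu; rewrite -[u in all P u](cat_take_drop (L.1 + size (fsrc L.2))) all_cat.
by case/andP.
Qed.

Lemma far_wrun k u D : all (fun L => apart k L.2) D ->
  all (fun l => far (wcol k) (wcol l)) u -> all (fun l => far (wcol k) (wcol l)) (wrun u D).
Proof.
elim: D u => //= L D IH u /andP[hL hD] hu; exact: IH hD (all_wapp hu (apart_tgt hL)).
Qed.

Lemma slide_natural A C B k u v p D : all (fun L => apart k L.2) D ->
  all (fun l => far (wcol k) (wcol l)) u -> good A C u v p D -> foam_step k C B ->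
  cv A B (k :: u) (rcons v k) p (shl 1 D ++ slide k v) (slide k u ++ D).
Proof.
move=> + + + st; elim: D u p => [|L D IH] u p hD hu [vD ev ep].
  subst v p; rewrite cats0 /=; apply: cv_refl; apply: slide_good => //.
  by exists C.
case/andP: hD => hL hD; case: vD => vL vD; subst p.
have hu' := all_wapp hu (apart_tgt hL).
have h1 := slide_layer hL hu vL st.
have gD : good A C (wapp u L) v (ddeg D) D by split.
have h2 := IH _ _ hD hu' gD.
have [g1 g2] := cv_good h1; have [g3 g4] := cv_good h2.
have pk : fpath [:: k] C B by exists C.
have gL : good A B (k :: u) (k :: wapp u L) (fdeg L.2) (shl 1 [:: L]).
  have g : good A C u (wapp u L) (fdeg L.2) [:: L].
    by split=> //=; [split=> //; case: (lvalid_path vL)|rewrite add0r].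
  exact: (good_whiskl pk g).
have [w [q [q' [g5 g6 eq]]]] := good_catP g4.
have gs : good A B (k :: wapp u L) (rcons (wapp u L) k) 0 (slide k (wapp u L)).
  by apply: slide_good => //; case: (good_path K g3).
have ew : w = rcons (wapp u L) k by case: g5 gs => _ <- _ [_ <- _].
subst w; have e0 : q = 0 by case: g5 gs => _ _ <- [_ _ <-].
subst q; rewrite addr0 in eq; subst q'.
have c1 := cv_cat (cv_refl gL) h2; have c2 := cv_cat h1 (cv_refl g6).
move: c1 c2; rewrite -!catA => c1 c2; exact: cv_trans c1 c2.
Qed.

(** The strands of [w] cross [D] one at a time, the head [k] after all the others. *)
Lemma exch_natural A C B w u v p D : farD w D -> farw w u ->
  good A C u v p D -> fpath w C B ->
  cv A B (w ++ u) (v ++ w) p (shl (size w) D ++ exch w v) (exch w u ++ D).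
Proof.
elim: w B => [|k w IH] B.
  by move=> _ _ g /= <-; rewrite shl0 !cats0; apply: cv_refl.
move=> /andP[hkD hD] /andP[hku hu] gD [C1 pw st].
have h1 := IH _ hD hu gD pw; have pk : fpath [:: k] C1 B by exists C1.
have h1' := cv_whiskl pk h1.
have [_ g1] := cv_good h1; have [x [q [q' [g2 g3 eq]]]] := good_catP g1.
have [puw pwu] := good_path K gD.
have g2' : good A C1 (w ++ u) (u ++ w) 0 (exch w u).
  by apply: exch_good => //; apply: path_cat pw puw.
have ex : x = u ++ w by case: g2 g2' => _ <- _ [_ <- _].
have eq0 : q = 0 by case: g2 g2' => _ _ <- [_ _ <-].
subst x q; rewrite addr0 in eq; subst q'.
have [_ /path_catP[A2 pwA _]] := good_path K g2.
have [fD _] : fits u D /\ True by case: gD => /valid_fits.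
have gD2 : good A2 C1 u v p D.
  case: gD => _ ev ep; case: g3 => v3 _ _.
  have [|B' vD /= <-] := @valid_unwhisk d A A2 C1 [::] u w D pwA _ fD; first by rewrite /= shl0.
  by [].
have h2 := cv_whiskr pwA (slide_natural hkD hku gD2 st).
have gv : good A B (k :: v ++ w) (v ++ k :: w) 0 (slide k v).
  have [_ pv] := good_path K gD2.
  have pkv : fpath (k :: v) A2 B by exists C1.
  have hv : all (fun l => far (wcol k) (wcol l)) v.
    by case: gD => _ <- _; apply: far_wrun.
  by have := good_whiskr pwA (slide_good pkv hv); rewrite -cats1 -catA.
have g4 := good_whiskl pk g2'.
have c1 := cv_cat0 h1' (cv_refl gv); have c2 := cv_0cat (cv_refl g4) h2.
move: c1 c2; rewrite -cats1 -!catA /= !shl_cat shl_shl add1n -!catA => c1 c2.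
exact: cv_trans c1 c2.
Qed.

Lemma slide_inv A B k v : fpath (k :: v) A B -> all (fun l => far (wcol k) (wcol l)) v ->
  cv A B (k :: v) (k :: v) 0 (slide k v ++ exch v [:: k]) [::].
Proof.
elim: v B => [|l v IH] B p; first by move=> _; apply: cv_refl.
move: p; rewrite -[k :: _]/([:: k; l] ++ v) => p hkl; case/path_catP: (p) => C pv pkl.
case/andP: hkl => /= hf hv.
have plk := path_far hf pkl; case: (plk) => C1 pk plC.
have pl : fpath [:: l] C1 B by exists C1.
have pkv : fpath (k :: v) A C1 := @path_cat d [:: k] v A C C1 pk pv.
have gkl : good C B [:: k; l] [:: l; k] 0 [:: (0%N, FCross k l)].
  exact: (@good_gen d C B (FCross k l)).
have glk : good C B [:: l; k] [:: k; l] 0 [:: (0%N, FCross l k)].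
  by apply: (@good_gen d C B (FCross l k)) => //=; rewrite farC.
have h1 := cv_whiskl pl (IH _ pkv hv).
have h2 : cv C B [:: k; l] [:: k; l] 0 [:: (0%N, FCross k l); (0%N, FCross l k)] [::].
  apply: (@cv_rule (RInv k l)) => //.
  by have := good_cat gkl glk; rewrite addr0.
have c1 := cv_cat0 (cv_0cat (cv_refl (good_whiskr pv gkl)) h1) (cv_refl (good_whiskr pv glk)).
have c2 := cv_whiskr pv h2.
move: c1; rewrite /= shl_cat -!catA => c1.
by have := cv_trans c1 c2; rewrite /= -?catA.
Qed.

(** [exch] recurses on its first argument; the decomposition along the second one holds only up to
    exchanges of disjoint crossings. *)
Lemma exch_consr A B v k u : fpath (v ++ k :: u) A B -> farw v (k :: u) ->
  cv A B (v ++ k :: u) ([:: k] ++ u ++ v) 0 (exch v (k :: u)) (exch v [:: k] ++ shl 1 (exch v u)).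
Proof.
elim: v B => [|y v IH] B; first by move=> p _; rewrite cats0; apply: cv_refl.
case=> C p st /= /andP[/andP[hyk hyu] hv].
have py : fpath [:: y] C B by exists C.
have h1 := cv_whiskl py (IH _ p hv).
have hvk : farw v [:: k].
  by apply/allP => x /(allP hv) /= /andP[->].
have hvu : farw v u.
  by apply/allP => x /(allP hv) /= /andP[].
have pvku : fpath ((v ++ [:: k]) ++ u) A C by rewrite -catA.
have [A1 pu pvk] := path_catP pvku.
have gvk := exch_good pvk hvk.
have [_ /path_catP[C2 pv pk]] := good_path K gvk.
have gvu := exch_good (path_cat pv pu) hvu.
have pyk : fpath ([:: y] ++ [:: k]) C2 B by apply: path_cat py pk.
have gx : good C2 B [:: y; k] [:: k; y] 0 [:: (0%N, FCross y k)].
  have pky := path_far hyk pyk.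
  exact: (@good_gen d C2 B (FCross y k)).
have [_ pky] := good_path K gx.
have [C3 pyC pkC] := @path_catP d [:: k] [:: y] _ _ pky.
have [_ /path_catP[A2 pv' pu']] := good_path K gvu.
have pyuv : fpath ((y :: u) ++ v) A C3.
  apply: (@path_cat d (y :: u) v A A2 C3) pv'.
  exact: (@path_cat d [:: y] u A2 C2 C3) pyC pu'.
have [A3 pv3 pyu] := path_catP pyuv.
have gyu : good A B ([:: k] ++ (y :: u) ++ v) ([:: k] ++ (rcons u y) ++ v) 0 (shl 1 (slide y u)).
  have := good_whiskl pkC (good_whiskr pv3 (slide_good pyu hyu)); exact.
have sw := cv_swapl gx gvu.
have g1 := good_whiskl py (good_whiskr pu gvk).
have g1' : good A B (y :: (v ++ k :: u)) ([:: y; k] ++ v ++ u) 0 (shl 1 (exch v [:: k])).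
  by move: g1; rewrite /= -!catA.
have g2 : good A B ([:: k] ++ (y :: u) ++ v) ([:: k] ++ u ++ y :: v) 0 (shl 1 (slide y u)).
  by move: gyu; rewrite /= cat_rcons.
have gx' := good_whiskr (path_cat pv pu) gx.
have gE := good_whiskl pyk gvu.
have gL : good A B ([:: y; k] ++ v ++ u) ([:: k] ++ (y :: u) ++ v) 0
    ([:: (0%N, FCross y k)] ++ shl 2 (exch v u)) by case/cv_good: sw.
have gR : good A B ([:: y; k] ++ v ++ u) ([:: k] ++ (y :: u) ++ v) 0
    (shl 2 (exch v u) ++ [:: (0%N, FCross y k)]) by case/cv_good: sw.
have [z [q [q' [g5 g6 eq]]]] := good_catP gR.
have ez : z = [:: y; k] ++ u ++ v by case: g5 gE => _ <- _ [_ <- _].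
have eq0 : q = 0 by case: g5 gE => _ _ <- [_ _ <-].
subst z q; rewrite addr0 in eq; subst q'.
have c1 := cv_cat0 h1 (cv_refl (good_cat g6 g2)).
have c2 := cv_0cat (cv_refl g1') (cv_cat0 (cv_sym sw) (cv_refl g2)).
move: c1 c2; rewrite /= !shl_cat !shl_shl /= addn1 -!catA => c1 c2.
exact: cv_trans c1 c2.
Qed.

Lemma farw_cons v k u : farw v (k :: u) = farw v [:: k] && farw v u.
Proof.
rewrite !(farwC v) /farw /= andbT.
by congr (_ && _); apply: eq_all => x; rewrite farC.
Qed.

(** Induction on [u]: with the return exchange decomposed by [exch_consr], the crossings of the head
    meet their inverses first ([slide_inv]), then those of the tail cancel. *)
Lemma exch_inv A B u v : fpath (u ++ v) A B -> farw u v ->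
  cv A B (u ++ v) (u ++ v) 0 (exch u v ++ exch v u) [::].
Proof.
elim: u B => [|k u IH] B p; first by rewrite /= exch_nilr => _; apply: cv_refl.
case: (p) => C puv pk hkuv; case/andP: (hkuv) => hk hu.
have pkC : fpath [:: k] C B by exists C.
have g1 := good_whiskl pkC (exch_good puv hu).
have [_ pvu] := good_path K (exch_good puv hu).
have [C2 pu pv] := path_catP pvu.
have pkv : fpath (k :: v) C2 B by exists C.
have g2 := good_whiskr pu (slide_good pkv hk).
have c2 := cv_whiskr pu (slide_inv pkv hk).
have hvk : farw v (k :: u) by rewrite farwC.
have [_ pvku] := good_path K (exch_good p hkuv).
have c3 := exch_consr pvku hvk.
have c4 := cv_whiskl pkC (IH _ puv hu).
have hvu : farw v u by rewrite farwC.
have g4 := good_whiskl pkC (exch_good pvu hvu).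
have c5 : cv A B (k :: u ++ v) (k :: u ++ v) 0 (exch (k :: u) v ++ exch v (k :: u))
    ((shl 1 (exch u v) ++ slide k v) ++ exch v [:: k] ++ shl 1 (exch v u)).
  have g2' : good A B (k :: v ++ u) (v ++ k :: u) 0 (slide k v) by move: g2; rewrite cat_rcons.
  by have := cv_cat0 (cv_refl (good_cat g1 g2')) c3.
have c6 := cv_cat0 (cv_0cat (cv_refl g1) c2) (cv_refl g4).
move: c4 c5 c6; rewrite !shl_cat -!catA /= => c4 c5 c6.
exact: cv_trans c5 (cv_trans c6 c4).
Qed.

Lemma step_flip k A B :
  foam_step k A B <-> foam_step (match k with Wm i => Wp i | Wp i => Wm i end) B A.
Proof. by case: k. Qed.

(** Splits and merges are inverse to each other, so a path is determined by its end as well as by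
    its start. *)
Lemma path_inj w A A' B : fpath w A B -> fpath w A' B -> A = A'.
Proof.
elim: w B => [|k w IH] B /=; first by move=> -> ->.
case=> C p1 /step_flip/foam_stepP s1 [C' p2 /step_flip/foam_stepP s2].
have e : C = C' by move: s2; rewrite s1 => -[/flam_eq].
by subst C'; apply: IH p1 p2.
Qed.

Lemma path_exch A B u w : fpath (u ++ w) A B -> farw w u -> fpath (w ++ u) A B.
Proof.
by move=> p hf; have [] := good_path K (exch_good p (etrans (farwC _ _) hf)).
Qed.

Lemma fgood_path w g A B : all (apart^~ g) w -> fpath w A B -> fgood g B -> fgood g A.
Proof.
elim: w B => [|k w IH] B; first by move=> _ /= ->.
move=> /andP[hk hw] [C p st] hg; apply: IH hw p _.
by apply: fgood_step ((step_flip _ _ _).1 st) hg; case: k hk {st} => i; case: g.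
Qed.

(** Each layer is also possible before [w]: paths of distant words commute, and [path_inj] shows
    that the commuted source and target of a generator still end at the same weight. *)
Lemma valid_far w A C B u D : farw w u -> farD w D -> fpath w A C -> valid C B u D ->
  exists2 C', valid A C' u D & fpath w C' B.
Proof.
move=> + + pw; elim: D u => [|[i g] D IH] u hu hD.
  move=> pu; have := path_exch (path_cat pu pw) hu.
  by case/path_catP => C'; exists C'.
case=> -[l [r [A1 [B1 [/= eu li pr [hg ps pt pl]]]]]] vD; subst u i.
have hg' : all (apart^~ g) w.
  by apply/allP => x /(allP hD) /andP[].
have hs : farw w (fsrc g) by apply/allP => x /(allP hg')/apart_src.
have ht : farw w (ftgt g) by apply/allP => x /(allP hg')/apart_tgt.
have hl : farw w l by apply/allP => x /(allP hu); rewrite !all_cat => /andP[].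
have hr : farw w r by apply/allP => x /(allP hu); rewrite !all_cat => /and3P[].
have hD' : farD w D by apply/allP => x /(allP hD) /andP[].
have [A2 pr' pw2] := path_catP (path_exch (path_cat pr pw) hr).
have [B2 ps' pw3] := path_catP (path_exch (path_cat ps pw2) hs).
have [B3 pt' pw4] := path_catP (path_exch (path_cat pt pw2) ht).
have eB : B3 = B2 by apply: path_inj pw4 pw3.
subst B3; have [C1 pl' pw5] := path_catP (path_exch (path_cat pl pw3) hl).
have hu' : farw w (wapp (l ++ fsrc g ++ r) (size l, g)).
  rewrite wappE //; apply/allP => x xw; rewrite !all_cat.
  by rewrite (allP hl x xw) (allP ht x xw) (allP hr x xw).
have [C' vD' pw6] := IH _ hu' hD' vD.
have pv := valid_path vD'; rewrite wappE // in pv.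
have eC := fpath_fun pv (path_cat pl' (path_cat pt' pr')); subst C'.
exists C1 => //; split=> //; exists l, r, A2, B2; split=> //; split=> //.
exact: fgood_path hg' pw2 hg.
Qed.

(** Naturality on the other side: [exch_natural], applied to the diagram moved before [w], is
    conjugated by the exchanges, which are invertible by [exch_inv]. *)
Lemma exch_natural_r A C B w u v p D : farD w D -> farw w u ->
  good C B u v p D -> fpath w A C ->
  cv A B (u ++ w) (w ++ v) p (D ++ exch v w) (exch u w ++ shl (size w) D).
Proof.
move=> hD hu gD pw; have [vD ev ep] := gD.
have [C' vD' pw'] := valid_far hu hD pw vD.
have gD' : good A C' u v p D by [].
have [pu pv] := good_path K gD; have huw : farw u w by rewrite farwC.
have hv : farw w v.
  apply/allP => k kw; rewrite -ev; apply: far_wrun; [exact: (allP hD)|exact: (allP hu)].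
have hvw : farw v w by rewrite farwC.
have puw := path_cat pu pw; have pvw := path_cat pv pw.
have gu := exch_good puw huw; have gv := exch_good pvw hvw.
have n := exch_natural hD hu gD' pw'.
have gDw := good_whiskr pw gD.
have gDr := cv_refl (good_whiskl pw' gD').
have i1 := cv_cat0 (cv_refl gDw) (cv_refl gv).
have i2 := cv_0cat (cv_sym (exch_inv puw huw)) i1.
have i3 := cv_0cat (cv_refl gu) (cv_cat0 (cv_sym n) (cv_refl gv)).
have [_ pwv] := good_path K gv.
have i4 := cv_0cat (cv_refl gu) (cv_cat0 gDr (exch_inv pwv hv)).
move: i2 i3 i4; rewrite /= ?cats0 -!catA => i2 i3 i4.
exact: cv_trans i2 (cv_trans i3 i4).
Qed.

End Far.

End DistantWebs.
Import DistantWebs.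

Module Weights.

(** * Executable words and generators of the 2-Schur algebra *)

Definition slet_code (l : slet) : nat + nat :=
  match l with Fl i => inl i | El i => inr i end.
Definition slet_decode (x : nat + nat) : slet :=
  match x with inl i => Fl i | inr i => El i end.
Lemma slet_codeK : cancel slet_code slet_decode. Proof. by case. Qed.
HB.instance Definition _ := Equality.copy slet (can_type slet_codeK).

Definition nw (a : seq nat) (i : nat) : nat := nth 0%N (0%N :: a) i.

Definition sidx (l : slet) : nat := match l with Fl i | El i => i end.

(** A letter moves one unit between two neighbouring coordinates; [None] stands for a weight outside
    Lambda_{n,d}. *)
Definition sact (l : slet) (a : seq nat) : option (seq nat) :=
  let i := sidx l in
  if (0 < i < size a)%N then
    match l, nw a i, nw a i.+1 with
    | Fl _, x.+1, y =>
        if (y < 2)%N then Some (take i.-1 a ++ [:: x, y.+1 & drop i.+1 a]) else None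
    | El _, x, y.+1 =>
        if (x < 2)%N then Some (take i.-1 a ++ [:: x.+1, y & drop i.+1 a]) else None
    | _, _, _ => None
    end
  else None.

Fixpoint spath (w : seq slet) (a : seq nat) : option (seq nat) :=
  if w is l :: w' then obind (sact l) (spath w' a) else Some a.

Definition cl (a : seq nat) (i : nat) : nat := (1 + sumn (take i.-1 a))%N.

(* the web of a letter, from the colour of its first coordinate and the two
   coordinates it acts on *)
Definition lweb (l : slet) (c x y : nat) : seq wlet :=
  match l, x, y with
  | Fl _, 2, 0 => [:: Wm c]
  | Fl _, 1, 1 => [:: Wp c]
  | Fl _, 2, 1 => [:: Wp c.+1; Wm c]
  | El _, 0, 2 => [:: Wm c]
  | El _, 1, 1 => [:: Wp c]
  | El _, 1, 2 => [:: Wp c; Wm c.+1]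
  | _, _, _ => [::]
  end.

Definition web (l : slet) (a : seq nat) : seq wlet :=
  let i := sidx l in lweb l (cl a i) (nw a i) (nw a i.+1).

Fixpoint webw (w : seq slet) (a : seq nat) : seq wlet :=
  if w is l :: w' then (if spath w' a is Some b then web l b else [::]) ++ webw w' a
  else [::].

Lemma sact_split l a : (0 < sidx l < size a)%N ->
  exists l1 x y l2, [/\ a = l1 ++ [:: x, y & l2], size l1 = (sidx l).-1,
    nw a (sidx l) = x, nw a (sidx l).+1 = y &
    sact l a = match l, x, y with
      | Fl _, x.+1, y => if (y < 2)%N then Some (l1 ++ [:: x, y.+1 & l2]) else None
      | El _, x, y.+1 => if (x < 2)%N then Some (l1 ++ [:: x.+1, y & l2]) else None
      | _, _, _ => None end].
Proof.
move=> h; have h' := h; case ei: (sidx l) h' => [|i] //= h'.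
have e1 : drop i a = nth 0%N a i :: drop i.+1 a by apply: drop_nth; lia.
have e2 : drop i.+1 a = nth 0%N a i.+1 :: drop i.+2 a by apply: drop_nth; lia.
exists (take i a), (nth 0%N a i), (nth 0%N a i.+1), (drop i.+2 a); split=> //.
- by rewrite -e2 -e1 cat_take_drop.
- by rewrite size_takel //; lia.
by case: l h ei => j /= h ei; rewrite /sact /= h /nw; subst j.
Qed.

Lemma sact_None l a : ~~ (0 < sidx l < size a)%N -> sact l a = None.
Proof. by rewrite /sact => /negbTE->. Qed.

Lemma spath_cat u v a : spath (u ++ v) a = obind (spath u) (spath v a).
Proof.
elim: u => [|l u IH] /=; first by case: (spath _ _).
by rewrite IH; case: (spath v a).
Qed.

Lemma webw_cat u v a b : spath v a = Some b -> webw (u ++ v) a = webw u b ++ webw v a.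
Proof. by move=> e; elim: u => [|l u IH] //=; rewrite IH spath_cat e catA. Qed.

Definition small (a : seq nat) : bool := all (fun x => (x <= 2)%N) a.

Lemma sact_ok l a b : sact l a = Some b -> small a -> [/\ small b, size b = size a & sumn b = sumn a].
Proof.
move=> e; have [h|/sact_None] := boolP (0 < sidx l < size a)%N; last by rewrite e.
have [l1 [x [y [l2 [ea _ _ _ e']]]]] := sact_split h; move: e; rewrite e' ea {ea e' h}.
rewrite /small all_cat /=; case: l => i.
  case: x => [|x] //; case: ifP => // hy [<-] /and4P[h1 h2 h3 h4].
  by rewrite all_cat !size_cat !sumn_cat /= h1 h4; split; lia.
case: y => [|y] //; case: ifP => // hy [<-] /and4P[h1 h2 h3 h4].
by rewrite all_cat !size_cat !sumn_cat /= h1 h4; split; lia.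
Qed.

Lemma spath_ok w a b : spath w a = Some b -> small a ->
  [/\ small b, size b = size a & sumn b = sumn a].
Proof.
elim: w b => [|l w IH] b /=; first by case=> <-.
case e: (spath w a) => [b1|] //= el ha; have [h1 h2 h3] := IH _ e ha.
by have [h4 h5 h6] := sact_ok el h1; rewrite h5 h6.
Qed.

Definition nz (a : seq nat) : seq nat := [seq x <- a | x != 0%N].

Lemma sumn_nz a : sumn (nz a) = sumn a.
Proof. by elim: a => //= -[|x] a /= ->. Qed.

Lemma ones_nz a : small a -> ones_twos (nz a).
Proof.
move=> h; apply/allP => x; rewrite mem_filter => /andP[x0 /(allP h)].
by case: x x0 => [|[|[|]]].
Qed.

Lemma nz_cat a b : nz (a ++ b) = nz a ++ nz b.
Proof. exact: filter_cat. Qed.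

(* webs of letters are paths *)
Lemma web_path l a b : sact l a = Some b -> small a -> opath (web l a) (nz a) = Some (nz b).
Proof.
move=> e; have [h|/sact_None] := boolP (0 < sidx l < size a)%N; last by rewrite e.
have [l1 [x [y [l2 [ea sl1 ex ey e']]]]] := sact_split h; move: e; rewrite e' {e'}.
have ec : cl a (sidx l) = (1 + sumn l1)%N by rewrite /cl ea take_size_cat.
rewrite /web ec ex ey ea /small all_cat /= => + /and4P[h1 h2 h3 h4].
have o1 := ones_nz h1; rewrite -(sumn_nz l1).
(* A step computed at colours starting from 1 is transported behind the coordinates of [l1]; the
   remaining cases are such computations on two coordinates. *)
have st k k' o o' : k' = shk (sumn (nz l1)) k -> ostep 1 k o = Some o' ->
    ostep 1 k' (nz l1 ++ o ++ nz l2) = Some (nz l1 ++ o' ++ nz l2).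
  by move=> ->; exact: ostep_context.
have m j : (1 + sumn (nz l1) + j)%N = (sumn (nz l1) + j.+1)%N by lia.
have m0 := m 0%N; have m1 := m 1%N; rewrite addn0 in m0; rewrite addn1 in m1.
case: l {h ea sl1 ex ey ec} => i; case: x h2 => [|[|[|x]]] // _; case: y h3 => [|[|[|y]]] // _.
all: move=> //= -[<-]; rewrite !nz_cat /= ?m1 ?m0 //.
- exact: (st (Wp 1) _ [:: 1; 1]%N [:: 2]%N).
- exact: (st (Wm 1) _ [:: 2]%N [:: 1; 1]%N).
- have /= -> := st (Wm 1) _ [:: 2; 1]%N [:: 1; 1; 1]%N erefl erefl.
  exact: (st (Wp 2) _ [:: 1; 1; 1]%N [:: 1; 2]%N).
- exact: (st (Wm 1) _ [:: 2]%N [:: 1; 1]%N).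
- exact: (st (Wp 1) _ [:: 1; 1]%N [:: 2]%N).
have /= -> := st (Wm 2) _ [:: 1; 2]%N [:: 1; 1; 1]%N erefl erefl.
exact: (st (Wp 1) _ [:: 1; 1; 1]%N [:: 2; 1]%N).
Qed.

Lemma webw_path w a b : spath w a = Some b -> small a ->
  opath (webw w a) (nz a) = Some (nz b) /\ small b.
Proof.
elim: w b => [|l w IH] b /=; first by case=> <-.
case e: (spath w a) => [b1|] //= el ha; have [h1 h2] := IH _ e ha.
by rewrite opath_cat h1 /= (web_path el h2); case: (sact_ok el h2).
Qed.

Section Weights.
Variables (n d : nat).
Implicit Types a b : lam n d.
Local Notation spathP_ := (@wpath (schur_sig n d)).

Lemma lam_small a : small (sval a).
Proof. by case: a => l /= /and3P[]. Qed.

Lemma lam_size a : size (sval a) = n.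
Proof. by case: a => l /= /and3P[/eqP]. Qed.

Lemma lam_sum a : sumn (sval a) = d.
Proof. by case: a => l /= /and3P[_ _ /eqP]. Qed.

Lemma lam_eq a b : sval a = sval b -> a = b.
Proof.
case: a b => [l h] [l' h'] /= e; subst l'; congr exist; exact: bool_irrelevance.
Qed.

Lemma lam_exists s : size s = n -> small s -> sumn s = d -> exists a, sval a = s.
Proof.
by move=> /eqP h1 h2 /eqP h3; unshelve eexists (exist _ s _ : lam n d) => //=; apply/and3P.
Qed.

(** The relation [lowers] consists of integer equations for all coordinates. Those away from the
    index give back the two ends of the sequence, the other two the new entries, where the bound 2
    on coordinates becomes the test of [sact]. *)
Lemma schur_stepP l a b : schur_step l a b <-> sact l (sval a) = Some (sval b).
Proof.
have hn := lam_size a; have sb := lam_size b.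
have hb := lam_small b; have ha := lam_small a.
have nth_le (s : seq nat) k : small s -> (nth 0%N s k <= 2)%N.
  move=> hs; case: (ltnP k (size s)) => hk; last by rewrite nth_default.
  by apply: (allP hs); apply: mem_nth.
split.
  move=> st.
  have [hi hw] : (0 < sidx l < n)%N /\ forall k, (wt b k)%:Z = (if l is Fl _ then (wt a k)%:Z - alpha (sidx l) k else (wt a k)%:Z + alpha (sidx l) k).
    by case: l st => i /= [h1 h2]; split=> // k; rewrite h2 ?subrK.
  rewrite -hn in hi; have [l1 [x [y [l2 [ea sl1 ex ey ->]]]]] := sact_split hi.
  have wtE k : wt b k.+1 = nth 0%N (sval b) k by [].
  have [j ej] : exists j, sidx l = j.+1 by case: (sidx l) hi => // j; exists j.
  have hw0 k : alpha (sidx l) k = 0 -> wt b k = wt a k.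
    by move=> e0; have := hw k; rewrite e0 ?subr0 ?addr0; case: (l) => _; rewrite ?subr0 ?addr0 => -[].
  have hj : (j <= size (sval b))%N by lia.
  have el1 : take j (sval b) = l1.
    apply: (@eq_from_nth _ 0%N); first by rewrite size_takel // sl1 ej.
    rewrite size_takel //.
    move=> k hk; rewrite nth_take // -wtE hw0; last by rewrite /alpha ej; move: hk; lia.
    by rewrite /wt ea /= nth_cat sl1 ej /= hk.
  have el2 : drop j.+2 (sval b) = l2.
    apply: (@eq_from_nth _ 0%N).
      by rewrite size_drop sb -hn ea size_cat /= sl1 ej; lia.
    move=> k hk; rewrite nth_drop -wtE hw0; last by rewrite /alpha ej; lia.
    rewrite /wt ea /= nth_cat sl1 ej /= ifN; last by lia.
    by rewrite (_ : (j.+2 + k - j)%N = k.+2) /=; last by lia.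
  have eb : sval b = l1 ++ [:: wt b j.+1, wt b j.+2 & l2].
    rewrite -el1 -el2 !wtE -!drop_nth ?cat_take_drop //; lia.
  have h1 := hw j.+1; have h2 := hw j.+2.
  have e1 : wt a j.+1 = x by rewrite -ex ej.
  have e2 : wt a j.+2 = y by rewrite -ey ej.
  have b1 : (wt b j.+1 <= 2)%N by rewrite wtE; apply: nth_le.
  have b2 : (wt b j.+2 <= 2)%N by rewrite wtE; apply: nth_le.
  have al1 : alpha (sidx l) j.+1 = 1 by rewrite /alpha ej; lia.
  have al2 : alpha (sidx l) j.+2 = -1 by rewrite /alpha ej; lia.
  rewrite al1 e1 in h1; rewrite al2 e2 in h2.
  clear hw0; case: l st hi hw ex ey ej sl1 al1 al2 h1 h2 => i st hi hw ex ey ej sl1 al1 al2 h1 h2.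
    case: x {ea ex e1 hw} h1 => [|x] h1; first by lia.
    by case: ifP => hy; [rewrite eb; do 2 f_equal; congr [:: _, _ & _]; lia|lia].
  case: y {ea ey e2 hw} h2 => [|y] h2; first by lia.
  by case: ifP => hy; [rewrite eb; do 2 f_equal; congr [:: _, _ & _]; lia|lia].
move=> e; have [hi|/sact_None] := boolP (0 < sidx l < size (sval a))%N; last by rewrite e.
have [l1 [x [y [l2 [ea sl1 ex ey e']]]]] := sact_split hi; rewrite e in e'.
have wtl (c : lam n d) z t k : sval c = l1 ++ [:: z, t & l2] -> wt c k =
    if k == sidx l then z else if k == (sidx l).+1 then t else wt c k.
  move=> ec; case: (k =P sidx l) => [->|_].
    rewrite /wt ec; case: (sidx l) sl1 hi => //= j <- _.
    by rewrite nth_cat ltnn subnn.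
  case: (k =P (sidx l).+1) => [->|//]; rewrite /wt ec; case: (sidx l) sl1 hi => //= j <- _.
  by rewrite nth_cat ltnNge leqnSn /= subSnn.
have wto (c1 c2 : lam n d) z t z' t' k : sval c1 = l1 ++ [:: z, t & l2] ->
    sval c2 = l1 ++ [:: z', t' & l2] -> k != sidx l -> k != (sidx l).+1 -> wt c1 k = wt c2 k.
  move=> e1 e2 n1 n2; rewrite /wt e1 e2; case: k n1 n2 => //= k n1 n2.
  rewrite !nth_cat; case: ifP => // hk; move: sl1; case ek: (k - size l1)%N => [|[|]] //; lia.
case: l e e' hi sl1 ex ey wtl wto => i e e' hi sl1 ex ey wtl wto; rewrite hn in hi.
  case: x ea ex e' => [|x] ea ex //; case: ifP => // hy [eb]; split=> // k.
  case: (k =P i) => [->|nk]; first by rewrite (wtl _ _ _ _ eb) (wtl _ _ _ _ ea) /= eqxx /alpha eqxx; lia.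
  case: (k =P i.+1) => [->|nk'].
    rewrite (wtl _ _ _ _ eb) (wtl _ _ _ _ ea) /= eqxx /alpha eqxx.
    by rewrite (_ : (i.+1 == i) = false) /=; lia.
  rewrite (wto _ _ _ _ _ _ _ eb ea) /=; try exact/eqP.
  by rewrite /alpha; lia.
case: y ea ey e' => [|y] ea ey //; case: ifP => // hy [eb]; split=> // k.
case: (k =P i) => [->|nk]; first by rewrite (wtl _ _ _ _ eb) (wtl _ _ _ _ ea) /= eqxx /alpha eqxx; lia.
case: (k =P i.+1) => [->|nk'].
  rewrite (wtl _ _ _ _ eb) (wtl _ _ _ _ ea) /= eqxx /alpha eqxx.
  by rewrite (_ : (i.+1 == i) = false) /=; lia.
rewrite (wto _ _ _ _ _ _ _ eb ea) /=; try exact/eqP.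
by rewrite /alpha; lia.
Qed.

Lemma spathP w a b : spathP_ w a b <-> spath w (sval a) = Some (sval b).
Proof.
elim: w b => [|l w IH] b /=; first by split=> [->//|[/lam_eq]].
split=> [[c /IH -> /schur_stepP //]|].
case e: (spath w _) => [s|] //= h.
have [h1 h2 h3] := spath_ok e (lam_small a).
have [c ec] : exists c : lam n d, sval c = s.
  by apply: lam_exists => //; rewrite ?h2 ?h3 ?lam_size ?lam_sum.
by exists c; [apply/IH; rewrite ec|apply/schur_stepP; rewrite ec].
Qed.

Lemma step_fun l a b b' : schur_step l a b -> schur_step l a b' -> b = b'.
Proof. by move=> /schur_stepP e /schur_stepP; rewrite e => -[/lam_eq]. Qed.

Lemma spath_exists w a s : spath w (sval a) = Some s -> exists2 b, spathP_ w a b & sval b = s.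
Proof.
move=> e; have [h1 h2 h3] := spath_ok e (lam_small a).
have [b eb] : exists b : lam n d, sval b = s.
  by apply: lam_exists => //; rewrite ?h2 ?h3 ?lam_size ?lam_sum.
by exists b => //; apply/spathP; rewrite eb.
Qed.

End Weights.

End Weights.
Import Weights.

(** * Images of the generators, including the adjoined inverses *)

Module Images.

Definition gsrc (s : sgen) : seq slet :=
  match s with
  | SEta _ | NInv _ _ => [::]
  | SEps i => [:: Fl i; El i]
  | SDot i => [:: Fl i]
  | STau i j => [:: Fl i; Fl j]
  | SInv i j => [:: El j; Fl i]
  | PInv i _ => [:: El i; Fl i]
  end.

Definition gtgt (s : sgen) : seq slet :=
  match s with
  | SEps _ | PInv _ _ => [::]
  | SEta i => [:: El i; Fl i]
  | SDot i => [:: Fl i]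
  | STau i j => [:: Fl j; Fl i]
  | SInv i j => [:: Fl i; El j]
  | NInv i _ => [:: Fl i; El i]
  end.

Definition gok (s : sgen) (a : seq nat) : bool :=
  match s with
  | PInv i m => (m < nw a i - nw a i.+1)%N
  | NInv i m => (m < nw a i.+1 - nw a i)%N
  | _ => true
  end.

Definition etad (a : seq nat) (i : nat) : Z2 :=
  dg (nw a i.+1)%:Z (- (nw a i)%:Z) + dg 0 1.

Definition epsd (a : seq nat) (i : nat) : Z2 :=
  - dg (nw a i.+1)%:Z (- (nw a i)%:Z) + dg 1 0.

Definition gdeg (s : sgen) (a : seq nat) : Z2 :=
  match s with
  | SEta i => etad a i
  | SEps i => epsd a i
  | SDot _ => dg 1 1
  | STau i j => tau_deg i j
  | SInv _ _ => 0
  | PInv i m => - (dg 1 1 *+ m + etad a i)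
  | NInv i m => - (epsd a i + dg 1 1 *+ m)
  end.

Lemma schur_gbdP n d s (a : lam n d) u v p : schur_gbd s a u v p <->
  [/\ gok s (sval a), u = gsrc s, v = gtgt s & p = gdeg s (sval a)].
Proof.
split; first by case.
by case: s => [i|i|i|i j|i j|i m|i m] [/= h -> -> ->]; constructor.
Qed.

(* (-XY)^b *)
Definition sgam (b : bool) : mscal := MSc b b b 0 0.

(* As the coordinates are at most 2, the number of those that are equal to 1
   has the parity of their sum.  The boolean [e] is a parity added to that
   number. *)
Definition gam (e : bool) (a : seq nat) (i : nat) : mscal := sgam (e (+) odd (sumn (take i a))).

(** The prescribed values as diagrams, completed by values for the inverses. [SInv i j] undoes the
    image of sigma; for distant indices its scalar is X^(1+lambda_{j+1}) Y^lambda_j, from the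
    adjunction relation. [PInv] and [NInv] are dual to the dotted cups and caps for neck-cutting or
    for the squeeze relation, the powers of Z compensating those of the units and of these
    relations. At (0,2) the value of [NInv i 1] has an extra -XY because its dual carries a dot
    placed after E_i, where lambda_i has become 1. The default values only matter where the foam is
    an identity. *)
Definition simg (e : bool) (a : seq nat) (s : sgen) : mscal * diag :=
  match s with
  | SDot i =>
      let c := cl a i in
      (gam e a i, match nw a i, nw a i.+1 with
                  | 1, 0 => [:: (0, FDot c)]
                  | 2, 0 => [:: (0, FDot c.+1)]
                  | 1, 1 => [:: (1, FDot c)]
                  | 2, 1 => [:: (1, FDot c.+1)]
                  | _, _ => [::]
                  end%N)
  | SEta i =>
      let c := cl a i in
      match nw a i, nw a i.+1 with
      | 2, 0 => (MSc false false false 0 2, [:: (0, FCup c)])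
      | 1, 1 => (sone, [:: (0, FZip c)])
      | 2, 1 => (MSc false false false 0 1, [:: (0, FCup c); (1, FZip c.+1)])
      | _, _ => (sone, [::])
      end%N
  | SEps i =>
      let c := cl a i in
      (sone, match nw a i, nw a i.+1 with
             | 0, 2 => [:: (0, FCap c)]
             | 1, 1 => [:: (0, FUnzip c)]
             | 1, 2 => [:: (1, FUnzip c); (0, FCap c.+1)]
             | _, _ => [::]
             end%N)
  | STau i j =>
      if i == j then
        let c := cl a i in (smul (sgam true) (gam e a i), [:: (0, FCap c); (0, FCup c)]%N)
      else if i == j.+1 then
        let c := cl a j in
        (sone, match nw a j, nw a i.+1 with
               | 1, 0 => [:: (0, FUnzip c)]
               | 2, 0 => [:: (0, FUnzip c.+1)]
               | 1, 1 => [:: (1, FUnzip c)]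
               | 2, 1 => [:: (1, FUnzip c.+1); (0, FCross (Wp c.+2) (Wm c))]
               | _, _ => [::]
               end%N)
      else if j == i.+1 then
        let c := cl a i in
        (gam e a j, match nw a i, nw a j.+1 with
               | 1, 0 => [:: (0, FZip c)]
               | 2, 0 => [:: (0, FZip c.+1)]
               | 1, 1 => [:: (1, FZip c)]
               | 2, 1 => [:: (0, FCross (Wm c) (Wp c.+2)); (1, FZip c.+1)]
               | _, _ => [::]
               end%N)
      else (sone, exch (web (Fl i) a) (web (Fl j) a))
  | SInv i j =>
      if i == j then
        (smul (MSc true false false 0 2) (gam e a i.-1), [::])
      else if j == i.+1 then
        let c := cl a i in
        match nw a i, nw a j.+1 with
        | _, 1 => (MSc false false true 0 0, [::])
        | 2, 2 => (MSc false true true 0 0, [:: (1, FCross (Wm c.+2) (Wm c))])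
        | _, _ => (MSc false true true 0 0, [::])
        end%N
      else if i == j.+1 then
        let c := cl a j in
        match nw a j, nw a i.+1 with
        | 0, _ => (smul (MSc false true false 0 0) (gam e a j), [::])
        | 1, 1 => (smul (MSc true false false 1 0) (gam e a j.-1),
                   [:: (0, FCross (Wp c) (Wp c.+2))])
        | _, _ => (smul (MSc true false false 1 0) (gam e a j.-1), [::])
        end%N
      else
        (MSc false (~~ odd (nw a j.+1)) (odd (nw a j)) 0 0,
         exch (web (El j) a) (web (Fl i) a))
  | PInv i m =>
      let c := cl a i in
      match nw a i, nw a i.+1, m with
      | 2, 1, _ => (sone, [:: (1, FUnzip c.+1); (0, FCap c)])
      | 2, 0, 0 => (MSc false false false 2 0, [:: (1, FDot c); (0, FCap c)])
      | 2, 0, _ => (smul (MSc false false false 2 0) (gam e a i), [:: (0, FCap c)])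
      | _, _, _ => (sone, [::])
      end%N
  | NInv i m =>
      let c := cl a i in
      match nw a i, nw a i.+1, m with
      | 1, 2, _ => (MSc false true true 0 1, [:: (0, FCup c.+1); (1, FZip c)])
      | 0, 2, 0 => (sone, [:: (0, FCup c); (1, FDot c)])
      | 0, 2, _ => (smul (sgam true) (gam e a i), [:: (0, FCup c)])
      | _, _, _ => (sone, [::])
      end%N
  end.

(** * Evaluation of monomial terms *)

Inductive smono :=
| MG of sgen | MI of seq slet | MV of smono & smono | MH of smono & smono.

Record eval := MkEval {
  v_ob : seq nat; v_src : seq slet; v_tgt : seq slet; v_coef : mscal; v_diag : diag }.

(** It fails exactly on the terms that are not typed at [a], which are those that the Schur quotient
    makes zero. *)
Fixpoint ev (e : bool) (a : seq nat) (m : smono) : option eval :=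
  match m with
  | MG s =>
      if spath (gsrc s) a is Some b then
        if (spath (gtgt s) a == Some b) && gok s a then
          let: (c, D) := simg e a s in Some (MkEval b (gsrc s) (gtgt s) c D)
        else None
      else None
  | MI w => if spath w a is Some b then Some (MkEval b w w sone [::]) else None
  | MV s t =>
      if ev e a t is Some (MkEval b u v c D) then
        if ev e a s is Some (MkEval b' v' w c' D') then
          if (b' == b) && (v' == v) then Some (MkEval b u w (smul c' c) (D ++ D')) else None
        else None
      else None
  | MH s t =>
      if ev e a t is Some (MkEval b u v c D) then
        if ev e b s is Some (MkEval b' u' v' c' D') then
          Some (MkEval b' (u' ++ u) (v' ++ v) (smul c' c)
                     (shl (size (webw u' b)) D ++ D'))
        else None
      else None
  end.

Definition shsl (m : nat) (l : slet) : slet :=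
  match l with Fl i => Fl (m + i) | El i => El (m + i) end.

Definition shsg (m : nat) (s : sgen) : sgen :=
  match s with
  | SEta i => SEta (m + i) | SEps i => SEps (m + i) | SDot i => SDot (m + i)
  | STau i j => STau (m + i) (m + j) | SInv i j => SInv (m + i) (m + j)
  | PInv i k => PInv (m + i) k | NInv i k => NInv (m + i) k
  end.

Fixpoint shm (m : nat) (t : smono) : smono :=
  match t with
  | MG s => MG (shsg m s) | MI w => MI (map (shsl m) w)
  | MV s t => MV (shm m s) (shm m t) | MH s t => MH (shm m s) (shm m t)
  end.

Definition inr_ (k i : nat) : bool := (0 < i < k)%N.
Definition inl_ (k : nat) (l : slet) : bool := inr_ k (sidx l).
Definition ing (k : nat) (s : sgen) : bool :=
  match s with
  | STau i j | SInv i j => inr_ k i && inr_ k j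
  | SEta i | SEps i | SDot i | PInv i _ | NInv i _ => inr_ k i
  end.
Fixpoint inm (k : nat) (t : smono) : bool :=
  match t with
  | MG s => ing k s | MI w => all (inl_ k) w | MV s t | MH s t => inm k s && inm k t
  end.

Arguments web : simpl never.
Arguments cl : simpl never.
Arguments nw : simpl never.
Arguments gam : simpl never.

Section Local.
Variables (l1 l2 : seq nat).
Local Notation m := (size l1).
Local Notation s := (sumn l1).
Local Notation ctx a := (l1 ++ a ++ l2).
Implicit Types a b : seq nat.

Lemma nw_ctx a i : (0 < i <= size a)%N -> nw (ctx a) (m + i) = nw a i.
Proof.
rewrite /nw; case: i => // i /= h; rewrite addnS /= nth_cat ifN; last by lia.
by rewrite addKn nth_cat h.
Qed.

Lemma take_ctx a i : (i <= size a)%N -> take (m + i) (ctx a) = l1 ++ take i a.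
Proof.
move=> h; rewrite take_cat ifN; last by lia.
by rewrite addKn takel_cat.
Qed.

Lemma cl_ctx a i : (0 < i <= size a)%N -> cl (ctx a) (m + i) = (s + cl a i)%N.
Proof.
rewrite /cl; case: i => // i h; rewrite addnS /= take_ctx; last by lia.
by rewrite sumn_cat; lia.
Qed.

Lemma sact_ctx a l : inl_ (size a) l ->
  sact (shsl m l) (ctx a) = omap (fun b => ctx b) (sact l a).
Proof.
rewrite /inl_ /inr_ => h; rewrite /sact.
have e : sidx (shsl m l) = (m + sidx l)%N by case: l {h}.
have h' : (0 < sidx (shsl m l) < size (ctx a))%N by rewrite e !size_cat; lia.
rewrite h h' e -addnS !nw_ctx; try by lia.
have -> : (m + sidx l).-1 = (m + (sidx l).-1)%N by lia.
rewrite take_ctx; last by lia.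
have -> : drop (m + (sidx l).+1) (ctx a) = drop (sidx l).+1 a ++ l2.
  rewrite addnC -drop_drop drop_size_cat // -{1}(cat_take_drop (sidx l).+1 a) -catA.
  by rewrite drop_size_cat // size_takel //; lia.
case: l h {h' e} => i /= h; case: (nw a i) => [|x]; case: (nw a i.+1) => [|y] //=;
  by rewrite -?catA //=; case: ifP => //= _; rewrite -!catA.
Qed.

Lemma sact_size a b l : sact l a = Some b -> size b = size a.
Proof.
have [h|/sact_None->] // := boolP (0 < sidx l < size a)%N.
have [k1 [x [y [k2 [ea _ _ _ ->]]]]] := sact_split h; rewrite ea.
case: l {h} => _; [case: x ea => //= x ea|case: y ea => //= y ea]; case: ifP => // _ [<-];
  by rewrite !size_cat.
Qed.

Lemma spath_size a b w : spath w a = Some b -> size b = size a.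
Proof.
elim: w b => [|l w IH] b /=; first by case=> ->.
by case e: (spath w a) => [b'|] //= /sact_size ->; apply: IH.
Qed.

Lemma spath_ctx a w : all (inl_ (size a)) w ->
  spath (map (shsl m) w) (ctx a) = omap (fun b => ctx b) (spath w a).
Proof.
elim: w => //= l w IH /andP[h /IH ->].
by case e: (spath w a) => [b|] //=; rewrite sact_ctx // (spath_size e).
Qed.

Lemma web_ctx a l : inl_ (size a) l -> web (shsl m l) (ctx a) = shw s (web l a).
Proof.
rewrite /inl_ /inr_ => h; rewrite /web.
have -> : sidx (shsl m l) = (m + sidx l)%N by case: l {h}.
rewrite -addnS !nw_ctx ?cl_ctx; try by lia.
case: l {h} => i /=; move: (nw a i) (nw a i.+1) => [|[|[|x]]] [|[|[|y]]] //=;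
  by rewrite addnS.
Qed.

Lemma webw_ctx a w : all (inl_ (size a)) w ->
  webw (map (shsl m) w) (ctx a) = shw s (webw w a).
Proof.
elim: w => //= l w IH /andP[h hw]; rewrite IH // spath_ctx // map_cat.
by case e: (spath w a) => [b|] //=; rewrite web_ctx // (spath_size e).
Qed.

Lemma slide_sh k v : slide (shk s k) (shw s v) = shd s (slide k v).
Proof. by elim: v => //= l v ->; rewrite shd_shl. Qed.

Lemma exch_sh u v : exch (shw s u) (shw s v) = shd s (exch u v).
Proof. by elim: u => //= k u ->; rewrite shd_cat shd_shl slide_sh. Qed.

Lemma gsrc_sh g : gsrc (shsg m g) = map (shsl m) (gsrc g). Proof. by case: g. Qed.
Lemma gtgt_sh g : gtgt (shsg m g) = map (shsl m) (gtgt g). Proof. by case: g. Qed.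

Lemma ing_src k g : ing k g -> all (inl_ k) (gsrc g) && all (inl_ k) (gtgt g).
Proof.
by case: g => [i|i|i|i j|i j|i q|i q] /=; rewrite /inl_ /=; do ?[case/andP=> -> ->|move=> ->].
Qed.

Lemma gok_ctx a g : ing (size a) g -> gok (shsg m g) (ctx a) = gok g a.
Proof.
by rewrite /inr_; case: g => //= i k; rewrite /inr_ => h; rewrite -?[(m + _).+1]addnS !nw_ctx //; lia.
Qed.

Lemma gdeg_ctx a g : ing (size a) g -> gdeg (shsg m g) (ctx a) = gdeg g a.
Proof.
case: g => //= [i|i|i j|i k|i k]; rewrite /inr_ => h; rewrite /etad /epsd -?addnS ?nw_ctx //; try lia.
rewrite /tau_deg /alpha; congr dg; lia.
Qed.

Lemma gam_ctx e a i : (i <= size a)%N -> gam e (ctx a) (m + i) = gam (e (+) odd s) a i.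
Proof. by move=> h; rewrite /gam take_ctx // sumn_cat oddD addbA. Qed.

(** All data of an image are read on the window: the coordinates before it enter only through their
    sum, which translates colours and whose parity is added to [e]. *)
Lemma simg_ctx e a g : ing (size a) g ->
  simg e (ctx a) (shsg m g) = ((simg (e (+) odd s) a g).1, shd s (simg (e (+) odd s) a g).2).
Proof.
case: g => /= [i|i|i|i j|i j|i k|i k]; rewrite /inr_ => h.
- rewrite -?[(m + _).+1]addnS !nw_ctx ?cl_ctx; try lia.
  by move: (nw a i) (nw a i.+1) => [|[|[|x]]] [|[|y]] //=; rewrite addnS.
- rewrite -?[(m + _).+1]addnS !nw_ctx ?cl_ctx; try lia.
  by move: (nw a i) (nw a i.+1) => [|[|x]] [|[|[|y]]] //=; rewrite addnS.
- rewrite -?[(m + _).+1]addnS !nw_ctx ?cl_ctx ?gam_ctx; try lia.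
  by move: (nw a i) (nw a i.+1) => [|[|[|x]]] [|[|y]] //=; rewrite addnS.
- rewrite -?[(m + i).+1]addnS -?[(m + j).+1]addnS !nw_ctx ?cl_ctx ?gam_ctx ?eqn_add2l; try lia.
  case: ifP => _ //; case: ifP => _; last case: ifP => _.
  + by move: (nw a j) (nw a i.+1) => [|[|[|x]]] [|[|y]] //=; rewrite !addnS.
  + by move: (nw a i) (nw a j.+1) => [|[|[|x]]] [|[|y]] //=; rewrite !addnS.
  case/andP: h => h h'; have e1 := web_ctx (l := Fl i) h; have e2 := web_ctx (l := Fl j) h'.
  by move: e1 e2; rewrite /shsl => -> ->; rewrite exch_sh.
- have p1 k : (0 < k)%N -> (m + k).-1 = (m + k.-1)%N by lia.
  rewrite -?[(m + i).+1]addnS -?[(m + j).+1]addnS !p1 ?nw_ctx ?cl_ctx ?gam_ctx ?eqn_add2l; try lia.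
  case: ifP => _ //; case: ifP => _; last case: ifP => _.
  + by move: (nw a i) (nw a j.+1) => [|[|[|x]]] [|[|[|y]]] //=; rewrite !addnS.
  + by move: (nw a j) (nw a i.+1) => [|[|x]] [|[|y]] //=; rewrite !addnS.
  case/andP: h => h h'; have e1 := web_ctx (l := Fl i) h; have e2 := web_ctx (l := El j) h'.
  by move: e1 e2; rewrite /shsl => -> ->; rewrite exch_sh.
- rewrite -?[(m + _).+1]addnS !nw_ctx ?cl_ctx ?gam_ctx; try lia.
  by move: (nw a i) (nw a i.+1) k => [|[|[|x]]] [|[|y]] [|k] //=; rewrite !addnS.
- rewrite -?[(m + _).+1]addnS !nw_ctx ?cl_ctx ?gam_ctx; try lia.
  by move: (nw a i) (nw a i.+1) k => [|[|x]] [|[|[|y]]] [|k] //=; rewrite !addnS.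
Qed.

Definition sheval (v : eval) : eval :=
  MkEval (ctx (v_ob v)) (map (shsl m) (v_src v)) (map (shsl m) (v_tgt v)) (v_coef v)
       (shd s (v_diag v)).

Lemma shsl_inj : injective (map (shsl m)).
Proof. by apply: inj_map => -[i|i] [j|j] //= [/addnI->]. Qed.

Lemma ctx_inj a b : (ctx a == ctx b) = (a == b).
Proof.
apply/eqP/eqP => [e|->//]; have e1 : a ++ l2 = b ++ l2.
  by have := congr1 (drop m) e; rewrite !drop_size_cat.
have es : size a = size b by have := congr1 size e1; rewrite !size_cat; lia.
by have := congr1 (take (size a)) e1; rewrite take_size_cat // es take_size_cat.
Qed.

Lemma ev_in e a t v : ev e a t = Some v -> inm (size a) t ->
  [/\ size (v_ob v) = size a, all (inl_ (size a)) (v_src v) & all (inl_ (size a)) (v_tgt v)].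
Proof.
elim: t a v => [g|w|t1 IH1 t2 IH2|t1 IH1 t2 IH2] a v /=.
- case e1: (spath _ a) => [b|] //; case: ifP => // _; case: (simg e a g) => c D [<-] /= /ing_src/andP[-> ->].
  by rewrite (spath_size e1).
- by case e1: (spath _ a) => [b|] // [<-] /= ->; rewrite (spath_size e1).
- case e2: (ev e a t2) => [[b u x c D]|] //; case e1: (ev e a t1) => [[b' x' w c' D']|] //.
  case: ifP => // _ [<-] /andP[h1 h2] /=.
  by have [/= ? ? ?] := IH1 _ _ e1 h1; have [/= ? ? ?] := IH2 _ _ e2 h2; split.
case e2: (ev e a t2) => [[b u x c D]|] //; case e1: (ev e b t1) => [[b' u' x' c' D']|] //.
case=> <- /andP[h1 h2] /=; have [/= sb ? ?] := IH2 _ _ e2 h2; rewrite -sb in h1.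
have [/= ? ? ?] := IH1 _ _ e1 h1; rewrite sb in h1 *.
by rewrite !all_cat -sb; split=> //; apply/andP; split=> //; rewrite sb.
Qed.

Lemma ev_ctx e a t : inm (size a) t ->
  ev e (ctx a) (shm m t) = omap sheval (ev (e (+) odd s) a t).
Proof.
elim: t a => [g|w|t1 IH1 t2 IH2|t1 IH1 t2 IH2] a /=.
- move=> h; have /andP[h1 h2] := ing_src h.
  rewrite gsrc_sh gtgt_sh !spath_ctx // gok_ctx // simg_ctx //.
  case e1: (spath (gsrc g) a) => [b|] //=.
  case e2: (spath (gtgt g) a) => [b'|] //=.
  rewrite (inj_eq (@Some_inj _)) ctx_inj (inj_eq (@Some_inj _)).
  by case: ifP => // _; case: (simg _ a g) => c D /=.
- by move=> h; rewrite spath_ctx //; case: (spath w a).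
- case/andP=> h1 h2; rewrite IH1 // IH2 //.
  case: (ev _ a t2) => [[b u x c D]|] //=; case: (ev _ a t1) => [[b' x' w c' D']|] //=.
  rewrite ctx_inj (inj_eq shsl_inj); case: ifP => // _ /=.
  by rewrite /sheval /= shd_cat.
case/andP=> h1 h2; rewrite IH2 //.
case e2: (ev _ a t2) => [[b u x c D]|] //=.
have [/= sb _ _] := ev_in e2 h2; rewrite -sb in h1; rewrite IH1 //.
case e1: (ev _ b t1) => [[b' u' x' c' D']|] //=.
have [/= _ hu _] := ev_in e1 h1.
by rewrite /sheval /= !map_cat shd_cat shd_shl webw_ctx // size_map.
Qed.

End Local.

End Images.
Import Images.

Module DistantLetters.

(** * Letters with distant indices *)

Lemma sact_range l a b : sact l a = Some b -> (0 < sidx l < size a)%N.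
Proof. by move=> e; apply: contraPT isT => /sact_None; rewrite e. Qed.

Lemma sact_catl l p q : (0 < sidx l < size p)%N ->
  sact l (p ++ q) = omap (cat^~ q) (sact l p).
Proof. by move=> h; rewrite -(@sact_ctx [::] q p l h); case: l h. Qed.

Lemma sact_catr l p q : (0 < sidx l < size q)%N ->
  sact (shsl (size p) l) (p ++ q) = omap (cat p) (sact l q).
Proof.
move=> h; have := @sact_ctx p [::] q l h; rewrite cats0 => ->.
by case: (sact l q) => //= b; rewrite cats0.
Qed.

(** The sequence is cut after the two coordinates of the smaller index; each letter then acts within
    one of the two pieces. *)
Lemma sact_comm_lt l l' a a1 b : ((sidx l).+1 < sidx l')%N \/ ((sidx l').+1 < sidx l)%N ->
  sact l a = Some a1 -> sact l' a1 = Some b ->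
  exists2 a1', sact l' a = Some a1' & sact l a1' = Some b.
Proof.
have split_l i t : (i < sidx t)%N -> exists2 t', t = shsl i t' & (sidx t' = sidx t - i)%N.
  by case: t => j /= h; [exists (Fl (j - i))|exists (El (j - i))] => //=; congr (_ _); lia.
move=> hij e e1; have h := sact_range e; have h1 := sact_range e1.
rewrite (sact_size e) in h1; case: hij => hij.
  set i := (sidx l).+1; have es : size (take i a) = i by rewrite size_takel //; lia.
  rewrite -(cat_take_drop i a) in e *.
  rewrite sact_catl ?es in e; last by lia.
  case e2: (sact l _) e => [p|] //= [ea]; subst a1.
  have [|t et it] := @split_l i l'; first by lia.
  have sp := sact_size e2; rewrite es in sp.
  have ht : (0 < sidx t < size (drop i a))%N by rewrite size_drop it; lia.
  rewrite et -[in shsl i _]sp sact_catr // in e1.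
  case e3: (sact t _) e1 => [q|] //= [eb]; subst b.
  exists (take i a ++ q); first by rewrite et -[in shsl i _]es sact_catr // e3.
  by rewrite sact_catl ?e2 // es; lia.
set i := (sidx l').+1; have es : size (take i a) = i by rewrite size_takel //; lia.
rewrite -(cat_take_drop i a) in e *.
have [|t et it] := @split_l i l; first by lia.
have ht : (0 < sidx t < size (drop i a))%N by rewrite size_drop it; lia.
rewrite et -[in shsl i _]es sact_catr // in e.
case e2: (sact t _) e => [q|] //= [ea]; subst a1.
rewrite sact_catl ?es in e1; last by lia.
case e3: (sact l' _) e1 => [p|] //= [eb]; subst b.
exists (p ++ drop i a); first by rewrite sact_catl ?e3 // es; lia.
by rewrite et -[in shsl i _]es -(sact_size e3) sact_catr // e2.
Qed.

Lemma sact_comm l l' a a1 b : far (sidx l) (sidx l') ->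
  sact l a = Some a1 -> sact l' a1 = Some b ->
  exists2 a1', sact l' a = Some a1' & sact l a1' = Some b.
Proof. by move/orP => h; apply: sact_comm_lt; lia. Qed.

Lemma nw_sact l a b i : sact l a = Some b -> i != sidx l -> i != (sidx l).+1 -> nw b i = nw a i.
Proof.
move=> e; have [k1 [x [y [k2 [ea sk _ _ e']]]]] := sact_split (sact_range e).
have hl := sact_range e; rewrite e in e' => h1 h2.
have main x' y' : nw (k1 ++ [:: x', y' & k2]) i = nw (k1 ++ [:: x, y & k2]) i.
  rewrite /nw; case: i h1 h2 => //= i h1 h2; rewrite !nth_cat; case: ifP => // hi.
  by case ei: (i - size k1)%N => [|[|j]] //; lia.
rewrite ea; case: l {e h1 h2 sk hl} e' => _; [case: x ea main => //= x ea main|case: y ea main => //= y ea main];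
  by case: ifP => // _ [->].
Qed.

Lemma sumn_take_sact l a b i : sact l a = Some b -> i != sidx l ->
  sumn (take i b) = sumn (take i a).
Proof.
move=> e; have [k1 [x [y [k2 [ea sk _ _ e']]]]] := sact_split (sact_range e).
have hl := sact_range e; rewrite e in e' => h1.
have main x' y' : (x' + y' = x + y)%N ->
    sumn (take i (k1 ++ [:: x', y' & k2])) = sumn (take i (k1 ++ [:: x, y & k2])).
  move=> exy; rewrite !take_cat; case: ifP => // hi.
  by case ei: (i - size k1)%N => [|[|j]] //=; rewrite ?sumn_cat //=; lia.
rewrite ea; case: l {e h1 sk hl} e' => _; [case: x ea main => //= x ea main|case: y ea main => //= y ea main];
  by case: ifP => // _ [->]; apply: main; lia.
Qed.

Lemma cl_sact l a b i : sact l a = Some b -> i != (sidx l).+1 -> cl b i = cl a i.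
Proof.
move=> e h; have := sact_range e => hr; rewrite /cl (sumn_take_sact e) //; lia.
Qed.

Lemma gam_sact l a b e i : sact l a = Some b -> i != sidx l -> gam e b i = gam e a i.
Proof. by move=> e1 h; rewrite /gam (sumn_take_sact e1). Qed.

Lemma web_far l l' a b : far (sidx l) (sidx l') -> sact l a = Some b -> web l' b = web l' a.
Proof.
rewrite /far => h e; rewrite /web (cl_sact e) ?(nw_sact e) //; lia.
Qed.

(* colours met by the action on the coordinates i, i+1 *)
Definition within (lo hi : nat) (k : wlet) : bool := (lo <= wcol k)%N && ((wcol k).+1 < hi)%N.

(** The first colour after the coordinates i and i+1. *)
Definition hi (a : seq nat) (i : nat) : nat := (cl a i + nw a i + nw a i.+1)%N.

Lemma web_within l a : all (within (cl a (sidx l)) (hi a (sidx l))) (web l a).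
Proof.
rewrite /web /hi; move: (nw a _) (nw a _) (cl a _) => x y c.
by case: l => i; case: x => [|[|[|x]]]; case: y => [|[|[|y]]] //=; rewrite /within /=; lia.
Qed.

Lemma cl_next a i : (0 < i)%N -> (cl a i + nw a i)%N = cl a i.+1.
Proof.
case: i => // i _; rewrite /cl /nw /=.
case: (ltnP i (size a)) => h; first by rewrite (take_nth 0%N h) sumn_rcons; lia.
by rewrite nth_default // !take_oversize //; lia.
Qed.

Lemma cl_mono a i j : (i <= j)%N -> (cl a i <= cl a j)%N.
Proof.
move=> h; rewrite /cl leq_add2l; have -> : take i.-1 a = take i.-1 (take j.-1 a).
  by rewrite take_takel //; lia.
by rewrite -[X in (_ <= sumn X)%N](cat_take_drop i.-1) sumn_cat leq_addr.
Qed.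

Lemma hi_cl a i j : (0 < i)%N -> (i.+1 < j)%N -> (hi a i <= cl a j)%N.
Proof. by move=> h1 h2; rewrite /hi !cl_next //; apply: cl_mono. Qed.

Lemma within_far lo hi_ lo' hi' k k' : (hi_ <= lo')%N || (hi' <= lo)%N ->
  within lo hi_ k -> within lo' hi' k' -> far (wcol k) (wcol k').
Proof. by rewrite /within /far; lia. Qed.

(** A strand of colour k occupies the colours k and k+1, and distant letters act on disjoint
    intervals of colours; this forces a gap of at least 2 between the colours of their strands. *)
Lemma farw_web l l' a : (0 < sidx l)%N -> (0 < sidx l')%N -> far (sidx l) (sidx l') ->
  farw (web l a) (web l' a).
Proof.
move=> h h' hf; apply/allP => k hk; apply/allP => k' hk'.
apply: within_far (allP (web_within l a) k hk) (allP (web_within l' a) k' hk').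
by case/orP: hf => hf; apply/orP; [left|right]; apply: hi_cl; lia.
Qed.

Definition gwithin (lo hi : nat) (g : fgen) : bool :=
  match g with
  | FDot i => (lo <= i < hi)%N
  | FCross k l => [&& within lo hi k, within lo hi l & far (wcol k) (wcol l)]
  | FCup i | FCap i | FZip i | FUnzip i => (lo <= i)%N && (i.+1 < hi)%N
  end.

Lemma within_apart lo hi_ lo' hi' k g : (hi_ <= lo')%N || (hi' <= lo)%N ->
  within lo hi_ k -> gwithin lo' hi' g -> apart k g.
Proof.
by case: g => [i|i|i|i|i|x y] /= h hk; move: h hk; rewrite /within /far; lia.
Qed.

Lemma farD_exch u v w : farw w u -> farw w v -> farw u v -> farD w (exch u v).
Proof.
move=> hu hv huv; apply/allP => k kw; move: (allP hu k kw) (allP hv k kw) => {}hu {}hv.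
elim: u hu huv => //= l u IH /andP[h1 h2] /andP[h3 h4].
have sh (D : diag) : all (fun L => apart k L.2) (shl 1 D) = all (fun L => apart k L.2) D.
  by rewrite /shl all_map.
rewrite all_cat sh IH //=.
elim: v hv h3 {h4 IH} => //= x v IH /andP[h5 h6] /andP[h7 h8].
by rewrite h1 h5 h7 sh IH.
Qed.

End DistantLetters.
Import DistantLetters.

Module Frames.

(** * The images of the generators are well typed *)

Fixpoint weights (k : nat) : seq (seq nat) :=
  if k is k'.+1 then flatten [seq [seq x :: a | a <- weights k'] | x <- [:: 0; 1; 2]%N]
  else [:: [::]].

Lemma mem_weights k a : size a = k -> small a -> a \in weights k.
Proof.
elim: k a => [|k IH] [|x a] //= [ea] /andP[hx ha].
have {}IH := IH _ ea ha; rewrite !mem_cat.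
by case: x hx => [|[|[|x]]] // _; rewrite map_f ?orbT.
Qed.

Lemma nw_small i a : small a -> (nw a i <= 2)%N.
Proof.
move=> h; rewrite /nw; case: i => //= i; case: (ltnP i (size a)) => hi.
  by apply: (allP h); apply: mem_nth.
by rewrite nth_default.
Qed.

Lemma frame n d (a : lam n d) i k : (0 < i)%N -> (i.-1 + k <= n)%N ->
  exists l1 a0 l2, [/\ sval a = l1 ++ a0 ++ l2, size l1 = i.-1, size a0 = k &
    a0 \in weights k /\ small l1].
Proof.
move=> hi hk; have sa := lam_size a; have ha := lam_small a.
exists (take i.-1 (sval a)), (take k (drop i.-1 (sval a))), (drop k (drop i.-1 (sval a))).
have s0 : size (take k (drop i.-1 (sval a))) = k.
  by rewrite size_takel // size_drop sa; lia.
rewrite !cat_take_drop size_takel; last by lia.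
move: ha; rewrite /small -{1}(cat_take_drop i.-1 (sval a)) all_cat.
rewrite -{1}(cat_take_drop k (drop i.-1 (sval a))) all_cat => /and3P[h1 h2 h3].
by split=> //; split=> //; apply: mem_weights.
Qed.

Definition gtyped (g : sgen) (a : seq nat) : bool :=
  if spath (gsrc g) a is Some b then (spath (gtgt g) a == Some b) && gok g a else false.

(** The parity only changes the scalar ([simg_parity]), so the check of the diagram at [false]
    covers both. *)
Definition gcheck (g : sgen) (a : seq nat) : bool :=
  gtyped g a ==>
  okd (nz a) (webw (gsrc g) a) (webw (gtgt g) a) (gdeg g a) (simg false a g).2.

Lemma simg_parity e e' a g : (simg e a g).2 = (simg e' a g).2.
Proof.
case: g => //= [i j|i j|i m|i m].
- by do 3?[case: ifP => _ //].
- case: ifP => _ //; case: ifP => _.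
    by case: (nw a i) => [|[|[|x]]]; case: (nw a j.+1) => [|[|[|x']]].
  case: ifP => _ //; by case: (nw a j) => [|[|[|x]]]; case: (nw a i.+1) => [|[|[|x']]].
- by case: (nw a i) => [|[|[|x]]]; case: (nw a i.+1) => [|[|[|x']]]; case: m.
by case: (nw a i) => [|[|[|x]]]; case: (nw a i.+1) => [|[|[|x']]]; case: m.
Qed.

(** Up to translation these are the generators with a single index, or with two equal ones; at most
    two dots occur in [PInv] and [NInv], numbered 0 and 1, because coordinates are at most 2.
    Neighbouring indices make up [gen3], and distant ones are treated by exchanges. *)
Definition gen2 : seq sgen :=
  [:: SDot 1; SEta 1; SEps 1; STau 1 1; SInv 1 1; PInv 1 0; PInv 1 1; NInv 1 0; NInv 1 1].
Definition gen3 : seq sgen := [:: STau 1 2; STau 2 1; SInv 1 2; SInv 2 1].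

Lemma gen_checks : all (fun g => all (gcheck g) (weights 2)) gen2
  && all (fun g => all (gcheck g) (weights 3)) gen3.
Proof. by vm_compute. Qed.

Section Images.
Variables (R : comPzRingType) (K : ground R) (n d : nat).
Local Notation mu := (bichar K).
Local Notation fpath := (@wpath (foam_sig d)).
Implicit Types a b : lam n d.
Local Notation ul := (@underline n d).
Local Notation spr := (schur_pres K n d).

Lemma webw_fpath w a b : wpath (S := schur_sig n d) w a b ->
  fpath (webw w (sval a)) (ul a) (ul b).
Proof.
move=> /spathP e; apply/fpathP; exact: (webw_path e (lam_small a)).1.
Qed.

Lemma ul_split a (l1 a0 l2 : seq nat) : sval a = l1 ++ a0 ++ l2 ->
  sval (ul a) = nz l1 ++ nz a0 ++ nz l2.
Proof. by move=> e; rewrite /= e -!nz_cat. Qed.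

Lemma gtyped_ctx g0 (l1 a0 l2 : seq nat) : ing (size a0) g0 ->
  gtyped (shsg (size l1) g0) (l1 ++ a0 ++ l2) = gtyped g0 a0.
Proof.
move=> h; have /andP[h1 h2] := ing_src h; rewrite /gtyped.
rewrite gsrc_sh gtgt_sh !spath_ctx // gok_ctx //.
case e1: (spath (gsrc g0) a0) => [b|] //=; case e2: (spath (gtgt g0) a0) => [b'|] //=.
by rewrite (inj_eq (@Some_inj _)) ctx_inj (inj_eq (@Some_inj _)).
Qed.

Lemma gtypedP g a : gtyped g (sval a) <-> exists2 b,
  wpath (S := schur_sig n d) (gsrc g) a b /\ wpath (S := schur_sig n d) (gtgt g) a b & gok g (sval a).
Proof.
rewrite /gtyped; split.
  case e: (spath _ _) => [s|] // /andP[/eqP e' h].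
  have [b pb eb] := spath_exists e; exists b => //; split=> //.
  by apply/spathP; rewrite eb.
by case=> b [/spathP -> /spathP ->] ->; rewrite eqxx.
Qed.

Lemma local_good k g0 a b (l1 a0 l2 : seq nat) : all (gcheck g0) (weights k) -> ing k g0 ->
  sval a = l1 ++ a0 ++ l2 -> size a0 = k -> a0 \in weights k -> small l1 ->
  forall g, g = shsg (size l1) g0 -> gtyped g (sval a) ->
  wpath (S := schur_sig n d) (gsrc g) a b ->
  good (ul a) (ul b) (webw (gsrc g) (sval a)) (webw (gtgt g) (sval a)) (gdeg g (sval a))
       (simg false (sval a) g).2.
Proof.
move=> hc hi ea s0 w0 sm g ->; rewrite -s0 in hi; rewrite ea gtyped_ctx // => gt pb.
have pw := webw_fpath pb.
have /andP[h1 h2] := ing_src hi.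
have := allP hc a0 w0; rewrite /gcheck gt /= => hok.
move: pw; rewrite ea gsrc_sh gtgt_sh !webw_ctx // gdeg_ctx // simg_ctx //=.
rewrite (simg_parity _ false) -(sumn_nz l1) => pw.
exact: (okd_good (ones_nz sm) hok (ul_split ea) pw).
Qed.

Lemma webw_far l l' a b (a1 : lam n d) : far (sidx l) (sidx l') ->
  schur_step l' a a1 -> schur_step l a1 b ->
  webw [:: l; l'] (sval a) = web l (sval a) ++ web l' (sval a).
Proof.
move=> hf /schur_stepP e1 _; rewrite /= e1 cats0 /=.
by rewrite (web_far _ e1) // farC.
Qed.

Lemma exch_typed l l' a b : far (sidx l) (sidx l') ->
  wpath (S := schur_sig n d) [:: l; l'] a b -> wpath (S := schur_sig n d) [:: l'; l] a b ->
  good (ul a) (ul b) (webw [:: l; l'] (sval a)) (webw [:: l'; l] (sval a)) 0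
    (exch (web l (sval a)) (web l' (sval a))).
Proof.
move=> hf p1 p2; have pw := webw_fpath p1.
case: p1 => a1 [a2 ea2 s1] s2; rewrite -{}ea2 in s1.
case: p2 => a3 [a4 ea4 s3] s4; rewrite -{}ea4 in s3.
have hf' : far (sidx l') (sidx l) by rewrite farC.
rewrite (webw_far hf s1 s2) in pw *; rewrite (webw_far hf' s3 s4).
apply: (exch_good K) => //; apply: farw_web => //.
  by have /schur_stepP/sact_range/andP[] := s3.
by have /schur_stepP/sact_range/andP[] := s1.
Qed.

(** Windows of two or three coordinates cover equal and neighbouring indices; for distant ones the
    image is an exchange of distant webs. *)
Lemma simg_good g a b : gok g (sval a) ->
  wpath (S := schur_sig n d) (gsrc g) a b -> wpath (S := schur_sig n d) (gtgt g) a b ->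
  good (ul a) (ul b) (webw (gsrc g) (sval a)) (webw (gtgt g) (sval a)) (gdeg g (sval a))
       (simg false (sval a) g).2.
Proof.
move=> hg p1 p2; have gt : gtyped g (sval a) by apply/gtypedP; exists b.
have [c2 c3] := andP gen_checks.
have at_nth (P : pred sgen) l k : (k < size l)%N -> all P l -> P (nth (SDot 1) l k).
  by move=> hk /(all_nthP (SDot 1)); apply.
have range l w c : wpath (S := schur_sig n d) (l :: w) a c -> (0 < sidx l < n)%N.
  by case=> c' _ /schur_stepP/sact_range; rewrite lam_size.
have range2 l l' c : wpath (S := schur_sig n d) [:: l; l'] a c -> (0 < sidx l' < n)%N.
  by case=> c' [c'' <- /schur_stepP/sact_range]; rewrite lam_size.
have loc2 k i (g0 := nth (SDot 1) gen2 k) : (0 < i < n)%N -> (k < 9)%N -> g = shsg i.-1 g0 ->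
    good (ul a) (ul b) (webw (gsrc g) (sval a)) (webw (gtgt g) (sval a)) (gdeg g (sval a))
       (simg false (sval a) g).2.
  move=> hi hk eg; have hc := at_nth _ _ _ (hk : (k < size gen2)%N) c2.
  have hin := at_nth (ing 2) _ _ (hk : (k < size gen2)%N) isT.
  have [||l1 [a0 [l2 [ea s1 s0 [w0 sm]]]]] := @frame n d a i 2; try by lia.
  by apply: (local_good hc hin ea s0 w0 sm _ gt p1); rewrite s1.
have loc3 k i (g0 := nth (SDot 1) gen3 k) : (0 < i)%N -> (i.+1 < n)%N -> (k < 4)%N -> g = shsg i.-1 g0 ->
    good (ul a) (ul b) (webw (gsrc g) (sval a)) (webw (gtgt g) (sval a)) (gdeg g (sval a))
       (simg false (sval a) g).2.
  move=> h1 h2 hk eg; have hc := at_nth _ _ _ (hk : (k < size gen3)%N) c3.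
  have hin := at_nth (ing 3) _ _ (hk : (k < size gen3)%N) isT.
  have [||l1 [a0 [l2 [ea s1 s0 [w0 sm]]]]] := @frame n d a i 3; try by lia.
  by apply: (local_good hc hin ea s0 w0 sm _ gt p1); rewrite s1.
have p1E i : (0 < i)%N -> (i.-1 + 1)%N = i by lia.
have p2E i : (0 < i)%N -> (i.-1 + 2)%N = i.+1 by lia.
case: g hg p1 p2 gt loc2 loc3 => [i|i|i|i j|i j|i m|i m] hg p1 p2 gt loc2 loc3.
- have hi := range _ _ _ p2; rewrite /= in hi; apply: (loc2 1%N i) => //=; rewrite p1E //; lia.
- have hi := range _ _ _ p1; rewrite /= in hi; apply: (loc2 2%N i) => //=; rewrite p1E //; lia.
- have hi := range _ _ _ p1; rewrite /= in hi; apply: (loc2 0%N i) => //=; rewrite p1E //; lia.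
- have hi := range _ _ _ p1; have hj := range _ _ _ p2; rewrite /= in hi hj.
  have [eij|nij] := eqVneq i j.
    by subst j; apply: (loc2 3%N i) => //=; rewrite p1E //; lia.
  have [ej|nj] := eqVneq j i.+1.
    by subst j; apply: (loc3 0%N i) => //=; rewrite ?p1E ?p2E //; lia.
  have [ei|ni] := eqVneq i j.+1.
    by subst i; apply: (loc3 1%N j) => //=; rewrite ?p1E ?p2E //; lia.
  rewrite /= (negbTE nij) (negbTE nj) (negbTE ni) /=.
  have -> : tau_deg i j = 0 by rewrite /tau_deg /alpha; congr pair; lia.
  by apply: (@exch_typed (Fl i) (Fl j)) => //; rewrite /far /=; lia.
- have hi := range _ _ _ p2; have hj := range _ _ _ p1; rewrite /= in hi hj.
  have [eij|nij] := eqVneq i j.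
    by subst j; apply: (loc2 4%N i) => //=; rewrite p1E //; lia.
  have [ej|nj] := eqVneq j i.+1.
    by subst j; apply: (loc3 2%N i) => //=; rewrite ?p1E ?p2E //; lia.
  have [ei|ni] := eqVneq i j.+1.
    by subst i; apply: (loc3 3%N j) => //=; rewrite ?p1E ?p2E //; lia.
  rewrite /= (negbTE nij) (negbTE nj) (negbTE ni) /=.
  by apply: (@exch_typed (El j) (Fl i)) => //; rewrite /far /=; lia.
- have hi := range _ _ _ p1; rewrite /= in hi.
  (* The number of dots is below lambda_i - lambda_{i+1}, which is at most 2. *)
  have hm : (m < 2)%N.
    by have hs := lam_small a; move: hg; rewrite /=; have := nw_small i hs; lia.
  case: m hm hg p1 p2 gt loc2 loc3 => [|[|m]] // _ hg p1 p2 gt loc2 loc3.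
    by apply: (loc2 5%N i) => //=; rewrite p1E //; lia.
  by apply: (loc2 6%N i) => //=; rewrite p1E //; lia.
have hi := range _ _ _ p2; rewrite /= in hi.
have hm : (m < 2)%N.
  by have hs := lam_small a; move: hg; rewrite /=; have := nw_small i.+1 hs; lia.
case: m hm hg p1 p2 gt loc2 loc3 => [|[|m]] // _ hg p1 p2 gt loc2 loc3.
  by apply: (loc2 7%N i) => //=; rewrite p1E //; lia.
by apply: (loc2 8%N i) => //=; rewrite p1E //; lia.
Qed.

(** * Translating terms *)

Definition fW (a : lam n d) (u : seq slet) : seq wlet := webw u (sval a).

Definition fG (a : lam n d) (g : sgen) : raw R (foam_sig d) :=
  Scale (sval_ K (simg false (sval a) g).1) (den R d (fW a (gsrc g)) (simg false (sval a) g).2).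

Lemma fG_typed g a b u v p : schur_gbd g a u v p ->
  wpath (S := schur_sig n d) u a b -> wpath (S := schur_sig n d) v a b ->
  @typed R (foam_sig d) (ul a) (ul b) (fW a u) (fW a v) p (fG a g).
Proof.
case/schur_gbdP => hg -> -> -> p1 p2; apply: typed_scale.
exact: (good_typed K (simg_good hg p1 p2)).
Qed.

Local Notation strans := (@tr R spr (fpr K d) fW fG).
Local Notation feq := (@eqv R mu (fpr K d)).

Fixpoint sraw_of (t : smono) : raw R (schur_sig n d) :=
  match t with
  | MG g => @Gen R (schur_sig n d) g
  | MI w => sid R n d w
  | MV s t => sraw_of s \v sraw_of t
  | MH s t => sraw_of s \h sraw_of t
  end.

Local Notation ftyped := (@typed R (foam_sig d)).

Lemma scale_vc A B u v w p q c c' s t : ftyped A B v w p s -> ftyped A B u v q t ->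
  feq A B u w (p + q) (Scale c s \v Scale c' t) (Scale (c * c') (s \v t)).
Proof.
move=> ts tt; have t1 := typed_vc ts tt.
apply: eqv_trans (eqv_law mu (law_vcZl _ _ _) (typed_vc (typed_scale c ts) (typed_scale c' tt))
  (typed_scale c (typed_vc ts (typed_scale c' tt)))) _.
apply: eqv_trans (eqv_scale c (eqv_law mu (law_vcZr _ _ _)
  (typed_vc ts (typed_scale c' tt)) (typed_scale c' t1))) _.
exact: eqv_law (law_scaleA _ _ _) (typed_scale c (typed_scale c' t1)) (typed_scale _ t1).
Qed.

Lemma scale_hc A B C u v u' v' p q c c' s t : ftyped B C u v p s -> ftyped A B u' v' q t ->
  feq A C (u ++ u') (v ++ v') (p + q) (Scale c s \h Scale c' t) (Scale (c * c') (s \h t)).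
Proof.
move=> ts tt; have t1 := typed_hc ts tt.
apply: eqv_trans (eqv_law mu (law_hcZl _ _ _) (typed_hc (typed_scale c ts) (typed_scale c' tt))
  (typed_scale c (typed_hc ts (typed_scale c' tt)))) _.
apply: eqv_trans (eqv_scale c (eqv_law mu (law_hcZr _ _ _)
  (typed_hc ts (typed_scale c' tt)) (typed_scale c' t1))) _.
exact: eqv_law (law_scaleA _ _ _) (typed_scale c (typed_scale c' t1)) (typed_scale _ t1).
Qed.

(** Every translation of a monomial, whatever intermediate objects it uses, reduces to the one
    scaled diagram that [ev] computes. *)
Lemma tr_ev a b u v p t t' : strans a b u v p (sraw_of t) t' ->
  exists c D, [/\ ev false (sval a) t = Some (MkEval (sval b) u v c D),
    good (ul a) (ul b) (fW a u) (fW a v) p D &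
    feq (ul a) (ul b) (fW a u) (fW a v) p t' (Scale (sval_ K c) (den R d (fW a u) D))].
Proof.
elim: t a b u v p t' => [g|w|t1 IH1 t2 IH2|t1 IH1 t2 IH2] a b u v p t' /= h.
- case/tr_inv: h => hb pu pv ->; case/schur_gbdP: (hb) => hg eu ev_ ep; subst u v p.
  have g1 := simg_good hg pu pv.
  exists (simg false (sval a) g).1, (simg false (sval a) g).2; split=> //.
    move/spathP: pu => ->; move/spathP: pv => ->; rewrite eqxx hg /=.
    by case: (simg _ _ _).
  exact/eqv_refl/typed_scale/(good_typed K g1).
- case/tr_inv: h => ? ? ? pw ->; subst u v p.
  have pf := webw_fpath pw; exists sone, [::]; split=> //.
    by move/spathP: pw => ->.
  rewrite sval_one /=; have t1 := @typed_id R (fpr K d) _ _ _ pf.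
  exact/eqv_sym/(@eqv_law R mu (fpr K d) _ _ _ _ _ _ _ (law_scale1 _) (typed_scale 1 t1) t1).
- case/tr_inv: h => w [q [r [s1 [s2 [h1 h2 -> ->]]]]].
  have [c1 [D1 [e1 g1 q1]]] := IH1 _ _ _ _ _ _ h1.
  have [c2 [D2 [e2 g2 q2]]] := IH2 _ _ _ _ _ _ h2.
  exists (smul c1 c2), (D2 ++ D1); rewrite e2 e1 !eqxx; split=> //.
    exact: good_cat g2 g1.
  have y1 := good_typed K g1; have y2 := good_typed K g2.
  apply: eqv_trans (eqv_vc q1 q2) (eqv_trans (scale_vc _ _ y1 y2) _).
  rewrite sval_mul; exact: eqv_scale (eqv_sym (den_cat' K g2 g1)).
case/tr_inv: h => b1 [u1 [v1 [u2 [v2 [q [r [s1 [s2 [h1 h2 [-> -> ->] ->]]]]]]]]].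
have [c1 [D1 [e1 g1 q1]]] := IH1 _ _ _ _ _ _ h1.
have [c2 [D2 [e2 g2 q2]]] := IH2 _ _ _ _ _ _ h2.
have [pu2 pv2] := typed_wpath (tr_typedl h2).
have wc w w' : wpath (S := schur_sig n d) w' a b1 -> fW a (w ++ w') = fW b1 w ++ fW a w'.
  by move/spathP => e; apply: webw_cat.
have [pw1 pw1'] := good_path K g1; have [pw2 pw2'] := good_path K g2.
exists (smul c1 c2), (shl (size (fW b1 u1)) D2 ++ D1); rewrite e2 e1 !wc //.
split=> //.
  by apply: good_cat (good_whiskl pw1 g2) (good_whiskr pw2' g1).
have y1 := good_typed K g1; have y2 := good_typed K g2.
apply: eqv_trans (eqv_hc q1 q2) (eqv_trans (scale_hc _ _ y1 y2) _).
by rewrite sval_mul; apply: eqv_scale (eqv_sym _); case: (den_juxt K g1 g2).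
Qed.

(** With [tr_ev] this shows that evaluation succeeds precisely on typed monomials, which matches the
    test made by [prune]. *)
Lemma ev_typed a t v : ev false (sval a) t = Some v -> exists b p, sval b = v_ob v /\
  @typed R (schur_sig n d) a b (v_src v) (v_tgt v) p (sraw_of t).
Proof.
elim: t a v => [g|w|t1 IH1 t2 IH2|t1 IH1 t2 IH2] a v /=.
- case e1: (spath _ _) => [s|] //; case: ifP => // /andP[/eqP e2 hg].
  have [b pb eb] := spath_exists e1.
  have pb' : wpath (S := schur_sig n d) (gtgt g) a b by apply/spathP; rewrite eb.
  case: (simg _ _ _) => c D [<-]; exists b, (gdeg g (sval a)); split=> //=.
  by apply: typed_gen => //; apply/schur_gbdP.
- case e1: (spath _ _) => [s|] // [<-]; have [b pb eb] := spath_exists e1.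
  by exists b, 0; split=> //; apply: typed_id.
- case e2: (ev _ _ t2) => [[s2 u x c D]|] //; case e1: (ev _ _ t1) => [[s1 x' w c' D']|] //.
  case: ifP => // /andP[/eqP es /eqP ex] [<-] /=; subst s1 x'.
  have [b [p [/= eb y2]]] := IH2 _ _ e2; have [b' [p' [/= eb' y1]]] := IH1 _ _ e1.
  have e : b' = b by apply: lam_eq; rewrite eb.
  by subst b'; exists b, (p' + p); split=> //; apply: typed_vc y1 y2.
case e2: (ev _ _ t2) => [[s2 u x c D]|] //.
have [b [p [/= eb y2]]] := IH2 _ _ e2; rewrite -eb.
case e1: (ev _ _ t1) => [[s1 u' x' c' D']|] // [<-] /=.
have [b' [p' [/= eb' y1]]] := IH1 _ _ e1.
by exists b', (p' + p); split=> //; apply: typed_hc y1 y2.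
Qed.

End Images.

End Frames.
Import Frames.

(** * Linear relations evaluated on windows *)

Module Terms.

Inductive slin := LM of smono | LA of slin & slin | LS of mscal & slin | LZ.

Fixpoint evl (e : bool) (a : seq nat) (U : slin) : seq eval :=
  match U with
  | LM t => if ev e a t is Some v then [:: v] else [::]
  | LA U V => evl e a U ++ evl e a V
  | LS c U => [seq MkEval (v_ob v) (v_src v) (v_tgt v) (smul c (v_coef v)) (v_diag v)
                | v <- evl e a U]
  | LZ => [::]
  end.

Definition terms (l : seq eval) : lincomb := [seq (v_coef v, v_diag v) | v <- l].

Fixpoint shlin (m : nat) (U : slin) : slin :=
  match U with
  | LM t => LM (shm m t) | LA U V => LA (shlin m U) (shlin m V)
  | LS c U => LS c (shlin m U) | LZ => LZ
  end.

Fixpoint inlin (k : nat) (U : slin) : bool :=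
  match U with
  | LM t => inm k t | LA U V => inlin k U && inlin k V
  | LS c U => inlin k U | LZ => true
  end.

Lemma evl_ctx l1 l2 e a U : inlin (size a) U ->
  evl e (l1 ++ a ++ l2) (shlin (size l1) U) =
  map (sheval l1 l2) (evl (e (+) odd (sumn l1)) a U).
Proof.
elim: U => //= [t h|U IHU V IHV /andP[hU hV]|c U IH h].
- by rewrite ev_ctx //; case: (ev _ a t).
- by rewrite IHU // IHV // map_cat.
by rewrite IH // -!map_comp; apply: eq_map => -[].
Qed.

Fixpoint letters (t : smono) : seq nat :=
  match t with
  | MG g => map sidx (gsrc g ++ gtgt g)
  | MI w => map sidx w
  | MV s t | MH s t => letters s ++ letters t
  end.

(** The index [i] occurs in every monomial; if it is not between 1 and n-1, none of them is typed
    and the whole expression vanishes. *)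
Fixpoint spans (i : nat) (U : slin) : bool :=
  match U with
  | LM t => i \in letters t | LA U V => spans i U && spans i V
  | LS _ U => spans i U | LZ => true
  end.

Lemma spath_range w a b : spath w a = Some b -> all (fun l => 0 < sidx l < size a)%N w.
Proof.
elim: w b => //= l w IH b; case e: (spath w a) => [b'|] //= /sact_range.
by rewrite (spath_size e) => ->; apply: IH e.
Qed.

Lemma ev_range e a t v : ev e a t = Some v ->
  all (fun i => 0 < i < size a)%N (letters t) /\ size (v_ob v) = size a.
Proof.
elim: t a v => [g|w|t1 IH1 t2 IH2|t1 IH1 t2 IH2] a v /=.
- case e1: (spath (gsrc g) a) => [b|] //; case: ifP => // /andP[/eqP e2 _].
  case: (simg e a g) => c D [<-]; rewrite map_cat all_cat !all_map (spath_range e1).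
  by rewrite (spath_range e2) (spath_size e1).
- case e1: (spath w a) => [b|] // [<-]; by rewrite all_map (spath_range e1) (spath_size e1).
- case e2: (ev e a t2) => [[b u x c D]|] //; case e1: (ev e a t1) => [[b' x' w c' D']|] //.
  by case: ifP => // _ [<-]; rewrite all_cat; have [-> _] := IH1 _ _ e1; have [-> ->] := IH2 _ _ e2.
case e2: (ev e a t2) => [[b u x c D]|] //; case e1: (ev e b t1) => [[b' x' w c' D']|] // [<-].
have [h2 /= s2] := IH2 _ _ e2; have [h1 /= s1] := IH1 _ _ e1.
by rewrite all_cat h2 s1 s2 in h1 *; rewrite h1.
Qed.

Lemma evl_range e a U i : ~~ (0 < i < size a)%N -> spans i U -> evl e a U = [::].
Proof.
move=> hi; elim: U => //= [t h|U IHU V IHV /andP[/IHU-> /IHV->]|c U IH /IH->] //.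
case et: (ev e a t) => [v|] //; have [/allP/(_ _ h)] := ev_range et.
by rewrite (negbTE hi).
Qed.

Lemma evl_in e a U : inlin (size a) U ->
  all (fun x => all (inl_ (size a)) (v_src x) && all (inl_ (size a)) (v_tgt x)) (evl e a U).
Proof.
elim: U => //= [t h|U IHU V IHV /andP[/IHU h1 /IHV h2]|c U IH /IH h].
- by case et: (ev e a t) => [x|] //=; have [_ -> ->] := ev_in et h.
- by rewrite all_cat h1.
by rewrite all_map; apply: sub_all h.
Qed.

(** Source, target and degree are taken from the first surviving term; if none survives, both sides
    are zero. *)
Definition check (e : bool) (a : seq nat) (U V : slin) (l : script) : bool :=
  let s := evl e a U in let t := evl e a V in
  if s ++ t is x :: _ then
    vanish predT (nz a) (webw (v_src x) a) (webw (v_tgt x) a) (ddeg (v_diag x))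
      (terms s ++ opp_lc (terms t)) l
  else true.

(* A relation of GSchur with indices in a window of [f_size] coordinates, for
   the weights satisfying [f_cond]; its sides may depend on the weight. *)
Record family := Family {
  f_size : nat; f_cond : pred (seq nat); f_lhs : seq nat -> slin; f_rhs : seq nat -> slin;
  f_scripts : seq (seq nat * script) }.

Fixpoint lookup (V : eqType) U (x : V) (y : U) (l : seq (V * U)) : U :=
  if l is (x', z) :: l' then if x == x' then z else lookup x y l' else y.

(** A weight without a script gets the empty one: its terms cancel as they stand, or none
    survives. *)
Definition f_check (f : family) : bool :=
  all (fun a => f_cond f a ==>
    [&& inlin (f_size f) (f_lhs f a), inlin (f_size f) (f_rhs f a) &
      let l := lookup a [::] (f_scripts f) in
      all (fun e => check e a (f_lhs f a) (f_rhs f a) l) [:: true; false]]) (weights (f_size f)).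

Section Relations.
Variables (R : comPzRingType) (K : ground R) (n d : nat).
Local Notation mu := (bichar K).
Local Notation fpath := (@wpath (foam_sig d)).
Local Notation spath_ := (@wpath (schur_sig n d)).
Implicit Types a b : lam n d.
Local Notation ul := (@underline n d).
Local Notation spr := (schur_pres K n d).
Local Notation strans := (@tr R spr (fpr K d) (@fW n d) (fG K (n := n) (d := d))).
Local Notation feq := (@eqv R mu (fpr K d)).
Local Notation dsum := (@dsum R d).

Fixpoint raw_lin (S : slin) : raw R (schur_sig n d) :=
  match S with
  | LM t => sraw_of R n d t
  | LA U V => Add (raw_lin U) (raw_lin V)
  | LS c U => Scale (sval_ K c) (raw_lin U)
  | LZ => Zero
  end.

Lemma terms_cat s t : terms (s ++ t) = terms s ++ terms t.
Proof. exact: map_cat. Qed.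

(** A monomial that is not typed at [a] is pruned to [Zero] in the presentation and skipped by
    [evl]; a typed one contributes the diagram of [tr_ev]. *)
Lemma tr_evl a b u v p S t' : strans a b u v p (prune a (raw_lin S)) t' ->
  let l := evl false (sval a) S in
  [/\ all (fun x => [&& v_ob x == sval b, v_src x == u & v_tgt x == v]) l,
    allgood (ul a) (ul b) (fW a u) (fW a v) p (isc K (terms l)) &
    feq (ul a) (ul b) (fW a u) (fW a v) p t' (dsum (fW a u) (isc K (terms l)))].
Proof.
move=> h; have [pu pv] := typed_wpath (tr_typedl h).
have pfu := webw_fpath pu; have pfv := webw_fpath pv.
elim: S t' h => [t|S IHS T IHT|c S IH|] t' /=.
- have -> : prune a (sraw_of R n d t) =
    if `[< exists b u v p, @typed R (schur_sig n d) a b u v p (sraw_of R n d t) >]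
    then sraw_of R n d t else Zero by case: t.
  case: asboolP => ht h.
    have [c [D [e g q]]] := tr_ev h; rewrite e /= !eqxx; split=> //.
      by move=> E [<-|[]].
    exact: eqv_trans q (eqv_sym (dsum1 K _ g)).
  case/tr_inv: h => _ _ ->.
  have -> : ev false (sval a) t = None.
    case e: (ev _ _ _) => [x|] //; case: ht.
    by have [b' [p' [_ ty]]] := ev_typed R e; exists b', (v_src x), (v_tgt x), p'.
  by split=> //; apply/eqv_refl/typed_zero.
- case/tr_inv=> s1 [t1 [hs ht ->]].
  have [a1 g1 q1] := IHS _ hs; have [a2 g2 q2] := IHT _ ht.
  have g12 : allgood (ul a) (ul b) (fW a u) (fW a v) p
     (isc K (terms (evl false (sval a) S)) ++ isc K (terms (evl false (sval a) T))).
    by apply/allgood_cat.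
  rewrite all_cat a1 a2 terms_cat isc_cat; split=> //.
  exact: eqv_trans (eqv_add q1 q2) (eqv_sym (dsum_cat K pfu pfv g12)).
- case/tr_inv=> s1 hs ->; have [a1 g1 q1] := IH _ hs.
  have -> : terms [seq MkEval (v_ob v0) (v_src v0) (v_tgt v0) (smul c (v_coef v0)) (v_diag v0)
      | v0 <- evl false (sval a) S] =
      [seq (smul c cE.1, cE.2) | cE <- terms (evl false (sval a) S)].
    by rewrite /terms -!map_comp; apply: eq_map.
  rewrite isc_scale; split.
  + by rewrite all_map; apply: sub_all a1 => x /and3P[/= -> -> ->].
  + exact: allgood_scale.
  exact: eqv_trans (eqv_scale _ q1) (eqv_sym (dsum_scale K _ pfu pfv g1)).
rewrite if_same => /tr_inv[_ _ ->]; split=> //; exact/eqv_refl/typed_zero.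
Qed.

(** By [evl_ctx] the evaluation at the full weight is the recoloured evaluation on the window, at
    the parity of the sum of [l1], so the certificate for the window applies. *)
Lemma local_rel a b u v p (l1 a0 l2 : seq nat) S T l s' t' :
  sval a = l1 ++ a0 ++ l2 -> small l1 -> inlin (size a0) S -> inlin (size a0) T ->
  check (odd (sumn l1)) a0 S T l ->
  strans a b u v p (prune a (raw_lin (shlin (size l1) S))) s' ->
  strans a b u v p (prune a (raw_lin (shlin (size l1) T))) t' ->
  feq (ul a) (ul b) (fW a u) (fW a v) p s' t'.
Proof.
move=> ea sm iS iT hc hs ht; have [pu pv] := typed_wpath (tr_typedl hs).
have pfu := webw_fpath pu; have pfv := webw_fpath pv.
have [aS gS qS] := tr_evl hs; have [aT gT qT] := tr_evl ht.
apply: eqv_trans qS (eqv_trans _ (eqv_sym qT)).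
move: aS gS aT gT; rewrite ea !evl_ctx // addFb.
set e := odd _ in hc *; set ls := evl e a0 S in hc *; set lt := evl e a0 T in hc *.
have termsE l0 : terms (map (sheval l1 l2) l0) = shS (sumn (nz l1)) (terms l0).
  by rewrite sumn_nz /terms /shS -!map_comp; apply: eq_map.
have all_p : all (fun x => [&& v_ob x == sval b, v_src x == u & v_tgt x == v])
    (map (sheval l1 l2) (ls ++ lt)) -> allgood (ul a) (ul b) (fW a u) (fW a v) p
    (isc K (shS (sumn (nz l1)) (terms (ls ++ lt)))) ->
    feq (ul a) (ul b) (fW a u) (fW a v) p
      (dsum (fW a u) (isc K (shS (sumn (nz l1)) (terms ls))))
      (dsum (fW a u) (isc K (shS (sumn (nz l1)) (terms lt)))).
  have : all (fun x => all (inl_ (size a0)) (v_src x) && all (inl_ (size a0)) (v_tgt x)) (ls ++ lt).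
    by rewrite all_cat (evl_in _ iS) (evl_in _ iT).
  move: hc; rewrite /check -/ls -/lt; case e0: (ls ++ lt) => [|x l0].
    have [-> ->] : ls = [::] /\ lt = [::] by case: (ls) (lt) e0 => // -[].
    by move=> _ _ _ _; apply/eqv_refl/typed_zero.
  move=> hv /= /andP[/andP[hu hv'] _] /andP[/and3P[_ /eqP eu /eqP ev_] _] hg.
  have wE : fW a u = shw (sumn (nz l1)) (webw (v_src x) a0).
    by rewrite /fW ea -eu webw_ctx // sumn_nz.
  have vE : fW a v = shw (sumn (nz l1)) (webw (v_tgt x) a0).
    by rewrite /fW ea -ev_ webw_ctx // sumn_nz.
  (* The degree is not part of an evaluation; it is read off from the first surviving term, known to
     be good. *)
  have ep : ddeg (v_diag x) = p.
    by have [|_ _ <-] := hg (shd (sumn (nz l1)) (v_diag x)); [left|rewrite ddeg_shd].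
  rewrite -[webw u _]/(fW a u) -[webw v _]/(fW a v) in pfu pfv; rewrite wE vE in pfu pfv *; rewrite ep in hv.
  have [] := @vanish_sound R K d (nz l1) (nz l2) (ones_nz sm) predT _ _ _ _ _ _ _ _ _
    (fun r _ => @rules_sound R K d r) (ul_split ea) pfu pfv hv; first by [].
  rewrite shS_cat -[shS _ (opp_lc _)]/(shS _ _).
  have -> : shS (sumn (nz l1)) (opp_lc (terms lt)) = opp_lc (shS (sumn (nz l1)) (terms lt)).
    by rewrite /shS /opp_lc -!map_comp; apply: eq_map.
  exact: dsum_sub pfu pfv.
move=> aS gS aT gT; rewrite !termsE in gS gT *; apply: all_p.
  by rewrite map_cat all_cat aS aT.
by rewrite terms_cat shS_cat isc_cat; apply/allgood_cat.
Qed.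

Lemma family_rel (f : family) a b u v p i s t s' t' : f_check f ->
  (0 < i)%N -> (i.-1 + f_size f <= n)%N ->
  (forall a0 : seq nat, size a0 = f_size f ->
     (forall k, (0 < k <= f_size f)%N -> nw (sval a) (i.-1 + k) = nw a0 k) ->
     [/\ f_cond f a0, s = raw_lin (shlin i.-1 (f_lhs f a0)) &
         t = raw_lin (shlin i.-1 (f_rhs f a0))]) ->
  strans a b u v p (prune a s) s' -> strans a b u v p (prune a t) t' ->
  feq (ul a) (ul b) (fW a u) (fW a v) p s' t'.
Proof.
move=> hf hi hk he; have [l1 [a0 [l2 [ea s1 s0 [w0 sm]]]]] := frame a hi hk.
have [k hk'|hc -> ->] := he a0 s0; first by rewrite ea -s1 nw_ctx // s0.
have := allP hf a0 w0; rewrite hc /= -s0 => /and3P[iS iT /and3P[c1 c2 _]].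
rewrite -s1; apply: (local_rel ea sm iS iT).
by case: (odd _); [exact: c1|exact: c2].
Qed.

Lemma range_rel a b u v p S T i s' t' : ~~ (0 < i < n)%N ->
  spans i S -> spans i T ->
  strans a b u v p (prune a (raw_lin S)) s' -> strans a b u v p (prune a (raw_lin T)) t' ->
  feq (ul a) (ul b) (fW a u) (fW a v) p s' t'.
Proof.
move=> hi hS hT hs ht; have [_ _ qS] := tr_evl hs; have [_ _ qT] := tr_evl ht.
rewrite -(lam_size a) in hi.
rewrite (evl_range _ hi hS) in qS; rewrite (evl_range _ hi hT) in qT.
exact: eqv_trans qS (eqv_sym qT).
Qed.

End Relations.

End Terms.
Import Terms.

Module Tables.

(** * The relations of the 2-Schur algebra at explicit weights *)

Definition mF (i : nat) : smono := MI [:: Fl i].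
Definition mE (i : nat) : smono := MI [:: El i].
Definition mx_ (i : nat) : smono := MG (SDot i).
Definition mtau (i j : nat) : smono := MG (STau i j).

Definition msigma (i j : nat) : smono :=
  MV (MV (MH (MI [:: El j; Fl i]) (MG (SEps j))) (MH (MH (mE j) (mtau j i)) (mE j)))
     (MH (MG (SEta j)) (MI [:: Fl i; El j])).

Definition mdots (i m : nat) : smono := iter m (fun t => MV (mx_ i) t) (mF i).
Definition meta (i m : nat) : smono := MV (MH (mE i) (mdots i m)) (MG (SEta i)).
Definition meps (i m : nat) : smono := MV (MG (SEps i)) (MH (mdots i m) (mE i)).

Definition lsum (k : nat) (t : nat -> slin) : slin :=
  foldr (fun m => LA (t m)) LZ (iota 0 k).

Definition left_braid (i j k : nat) : smono :=
  MV (MV (MH (mtau j k) (mF i)) (MH (mF j) (mtau i k))) (MH (mtau i j) (mF k)).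
Definition right_braid (i j k : nat) : smono :=
  MV (MV (MH (mF k) (mtau i j)) (MH (mtau i k) (mF j))) (MH (mF i) (mtau j k)).

Definition cXYZ : mscal := MSc false true true 1 0.
Definition cYZ2 : mscal := MSc false false true 2 0.
Definition mXY : mscal := MSc true true true 0 0.

Definition r_dot2 i : slin * slin := (LM (MV (mx_ i) (mx_ i)), LZ).
Definition r_tau2 i : slin * slin := (LM (MV (mtau i i) (mtau i i)), LZ).
Definition r_tau2s i j : slin * slin :=
  (LM (MV (mtau j i) (mtau i j)),
   LA (LS (sneg cXYZ) (LM (MH (mx_ i) (mF j)))) (LS cXYZ (LM (MH (mF i) (mx_ j))))).
Definition r_tau2p i j : slin * slin :=
  (LM (MV (mtau j i) (mtau i j)),
   LA (LS cYZ2 (LM (MH (mx_ i) (mF j)))) (LS (sneg cYZ2) (LM (MH (mF i) (mx_ j))))).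
Definition r_dtl i j : slin * slin :=
  (LM (MV (MH (mx_ j) (mF i)) (mtau i j)),
   LS (smu (dg 1 1) (tau_deg i j)) (LM (MV (mtau i j) (MH (mF i) (mx_ j))))).
Definition r_dtr i j : slin * slin :=
  (LM (MV (mtau i j) (MH (mx_ i) (mF j))),
   LS (smu (tau_deg i j) (dg 1 1)) (LM (MV (MH (mF j) (mx_ i)) (mtau i j)))).
Definition r_nill i : slin * slin :=
  (LA (LM (MV (MH (mx_ i) (mF i)) (mtau i i))) (LS mXY (LM (MV (mtau i i) (MH (mF i) (mx_ i))))),
   LM (MI [:: Fl i; Fl i])).
Definition r_nilr i : slin * slin :=
  (LA (LM (MV (mtau i i) (MH (mx_ i) (mF i)))) (LS mXY (LM (MV (MH (mF i) (mx_ i)) (mtau i i)))),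
   LM (MI [:: Fl i; Fl i])).
Definition r_braid i j k : slin * slin :=
  (LM (left_braid i j k),
   LS (smul (smul (smu (tau_deg j k) (tau_deg i j)) (smu (tau_deg i k) (tau_deg i j)))
            (smu (tau_deg j k) (tau_deg i k)))
      (LM (right_braid i j k))).
Definition r_serres i j : slin * slin :=
  (LA (LS (MSc true false true 0 2) (LM (left_braid i j i)))
      (LS (MSc false false false 0 1) (LM (right_braid i j i))),
   LM (MI [:: Fl i; Fl j; Fl i])).
Definition r_serrep i j : slin * slin :=
  (LA (LS (MSc false true true 0 1) (LM (left_braid i j i)))
      (LS (MSc true true false 0 2) (LM (right_braid i j i))),
   LM (MI [:: Fl i; Fl j; Fl i])).
Definition r_adjF i : slin * slin :=
  (LM (MV (MH (MG (SEps i)) (mF i)) (MH (mF i) (MG (SEta i)))), LM (mF i)).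
(** The scalar X^(1+y) Y^x, reduced by X^2 = Y^2 = 1. *)
Definition r_adjE x y i : slin * slin :=
  (LS (MSc false (~~ odd y) (odd x) 0 0)
     (LM (MV (MH (mE i) (MG (SEps i))) (MH (MG (SEta i)) (mE i)))), LM (mE i)).
Definition r_sinvl i j : slin * slin :=
  (LM (MV (MG (SInv i j)) (msigma i j)), LM (MI [:: Fl i; El j])).
Definition r_sinvr i j : slin * slin :=
  (LM (MV (msigma i j) (MG (SInv i j))), LM (MI [:: El j; Fl i])).
Definition r_posr k i : slin * slin :=
  (LA (LM (MV (msigma i i) (MG (SInv i i))))
      (lsum k (fun m => LM (MV (meta i m) (MG (PInv i m))))), LM (MI [:: El i; Fl i])).
Definition r_posl i : slin * slin :=
  (LM (MV (MG (SInv i i)) (msigma i i)), LM (MI [:: Fl i; El i])).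
Definition r_posld m i : slin * slin := (LM (MV (MG (SInv i i)) (meta i m)), LZ).
Definition r_posdl m i : slin * slin := (LM (MV (MG (PInv i m)) (msigma i i)), LZ).
Definition r_posd m m' i : slin * slin :=
  (LM (MV (MG (PInv i m)) (meta i m')), if m == m' then LM (MI [::]) else LZ).
Definition r_negl k i : slin * slin :=
  (LA (LM (MV (MG (SInv i i)) (msigma i i)))
      (lsum k (fun m => LM (MV (MG (NInv i m)) (meps i m)))), LM (MI [:: Fl i; El i])).
Definition r_negr i : slin * slin :=
  (LM (MV (msigma i i) (MG (SInv i i))), LM (MI [:: El i; Fl i])).
Definition r_negdr m i : slin * slin := (LM (MV (meps i m) (MG (SInv i i))), LZ).
Definition r_negrd m i : slin * slin := (LM (MV (msigma i i) (MG (NInv i m))), LZ).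
Definition r_negd m m' i : slin * slin :=
  (LM (MV (meps i m) (MG (NInv i m'))), if m == m' then LM (MI [::]) else LZ).

Definition constant_family (k : nat) (r : slin * slin) (l : seq (seq nat * script)) : family :=
  Family k predT (fun _ => r.1) (fun _ => r.2) l.

Definition pos (a : seq nat) : nat := (nw a 1 - nw a 2)%N.
Definition neg (a : seq nat) : nat := (nw a 2 - nw a 1)%N.

Definition f_adjF_1 : family := constant_family 2 (r_adjF 1) [::
    ([:: 1; 1]%N, [:: (0, MRule (RZig1 1) false 0 0)]%N);
    ([:: 2; 0]%N, [:: (0, MRule (RZig3 1) false 0 0)]%N);
    ([:: 2; 1]%N, [:: (0, MSwap 1 true); (0, MRule (RZig3 1) false 0 1); (0, MRule (RZig1 2) false 0 0)]%N)].

(** With a repeated index the source and target words are never both paths: lambda_1 would drop by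
    3, or, in the four mixed families below, the two orders impose contradictory bounds on lambda_2.
    Both sides vanish, and no script is given. *)
Definition f_braid_1_1_1 : family := constant_family 2 (r_braid 1 1 1) [::].

Definition f_braid_1_1_2 : family := constant_family 3 (r_braid 1 1 2) [::].

Definition f_braid_1_2_2 : family := constant_family 3 (r_braid 1 2 2) [::].

Definition f_braid_1_2_3 : family := constant_family 4 (r_braid 1 2 3) [::
    ([:: 1; 1; 1; 0]%N, [:: (1, MSwap 0 false)]%N);
    ([:: 1; 1; 1; 1]%N, [:: (1, MSwap 0 false); (0, MRule (RSlide (Wp 3) (FZip 1)) true 0 0); (0, MRule (RInv (Wp 3) (Wp 1)) false 2 1); (0, MRule (RInv (Wp 3) (Wm 1)) false 1 0)]%N);
    ([:: 2; 1; 1; 0]%N, [:: (1, MRule (RInv (Wm 1) (Wp 3)) true 2 1); (1, MRule (RSlide (Wm 1) (FZip 3)) false 0 0); (1, MRule (RInv (Wp 3) (Wm 1)) false 1 1); (1, MSwap 0 false)]%N);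
    ([:: 2; 1; 1; 1]%N, [:: (1, MSwap 0 true); (1, MRule (RInv (Wm 1) (Wp 3)) true 3 2); (1, MRule (RSlide (Wm 1) (FZip 3)) false 1 1); (1, MRule (RInv (Wp 3) (Wm 1)) false 2 2); (1, MSwap 1 false); (0, MSwap 0 false); (0, MRule (RSlide (Wp 4) (FZip 2)) true 1 0); (0, MRule (RInv (Wp 4) (Wp 2)) false 3 1); (0, MRule (RInv (Wp 4) (Wm 2)) false 2 0)]%N)].

Definition f_braid_1_3_2 : family := constant_family 4 (r_braid 1 3 2) [::
    ([:: 1; 1; 1; 0]%N, [:: (1, MSwap 0 false)]%N);
    ([:: 1; 1; 1; 1]%N, [:: (1, MRule (RSlide (Wp 3) (FZip 1)) true 1 0); (1, MRule (RInv (Wp 3) (Wp 1)) false 3 1); (0, MSwap 0 true)]%N);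
    ([:: 2; 1; 1; 0]%N, [:: (0, MSwap 2 true); (0, MRule (RInv (Wm 3) (Wm 1)) true 1 0); (0, MRule (RSlide (Wm 1) (FUnzip 3)) true 2 0); (0, MRule (RInv (Wm 1) (Wm 3)) false 0 0)]%N);
    ([:: 2; 1; 1; 1]%N, [:: (1, MSwap 1 false); (1, MSwap 0 true); (1, MRule (RSlide (Wp 4) (FZip 2)) true 2 0); (1, MRule (RInv (Wp 4) (Wp 2)) false 4 1); (0, MSwap 3 true); (0, MRule (RInv (Wm 3) (Wm 1)) true 2 1); (0, MRule (RSlide (Wm 1) (FUnzip 3)) true 3 1); (0, MRule (RInv (Wm 1) (Wm 3)) false 1 1)]%N)].

Definition f_braid_2_1_1 : family := constant_family 3 (r_braid 2 1 1) [::].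

Definition f_braid_2_1_3 : family := constant_family 4 (r_braid 2 1 3) [::
    ([:: 1; 1; 1; 0]%N, [:: (1, MSwap 0 false)]%N);
    ([:: 1; 1; 1; 1]%N, [:: (1, MSwap 2 false); (1, MRule (RSlide (Wp 3) (FUnzip 1)) false 2 0); (1, MRule (RInv (Wm 1) (Wp 3)) false 1 0); (1, MRule (RInv (Wp 1) (Wp 3)) false 0 1)]%N);
    ([:: 2; 1; 1; 0]%N, [:: (1, MSwap 0 false); (1, MRule (RSlide (Wm 1) (FZip 3)) true 1 0); (1, MRule (RInv (Wm 1) (Wp 3)) false 3 1)]%N);
    ([:: 2; 1; 1; 1]%N, [:: (1, MSwap 3 false); (1, MRule (RSlide (Wp 4) (FUnzip 2)) false 3 0); (1, MRule (RInv (Wm 2) (Wp 4)) false 2 0); (1, MRule (RInv (Wp 2) (Wp 4)) false 1 1); (0, MSwap 1 true); (0, MSwap 0 false); (0, MRule (RInv (Wm 1) (Wp 3)) true 4 2); (0, MRule (RSlide (Wm 1) (FZip 3)) false 2 1)]%N)].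

Definition f_braid_2_2_1 : family := constant_family 3 (r_braid 2 2 1) [::].

Definition f_braid_2_3_1 : family := constant_family 4 (r_braid 2 3 1) [::
    ([:: 1; 1; 1; 0]%N, [:: (1, MSwap 0 true)]%N);
    ([:: 1; 1; 1; 1]%N, [:: (1, MRule (RInv (Wm 1) (Wp 3)) true 0 0); (1, MRule (RSlide (Wp 3) (FUnzip 1)) true 1 0); (0, MSwap 1 false)]%N);
    ([:: 2; 1; 1; 0]%N, [:: (0, MSwap 0 false); (0, MRule (RSlide (Wm 1) (FZip 3)) true 1 0); (0, MRule (RInv (Wm 1) (Wp 3)) false 3 1); (0, MRule (RInv (Wm 1) (Wm 3)) false 2 0)]%N);
    ([:: 2; 1; 1; 1]%N, [:: (1, MSwap 1 true); (1, MSwap 2 false); (1, MRule (RInv (Wm 2) (Wp 4)) true 0 0); (1, MRule (RSlide (Wp 4) (FUnzip 2)) true 1 0); (0, MSwap 1 false); (0, MRule (RSlide (Wm 1) (FZip 3)) true 2 1); (0, MRule (RInv (Wm 1) (Wp 3)) false 4 2); (0, MRule (RInv (Wm 1) (Wm 3)) false 3 1)]%N)].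

Definition f_braid_3_1_2 : family := constant_family 4 (r_braid 3 1 2) [::
    ([:: 1; 1; 1; 0]%N, [:: (1, MSwap 0 true)]%N);
    ([:: 1; 1; 1; 1]%N, [:: (1, MSwap 0 true); (1, MRule (RInv (Wp 3) (Wp 1)) true 3 1); (1, MRule (RSlide (Wp 3) (FZip 1)) false 1 0); (1, MRule (RInv (Wp 1) (Wp 3)) false 2 1)]%N);
    ([:: 2; 1; 1; 0]%N, [:: (1, MSwap 1 true); (1, MRule (RInv (Wm 3) (Wm 1)) true 0 0); (1, MRule (RSlide (Wm 1) (FUnzip 3)) true 1 0)]%N);
    ([:: 2; 1; 1; 1]%N, [:: (1, MSwap 1 true); (1, MRule (RInv (Wp 4) (Wp 2)) true 4 1); (1, MRule (RSlide (Wp 4) (FZip 2)) false 2 0); (1, MRule (RInv (Wp 2) (Wp 4)) false 3 1); (0, MSwap 1 false); (0, MSwap 2 true); (0, MRule (RSlide (Wm 1) (FUnzip 3)) false 1 1); (0, MRule (RInv (Wm 3) (Wm 1)) false 0 1)]%N)].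

Definition f_braid_3_2_1 : family := constant_family 4 (r_braid 3 2 1) [::
    ([:: 1; 1; 1; 0]%N, [:: (1, MSwap 0 true)]%N);
    ([:: 1; 1; 1; 1]%N, [:: (1, MSwap 0 true); (0, MRule (RInv (Wm 1) (Wp 3)) true 2 0); (0, MRule (RSlide (Wp 3) (FUnzip 1)) true 3 0); (0, MRule (RInv (Wp 3) (Wm 1)) false 1 0)]%N);
    ([:: 2; 1; 1; 0]%N, [:: (1, MRule (RSlide (Wm 1) (FUnzip 3)) false 3 0); (1, MRule (RInv (Wm 3) (Wm 1)) false 2 0); (1, MRule (RInv (Wp 3) (Wm 1)) false 1 1); (1, MSwap 0 true)]%N);
    ([:: 2; 1; 1; 1]%N, [:: (1, MSwap 3 false); (1, MRule (RSlide (Wm 1) (FUnzip 3)) false 3 1); (1, MRule (RInv (Wm 3) (Wm 1)) false 2 1); (1, MRule (RInv (Wp 3) (Wm 1)) false 1 2); (1, MSwap 0 true); (0, MSwap 3 true); (0, MRule (RInv (Wm 2) (Wp 4)) true 2 0); (0, MRule (RSlide (Wp 4) (FUnzip 2)) true 3 0); (0, MRule (RInv (Wp 4) (Wm 2)) false 1 0)]%N)].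

Definition f_dot2_1 : family := constant_family 2 (r_dot2 1) [::
    ([:: 1; 0]%N, [:: (0, MRule (RDot2 1) false 0 0)]%N);
    ([:: 1; 1]%N, [:: (0, MRule (RDot2 1) false 0 1)]%N);
    ([:: 2; 0]%N, [:: (0, MRule (RDot2 2) false 0 0)]%N);
    ([:: 2; 1]%N, [:: (0, MRule (RDot2 2) false 0 1)]%N)].

Definition f_dtl_1_2 : family := constant_family 3 (r_dtl 1 2) [::
    ([:: 1; 1; 0]%N, [:: (1, MSwap 0 false)]%N);
    ([:: 1; 1; 1]%N, [:: (1, MSwap 0 false)]%N);
    ([:: 2; 1; 0]%N, [:: (1, MRule (RDotSlide 3 (Wm 1)) true 0 0); (0, MSwap 0 true)]%N);
    ([:: 2; 1; 1]%N, [:: (1, MSwap 0 true); (1, MRule (RDotSlide 3 (Wm 1)) true 1 1); (0, MSwap 1 true)]%N)].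

Definition f_dtl_2_1 : family := constant_family 3 (r_dtl 2 1) [::
    ([:: 1; 1; 0]%N, [:: (1, MSwap 0 true)]%N);
    ([:: 1; 1; 1]%N, [:: (1, MSwap 0 true); (0, MRule (RDotSlide 1 (Wp 2)) false 1 0)]%N);
    ([:: 2; 1; 0]%N, [:: (1, MSwap 0 true)]%N);
    ([:: 2; 1; 1]%N, [:: (1, MSwap 0 true); (0, MSwap 1 true); (0, MRule (RDotSlide 2 (Wp 3)) false 1 0)]%N)].

Definition f_dtr_1_2 : family := constant_family 3 (r_dtr 1 2) [::
    ([:: 1; 1; 0]%N, [:: (1, MSwap 0 false)]%N);
    ([:: 1; 1; 1]%N, [:: (1, MSwap 0 false); (0, MRule (RDotSlide 1 (Wp 2)) false 0 0)]%N);
    ([:: 2; 1; 0]%N, [:: (1, MSwap 0 false)]%N);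
    ([:: 2; 1; 1]%N, [:: (1, MSwap 1 false); (0, MSwap 0 false); (0, MRule (RDotSlide 2 (Wp 3)) false 1 0)]%N)].

Definition f_dtr_2_1 : family := constant_family 3 (r_dtr 2 1) [::
    ([:: 1; 1; 0]%N, [:: (1, MSwap 0 true)]%N);
    ([:: 1; 1; 1]%N, [:: (1, MSwap 0 true)]%N);
    ([:: 2; 1; 0]%N, [:: (1, MRule (RDotSlide 3 (Wm 1)) true 1 0); (0, MSwap 0 false)]%N);
    ([:: 2; 1; 1]%N, [:: (1, MSwap 1 false); (1, MRule (RDotSlide 3 (Wm 1)) true 1 1); (0, MSwap 0 false)]%N)].

Definition f_nill_1 : family := constant_family 2 (r_nill 1) [::
    ([:: 2; 0]%N, [:: (2, MRule (RNeck 1) false 0 0); (3, MRule (RDotM 1) false 0 1)]%N)].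

Definition f_nilr_1 : family := constant_family 2 (r_nilr 1) [::
    ([:: 2; 0]%N, [:: (2, MRule (RNeck 1) false 0 0); (2, MRule (RDotM 1) false 2 1)]%N)].

(** At a weight where the identity survives, exactly one of the two composites does: it straightens
    by zigzags (lambda_2 = 1) or is the foam of the mirrored squeeze relation (lambda_2 = 2). The
    other Serre family is similar, with [RSq]. *)
Definition f_serrep_2_1 : family := constant_family 3 (r_serrep 2 1) [::
    ([:: 1; 1; 0]%N, [:: (0, MRule (RZig1 1) false 0 0); (0, MRule (RZig4 1) false 0 0)]%N);
    ([:: 1; 2; 0]%N, [:: (0, MRule (RSq2 1) true 0 0)]%N);
    ([:: 2; 1; 0]%N, [:: (0, MRule (RZig1 2) false 0 0); (0, MRule (RZig4 2) false 0 0)]%N);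
    ([:: 2; 2; 0]%N, [:: (0, MRule (RInv (Wm 1) (Wm 3)) true 5 1); (0, MRule (RSlide (Wm 1) (FCup 3)) false 3 0); (0, MSwap 4 true); (0, MRule (RSlide (Wm 1) (FCap 3)) false 2 0); (0, MRule (RInv (Wp 3) (Wm 1)) false 1 0); (0, MSwap 0 false); (0, MRule (RSq2 2) true 1 0); (0, MRule (RInv (Wm 1) (Wm 3)) false 0 3)]%N)].

Definition f_serres_1_2 : family := constant_family 3 (r_serres 1 2) [::
    ([:: 2; 0; 0]%N, [:: (0, MRule (RZig2 1) false 0 0); (0, MRule (RZig3 1) false 0 0)]%N);
    ([:: 2; 0; 1]%N, [:: (0, MRule (RZig2 1) false 0 1); (0, MRule (RZig3 1) false 0 1)]%N);
    ([:: 2; 1; 0]%N, [:: (0, MRule (RSq 1) true 0 0)]%N);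
    ([:: 2; 1; 1]%N, [:: (0, MRule (RSlide (Wp 3) (FCup 1)) true 3 0); (0, MRule (RInv (Wp 3) (Wm 1)) false 5 1); (0, MSwap 4 false); (0, MRule (RInv (Wp 1) (Wp 3)) true 1 0); (0, MRule (RSlide (Wp 3) (FCap 1)) true 2 0); (0, MSwap 0 true); (0, MRule (RSq 1) true 1 1); (0, MRule (RInv (Wp 1) (Wp 3)) false 0 0)]%N)].

Definition f_sinvl_1_2 : family := constant_family 3 (r_sinvl 1 2) [::
    ([:: 1; 0; 1]%N, [:: (0, MRule (RZig4 1) false 0 0)]%N);
    ([:: 1; 0; 2]%N, [:: (0, MSwap 1 false); (0, MRule (RZig4 1) false 0 0); (0, MRule (RZig2 2) false 0 1)]%N);
    ([:: 2; 0; 1]%N, [:: (0, MRule (RZig4 2) false 0 0)]%N);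
    ([:: 2; 0; 2]%N, [:: (0, MSwap 1 false); (0, MSwap 4 true); (0, MRule (RSlide (Wm 1) (FZip 3)) true 2 1); (0, MRule (RInv (Wm 1) (Wp 3)) false 4 2); (0, MRule (RInv (Wm 1) (Wm 3)) false 3 1); (0, MRule (RZig4 2) false 0 0); (0, MRule (RZig2 3) false 0 2)]%N)].

Definition f_sinvl_2_1 : family := constant_family 3 (r_sinvl 2 1) [::
    ([:: 0; 2; 0]%N, [:: (0, MRule (RZig2 1) false 0 0)]%N);
    ([:: 0; 2; 1]%N, [:: (0, MRule (RZig2 1) false 0 1)]%N);
    ([:: 1; 2; 0]%N, [:: (0, MSwap 1 false); (0, MRule (RZig4 1) false 0 0); (0, MRule (RZig2 2) false 0 1)]%N);
    ([:: 1; 2; 1]%N, [:: (0, MSwap 2 false); (0, MRule (RSlide (Wp 3) (FCup 1)) true 0 0); (0, MRule (RInv (Wp 3) (Wm 1)) false 2 1); (0, MSwap 1 false); (0, MRule (RZig4 1) false 0 1); (0, MRule (RZig2 2) false 1 2); (0, MRule (RInv (Wp 3) (Wp 1)) false 0 0)]%N)].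

Definition f_sinvr_1_2 : family := constant_family 3 (r_sinvr 1 2) [::
    ([:: 1; 0; 1]%N, [:: (0, MRule (RZig4 1) false 0 0)]%N);
    ([:: 1; 0; 2]%N, [:: (0, MSwap 1 false); (0, MRule (RZig4 1) false 0 0); (0, MRule (RZig2 2) false 0 1)]%N);
    ([:: 2; 0; 1]%N, [:: (0, MRule (RZig4 2) false 0 0)]%N);
    ([:: 2; 0; 2]%N, [:: (0, MSwap 2 false); (0, MRule (RSlide (Wm 1) (FCap 3)) false 5 2); (0, MRule (RInv (Wp 3) (Wm 1)) false 4 2); (0, MSwap 3 false); (0, MRule (RZig4 2) false 1 0); (0, MRule (RInv (Wm 3) (Wm 1)) false 0 1); (0, MRule (RZig2 3) false 0 1)]%N)].

Definition f_sinvr_2_1 : family := constant_family 3 (r_sinvr 2 1) [::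
    ([:: 0; 2; 0]%N, [:: (0, MRule (RZig2 1) false 0 0)]%N);
    ([:: 0; 2; 1]%N, [:: (0, MRule (RZig2 1) false 0 1)]%N);
    ([:: 1; 2; 0]%N, [:: (0, MSwap 1 false); (0, MRule (RZig4 1) false 0 0); (0, MRule (RZig2 2) false 0 1)]%N);
    ([:: 1; 2; 1]%N, [:: (0, MSwap 0 true); (0, MSwap 3 false); (0, MRule (RSlide (Wp 3) (FUnzip 1)) false 3 1); (0, MRule (RInv (Wm 1) (Wp 3)) false 2 1); (0, MRule (RInv (Wp 1) (Wp 3)) false 1 2); (0, MRule (RZig4 1) false 0 0); (0, MRule (RZig2 2) false 0 2)]%N)].

Definition f_tau2eq_1 : family := constant_family 2 (r_tau2 1) [::
    ([:: 2; 0]%N, [:: (0, MRule (RBub0 1) false 1 0)]%N)].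

Definition f_tau2p_2_1 : family := constant_family 3 (r_tau2p 2 1) [::
    ([:: 1; 1; 0]%N, [:: (0, MRule (RZU 1) false 0 0)]%N);
    ([:: 1; 1; 1]%N, [:: (0, MRule (RZU 1) false 0 1)]%N);
    ([:: 2; 1; 0]%N, [:: (0, MRule (RZU 2) false 0 0)]%N);
    ([:: 2; 1; 1]%N, [:: (0, MRule (RInv (Wp 3) (Wm 1)) false 1 0); (0, MRule (RZU 2) false 0 1)]%N)].

Definition f_tau2s_1_2 : family := constant_family 3 (r_tau2s 1 2) [::
    ([:: 1; 1; 0]%N, [:: (0, MRule (RUZ 1) false 0 0)]%N);
    ([:: 1; 1; 1]%N, [:: (0, MRule (RUZ 1) false 0 1); (2, MRule (RDotSlide 1 (Wp 2)) false 0 0)]%N);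
    ([:: 1; 2; 0]%N, [:: (1, MRule (RDotM 2) true 0 1); (0, MRule (RDotP 1) false 0 0)]%N);
    ([:: 1; 2; 1]%N, [:: (1, MRule (RDotM 2) true 0 2); (1, MRule (RDotSlide 2 (Wp 3)) true 0 1); (0, MRule (RDotP 1) false 0 0)]%N);
    ([:: 2; 1; 0]%N, [:: (0, MRule (RUZ 2) false 0 0); (3, MRule (RDotSlide 3 (Wm 1)) true 0 0)]%N);
    ([:: 2; 1; 1]%N, [:: (0, MRule (RUZ 2) false 1 1); (0, MRule (RDotSlide 2 (Wp 3)) true 1 0); (0, MSwap 0 true); (0, MRule (RInv (Wm 1) (Wp 3)) false 1 0); (1, MRule (RDotSlide 3 (Wm 1)) false 1 1); (1, MSwap 0 false); (1, MRule (RInv (Wm 1) (Wp 3)) false 1 0)]%N);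
    ([:: 2; 2; 0]%N, [:: (1, MRule (RDotM 3) true 0 2); (1, MRule (RDotSlide 3 (Wm 1)) true 0 1); (0, MRule (RDotP 2) false 0 0)]%N);
    ([:: 2; 2; 1]%N, [:: (1, MRule (RDotM 3) true 0 3); (1, MRule (RDotSlide 3 (Wp 4)) true 0 2); (1, MRule (RDotSlide 3 (Wm 1)) true 0 1); (0, MRule (RDotP 2) false 0 0)]%N)].

Definition f_adjE_1 : family := Family 2 predT
  (fun a => (r_adjE (nw a 1) (nw a 2) 1).1) (fun a => (r_adjE (nw a 1) (nw a 2) 1).2) [::
    ([:: 0; 2]%N, [:: (0, MRule (RZig2 1) false 0 0)]%N);
    ([:: 1; 1]%N, [:: (0, MRule (RZig4 1) false 0 0)]%N);
    ([:: 1; 2]%N, [:: (0, MSwap 1 false); (0, MRule (RZig4 1) false 0 0); (0, MRule (RZig2 2) false 0 1)]%N)].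

(** The decomposition of the identity of E_i F_i: neck-cutting at (2,0), the squeeze relation at
    (2,1), and at (1,1) sigma alone, an invertible multiple of the identity. *)
Definition f_posr_1 : family := Family 2 (fun a => nw a 2 <= nw a 1)%N
  (fun a => (r_posr (pos a) 1).1) (fun a => (r_posr (pos a) 1).2) [::
    ([:: 1; 1]%N, [:: (0, MRule (RZig2 1) false 0 0); (0, MRule (RZig4 1) false 0 1)]%N);
    ([:: 2; 0]%N, [:: (2, MRule (RNeck 1) false 0 0); (2, MRule (RDotM 1) false 2 1)]%N);
    ([:: 2; 1]%N, [:: (0, MRule (RSq 1) true 0 0)]%N)].

Definition f_posl_1 : family := Family 2 (fun a => nw a 2 <= nw a 1)%N
  (fun a => (r_posl 1).1) (fun a => (r_posl 1).2) [::
    ([:: 1; 1]%N, [:: (0, MRule (RZig2 1) false 0 0); (0, MRule (RZig4 1) false 0 1)]%N)].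

Definition f_negl_1 : family := Family 2 (fun a => nw a 1 <= nw a 2)%N
  (fun a => (r_negl (neg a) 1).1) (fun a => (r_negl (neg a) 1).2) [::
    ([:: 0; 2]%N, [:: (2, MRule (RNeck 1) false 0 0)]%N);
    ([:: 1; 1]%N, [:: (0, MRule (RZig2 1) false 0 0); (0, MRule (RZig4 1) false 0 1)]%N);
    ([:: 1; 2]%N, [:: (0, MRule (RSq2 1) true 0 0)]%N)].

Definition f_negr_1 : family := Family 2 (fun a => nw a 1 <= nw a 2)%N
  (fun a => (r_negr 1).1) (fun a => (r_negr 1).2) [::
    ([:: 1; 1]%N, [:: (0, MRule (RZig2 1) false 0 0); (0, MRule (RZig4 1) false 0 1)]%N)].

(** If lambda_i > lambda_{i+1}, then lambda_i = 2 or lambda_{i+1} = 0, so F_i E_i passes through a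
    missing weight and the expression is pruned. The other families with empty scripts below are
    alike. *)
Definition f_posld_1_0 : family := Family 2 (fun a => 0 < pos a)%N
  (fun a => (r_posld 0 1).1) (fun a => (r_posld 0 1).2) [::].

Definition f_posdl_1_0 : family := Family 2 (fun a => 0 < pos a)%N
  (fun a => (r_posdl 0 1).1) (fun a => (r_posdl 0 1).2) [::].

Definition f_negdr_1_0 : family := Family 2 (fun a => 0 < neg a)%N
  (fun a => (r_negdr 0 1).1) (fun a => (r_negdr 0 1).2) [::].

Definition f_negrd_1_0 : family := Family 2 (fun a => 0 < neg a)%N
  (fun a => (r_negrd 0 1).1) (fun a => (r_negrd 0 1).2) [::].

Definition f_posd_1_0_0 : family := Family 2 (fun a => (0 < pos a) && (0 < pos a))%N
  (fun a => (r_posd 0 0 1).1) (fun a => (r_posd 0 0 1).2) [::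
    ([:: 2; 0]%N, [:: (0, MRule (RBub1 1) false 0 0)]%N);
    ([:: 2; 1]%N, [:: (0, MRule (RUZ 2) false 1 1); (1, MRule (RDotSlide 3 (Wm 1)) false 1 1); (1, MSwap 0 false); (1, MRule (RBub0 1) false 1 0); (0, MRule (RDotM 1) true 1 1); (0, MRule (RBub1 1) false 0 0)]%N)].

Definition f_negd_1_0_0 : family := Family 2 (fun a => (0 < neg a) && (0 < neg a))%N
  (fun a => (r_negd 0 0 1).1) (fun a => (r_negd 0 0 1).2) [::
    ([:: 0; 2]%N, [:: (0, MRule (RBub1 1) false 0 0)]%N);
    ([:: 1; 2]%N, [:: (0, MRule (RUZ 1) false 1 1); (0, MRule (RDotSlide 1 (Wm 2)) false 1 1); (0, MSwap 0 false); (0, MRule (RBub0 2) false 1 0); (0, MRule (RBub1 2) false 0 0)]%N)].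

Definition f_posd_1_0_1 : family := Family 2 (fun a => (0 < pos a) && (1 < pos a))%N
  (fun a => (r_posd 0 1 1).1) (fun a => (r_posd 0 1 1).2) [::
    ([:: 2; 0]%N, [:: (0, MRule (RDotM 1) false 2 1); (0, MRule (RDot2 2) false 1 1)]%N)].

Definition f_negd_1_0_1 : family := Family 2 (fun a => (0 < neg a) && (1 < neg a))%N
  (fun a => (r_negd 0 1 1).1) (fun a => (r_negd 0 1 1).2) [::
    ([:: 0; 2]%N, [:: (0, MRule (RBub0 1) false 0 0)]%N)].

Definition f_posld_1_1 : family := Family 2 (fun a => 1 < pos a)%N
  (fun a => (r_posld 1 1).1) (fun a => (r_posld 1 1).2) [::].

Definition f_posdl_1_1 : family := Family 2 (fun a => 1 < pos a)%N
  (fun a => (r_posdl 1 1).1) (fun a => (r_posdl 1 1).2) [::].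

Definition f_negdr_1_1 : family := Family 2 (fun a => 1 < neg a)%N
  (fun a => (r_negdr 1 1).1) (fun a => (r_negdr 1 1).2) [::].

Definition f_negrd_1_1 : family := Family 2 (fun a => 1 < neg a)%N
  (fun a => (r_negrd 1 1).1) (fun a => (r_negrd 1 1).2) [::].

Definition f_posd_1_1_0 : family := Family 2 (fun a => (1 < pos a) && (0 < pos a))%N
  (fun a => (r_posd 1 0 1).1) (fun a => (r_posd 1 0 1).2) [::
    ([:: 2; 0]%N, [:: (0, MRule (RBub0 1) false 0 0)]%N)].

Definition f_negd_1_1_0 : family := Family 2 (fun a => (1 < neg a) && (0 < neg a))%N
  (fun a => (r_negd 1 0 1).1) (fun a => (r_negd 1 0 1).2) [::
    ([:: 0; 2]%N, [:: (0, MRule (RDot2 1) false 1 1)]%N)].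

Definition f_posd_1_1_1 : family := Family 2 (fun a => (1 < pos a) && (1 < pos a))%N
  (fun a => (r_posd 1 1 1).1) (fun a => (r_posd 1 1 1).2) [::
    ([:: 2; 0]%N, [:: (0, MRule (RDotM 1) true 1 1); (0, MRule (RBub1 1) false 0 0)]%N)].

Definition f_negd_1_1_1 : family := Family 2 (fun a => (1 < neg a) && (1 < neg a))%N
  (fun a => (r_negd 1 1 1).1) (fun a => (r_negd 1 1 1).2) [::
    ([:: 0; 2]%N, [:: (0, MRule (RBub1 1) false 0 0)]%N)].

End Tables.
Import Tables.

(** * Relations with neighbouring indices *)

Module NearRelations.

Definition shrel (m : nat) (r : slin * slin) : slin * slin := (shlin m r.1, shlin m r.2).

Lemma tau_deg_sh m i j : tau_deg (m + i) (m + j) = tau_deg i j.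
Proof. by rewrite /tau_deg /alpha; congr dg; lia. Qed.

Section Near.
Variables (R : comPzRingType) (K : ground R) (n d : nat).
Local Notation mu := (bichar K).
Implicit Types a b : lam n d.
Local Notation ul := (@underline n d).
Local Notation spr := (schur_pres K n d).
Local Notation strans := (@tr R spr (fpr K d) (@fW n d) (fG K (n := n) (d := d))).
Local Notation feq := (@eqv R mu (fpr K d)).
Local Notation sraw := (raw R (schur_sig n d)).
Local Notation raw_lin := (@raw_lin R K n d).

(* the functor respects the relation s = t at the weight [a] *)
Definition respected a (s t : sraw) : Prop := forall b u v p s' t',
  strans a b u v p (prune a s) s' -> strans a b u v p (prune a t) t' ->
  feq (ul a) (ul b) (fW a u) (fW a v) p s' t'.

(** Either the window fits in the weight and the certificates apply, or some index is out of range
    and both sides vanish. *)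
Lemma near a k r0 l i r : f_check (constant_family k r0 l) ->
  ((0 < i)%N -> (i.-1 + k <= n)%N -> shrel i.-1 r0 = r) ->
  (~~ ((0 < i) && (i.-1 + k <= n))%N ->
     exists j, [&& ~~ (0 < j < n)%N, spans j r.1 & spans j r.2]) ->
  respected a (raw_lin r.1) (raw_lin r.2).
Proof.
move=> hf hin hout b u v p s' t'; case: (boolP (_ && _)) hout => [/andP[h1 h2] _|h /(_ isT)].
  apply: (family_rel hf h1) => // a0 s0 _.
  by rewrite -(hin h1 h2).
by case=> j /and3P[hj h1 h2]; apply: range_rel hj h1 h2.
Qed.

(** For relations whose shape or scalar depends on the weight: this dependence is only through
    lambda_i and lambda_{i+1}, which the window shows. *)
Lemma near_family a (f : family) i (s t : sraw) : f_check f ->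
  (0 < i < n)%N -> f_size f = 2%N ->
  (forall a0 : seq nat, nw a0 1 = wt a i -> nw a0 2 = wt a i.+1 ->
     [/\ f_cond f a0, s = raw_lin (shlin i.-1 (f_lhs f a0)) &
         t = raw_lin (shlin i.-1 (f_rhs f a0))]) ->
  respected a s t.
Proof.
move=> hf hi hk he b u v p s' t'; apply: (family_rel hf (i := i)); try lia.
move=> a0 s0 h; apply: he.
  by rewrite -h ?hk // /wt -[nth _ _ _]/(nw (sval a) i); congr nw; lia.
by rewrite -h ?hk // /wt -[nth _ _ _]/(nw (sval a) i.+1); congr nw; lia.
Qed.

Lemma prednK1 i : (0 < i)%N -> (i.-1 + 1)%N = i. Proof. by lia. Qed.
Lemma prednK2 i : (0 < i)%N -> (i.-1 + 2)%N = i.+1. Proof. by lia. Qed.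
Lemma prednK3 i : (0 < i)%N -> (i.-1 + 3)%N = i.+2. Proof. by lia. Qed.

Lemma near1 a r0 l i r : f_check (constant_family 2 r0 l) ->
  ((0 < i)%N -> shrel i.-1 r0 = r) -> spans i r.1 -> spans i r.2 ->
  respected a (raw_lin r.1) (raw_lin r.2).
Proof.
move=> hf hin h1 h2; apply: (near hf) => [h0 _|hi]; first exact: hin.
by exists i; rewrite h1 h2 andbT; move: hi; lia.
Qed.

Lemma near2 a r0 l i r : f_check (constant_family 3 r0 l) ->
  ((0 < i)%N -> shrel i.-1 r0 = r) -> spans i r.1 -> spans i r.2 ->
  spans i.+1 r.1 -> spans i.+1 r.2 -> respected a (raw_lin r.1) (raw_lin r.2).
Proof.
move=> hf hin h1 h2 h3 h4; apply: (near hf) => [h0 _|hi]; first exact: hin.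
case: (boolP (0 < i < n)%N) => hj; last by exists i; rewrite h1 h2 hj.
by exists i.+1; rewrite h3 h4 andbT; move: hi; lia.
Qed.

Lemma near3 a r0 l i r : f_check (constant_family 4 r0 l) ->
  ((0 < i)%N -> shrel i.-1 r0 = r) -> spans i r.1 -> spans i r.2 ->
  spans i.+1 r.1 -> spans i.+1 r.2 -> spans i.+2 r.1 -> spans i.+2 r.2 ->
  respected a (raw_lin r.1) (raw_lin r.2).
Proof.
move=> hf hin h1 h2 h3 h4 h5 h6; apply: (near hf) => [h0 _|hi]; first exact: hin.
case: (boolP (0 < i < n)%N) => hj; last by exists i; rewrite h1 h2 hj.
case: (boolP (0 < i.+1 < n)%N) => hj'; last by exists i.+1; rewrite h3 h4 hj'.
by exists i.+2; rewrite h5 h6 andbT; move: hi hj'; lia.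
Qed.

Lemma sv_XY : sval_ K mXY = - (gX K * gY K).
Proof. by rewrite /sval_ /= !expr0 !expr1; ring. Qed.
Lemma sv_XYZ : sval_ K cXYZ = gX K * gY K * gZ K.
Proof. by rewrite /sval_ /= !expr0 !expr1; ring. Qed.
Lemma sv_YZ2 : sval_ K cYZ2 = gY K * gZ K ^+ 2.
Proof. by rewrite /sval_ /= !expr0 !expr1; ring. Qed.
Lemma sv_s1 : sval_ K (MSc true false true 0 2) = - (gY K * gZi K ^+ 2).
Proof. by rewrite /sval_ /= !expr0 !expr1; ring. Qed.
Lemma sv_s2 : sval_ K (MSc false false false 0 1) = gZi K.
Proof. by rewrite /sval_ /= !expr0 !expr1; ring. Qed.
Lemma sv_p1 : sval_ K (MSc false true true 0 1) = gX K * gY K * gZi K.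
Proof. by rewrite /sval_ /= !expr0 !expr1; ring. Qed.
Lemma sv_p2 : sval_ K (MSc true true false 0 2) = - (gX K * gZi K ^+ 2).
Proof. by rewrite /sval_ /= !expr0 !expr1; ring. Qed.

Ltac shift_rel := move=> ?; rewrite /shrel /= ?prednK1 ?prednK2 ?prednK3 //.
Ltac spans_rel := by rewrite /= ?inE ?eqxx ?orbT.
Local Notation dot i := (sdot R n d i).
Local Notation tau i j := (stau R n d i j).
Local Notation F i := (sid R n d [:: Fl i]).
Local Notation X := (gX K).
Local Notation Y := (gY K).
Local Notation Z := (gZ K).
Local Notation Zi := (gZi K).

Lemma rel_dot2 a i : respected a (dot i \v dot i) Zero.
Proof.
apply: (@near1 a (r_dot2 1) _ i (r_dot2 i) (_ : f_check f_dot2_1)); try (by vm_compute); try spans_rel.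
by shift_rel.
Qed.

Lemma rel_tau2 a i : respected a (tau i i \v tau i i) Zero.
Proof.
apply: (@near1 a (r_tau2 1) _ i (r_tau2 i) (_ : f_check f_tau2eq_1)); try (by vm_compute); try spans_rel.
by shift_rel.
Qed.

Lemma rel_tau2_succ a i : respected a (tau i.+1 i \v tau i i.+1)
  (Add (Scale (- (X * Y * Z)) (dot i \h F i.+1)) (Scale (X * Y * Z) (F i \h dot i.+1))).
Proof.
rewrite -sv_XYZ -sval_neg.
apply: (@near2 a (r_tau2s 1 2) _ i (r_tau2s i i.+1) (_ : f_check f_tau2s_1_2)); try (by vm_compute); try spans_rel.
by shift_rel.
Qed.

Lemma rel_tau2_pred a i : respected a (tau i i.+1 \v tau i.+1 i)
  (Add (Scale (Y * Z ^+ 2) (dot i.+1 \h F i)) (Scale (- (Y * Z ^+ 2)) (F i.+1 \h dot i))).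
Proof.
rewrite -sv_YZ2 -sval_neg.
apply: (@near2 a (r_tau2p 2 1) _ i (r_tau2p i.+1 i) (_ : f_check f_tau2p_2_1)); try (by vm_compute); try spans_rel.
by shift_rel.
Qed.

Lemma tau_deg_near i : (tau_deg i i.+1 = tau_deg 1 2) * (tau_deg i.+1 i = tau_deg 2 1).
Proof.
split; first by have := tau_deg_sh i 0 1; rewrite addn0 addn1 => ->; apply: (tau_deg_sh 1 0 1).
by have := tau_deg_sh i 1 0; rewrite addn0 addn1 => ->; apply: (tau_deg_sh 1 1 0).
Qed.

Lemma rel_dtl_near a i j : adjacent i j -> respected a ((dot j \h F i) \v tau i j)
  (Scale (mu (dg 1 1) (tau_deg i j)) (tau i j \v (F i \h dot j))).
Proof.
rewrite sval_mu; case/orP => /eqP->.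
  apply: (@near2 a (r_dtl 1 2) _ i (r_dtl i i.+1) (_ : f_check f_dtl_1_2)); try (by vm_compute); try spans_rel.
  by shift_rel; rewrite /r_dtl !tau_deg_near.
apply: (@near2 a (r_dtl 2 1) _ j (r_dtl j.+1 j) (_ : f_check f_dtl_2_1)); try (by vm_compute); try spans_rel.
by shift_rel; rewrite /r_dtl !tau_deg_near.
Qed.

Lemma rel_dtr_near a i j : adjacent i j -> respected a (tau i j \v (dot i \h F j))
  (Scale (mu (tau_deg i j) (dg 1 1)) ((F j \h dot i) \v tau i j)).
Proof.
rewrite sval_mu; case/orP => /eqP->.
  apply: (@near2 a (r_dtr 1 2) _ i (r_dtr i i.+1) (_ : f_check f_dtr_1_2)); try (by vm_compute); try spans_rel.
  by shift_rel; rewrite /r_dtr !tau_deg_near.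
apply: (@near2 a (r_dtr 2 1) _ j (r_dtr j.+1 j) (_ : f_check f_dtr_2_1)); try (by vm_compute); try spans_rel.
by shift_rel; rewrite /r_dtr !tau_deg_near.
Qed.

Lemma rel_nil_l a i : respected a
  (Add ((dot i \h F i) \v tau i i) (Scale (- (X * Y)) (tau i i \v (F i \h dot i))))
  (sid R n d [:: Fl i; Fl i]).
Proof.
rewrite -sv_XY.
apply: (@near1 a (r_nill 1) _ i (r_nill i) (_ : f_check f_nill_1)); try (by vm_compute); try spans_rel.
by shift_rel.
Qed.

Lemma rel_nil_r a i : respected a
  (Add (tau i i \v (dot i \h F i)) (Scale (- (X * Y)) ((F i \h dot i) \v tau i i)))
  (sid R n d [:: Fl i; Fl i]).
Proof.
rewrite -sv_XY.
apply: (@near1 a (r_nilr 1) _ i (r_nilr i) (_ : f_check f_nilr_1)); try (by vm_compute); try spans_rel.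
by shift_rel.
Qed.

Lemma rel_serre_succ a i j : j = i.+1 -> respected a
  (Add (Scale (- (Y * Zi ^+ 2))
         ((tau j i \h F i) \v (F j \h tau i i) \v (tau i j \h F i)))
       (Scale Zi ((F i \h tau i j) \v (tau i i \h F j) \v (F i \h tau j i))))
  (sid R n d [:: Fl i; Fl j; Fl i]).
Proof.
move->; rewrite -sv_s1 -sv_s2.
apply: (@near2 a (r_serres 1 2) _ i (r_serres i i.+1) (_ : f_check f_serres_1_2)); try (by vm_compute); try spans_rel.
by shift_rel.
Qed.

Lemma rel_serre_pred a i j : i = j.+1 -> respected a
  (Add (Scale (X * Y * Zi)
         ((tau j i \h F i) \v (F j \h tau i i) \v (tau i j \h F i)))
       (Scale (- (X * Zi ^+ 2)) ((F i \h tau i j) \v (tau i i \h F j) \v (F i \h tau j i))))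
  (sid R n d [:: Fl i; Fl j; Fl i]).
Proof.
move->; rewrite -sv_p1 -sv_p2.
apply: (@near2 a (r_serrep 2 1) _ j (r_serrep j.+1 j) (_ : f_check f_serrep_2_1)); try (by vm_compute); try spans_rel.
by shift_rel.
Qed.

Lemma rel_adj_F a i : respected a ((seps R n d i \h F i) \v (F i \h seta R n d i)) (F i).
Proof.
apply: (@near1 a (r_adjF 1) _ i (r_adjF i) (_ : f_check f_adjF_1)); try (by vm_compute); try spans_rel.
by shift_rel.
Qed.

Lemma rel_sinv_l_near a i j : adjacent i j ->
  respected a (sinv R n d i j \v sigma R n d i j) (sid R n d [:: Fl i; El j]).
Proof.
case/orP => /eqP->.
  apply: (@near2 a (r_sinvl 1 2) _ i (r_sinvl i i.+1) (_ : f_check f_sinvl_1_2)); try (by vm_compute); try spans_rel.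
  by shift_rel.
apply: (@near2 a (r_sinvl 2 1) _ j (r_sinvl j.+1 j) (_ : f_check f_sinvl_2_1)); try (by vm_compute); try spans_rel.
by shift_rel.
Qed.

Lemma rel_sinv_r_near a i j : adjacent i j ->
  respected a (sigma R n d i j \v sinv R n d i j) (sid R n d [:: El j; Fl i]).
Proof.
case/orP => /eqP->.
  apply: (@near2 a (r_sinvr 1 2) _ i (r_sinvr i i.+1) (_ : f_check f_sinvr_1_2)); try (by vm_compute); try spans_rel.
  by shift_rel.
apply: (@near2 a (r_sinvr 2 1) _ j (r_sinvr j.+1 j) (_ : f_check f_sinvr_2_1)); try (by vm_compute); try spans_rel.
by shift_rel.
Qed.

Lemma raw_lsum k (t : nat -> slin) : raw_lin (lsum k t) = ssum k (fun m => raw_lin (t m)).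
Proof. by rewrite /lsum /ssum; elim: (iota 0 k) => //= m l ->. Qed.

Lemma sh_lsum q k (t : nat -> slin) : shlin q (lsum k t) = lsum k (fun m => shlin q (t m)).
Proof. by rewrite /lsum; elim: (iota 0 k) => //= m l ->. Qed.

Lemma raw_mdots i m : sraw_of R n d (mdots i m) = sdotX R n d i m.
Proof. by elim: m => //= m ->. Qed.

Lemma sh_mdots q i m : shm q (mdots i m) = mdots (q + i) m.
Proof. by elim: m => //= m ->. Qed.

Lemma raw_meta i m : sraw_of R n d (meta i m) = eta_dots R n d i m.
Proof. by rewrite /= raw_mdots. Qed.

Lemma raw_meps i m : sraw_of R n d (meps i m) = eps_dots R n d i m.
Proof. by rewrite /= raw_mdots. Qed.

Lemma sv_adj x y : sval_ K (MSc false (~~ odd y) (odd x) 0 0) = X ^+ (1 + y) * Y ^+ x.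
Proof.
have h (t : R) k : t * t = 1 -> t ^+ odd k = t ^+ k.
  by move=> tt; rewrite -[in RHS](odd_double_half k) exprD -mul2n exprM expr2 tt expr1n mulr1.
have hX := h X y.+1 (gXX K); have hY := h Y x (gYY K).
by rewrite /sval_ add1n -hX -hY /= !expr0 !mulr1 mul1r.
Qed.

Lemma wt_small a i : (wt a i <= 2)%N.
Proof. exact: nw_small (lam_small a). Qed.

Ltac near_fam e1 e2 := rewrite /= /pos /neg ?e1 ?e2; split=> //;
  rewrite /= ?sh_lsum ?raw_lsum /= ?sh_mdots ?prednK1 ?raw_mdots //.

Lemma eq_ssum k (t t' : nat -> sraw) : t =1 t' -> ssum k t = ssum k t'.
Proof. by move=> e; rewrite /ssum; elim: (iota 0 k) => //= m l ->; rewrite e. Qed.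

Lemma rel_adj_E a i : respected a
  (Scale (X ^+ (1 + wt a i.+1) * Y ^+ wt a i)
    ((sid R n d [:: El i] \h seps R n d i) \v (seta R n d i \h sid R n d [:: El i])))
  (sid R n d [:: El i]).
Proof.
(* The scalar is read on a window, which requires an index in range; for the other indices both
   sides vanish. *)
rewrite -sv_adj; case: (boolP (0 < i < n)%N) => hi; last first.
  move=> b u v p s' t'; apply: (@range_rel R K n d a b u v p
    (r_adjE (wt a i) (wt a i.+1) i).1 (r_adjE (wt a i) (wt a i.+1) i).2 i) => //; spans_rel.
apply: (near_family (f := f_adjE_1) _ hi) ; try (by vm_compute); try done.
have hi0 : (0 < i)%N by lia.
by move=> a0 e1 e2; near_fam e1 e2.
Qed.

Lemma rel_pos_r a i : (0 < i < n)%N -> (wt a i.+1 <= wt a i)%N -> respected a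
  (Add (sigma R n d i i \v sinv R n d i i)
    (ssum (wt a i - wt a i.+1) (fun m => eta_dots R n d i m \v pinv R n d i m)))
  (sid R n d [:: El i; Fl i]).
Proof.
move=> hi hw; apply: (near_family (f := f_posr_1) _ hi) ; try (by vm_compute); try done.
have hi0 : (0 < i)%N by lia.
move=> a0 e1 e2; near_fam e1 e2; congr Add; apply: eq_ssum => m /=.
by rewrite sh_mdots prednK1 ?raw_mdots.
Qed.

Lemma rel_pos_l a i : (0 < i < n)%N -> (wt a i.+1 <= wt a i)%N -> respected a
  (sinv R n d i i \v sigma R n d i i) (sid R n d [:: Fl i; El i]).
Proof.
move=> hi hw; apply: (near_family (f := f_posl_1) _ hi) ; try (by vm_compute); try done.
have hi0 : (0 < i)%N by lia.
by move=> a0 e1 e2; near_fam e1 e2.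
Qed.

Lemma rel_neg_l a i : (0 < i < n)%N -> (wt a i <= wt a i.+1)%N -> respected a
  (Add (sinv R n d i i \v sigma R n d i i)
    (ssum (wt a i.+1 - wt a i) (fun m => ninv R n d i m \v eps_dots R n d i m)))
  (sid R n d [:: Fl i; El i]).
Proof.
move=> hi hw; apply: (near_family (f := f_negl_1) _ hi) ; try (by vm_compute); try done.
have hi0 : (0 < i)%N by lia.
move=> a0 e1 e2; near_fam e1 e2; congr Add; apply: eq_ssum => m /=.
by rewrite sh_mdots prednK1 ?raw_mdots.
Qed.

Lemma rel_neg_r a i : (0 < i < n)%N -> (wt a i <= wt a i.+1)%N -> respected a
  (sigma R n d i i \v sinv R n d i i) (sid R n d [:: El i; Fl i]).
Proof.
move=> hi hw; apply: (near_family (f := f_negr_1) _ hi) ; try (by vm_compute); try done.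
have hi0 : (0 < i)%N by lia.
by move=> a0 e1 e2; near_fam e1 e2.
Qed.

Ltac near_case f hi := apply: (near_family (f := f) _ hi) ; try (by vm_compute); try done;
  let e1 := fresh in let e2 := fresh in move=> ? e1 e2; near_fam e1 e2.

Lemma rel_pos_l_dots a i m : (0 < i < n)%N -> (m < wt a i - wt a i.+1)%N ->
  respected a (sinv R n d i i \v eta_dots R n d i m) Zero.
Proof.
move=> hi hm; have hi0 : (0 < i)%N by lia.
have := wt_small a i; case: m hm => [|[|m]] hm; last by lia.
  by move=> _; near_case f_posld_1_0 hi.
by move=> _; near_case f_posld_1_1 hi.
Qed.

Lemma rel_pos_dots_l a i m : (0 < i < n)%N -> (m < wt a i - wt a i.+1)%N ->
  respected a (pinv R n d i m \v sigma R n d i i) Zero.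
Proof.
move=> hi hm; have hi0 : (0 < i)%N by lia.
have := wt_small a i; case: m hm => [|[|m]] hm; last by lia.
  by move=> _; near_case f_posdl_1_0 hi.
by move=> _; near_case f_posdl_1_1 hi.
Qed.

Lemma rel_pos_dots a i m m' : (0 < i < n)%N ->
  (m < wt a i - wt a i.+1)%N -> (m' < wt a i - wt a i.+1)%N ->
  respected a (pinv R n d i m \v eta_dots R n d i m') (if m == m' then sid R n d [::] else Zero).
Proof.
move=> hi hm hm'; have hi0 : (0 < i)%N by lia.
have := wt_small a i; case: m hm => [|[|m]] hm; last by lia.
  case: m' hm' => [|[|m']] hm'; last by lia.
    by move=> _; near_case f_posd_1_0_0 hi; rewrite ?hm.
  by move=> _; near_case f_posd_1_0_1 hi; rewrite ?hm ?hm'.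
case: m' hm' => [|[|m']] hm'; last by lia.
  by move=> _; near_case f_posd_1_1_0 hi; rewrite ?hm ?hm'.
by move=> _; near_case f_posd_1_1_1 hi; rewrite ?hm.
Qed.

Lemma rel_neg_dots_r a i m : (0 < i < n)%N -> (m < wt a i.+1 - wt a i)%N ->
  respected a (eps_dots R n d i m \v sinv R n d i i) Zero.
Proof.
move=> hi hm; have hi0 : (0 < i)%N by lia.
have := wt_small a i.+1; case: m hm => [|[|m]] hm; last by lia.
  by move=> _; near_case f_negdr_1_0 hi.
by move=> _; near_case f_negdr_1_1 hi.
Qed.

Lemma rel_neg_r_dots a i m : (0 < i < n)%N -> (m < wt a i.+1 - wt a i)%N ->
  respected a (sigma R n d i i \v ninv R n d i m) Zero.
Proof.
move=> hi hm; have hi0 : (0 < i)%N by lia.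
have := wt_small a i.+1; case: m hm => [|[|m]] hm; last by lia.
  by move=> _; near_case f_negrd_1_0 hi.
by move=> _; near_case f_negrd_1_1 hi.
Qed.

Lemma rel_neg_dots a i m m' : (0 < i < n)%N ->
  (m < wt a i.+1 - wt a i)%N -> (m' < wt a i.+1 - wt a i)%N ->
  respected a (eps_dots R n d i m \v ninv R n d i m') (if m == m' then sid R n d [::] else Zero).
Proof.
move=> hi hm hm'; have hi0 : (0 < i)%N by lia.
have := wt_small a i.+1; case: m hm => [|[|m]] hm; last by lia.
  case: m' hm' => [|[|m']] hm'; last by lia.
    by move=> _; near_case f_negd_1_0_0 hi; rewrite ?hm.
  by move=> _; near_case f_negd_1_0_1 hi; rewrite ?hm ?hm'.
case: m' hm' => [|[|m']] hm'; last by lia.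
  by move=> _; near_case f_negd_1_1_0 hi; rewrite ?hm ?hm'.
by move=> _; near_case f_negd_1_1_1 hi; rewrite ?hm.
Qed.

(** [m] is the least index and [q] holds the indices relative to it, counted from 1. As they fill
    the interval from 1 to [k], a window that does not fit forces an index out of range. *)
Lemma braid_near a m (q : nat * nat * nat) k l : f_check (constant_family k.+1 (r_braid q.1.1 q.1.2 q.2) l) ->
  [&& 0 < k, 0 < q.1.1, 0 < q.1.2, 0 < q.2 & all (fun j => j \in [:: q.1.1; q.1.2; q.2]) (iota 1 k)]%N ->
  let i1 := (m + q.1.1).-1 in let i2 := (m + q.1.2).-1 in let i3 := (m + q.2).-1 in
  respected a ((tau i2 i3 \h F i1) \v (F i2 \h tau i1 i3) \v (tau i1 i2 \h F i3))
    (Scale (mu (tau_deg i2 i3) (tau_deg i1 i2) * mu (tau_deg i1 i3) (tau_deg i1 i2)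
            * mu (tau_deg i2 i3) (tau_deg i1 i3))
      ((F i3 \h tau i1 i2) \v (tau i1 i3 \h F i2) \v (F i1 \h tau i2 i3))).
Proof.
case: q => [[q1 q2] q3] /= hf /and5P[hk h1 h2 h3 hall].
set i1 := (m + q1).-1; set i2 := (m + q2).-1; set i3 := (m + q3).-1.
rewrite !sval_mu -!sval_mul.
apply: (@near a k.+1 (r_braid q1 q2 q3) l m (r_braid i1 i2 i3) hf).
  move=> hm _; have e q : (0 < q)%N -> (m.-1 + q)%N = (m + q).-1 by lia.
  by rewrite /i1 /i2 /i3 -(e _ h1) -(e _ h2) -(e _ h3) /r_braid !tau_deg_sh.
move=> hm; have [j hj jq] : exists2 j, ~~ (0 < j < n)%N & exists2 q, q \in [:: q1; q2; q3] & j = (m + q).-1.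
  have kq q : (0 < q <= k)%N -> q \in [:: q1; q2; q3].
    by move=> hq; apply: (allP hall); rewrite mem_iota; lia.
  case: (boolP (0 < m < n)%N) => h0.
  + exists (m + k).-1; last by exists k => //; apply: kq; lia.
    by move: hm; lia.
  exists (m + 1).-1; last by exists 1%N => //; apply: kq; lia.
  by move: h0; lia.
exists j; rewrite hj /=; case: jq => q; rewrite !inE => hq ->.
by rewrite -/i1 -/i2 -/i3; case/or3P: hq => /eqP->; rewrite ?eqxx ?orbT.
Qed.

End Near.

End NearRelations.
Import NearRelations.

(** * Relations with distant indices *)

Module FarRelations.

Arguments sact : simpl never.
Arguments simg : simpl never.

Fixpoint msrc (t : smono) : seq slet :=
  match t with
  | MG g => gsrc g | MI w => w | MV _ t => msrc t | MH s t => msrc s ++ msrc t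
  end.
Fixpoint mtgt (t : smono) : seq slet :=
  match t with
  | MG g => gtgt g | MI w => w | MV s _ => mtgt s | MH s t => mtgt s ++ mtgt t
  end.

Lemma ev_path e a t v : ev e a t = Some v ->
  [/\ spath (v_src v) a = Some (v_ob v), spath (v_tgt v) a = Some (v_ob v),
      v_src v = msrc t & v_tgt v = mtgt t].
Proof.
elim: t a v => [g|w|t1 IH1 t2 IH2|t1 IH1 t2 IH2] a v /=.
- case e1: (spath (gsrc g) a) => [b|] //; case: ifP => // /andP[/eqP e2 _].
  by case: (simg e a g) => c D [<-].
- by case e1: (spath w a) => [b|] // [<-].
- case e2: (ev e a t2) => [[b u x c D]|] //; case e1: (ev e a t1) => [[b' x' w c' D']|] //.
  case: ifP => // /andP[/eqP eb /eqP ex] [<-] /=; subst b' x'.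
  by have [/= ? ? _ ?] := IH1 _ _ e1; have [/= ? ? ? _] := IH2 _ _ e2; split.
case e2: (ev e a t2) => [[b u x c D]|] //; case e1: (ev e b t1) => [[b' u' x' c' D']|] // [<-] /=.
have [/= h1 h1' eu' ex'] := IH1 _ _ e1; have [/= h2 h2' eu ex] := IH2 _ _ e2.
by rewrite !spath_cat h2 h2' /= h1 h1' eu' eu ex ex'.
Qed.

Lemma ev_gen e a b g : spath (gsrc g) a = Some b -> spath (gtgt g) a = Some b -> gok g a ->
  ev e a (MG g) = Some (MkEval b (gsrc g) (gtgt g) (simg e a g).1 (simg e a g).2).
Proof. by move=> h1 h2 h3 /=; rewrite h1 h2 h3 eqxx; case: (simg e a g). Qed.

Lemma ev_id e a b w : spath w a = Some b -> ev e a (MI w) = Some (MkEval b w w sone [::]).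
Proof. by move=> /= ->. Qed.

Lemma ev_V e a s t b u v w c c' D D' :
  ev e a s = Some (MkEval b v w c' D') -> ev e a t = Some (MkEval b u v c D) ->
  ev e a (MV s t) = Some (MkEval b u w (smul c' c) (D ++ D')).
Proof. by move=> /= -> ->; rewrite !eqxx. Qed.

Lemma ev_H e a s t b b' u u' v v' c c' D D' :
  ev e b s = Some (MkEval b' u' v' c' D') -> ev e a t = Some (MkEval b u v c D) ->
  ev e a (MH s t) = Some (MkEval b' (u' ++ u) (v' ++ v) (smul c' c)
    (shl (size (webw u' b)) D ++ D')).
Proof. by move=> h /= ->; rewrite h. Qed.

Lemma evl_one e a t : evl e a (LM t) = evl e a (LS sone (LM t)).
Proof.
by rewrite /=; case: (ev e a t) => //= -[b u v [s x y p q] D].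
Qed.

Lemma smulr1 c : smul c sone = c.
Proof. by case: c => s x y p q; rewrite /smul /= !addbF !addn0. Qed.

Lemma seqs_refl c : seqs c c.
Proof. by rewrite /seqs !eqxx /=. Qed.

Lemma smul1 c : smul sone c = c.
Proof. by case: c => s x y p q. Qed.

Section ExchCat.
Variables (R : comPzRingType) (K : ground R) (d : nat).
Local Notation fpath := (@wpath (foam_sig d)).
Local Notation cv := (@cv R K d).

(** The counterpart of [exch_cat] for the second argument; since [exch] recurses on the first, the
    crossings have to be reordered. *)
Lemma exch_catr (A B : flam d) w u u' : fpath (w ++ u ++ u') A B -> farw w (u ++ u') ->
  cv A B (w ++ u ++ u') (u ++ u' ++ w) 0 (exch w (u ++ u'))
    (exch w u ++ shl (size u) (exch w u')).
Proof.
elim: w B => [|k w IH] B p.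
  by move=> _; apply: cv_refl; have := @exch_good R K d A B [::] (u ++ u') p isT; rewrite !cats0.
move=> /= /andP[hk hw]; have [C pC st] := p; have pk : fpath [:: k] C B by exists C.
have := hk; rewrite all_cat => /andP[hku hku'].
have hwu : farw w u by apply/allP => x /(allP hw); rewrite all_cat => /andP[].
have hwu' : farw w u' by apply/allP => x /(allP hw); rewrite all_cat => /andP[].
have h1 := cv_whiskl pk (IH _ pC hw).
have pC' : fpath ((w ++ u) ++ u') A C by rewrite -catA.
have [C1 pu' pwu] := path_catP pC'.
have g1 := exch_good K pwu hwu.
have [_ /path_catP[C2 pw pu]] := good_path K g1.
have gE := exch_good K (path_cat pw pu') hwu'.
have pku : fpath (k :: u) C2 B by exists C.
have gD := slide_good pku hku.
have sw := cv_swapl K gD gE.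
have [_ /path_catP[C3 pw2 pu'2]] := good_path K gE.
have [_] := good_path K gD; rewrite -cats1 => /path_catP[C4 pk4 pu4].
have pku' : fpath (k :: u') C3 C4 by apply: (@path_cat d [:: k] u') pk4 pu'2.
have gF := good_whiskl pu4 (good_whiskr pw2 (slide_good pku' hku')).
have gF' : good A B (rcons u k ++ u' ++ w) (u ++ u' ++ k :: w) 0 (shl (size u) (slide k u')).
  by move: gF; rewrite -!cats1 /= -!catA.
have g1' := good_whiskl pk (good_whiskr pu' g1).
have c1 := cv_cat0 h1 (cv_refl K (good_cat (good_whiskr (path_cat pu'2 pw2) gD) gF')).
have c3 := cv_cat0 (cv_sym sw) (cv_refl K gF').
rewrite -[(k :: u) ++ _]/([:: k] ++ u ++ w ++ u') [u ++ w ++ u']catA in c3.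
have c2 := cv_0cat (cv_refl K g1') c3.
rewrite slide_cat; move: c1 c2.
rewrite /= !shl_cat !shl_shl size_rcons -!catA !add1n !addn1 => c1 c2.
exact: cv_trans c1 c2.
Qed.

End ExchCat.

(** * Generators and distant letters *)

Definition gidx (g : sgen) : seq nat :=
  match g with
  | STau i j | SInv i j => [:: i; j]
  | SEta i | SEps i | SDot i | PInv i _ | NInv i _ => [:: i]
  end.

(** Colours and parities are sums of initial segments, and a letter changes only the sum that ends
    between its two coordinates. *)
Lemma simg_sact l a b e g : all (far (sidx l)) (gidx g) -> sact l a = Some b ->
  simg e b g = simg e a g.
Proof.
move=> + h.
have nwE i : far (sidx l) i -> nw b i = nw a i /\ nw b i.+1 = nw a i.+1.
  by move=> hf; split; apply: (nw_sact h); move: hf; rewrite /far; lia.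
have clE i : far (sidx l) i -> cl b i = cl a i.
  by move=> hf; apply: (cl_sact h); move: hf; rewrite /far; lia.
have gamE i : far (sidx l) i -> gam e b i = gam e a i /\ gam e b i.-1 = gam e a i.-1.
  move=> hf; split; apply: (gam_sact _ h); move: hf; rewrite /far; first lia.
  by move: (sact_range h); lia.
have webE x : far (sidx l) (sidx x) -> web x b = web x a by move=> hf; apply: web_far hf h.
rewrite /simg; case: g => [i|i|i|i j|i j|i m|i m] /=; rewrite ?andbT; 
  [move=> hi|move=> hi|move=> hi|case/andP=> hi hj|case/andP=> hi hj|move=> hi|move=> hi].
all: have [N1 N2] := nwE _ hi; have [G1 G2] := gamE _ hi; have C1 := clE _ hi.
all: rewrite ?N1 ?N2 ?G1 ?G2 ?C1 //.
all: have [N3 N4] := nwE _ hj; have [G3 G4] := gamE _ hj; have C2 := clE _ hj.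
  by rewrite ?N3 ?N4 ?G3 ?G4 ?C2 (webE (Fl i)) // (webE (Fl j)).
by rewrite ?N3 ?N4 ?G3 ?G4 ?C2 (webE (Fl i)) // (webE (El j)).
Qed.

(** The image uses only the colours of the window, from 1 to the sum of [a]; this is what keeps it
    apart from the strands of distant letters. *)
Definition gwithin_check (g : sgen) (a : seq nat) : bool :=
  gtyped g a ==> all (fun L => gwithin 1 (1 + sumn a) L.2) (simg false a g).2.

Lemma gwithin_checks : all (fun g => all (gwithin_check g) (weights 2)) [:: SDot 1; SEta 1; SEps 1; STau 1 1]
  && all (fun g => all (gwithin_check g) (weights 3)) [:: STau 1 2; STau 2 1].
Proof. by vm_compute. Qed.

Lemma gwithin_sh s lo hi g : gwithin (s + lo) (s + hi) (shg s g) = gwithin lo hi g.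
Proof.
have w k : within (s + lo) (s + hi) (shk s k) = within lo hi k.
  by rewrite /within !wcol_shk; lia.
by case: g => [i|i|i|i|i|k l] /=; rewrite ?w ?wcol_shk ?far_shk //; lia.
Qed.

Section Far.
Variables (R : comPzRingType) (K : ground R) (n d : nat).
Local Notation mu := (bichar K).
Local Notation fpath := (@wpath (foam_sig d)).
Implicit Types a b : lam n d.
Local Notation ul := (@underline n d).
Local Notation spr := (schur_pres K n d).
Local Notation strans := (@tr R spr (fpr K d) (@fW n d) (fG K (n := n) (d := d))).
Local Notation feq := (@eqv R mu (fpr K d)).
Local Notation sraw := (raw R (schur_sig n d)).
Local Notation raw_lin := (@raw_lin R K n d).
Local Notation respected := (@respected R K n d).
Local Notation conv := (conv K).
Local Notation cv := (@cv R K d).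

(** When each side is a single monomial, it suffices to convert one diagram into the other at the
    weights where both words are paths; at all others both sides are zero. *)
Lemma mono_rel a S T c1 c2 t1 t2 u v : 
  evl false (sval a) S = evl false (sval a) (LS c1 (LM t1)) ->
  evl false (sval a) T = evl false (sval a) (LS c2 (LM t2)) ->
  msrc t1 = u -> msrc t2 = u -> mtgt t1 = v -> mtgt t2 = v ->
  (forall b, spath u (sval a) = Some (sval b) -> spath v (sval a) = Some (sval b) -> exists c D c' D', exists p k,
    [/\ ev false (sval a) t1 = Some (MkEval (sval b) u v c D),
        ev false (sval a) t2 = Some (MkEval (sval b) u v c' D'),
        conv (ul a) (ul b) (fW a u) (fW a v) p (sval_ K k) D D' &
        seqs (smul (smul c1 c) k) (smul c2 c')]) ->
  respected a (raw_lin S) (raw_lin T).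
Proof.
move=> eS eT e1 e2 e3 e4 main b u' v' p s' t' hs ht.
have [aS gS qS] := tr_evl hs; have [aT gT qT] := tr_evl ht.
have [pu pv] := typed_wpath (tr_typedl hs).
have pfu := webw_fpath pu; have pfv := webw_fpath pv.
apply: eqv_trans qS (eqv_trans _ (eqv_sym qT)).
move: aS gS aT gT; rewrite eS eT /=.
case ev1: (ev false (sval a) t1) => [x|]; last first.
  case ev2: (ev false (sval a) t2) => [y|]; last first.
    by move=> _ _ _ _; apply/eqv_refl/typed_zero.
  have [h h' es et] := ev_path ev2; rewrite es e2 in h; rewrite et e4 in h'.
  have [b' pb eb] := spath_exists h; rewrite -eb in h h'.
  by have [c [D [c' [D' [q [k []]]]]]] := main _ h h'; rewrite ev1.
have [h h' es et] := ev_path ev1; rewrite es e1 in h; rewrite et e3 in h'.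
have [b' pb eb] := spath_exists h; rewrite -eb in h h'.
have [c [D [c' [D' [q [k [ex -> hc hk]]]]]]] := main _ h h'.
move: ex; rewrite ev1 => -[->] /= /andP[/and3P[/eqP e0 /eqP eu /eqP ev_] _] gS _ gT.
have ebb : b' = b by apply: lam_eq.
subst u' v' b'.
have gD : good (ul a) (ul b) (fW a u) (fW a v) p D by apply: gS; left.
have gD' : good (ul a) (ul b) (fW a u) (fW a v) p D' by apply: gT; left.
have ep : q = p by case/convP: hc => -[_ _ <-] _ _; case: gD.
subst q.
apply: eqv_trans (dsum1 K _ gD) (eqv_trans _ (eqv_sym (dsum1 K _ gD'))).
have [_ _ e] := (convP _ _ _ _ _ _ _ _ _).1 hc.
apply: eqv_trans (eqv_scale _ e) _.
have y := good_typed K gD'.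
apply: eqv_trans (eqv_law mu (law_scaleA _ _ _) (typed_scale _ (typed_scale _ y)) (typed_scale _ y)) _.
rewrite -sval_mul (sval_eq K hk); exact/eqv_refl/typed_scale.
Qed.

(** The colours of the image lie in the interval of the window, those of the distant web in an
    interval before or after it. *)
Lemma farD_local l a k g0 i : all (gwithin_check g0) (weights k) -> ing k g0 ->
  (0 < i)%N -> (i.-1 + k <= n)%N -> gtyped (shsg i.-1 g0) (sval a) -> (0 < sidx l)%N ->
  ((sidx l).+1 < i)%N || (i.-1 + k < sidx l)%N ->
  farD (web l (sval a)) (simg false (sval a) (shsg i.-1 g0)).2.
Proof.
move=> hc hin hi hk ht hl hf.
have [l1 [a0 [l2 [ea s1 s0 [w0 sm]]]]] := frame a hi hk.
have hw := web_within l (sval a).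
have h1 : (sumn l1 + 1)%N = cl (sval a) i by rewrite ea /cl -s1 take_size_cat // addnC.
have h2 : (sumn l1 + (1 + sumn a0))%N = cl (sval a) (i + k).
  rewrite ea /cl (_ : (i + k).-1 = (size l1 + size a0)%N); last by rewrite s1 s0; lia.
  by rewrite catA take_size_cat ?size_cat // sumn_cat; lia.
rewrite -s1 in ht *; rewrite -s0 in hin; rewrite ea in ht *.
rewrite gtyped_ctx // in ht; rewrite simg_ctx //= (simg_parity _ false).
have := allP hc a0 w0; rewrite /gwithin_check ht /= => hg.
apply/allP => k' hk'; rewrite -ea in hk'; have := allP hw k' hk' => hww.
rewrite /shd all_map; apply: sub_all hg => L /= hL.
apply: (within_apart (lo' := (sumn l1 + 1)%N) (hi' := (sumn l1 + (1 + sumn a0))%N) _ hww).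
  rewrite h1 h2; case/orP: hf => hf; apply/orP; [left|right]; first exact: hi_cl.
  by apply: cl_mono; lia.
by rewrite gwithin_sh.
Qed.

Definition near_gen (g : sgen) : bool :=
  match g with
  | STau i j => (i == j) || adjacent i j
  | SInv _ _ | PInv _ _ | NInv _ _ => false
  | _ => true
  end.

Lemma farD_near l a g : near_gen g -> gtyped g (sval a) -> (0 < sidx l)%N ->
  all (far (sidx l)) (gidx g) -> farD (web l (sval a)) (simg false (sval a) g).2.
Proof.
move=> hg ht hl hf.
have rng : all (fun j => 0 < j < n)%N (gidx g).
  move: ht; rewrite /gtyped; case e1: (spath _ _) => [b|] // /andP[/eqP e2 _].
  have := spath_range e1; have := spath_range e2; rewrite !lam_size.
  by case: g {hf e1 e2} hg => [i|i|i|i j|i j|i m|i m] //= _; lia.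
have /andP[/and5P[c1 c2 c3 c4 _] /and3P[c5 c6 _]] := gwithin_checks.
have loc k g0 i : all (gwithin_check g0) (weights k) -> ing k g0 -> (0 < i)%N ->
    (i.-1 + k <= n)%N -> g = shsg i.-1 g0 ->
    ((sidx l).+1 < i)%N || (i.-1 + k < sidx l)%N ->
    farD (web l (sval a)) (simg false (sval a) g).2.
  by move=> hc hi h1 h2 eg; rewrite eg in ht *; move=> hh; apply: (farD_local hc hi h1 h2 ht hl hh).
case: g hg ht hf rng loc => [i|i|i|i j|i j|i m|i m] //= hg ht; rewrite ?andbT /far.
- by move=> hf hi loc; apply: (loc 2%N (SEta 1) i) => //=; rewrite ?prednK1 //; lia.
- by move=> hf hi loc; apply: (loc 2%N (SEps 1) i) => //=; rewrite ?prednK1 //; lia.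
- by move=> hf hi loc; apply: (loc 2%N (SDot 1) i) => //=; rewrite ?prednK1 //; lia.
move=> /andP[hf hf'] /andP[hi hj] loc; case/or3P: hg => /eqP e; subst.
- by apply: (loc 2%N (STau 1 1) j) => //=; rewrite ?prednK1 //; lia.
- by apply: (loc 3%N (STau 1 2) i) => //=; rewrite ?prednK1 ?prednK2 //; lia.
by apply: (loc 3%N (STau 2 1) j) => //=; rewrite ?prednK1 ?prednK2 //; lia.
Qed.

Lemma spath_far l l' (a : seq nat) : far (sidx l) (sidx l') -> spath [:: l; l'] a = spath [:: l'; l] a.
Proof.
move=> hf; have half x x' (b : seq nat) : far (sidx x) (sidx x') -> spath [:: x; x'] a = Some b ->
    spath [:: x'; x] a = Some b.
  move=> h /=; case e: (sact x' a) => [a1|] //= e1.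
  have hf' : far (sidx x') (sidx x) by rewrite farC.
  by have [a2 -> /= ->] := sact_comm hf' e e1.
case e: (spath [:: l; l'] a) => [b|]; first by rewrite (half _ _ _ hf e).
case e': (spath [:: l'; l] a) => [b|] //.
by rewrite (half _ _ _ _ e') // farC in e.
Qed.

Lemma webw_far2 l l' (a b : seq nat) : far (sidx l) (sidx l') -> spath [:: l; l'] a = Some b ->
  webw [:: l; l'] a = web l a ++ web l' a.
Proof.
move=> hf /=; case e: (sact l' a) => [a1|] //= _.
by rewrite cats0 (web_far _ e) // farC.
Qed.

Lemma far_square l l' a b : far (sidx l) (sidx l') -> spath [:: l; l'] (sval a) = Some (sval b) ->
  exists a1 a2 : lam n d,
  [/\ sact l' (sval a) = Some (sval a1), sact l (sval a1) = Some (sval b),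
      sact l (sval a) = Some (sval a2) & sact l' (sval a2) = Some (sval b)] /\
  farw (web l (sval a)) (web l' (sval a)).
Proof.
move=> hf p1; have p2 := p1; rewrite spath_far // in p2.
move/spathP: p1 => [a1 [x1 <- s1] s2]; move/spathP: p2 => [a2 [x2 <- s3] s4].
move/schur_stepP: s1 => s1; move/schur_stepP: s2 => s2.
move/schur_stepP: s3 => s3; move/schur_stepP: s4 => s4.
exists a1, a2; split=> //; apply: farw_web => //.
  by have /andP[] := sact_range s3.
by have /andP[] := sact_range s1.
Qed.

Lemma fpath_web l a b : sact l (sval a) = Some (sval b) -> fpath (web l (sval a)) (ul a) (ul b).
Proof.
by move=> e; apply/fpathP; rewrite (web_path e (lam_small a)).
Qed.

Lemma ev_tau_far e (a b : seq nat) i j : far i j -> spath [:: Fl i; Fl j] a = Some b ->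
  ev e a (mtau i j) = Some (MkEval b [:: Fl i; Fl j] [:: Fl j; Fl i] sone
    (exch (web (Fl i) a) (web (Fl j) a))).
Proof.
move=> hf h; have h' := h; rewrite (@spath_far (Fl i) (Fl j)) // in h'.
rewrite /mtau (@ev_gen e a b (STau i j) h h') // /simg; move: hf; rewrite /far => hf.
by rewrite !ifF //; apply/eqP; lia.
Qed.

Lemma tau_deg_far i j : far i j -> tau_deg i j = 0.
Proof. by rewrite /far /tau_deg /alpha => h; congr pair; lia. Qed.

Local Notation tau i j := (stau R n d i j).
Local Notation dot i := (sdot R n d i).
Local Notation F i := (sid R n d [:: Fl i]).

Lemma rel_tau2_far a i j : far i j -> respected a (tau j i \v tau i j) (sid R n d [:: Fl i; Fl j]).
Proof.
move=> hf; have hf' : far j i by rewrite farC.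
apply: (@mono_rel a (LM (MV (mtau j i) (mtau i j))) (LM (MI [:: Fl i; Fl j])) sone sone _ _
  [:: Fl i; Fl j] [:: Fl i; Fl j] (evl_one _ _ _) (evl_one _ _ _)) => // b pb _.
have pb' := pb; rewrite (@spath_far (Fl i) (Fl j)) // in pb'.
have [a1 [a2 [[s1 s2 s3 s4] hw]]] := far_square (l := Fl i) (l' := Fl j) hf pb.
do 4!eexists; exists 0, sone; split; first exact: ev_V (ev_tau_far _ hf' pb') (ev_tau_far _ hf pb).
- exact: ev_id.
- rewrite /fW (webw_far2 (l := Fl i) (l' := Fl j) hf pb) sval_one.
  apply: (exch_inv K) hw; rewrite -(webw_far2 (l := Fl i) (l' := Fl j) hf pb).
  by apply: webw_fpath; apply/spathP.
by [].
Qed.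

Lemma rel_dtl_far a i j : far i j -> respected a ((dot j \h F i) \v tau i j)
  (Scale (mu (dg 1 1) (tau_deg i j)) (tau i j \v (F i \h dot j))).
Proof.
move=> hf; have hf' : far j i by rewrite farC.
rewrite sval_mu.
apply: (@mono_rel a (LM (MV (MH (mx_ j) (mF i)) (mtau i j)))
  (LS (smu (dg 1 1) (tau_deg i j)) (LM (MV (mtau i j) (MH (mF i) (mx_ j))))) sone _ _ _
  [:: Fl i; Fl j] [:: Fl j; Fl i] (evl_one _ _ _) erefl) => // b pb _.
have [a1 [a2 [[s1 s2 s3 s4] hw]]] := far_square (l := Fl i) (l' := Fl j) hf pb.
have p1 : spath [:: Fl j] (sval a) = Some (sval a1) by rewrite /= s1.
have p2 : spath [:: Fl j] (sval a2) = Some (sval b) by rewrite /= s4.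
have q1 : spath [:: Fl i] (sval a) = Some (sval a2) by rewrite /= s3.
have q2 : spath [:: Fl i] (sval a1) = Some (sval b) by rewrite /= s2.
have d1 := @ev_gen false _ _ (SDot j) p1 p1 isT; have d2 := @ev_gen false _ _ (SDot j) p2 p2 isT.
have f1 := ev_id false q1; have f2 := ev_id false q2.
have hff : all (far (sidx (Fl i))) (gidx (SDot j)) by rewrite /= hf.
(* The dot has the same value before and after the distant letter; from here on that common value is
   an arbitrary diagram satisfying naturality. *)
rewrite (simg_sact false hff s3) in d2.
move: (simg false _ _) d1 d2 (@farD_near (Fl i) a (SDot j)) (@simg_good R K n d (SDot j) a a1 isT) => X d1 d2 hD gX.
do 4!eexists; exists (dg 1 1), sone; split.
- exact: ev_V (ev_H d2 f1) (ev_tau_far _ hf pb).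
- exact: ev_V (ev_tau_far _ hf pb) (ev_H f2 d1).
- have pF : wpath (S := schur_sig n d) [:: Fl j] a a1 by apply/spathP.
  have {}gX := gX pF pF; rewrite /= cats0 in gX.
  have pb' := pb; rewrite (@spath_far (Fl i) (Fl j)) // in pb'.
  have {}hD : farD (web (Fl i) (sval a)) X.2.
    apply: hD => //; first by rewrite /gtyped p1 /= eqxx.
    by have /andP[] := sact_range s3.
  rewrite /fW (webw_far2 (l := Fl i) (l' := Fl j) hf pb) (webw_far2 (l := Fl j) (l' := Fl i) hf' pb').
  rewrite /= !cats0 sval_one (@web_far (Fl j) (Fl i) _ _ hf' s1).
  have pw := fpath_web s2; rewrite (@web_far (Fl j) (Fl i) _ _ hf' s1) in pw.
  exact: cv_sym (exch_natural K hD hw gX pw).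
by rewrite tau_deg_far // !smulr1 !smul1; apply: seqs_refl.
Qed.

(** The dot now sits on the left letter while the other strand crosses from the right, whence
    [exch_natural_r] in place of [exch_natural]. *)
Lemma rel_dtr_far a i j : far i j -> respected a (tau i j \v (dot i \h F j))
  (Scale (mu (tau_deg i j) (dg 1 1)) ((F j \h dot i) \v tau i j)).
Proof.
move=> hf; have hf' : far j i by rewrite farC.
rewrite sval_mu.
apply: (@mono_rel a (LM (MV (mtau i j) (MH (mx_ i) (mF j))))
  (LS (smu (tau_deg i j) (dg 1 1)) (LM (MV (MH (mF j) (mx_ i)) (mtau i j)))) sone _ _ _
  [:: Fl i; Fl j] [:: Fl j; Fl i] (evl_one _ _ _) erefl) => // b pb _.
have [a1 [a2 [[s1 s2 s3 s4] hw]]] := far_square (l := Fl i) (l' := Fl j) hf pb.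
have p1 : spath [:: Fl j] (sval a) = Some (sval a1) by rewrite /= s1.
have p2 : spath [:: Fl j] (sval a2) = Some (sval b) by rewrite /= s4.
have q1 : spath [:: Fl i] (sval a) = Some (sval a2) by rewrite /= s3.
have q2 : spath [:: Fl i] (sval a1) = Some (sval b) by rewrite /= s2.
have d1 := @ev_gen false _ _ (SDot i) q1 q1 isT; have d2 := @ev_gen false _ _ (SDot i) q2 q2 isT.
have f1 := ev_id false p1; have f2 := ev_id false p2.
have hff : all (far (sidx (Fl j))) (gidx (SDot i)) by rewrite /= hf'.
have gX := @simg_good R K n d (SDot i) a1 b isT.
rewrite (simg_sact false hff s1) in d2 gX.
move: (simg false _ _) d1 d2 (@farD_near (Fl j) a (SDot i)) gX => X d1 d2 hD gX.
do 4!eexists; exists (dg 1 1), sone; split.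
- exact: ev_V (ev_tau_far _ hf pb) (ev_H d2 f1).
- exact: ev_V (ev_H f2 d1) (ev_tau_far _ hf pb).
- have pF : wpath (S := schur_sig n d) [:: Fl i] a1 b by apply/spathP.
  have {}gX := gX pF pF; rewrite /= !cats0 (@web_far (Fl j) (Fl i) _ _ hf' s1) in gX.
  have pb' := pb; rewrite (@spath_far (Fl i) (Fl j)) // in pb'.
  have {}hD : farD (web (Fl j) (sval a)) X.2.
    apply: hD => //; first by rewrite /gtyped q1 /= eqxx.
    by have /andP[] := sact_range s1.
  rewrite /fW (webw_far2 (l := Fl i) (l' := Fl j) hf pb) (webw_far2 (l := Fl j) (l' := Fl i) hf' pb').
  rewrite /= !cats0 sval_one (@web_far (Fl i) (Fl j) _ _ hf s3).
  have hw' : farw (web (Fl j) (sval a)) (web (Fl i) (sval a)) by rewrite farwC.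
  exact: (exch_natural_r K hD hw' gX (fpath_web s1)).
by rewrite tau_deg_far // !smulr1 !smul1; apply: seqs_refl.
Qed.

Lemma spath_move l w (a a1 b : seq nat) : all (fun x => far (sidx l) (sidx x)) w ->
  sact l a = Some a1 -> spath w a1 = Some b -> exists a' : seq nat,
  [/\ spath w a = Some a', sact l a' = Some b, webw w a1 = webw w a & web l a' = web l a].
Proof.
move=> + s1; elim: w b => [|x w IH] b; first by move=> _ [<-]; exists a.
move=> /= /andP[hx hw]; case e: (spath w a1) => [b1|] //= s2.
have [a' [-> s3 -> e1]] := IH _ hw e.
have [a2 s4 s5] := sact_comm hx s3 s2.
have hx' : far (sidx x) (sidx l) by rewrite farC.
exists a2; rewrite /= s4 s5; split=> //; first by rewrite (web_far hx s3).
by rewrite (web_far hx' s4).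
Qed.

Lemma spath_move_r l w (a a' b : seq nat) : all (fun x => far (sidx l) (sidx x)) w ->
  spath w a = Some a' -> sact l a' = Some b -> exists a1 : seq nat,
  [/\ sact l a = Some a1, spath w a1 = Some b, webw w a1 = webw w a & web l a' = web l a].
Proof.
elim: w a' b => [|x w IH] a' b; first by move=> _ [<-]; exists b.
move=> /= /andP[hx hw]; case e: (spath w a) => [b1|] //= s2 s3.
have hx' : far (sidx x) (sidx l) by rewrite farC.
have [c s4 s5] := sact_comm hx' s2 s3.
have [a1 [h1 h2 h3 h4]] := IH _ _ hw e s4.
exists a1; rewrite h2 /= s5 h3; split=> //; first by rewrite (web_far hx s4).
by rewrite (web_far hx' s2).
Qed.

Lemma farw_webw l w (a b : seq nat) : all (fun x => far (sidx l) (sidx x)) w -> (0 < sidx l)%N ->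
  spath w a = Some b -> farw (web l a) (webw w a).
Proof.
move=> hw hl; elim: w b hw => [|x w IH] b /=; first by move=> _ _; apply/allP.
case/andP => hx hw; case e: (spath w a) => [b1|] //= s1.
have {}IH := IH _ hw e; apply/allP => k hk; rewrite all_cat.
rewrite (allP IH k hk) andbT.
have ew : web l b1 = web l a.
  elim: w hw b1 e {IH s1} => [|y w IH] /=; first by move=> _ ? [<-].
  case/andP=> hy hw b1; case e: (spath w a) => [b2|] //= s1.
  have hy' : far (sidx y) (sidx l) by rewrite farC.
  by rewrite (web_far hy' s1) (IH hw _ e).
rewrite -ew in hk; have /andP[hx0 _] := sact_range s1.
exact: (allP (farw_web b1 hl hx0 hx) k hk).
Qed.

End Far.

End FarRelations.
Import FarRelations.

(** * Braid relations with a distant index *)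

Module FarBraids.

Section ExchMid.
Variables (R : comPzRingType) (K : ground R) (d : nat).
Local Notation fpath := (@wpath (foam_sig d)).
Local Notation cv := (@cv R K d).

Lemma cv_between A B u v w x q D1 D D' D2 : good A B u v 0 D1 -> cv A B v w q D D' ->
  good A B w x 0 D2 -> cv A B u x q (D1 ++ D ++ D2) (D1 ++ D' ++ D2).
Proof.
move=> g1 c g2; exact: cv_0cat (cv_refl K g1) (cv_cat0 c (cv_refl K g2)).
Qed.

(** Naturality for a strand bundle that lies between the two parts of the source and of the target:
    the case of [w] on the left is conjugated by [exch ui w] and [exch vi w]. *)
Lemma exch_mid (A C B : flam d) w ui uk vi vk p D :
  good A C (ui ++ uk) (vk ++ vi) p D -> fpath w C B -> farD w D -> farw w (ui ++ uk) ->
  cv A B (ui ++ w ++ uk) (vk ++ w ++ vi) p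
    (exch ui w ++ shl (size w) D ++ exch w vk)
    (shl (size ui) (exch w uk) ++ D ++ shl (size vk) (exch vi w)).
Proof.
move=> gD pw hD hu; have nat_ := exch_natural K hD hu gD pw.
have hv : farw w (vk ++ vi).
  apply/allP => x xw; case: gD => _ <- _; apply: far_wrun; [exact: (allP hD)|exact: (allP hu)].
have fl (s t : seq wlet) : farw w (s ++ t) -> farw w s /\ farw w t.
  by move=> h; split; apply/allP => x /(allP h); rewrite all_cat => /andP[].
have [hui huk] := fl _ _ hu; have [hvk hvi] := fl _ _ hv.
have huiw : farw ui w by rewrite farwC.
have [pu pv] := good_path K gD.
have pwu := path_cat pw pu; have pwv := path_cat pw pv.
have cu := exch_catr K pwu hu; have cvv := exch_catr K pwv hv.
have gwu := exch_good K pwu hu; have gwv := exch_good K pwv hv.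
have pwu' : fpath ((w ++ ui) ++ uk) A B by rewrite -catA.
have [A1 puk pwui] := path_catP pwu'.
have gwui := exch_good K pwui hui.
have [_ puiw] := good_path K gwui.
have guiw := exch_good K puiw huiw.
have g1 : good A B (ui ++ w ++ uk) (w ++ ui ++ uk) 0 (exch ui w).
  by have := good_whiskr puk guiw; rewrite -!catA.
have inv1 := cv_whiskr puk (exch_inv K puiw huiw).
have [_ pvw] := good_path K gwv.
have pvw' : fpath (vk ++ vi ++ w) A B by move: pvw; rewrite catA.
have [C1 pviw pvk] := path_catP pvw'.
have hviw : farw vi w by rewrite farwC.
have gviw := exch_good K pviw hviw.
have [_ pwvi] := good_path K gviw.
have gwvi := exch_good K pwvi hvi.
have g2 := good_whiskl pvk gviw.
have inv2 := cv_whiskl pvk (exch_inv K pwvi hvi).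
have g2' := good_whiskl pvk gwvi.
have g3 : good A B (w ++ vk ++ vi) (vk ++ w ++ vi) 0 (exch w vk).
  have [C2 pvi pwvk] := @path_catP d (w ++ vk) vi A B (eq_ind _ (fun z => fpath z A B) pwv _ (catA _ _ _)).
  by have := good_whiskr pvi (exch_good K pwvk hvk); rewrite -!catA.
have gTw := good_whiskl pw gD.
have [_ g67] := cv_good nat_; have [x [q [q' [g6 gDw eq]]]] := good_catP g67.
have ex : x = (ui ++ uk) ++ w by case: g6 gwu => _ <- _ [_ <- _].
have eq0 : q = 0 by case: g6 gwu => _ _ <- [_ _ <-].
subst x q; rewrite addr0 in eq; subst q'.
rewrite -!catA in gwv gwu gDw nat_ cu cvv gTw g1.
have cM := cv_trans (cv_sym (cv_cat0 (cv_refl K gTw) cvv)) (cv_trans nat_ (cv_0cat cu (cv_refl K gDw))).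
have c1 := cv_between g1 cM g2.
have gL := good_cat (good_cat g1 gTw) g3.
rewrite !addr0 ?add0r in gL.
have c2 := cv_cat0 (cv_refl K gL) inv2.
have puwk : fpath (ui ++ w ++ uk) A B by move: puiw => /(fun h => path_cat h puk); rewrite -catA.
have [A2 pwuk pui] := path_catP puwk.
have gE7 := good_whiskl pui (exch_good K pwuk huk).
have gR := good_cat (good_cat gE7 gDw) g2.
rewrite -!catA in inv1.
have c3 := cv_0cat inv1 (cv_refl K gR).
rewrite ?addr0 ?add0r in c3.
move: c1 c2 c3; rewrite !shl_cat /= ?cats0 -!catA => c1 c2 c3.
exact: cv_trans (cv_sym c2) (cv_trans c1 c3).
Qed.

Lemma exch_natural_cat (A C B : flam d) w u1 u2 v1 v2 p D : farD w D -> farw w (u1 ++ u2) ->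
  good A C (u1 ++ u2) (v1 ++ v2) p D -> fpath w C B ->
  cv A B (w ++ u1 ++ u2) ((v1 ++ v2) ++ w) p
    (exch w u1 ++ shl (size u1) (exch w u2) ++ D)
    (shl (size w) D ++ exch w v1 ++ shl (size v1) (exch w v2)).
Proof.
move=> hD hu gD pw; have nat_ := exch_natural K hD hu gD pw.
have hv : farw w (v1 ++ v2).
  apply/allP => x xw; case: gD => _ <- _; apply: far_wrun; [exact: (allP hD)|exact: (allP hu)].
have [pu pv] := good_path K gD.
have cu := exch_catr K (path_cat pw pu) hu.
have cvv := exch_catr K (path_cat pw pv) hv.
have gwu := exch_good K (path_cat pw pu) hu.
have [_ g67] := cv_good nat_; have [x [q [q' [g6 gDw eq]]]] := good_catP g67.
have ex : x = (u1 ++ u2) ++ w by case: g6 gwu => _ <- _ [_ <- _].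
have eq0 : q = 0 by case: g6 gwu => _ _ <- [_ _ <-].
subst x q; rewrite addr0 in eq; subst q'.
have gTw := good_whiskl pw gD.
rewrite -!catA in nat_ cu cvv gDw gTw *.
have c1 := cv_0cat cu (cv_refl K gDw).
have c2 := cv_cat0 (cv_refl K gTw) cvv.
rewrite -!catA in c1 c2.
exact: cv_trans (cv_sym c1) (cv_trans (cv_sym nat_) c2).
Qed.

End ExchMid.

Section Braids.
Variables (R : comPzRingType) (K : ground R) (n d : nat).
Local Notation mu := (bichar K).
Local Notation fpath := (@wpath (foam_sig d)).
Implicit Types a b : lam n d.
Local Notation ul := (@underline n d).
Local Notation raw_lin := (@raw_lin R K n d).
Local Notation respected := (@respected R K n d).
Local Notation cv := (@cv R K d).
Local Notation tau i j := (stau R n d i j).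
Local Notation F i := (sid R n d [:: Fl i]).

(* [moves w a b]: the word [w] is a path from [a] to [b] *)
Definition moves (w : seq slet) a b : Prop := spath w (sval a) = Some (sval b).

Lemma moves1 l a b : moves [:: l] a b <-> sact l (sval a) = Some (sval b).
Proof. by []. Qed.

Lemma moves_cat u v a b : moves (u ++ v) a b -> exists2 c, moves v a c & moves u c b.
Proof.
rewrite /moves spath_cat; case e: (spath v _) => [s|] //= h.
have [c pc ec] := spath_exists e; exists c; rewrite ec //.
Qed.

Lemma moves_trans u v a b c : moves v a c -> moves u c b -> moves (u ++ v) a b.
Proof. by rewrite /moves spath_cat => ->. Qed.

Lemma moves_fun w a b b' : moves w a b -> moves w a b' -> b = b'.
Proof. by rewrite /moves => -> [/lam_eq]. Qed.

Lemma moves_inj l a a' b : moves [:: l] a b -> moves [:: l] a' b -> a = a'.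
Proof.
have flip x (c c' : lam n d) : moves [:: x] c c' ->
    schur_step (match x with Fl i => El i | El i => Fl i end) c' c.
  by rewrite moves1 => /schur_stepP; case: x.
by move=> /flip h /flip h'; apply: step_fun h h'.
Qed.

Lemma moves_in l w a a1 b : all (fun x => far (sidx l) (sidx x)) w ->
  moves [:: l] a a1 -> moves w a1 b -> exists a',
  [/\ moves w a a', moves [:: l] a' b, webw w (sval a1) = webw w (sval a) &
      web l (sval a') = web l (sval a)].
Proof.
move=> hw h1 h2; have [s [e1 e2 e3 e4]] := spath_move hw h1 h2.
have [a' pa ea] := spath_exists e1; subst s.
by exists a'; split=> //; rewrite /moves /= e2.
Qed.

Lemma moves_out l w a a' b : all (fun x => far (sidx l) (sidx x)) w ->
  moves w a a' -> moves [:: l] a' b -> exists a1,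
  [/\ moves [:: l] a a1, moves w a1 b, webw w (sval a1) = webw w (sval a) &
      web l (sval a') = web l (sval a)].
Proof.
move=> hw h1 h2; have [s [e1 e2 e3 e4]] := spath_move_r hw h1 h2.
have [a1 pa ea] : exists2 a1, wpath (S := schur_sig n d) [:: l] a a1 & sval a1 = s.
  by apply: spath_exists.
by subst s; exists a1.
Qed.

Lemma moves_far l l' a b : far (sidx l) (sidx l') -> moves [:: l; l'] a b -> moves [:: l'; l] a b.
Proof. by move=> hf; rewrite /moves spath_far. Qed.

Lemma webw1 l (a : seq nat) : webw [:: l] a = web l a.
Proof. by rewrite /= cats0. Qed.

Local Notation T i j a := (simg false (sval a) (STau i j)).

Lemma ev_tau a b i j : moves [:: Fl i; Fl j] a b -> moves [:: Fl j; Fl i] a b ->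
  ev false (sval a) (mtau i j) =
  Some (MkEval (sval b) [:: Fl i; Fl j] [:: Fl j; Fl i] (T i j a).1 (T i j a).2).
Proof. by move=> h h'; apply: (@ev_gen false _ _ (STau i j)). Qed.

Lemma ev_left i j k a ak ai aik b :
  moves [:: Fl k] a ak -> moves [:: Fl i; Fl j] ak b -> moves [:: Fl j; Fl i] ak b ->
  moves [:: Fl i; Fl k] a aik -> moves [:: Fl k; Fl i] a aik -> moves [:: Fl j] aik b ->
  moves [:: Fl i] a ai -> moves [:: Fl j; Fl k] ai b -> moves [:: Fl k; Fl j] ai b ->
  ev false (sval a) (left_braid i j k) =
  Some (MkEval (sval b) [:: Fl i; Fl j; Fl k] [:: Fl k; Fl j; Fl i]
    (smul (smul (smul (T j k ai).1 sone) (smul sone (T i k a).1)) (smul (T i j ak).1 sone))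
    ((T i j ak).2 ++ ((shl (size (webw [:: Fl j] (sval aik))) (T i k a).2 ++ [::]) ++ (T j k ai).2))).
Proof.
move=> h1 h2 h3 h4 h5 h6 h7 h8 h9.
apply: ev_V (ev_V (ev_H (ev_tau h8 h9) (ev_id _ h7)) (ev_H (ev_id _ h6) (ev_tau h4 h5))) _.
exact: ev_H (ev_tau h2 h3) (ev_id _ h1).
Qed.

Lemma ev_right i j k a aj ajk aij b :
  moves [:: Fl j; Fl k] a ajk -> moves [:: Fl k; Fl j] a ajk -> moves [:: Fl i] ajk b ->
  moves [:: Fl j] a aj -> moves [:: Fl i; Fl k] aj b -> moves [:: Fl k; Fl i] aj b ->
  moves [:: Fl i; Fl j] a aij -> moves [:: Fl j; Fl i] a aij -> moves [:: Fl k] aij b ->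
  ev false (sval a) (right_braid i j k) =
  Some (MkEval (sval b) [:: Fl i; Fl j; Fl k] [:: Fl k; Fl j; Fl i]
    (smul (smul (smul sone (T i j a).1) (smul (T i k aj).1 sone)) (smul sone (T j k a).1))
    ((shl (size (webw [:: Fl i] (sval ajk))) (T j k a).2 ++ [::]) ++ ((T i k aj).2 ++
     (shl (size (webw [:: Fl k] (sval aij))) (T i j a).2 ++ [::])))).
Proof.
move=> h1 h2 h3 h4 h5 h6 h7 h8 h9.
apply: ev_V (ev_V (ev_H (ev_id _ h9) (ev_tau h7 h8)) (ev_H (ev_tau h5 h6) (ev_id _ h4))) _.
exact: ev_H (ev_id _ h3) (ev_tau h1 h2).
Qed.

Lemma T_far i j a : far i j -> T i j a = (sone, exch (web (Fl i) (sval a)) (web (Fl j) (sval a))).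
Proof.
by rewrite /far /simg => hf; rewrite !ifF //; apply/eqP; lia.
Qed.

Lemma T_sact l i j a b : far (sidx l) i -> far (sidx l) j -> moves [:: l] a b -> T i j b = T i j a.
Proof. by move=> h1 h2 h; apply: (simg_sact _ _ h); rewrite /= h1 h2. Qed.

Lemma T_good i j a b : moves [:: Fl i; Fl j] a b -> moves [:: Fl j; Fl i] a b ->
  good (ul a) (ul b) (webw [:: Fl i; Fl j] (sval a)) (webw [:: Fl j; Fl i] (sval a))
    (tau_deg i j) (T i j a).2.
Proof.
by move=> /spathP h /spathP h'; apply: (@simg_good R K n d (STau i j) a b isT h h').
Qed.

Lemma farD_tau l i j a b : far (sidx l) i -> far (sidx l) j -> (0 < sidx l)%N ->
  moves [:: Fl i; Fl j] a b -> moves [:: Fl j; Fl i] a b ->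
  farD (web l (sval a)) (T i j a).2.
Proof.
move=> h1 h2 hl m1 m2; case: (boolP (near_gen (STau i j))) => [hg|/= hg].
  apply: farD_near => //=; first by rewrite /gtyped m1 m2 eqxx.
  by rewrite h1 h2.
have hf : far i j by move: hg; rewrite /adjacent /far; lia.
have [c s1 s2] := moves_cat (u := [:: Fl i]) (v := [:: Fl j]) m1.
have [c' s3 s4] := moves_cat (u := [:: Fl j]) (v := [:: Fl i]) m2.
have /andP[hi _] := sact_range s3; have /andP[hj _] := sact_range s1.
rewrite T_far //; apply: farD_exch.
- exact: (@farw_web l (Fl i)).
- exact: (@farw_web l (Fl j)).
exact: (@farw_web (Fl i) (Fl j)).
Qed.

Lemma fpath_moves l a b : moves [:: l] a b -> fpath (web l (sval a)) (ul a) (ul b).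
Proof. exact: fpath_web. Qed.

(* [i], [j], [k] are such that one of them is far from the two others *)
Definition braid_respected (a : lam n d) i j k : Prop :=
  respected a ((tau j k \h F i) \v (F j \h tau i k) \v (tau i j \h F k))
    (Scale (mu (tau_deg j k) (tau_deg i j) * mu (tau_deg i k) (tau_deg i j)
            * mu (tau_deg j k) (tau_deg i k))
      ((F k \h tau i j) \v (tau i k \h F j) \v (F i \h tau j k))).

(** A crossing with a distant letter has degree 0, so the scalar of the relation is 1, and the
    coefficients of the two composites agree; once the intermediate weights are given, only the
    diagrams are left to compare. *)
Lemma braid_conv a i j k :
  (forall b, moves [:: Fl i; Fl j; Fl k] a b -> moves [:: Fl k; Fl j; Fl i] a b ->
   exists ak ai aik aj ajk aij, exists p,
   [/\ [/\ moves [:: Fl k] a ak, moves [:: Fl i; Fl j] ak b & moves [:: Fl j; Fl i] ak b],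
       [/\ moves [:: Fl i; Fl k] a aik, moves [:: Fl k; Fl i] a aik & moves [:: Fl j] aik b] /\
       [/\ moves [:: Fl i] a ai, moves [:: Fl j; Fl k] ai b & moves [:: Fl k; Fl j] ai b],
       [/\ moves [:: Fl j; Fl k] a ajk, moves [:: Fl k; Fl j] a ajk & moves [:: Fl i] ajk b] /\
       [/\ moves [:: Fl j] a aj, moves [:: Fl i; Fl k] aj b & moves [:: Fl k; Fl i] aj b] /\
       [/\ moves [:: Fl i; Fl j] a aij, moves [:: Fl j; Fl i] a aij & moves [:: Fl k] aij b],
       cv (ul a) (ul b) (fW a [:: Fl i; Fl j; Fl k]) (fW a [:: Fl k; Fl j; Fl i]) p
         ((T i j ak).2 ++ shl (size (web (Fl j) (sval aik))) (T i k a).2 ++ (T j k ai).2)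
         (shl (size (web (Fl i) (sval ajk))) (T j k a).2 ++ (T i k aj).2 ++
            shl (size (web (Fl k) (sval aij))) (T i j a).2) &
       (T i j ak).1 = (T i j a).1 /\ (T i k aj).1 = (T i k a).1 /\ (T j k ai).1 = (T j k a).1 ]) ->
  smul (smul (smu (tau_deg j k) (tau_deg i j)) (smu (tau_deg i k) (tau_deg i j)))
    (smu (tau_deg j k) (tau_deg i k)) = sone ->
  braid_respected a i j k.
Proof.
move=> main hmu; rewrite /braid_respected !sval_mu -!sval_mul hmu.
apply: (@mono_rel R K n d a (LM (left_braid i j k)) (LS sone (LM (right_braid i j k))) sone sone _ _
  [:: Fl i; Fl j; Fl k] [:: Fl k; Fl j; Fl i] (evl_one _ _ _) erefl) => // b h1 h2.
have [ak [ai [aik [aj [ajk [aij [p [[u1 u2 u3] [[u4 u5 u6] [u7 u8 u9]]]]]]]]]] := main b h1 h2.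
case=> [[v1 v2 v3] [[v4 v5 v6] [v7 v8 v9]]] hc [e1 [e2 e3]].
do 4!eexists; exists p, sone; split.
- exact: ev_left u1 u2 u3 u4 u5 u6 u7 u8 u9.
- exact: ev_right v1 v2 v3 v4 v5 v6 v7 v8 v9.
- by rewrite sval_one !cats0 !webw1.
rewrite e1 e2 e3; case: (T i j a).1 (T i k a).1 (T j k a).1 => [s1 x1 y1 p1 q1] [s2 x2 y2 p2 q2] [s3 x3 y3 p3 q3].
rewrite /seqs /=; do ?[apply/andP; split]; rewrite ?addbF; try lia.
all: apply/eqP; rewrite ?addn0 ?add0n; try ring.
Qed.

Lemma smu0 p : (smu 0 p = sone) * (smu p 0 = sone).
Proof. by split; rewrite /smu /= ?mul0r ?mulr0. Qed.

(** The letter F_k passes from the right end to the left end across the image of [tau i j]: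
    [exch_natural_r]. *)
Lemma braid_far3 a i j k : far i k -> far j k -> braid_respected a i j k.
Proof.
move=> hik hjk; have hki : far k i by rewrite farC.
have hkj : far k j by rewrite farC.
apply: braid_conv => [b h1 h2|]; last by rewrite (tau_deg_far hik) (tau_deg_far hjk) !smu0.
(* All intermediate weights of the two composites are obtained from the two given paths by moving
   the distant letter. *)
have [ak s1 m1] := moves_cat (u := [:: Fl i; Fl j]) (v := [:: Fl k]) h1.
have [a' m2 s2] := moves_cat (u := [:: Fl k]) (v := [:: Fl j; Fl i]) h2.
have hw1 : all (fun x => far (sidx (Fl k)) (sidx x)) [:: Fl i; Fl j] by rewrite /= hki hkj.
have hw2 : all (fun x => far (sidx (Fl k)) (sidx x)) [:: Fl j; Fl i] by rewrite /= hki hkj.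
have [a'' [m3 s3 W1 L1]] := moves_in hw1 s1 m1.
have ea := moves_inj s3 s2; subst a''.
have [ak' [s4 m4 W2 L2]] := moves_out hw2 m2 s2.
have ek := moves_fun s4 s1; subst ak'.
have [ai s5 s6] := moves_cat (u := [:: Fl j]) (v := [:: Fl i]) m2.
have [aj s7 s8] := moves_cat (u := [:: Fl i]) (v := [:: Fl j]) m3.
have [aik s9 s10] := moves_cat (u := [:: Fl j]) (v := [:: Fl i]) m4.
have [ajk s11 s12] := moves_cat (u := [:: Fl i]) (v := [:: Fl j]) m1.
have m5 : moves [:: Fl i; Fl k] a aik := moves_trans (u := [:: Fl i]) s1 s9.
have m6 := @moves_far (Fl i) (Fl k) _ _ hik m5.
have m7 : moves [:: Fl j; Fl k] a ajk := moves_trans (u := [:: Fl j]) s1 s11.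
have m8 := @moves_far (Fl j) (Fl k) _ _ hjk m7.
have s13 : moves [:: Fl k] ai aik.
  have [c c1 c2] := moves_cat (u := [:: Fl k]) (v := [:: Fl i]) m6.
  by rewrite (moves_fun s5 c1).
have s14 : moves [:: Fl k] aj ajk.
  have [c c1 c2] := moves_cat (u := [:: Fl k]) (v := [:: Fl j]) m8.
  by rewrite (moves_fun s7 c1).
have m9 : moves [:: Fl j; Fl k] ai b := moves_trans (u := [:: Fl j]) s13 s10.
have m10 := @moves_far (Fl j) (Fl k) _ _ hjk m9.
have m11 : moves [:: Fl i; Fl k] aj b := moves_trans (u := [:: Fl i]) s14 s12.
have m12 := @moves_far (Fl i) (Fl k) _ _ hik m11.
exists ak, ai, aik, aj, ajk, a', (tau_deg i j).
have Tk := @T_sact (Fl k) i j _ _ hki hkj s1.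
have wij : web (Fl j) (sval aik) = web (Fl j) (sval ai) := @web_far (Fl k) (Fl j) _ _ hkj s13.
have wji : web (Fl i) (sval ajk) = web (Fl i) (sval aj) := @web_far (Fl k) (Fl i) _ _ hki s14.
split=> //; first last.
  by rewrite Tk !(T_far _ hik) !(T_far _ hjk).
rewrite Tk !(T_far _ hik) !(T_far _ hjk) /= wij wji L1.
rewrite (@web_far (Fl i) (Fl k) _ _ hik s5) (@web_far (Fl j) (Fl k) _ _ hjk s7).
have hk0 : (0 < k)%N by have /andP[] := sact_range s1.
have hD := @farD_tau (Fl k) i j _ _ hki hkj hk0 m3 m2.
have wk : fpath (web (Fl k) (sval a)) (ul a) (ul ak) := fpath_moves s1.
have gT := T_good m1 m4; rewrite Tk W1 W2 in gT.
have hw : farw (web (Fl k) (sval a)) (webw [:: Fl i; Fl j] (sval a)).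
  exact: (@farw_webw (Fl k) _ _ _ hw1 hk0 m3).
have := exch_natural_r K hD hw gT wk.
have e1 : webw [:: Fl j; Fl i] (sval a) = web (Fl j) (sval ai) ++ web (Fl i) (sval a).
  by rewrite /= (s5 : sact _ _ = _) cats0.
have e2 : webw [:: Fl i; Fl j] (sval a) = web (Fl i) (sval aj) ++ web (Fl j) (sval a).
  by rewrite /= (s7 : sact _ _ = _) cats0.
rewrite /fW.
have -> : webw [:: Fl i; Fl j; Fl k] (sval a) = webw [:: Fl i; Fl j] (sval a) ++ web (Fl k) (sval a).
  by rewrite (@webw_cat [:: Fl i; Fl j] [:: Fl k] _ _ s1) W1 webw1.
have -> : webw [:: Fl k; Fl j; Fl i] (sval a) = web (Fl k) (sval a) ++ webw [:: Fl j; Fl i] (sval a).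
  by rewrite (@webw_cat [:: Fl k] [:: Fl j; Fl i] _ _ m2) webw1 L1.
by rewrite e1 e2 !exch_cat -!catA.
Qed.

(** The letter F_i passes from the left end to the right end across the image of [tau j k]:
    [exch_natural_cat]. *)
Lemma braid_far1 a i j k : far i j -> far i k -> braid_respected a i j k.
Proof.
move=> hij hik; have hji : far j i by rewrite farC.
have hki : far k i by rewrite farC.
apply: braid_conv => [b h1 h2|]; last by rewrite (tau_deg_far hik) (tau_deg_far hij) !smu0.
have [ai s1 m1] := moves_cat (u := [:: Fl k; Fl j]) (v := [:: Fl i]) h2.
have [a' m2 s2] := moves_cat (u := [:: Fl i]) (v := [:: Fl j; Fl k]) h1.
have hw1 : all (fun x => far (sidx (Fl i)) (sidx x)) [:: Fl k; Fl j] by rewrite /= hij hik.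
have hw2 : all (fun x => far (sidx (Fl i)) (sidx x)) [:: Fl j; Fl k] by rewrite /= hij hik.
have [a'' [m3 s3 W1 L1]] := moves_in hw1 s1 m1.
have ea := moves_inj s3 s2; subst a''.
have [ai' [s4 m4 W2 L2]] := moves_out hw2 m2 s2.
have ek := moves_fun s4 s1; subst ai'.
have [ak s5 s6] := moves_cat (u := [:: Fl j]) (v := [:: Fl k]) m2.
have [aj s7 s8] := moves_cat (u := [:: Fl k]) (v := [:: Fl j]) m3.
have [aik s9 s10] := moves_cat (u := [:: Fl j]) (v := [:: Fl k]) m4.
have [aij s11 s12] := moves_cat (u := [:: Fl k]) (v := [:: Fl j]) m1.
have m5 : moves [:: Fl k; Fl i] a aik := moves_trans (u := [:: Fl k]) s1 s9.
have m6 := @moves_far (Fl k) (Fl i) _ _ hki m5.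
have m7 : moves [:: Fl j; Fl i] a aij := moves_trans (u := [:: Fl j]) s1 s11.
have m8 := @moves_far (Fl j) (Fl i) _ _ hji m7.
have s13 : moves [:: Fl i] ak aik.
  have [c c1 c2] := moves_cat (u := [:: Fl i]) (v := [:: Fl k]) m6.
  by rewrite (moves_fun s5 c1).
have s14 : moves [:: Fl i] aj aij.
  have [c c1 c2] := moves_cat (u := [:: Fl i]) (v := [:: Fl j]) m8.
  by rewrite (moves_fun s7 c1).
have m9 : moves [:: Fl j; Fl i] ak b := moves_trans (u := [:: Fl j]) s13 s10.
have m10 := @moves_far (Fl j) (Fl i) _ _ hji m9.
have m11 : moves [:: Fl k; Fl i] aj b := moves_trans (u := [:: Fl k]) s14 s12.
have m12 := @moves_far (Fl k) (Fl i) _ _ hki m11.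
exists ak, ai, aik, aj, a', aij, (tau_deg j k).
have Tk := @T_sact (Fl i) j k _ _ hij hik s1.
have wij : web (Fl j) (sval aik) = web (Fl j) (sval ak) := @web_far (Fl i) (Fl j) _ _ hij s13.
have wji : web (Fl k) (sval aij) = web (Fl k) (sval aj) := @web_far (Fl i) (Fl k) _ _ hik s14.
split=> //; first last.
  by rewrite Tk !(T_far _ hik) !(T_far _ hij).
rewrite Tk !(T_far _ hik) !(T_far _ hij) /= wij wji L2.
rewrite (@web_far (Fl k) (Fl i) _ _ hki s5) (@web_far (Fl j) (Fl i) _ _ hji s7).
have hi0 : (0 < i)%N by have /andP[] := sact_range s1.
have hD := @farD_tau (Fl i) j k _ _ hij hik hi0 m2 m3.
have wi : fpath (web (Fl i) (sval a)) (ul a') (ul b) by rewrite -L1; apply: fpath_moves s2.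
have gT := T_good m2 m3.
have hw : farw (web (Fl i) (sval a)) (webw [:: Fl j; Fl k] (sval a)).
  exact: (@farw_webw (Fl i) _ _ _ hw2 hi0 m2).
have hv : farw (web (Fl i) (sval a)) (webw [:: Fl k; Fl j] (sval a)).
  exact: (@farw_webw (Fl i) _ _ _ hw1 hi0 m3).
have e1 : webw [:: Fl j; Fl k] (sval a) = web (Fl j) (sval ak) ++ web (Fl k) (sval a).
  by rewrite /= (s5 : sact _ _ = _) cats0.
have e2 : webw [:: Fl k; Fl j] (sval a) = web (Fl k) (sval aj) ++ web (Fl j) (sval a).
  by rewrite /= (s7 : sact _ _ = _) cats0.
rewrite e1 e2 in gT; rewrite e1 in hw.
have := exch_natural_cat K hD hw gT wi.
rewrite /fW.
have -> : webw [:: Fl i; Fl j; Fl k] (sval a) = web (Fl i) (sval a) ++ webw [:: Fl j; Fl k] (sval a).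
  by rewrite (@webw_cat [:: Fl i] [:: Fl j; Fl k] _ _ m2) webw1 L1.
have -> : webw [:: Fl k; Fl j; Fl i] (sval a) = webw [:: Fl k; Fl j] (sval a) ++ web (Fl i) (sval a).
  by rewrite (@webw_cat [:: Fl k; Fl j] [:: Fl i] _ _ s1) W1 webw1.
by rewrite e1 e2.
Qed.

(** The letter F_j stays in the middle while the image of [tau i k] passes on either side of it:
    [exch_mid]. *)
Lemma braid_far2 a i j k : far i j -> far j k -> braid_respected a i j k.
Proof.
move=> hij hjk; have hji : far j i by rewrite farC.
have hkj : far k j by rewrite farC.
apply: braid_conv => [b h1 h2|]; last by rewrite (tau_deg_far hij) (tau_deg_far hjk) !smu0.
have [ak s1 m1] := moves_cat (u := [:: Fl i; Fl j]) (v := [:: Fl k]) h1.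
have [ai s2 m2] := moves_cat (u := [:: Fl k; Fl j]) (v := [:: Fl i]) h2.
have m3 := @moves_far (Fl i) (Fl j) _ _ hij m1.
have m4 := @moves_far (Fl k) (Fl j) _ _ hkj m2.
have [aik s3 s4] := moves_cat (u := [:: Fl j]) (v := [:: Fl i]) m3.
have [aik' s5 s6] := moves_cat (u := [:: Fl j]) (v := [:: Fl k]) m4.
have e := moves_inj s6 s4; subst aik'.
have m5 : moves [:: Fl i; Fl k] a aik := moves_trans (u := [:: Fl i]) s1 s3.
have m6 : moves [:: Fl k; Fl i] a aik := moves_trans (u := [:: Fl k]) s2 s5.
have hw1 : all (fun x => far (sidx (Fl j)) (sidx x)) [:: Fl i; Fl k] by rewrite /= hji hjk.
have hw2 : all (fun x => far (sidx (Fl j)) (sidx x)) [:: Fl k; Fl i] by rewrite /= hji hjk.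
have [aj [s7 m7 W1 L1]] := moves_out hw1 m5 s4.
have [aj' [s8 m8 W2 L2]] := moves_out hw2 m6 s4.
have e := moves_fun s8 s7; subst aj'.
have [ajk s9 s10] := moves_cat (u := [:: Fl i]) (v := [:: Fl k]) m7.
have [aij s11 s12] := moves_cat (u := [:: Fl k]) (v := [:: Fl i]) m8.
have m9 : moves [:: Fl k; Fl j] a ajk := moves_trans (u := [:: Fl k]) s7 s9.
have m10 := @moves_far (Fl k) (Fl j) _ _ hkj m9.
have m11 : moves [:: Fl i; Fl j] a aij := moves_trans (u := [:: Fl i]) s7 s11.
have m12 := @moves_far (Fl i) (Fl j) _ _ hij m11.
have s13 : moves [:: Fl j] ak ajk.
  have [c c1 c2] := moves_cat (u := [:: Fl j]) (v := [:: Fl k]) m10.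
  by rewrite (moves_fun s1 c1).
have s14 : moves [:: Fl j] ai aij.
  have [c c1 c2] := moves_cat (u := [:: Fl j]) (v := [:: Fl i]) m12.
  by rewrite (moves_fun s2 c1).
exists ak, ai, aik, aj, ajk, aij, (tau_deg i k).
have Tj := @T_sact (Fl j) i k _ _ hji hjk s7.
split=> //; first last.
  by rewrite Tj !(T_far _ hij) !(T_far _ hjk).
rewrite Tj !(T_far _ hij) !(T_far _ hjk) /= L1.
rewrite (@web_far (Fl j) (Fl i) _ _ hji s13) (@web_far (Fl j) (Fl k) _ _ hjk s14).
rewrite (@web_far (Fl k) (Fl j) _ _ hkj s1) (@web_far (Fl i) (Fl j) _ _ hij s2).
have hj0 : (0 < j)%N by have /andP[] := sact_range s7.
have hD := @farD_tau (Fl j) i k _ _ hji hjk hj0 m5 m6.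
have wj : fpath (web (Fl j) (sval a)) (ul aik) (ul b) by rewrite -L1; apply: fpath_moves s4.
have gT := T_good m5 m6.
have hw : farw (web (Fl j) (sval a)) (webw [:: Fl i; Fl k] (sval a)).
  exact: (@farw_webw (Fl j) _ _ _ hw1 hj0 m5).
have e1 : webw [:: Fl i; Fl k] (sval a) = web (Fl i) (sval ak) ++ web (Fl k) (sval a).
  by rewrite /= (s1 : sact _ _ = _) cats0.
have e2 : webw [:: Fl k; Fl i] (sval a) = web (Fl k) (sval ai) ++ web (Fl i) (sval a).
  by rewrite /= (s2 : sact _ _ = _) cats0.
rewrite e1 e2 in gT; rewrite e1 in hw.
have := exch_mid K gT wj hD hw.
rewrite /fW.
have -> : webw [:: Fl i; Fl j; Fl k] (sval a) =
    web (Fl i) (sval ak) ++ web (Fl j) (sval a) ++ web (Fl k) (sval a).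
  rewrite (@webw_cat [:: Fl i; Fl j] [:: Fl k] _ _ s1) webw1 (webw_far2 (l := Fl i) (l' := Fl j) hij m1).
  by rewrite (@web_far (Fl k) (Fl j) _ _ hkj s1) -catA.
have -> : webw [:: Fl k; Fl j; Fl i] (sval a) =
    web (Fl k) (sval ai) ++ web (Fl j) (sval a) ++ web (Fl i) (sval a).
  rewrite (@webw_cat [:: Fl k; Fl j] [:: Fl i] _ _ s2) webw1 (webw_far2 (l := Fl k) (l' := Fl j) hkj m2).
  by rewrite (@web_far (Fl i) (Fl j) _ _ hij s2) -catA.
by [].
Qed.

End Braids.

End FarBraids.
Import FarBraids.

(** * Invertibility of sigma for distant indices, and all braid relations *)

Module FarSigma.

Section SigmaFoam.
Variables (R : comPzRingType) (K : ground R) (d : nat).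
Local Notation fpath := (@wpath (foam_sig d)).
Local Notation cv := (@cv R K d).

(** With unit [D] and counit [E] between [v] and [q], the left side is the crossing of [q] and [w]
    rotated by the adjunction. Sliding [w] through the counit cancels that crossing, turns it into
    the one of [w] and [v], and leaves a zigzag of scalar [k]. *)
Lemma sigma_foam (A A1 A2 B : flam d) w v q p p' k (D E : diag) :
  fpath v A A1 -> fpath w A1 B -> fpath w A A2 -> fpath v A2 B ->
  fpath q B A2 -> good B B [::] (v ++ q) p D -> good A A (q ++ v) [::] p' E ->
  farD w E -> farw w (q ++ v) ->
  conv K A2 B v v 0 k (D ++ shl (size v) E) [::] ->
  conv K A B (w ++ v) (v ++ w) 0 k
    (D ++ shl (size v) (exch q w) ++ shl (size v + size w) E) (exch w v).
Proof.
move=> v1 w1 w2 v2 q1 gD gE hE hw adj.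
have [hq hv] : farw w q /\ farw w v.
  by split; apply/allP => x /(allP hw); rewrite all_cat => /andP[].
have hqw : farw q w by rewrite farwC.
have n1 := exch_natural K hE hw gE w2.
have [pqv _] := good_path K gE.
have n2 := exch_catr K (path_cat w2 pqv) hw.
have pqw : fpath (q ++ w) A1 A2 := path_cat q1 w1.
have n3 := cv_whiskr v1 (exch_inv K pqw hqw).
have gqw := good_whiskr v1 (exch_good K pqw hqw).
have gwv := exch_good K (path_cat w1 v1) hv.
have [_ g67] := cv_good n1; have [x [r [r' [g6 g7 eq]]]] := good_catP g67.
have g6' := exch_good K (path_cat w2 pqv) hw.
have ex : x = (q ++ v) ++ w by case: g6 g6' => _ <- _ [_ <- _].
have eq0 : r = 0 by case: g6 g6' => _ _ <- [_ _ <-].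
subst x r; rewrite addr0 in eq; subst r'.
have gqwv := good_whiskl q1 gwv.
rewrite exch_nilr cats0 /= -!catA in n1 n2 n3 gqw g7.
have m1 := cv_0cat (cv_refl K gqw) (cv_trans n1 (cv_0cat n2 (cv_refl K g7))).
have m2 := cv_0cat n3 (cv_refl K (good_cat gqwv g7)).
rewrite ?addr0 -!catA /= in m1 m2.
have c1 := cv_whiskl v2 (cv_trans m1 m2).
have gD' := good_whiskr (path_cat w1 v1) gD.
rewrite -!catA in gD'.
have c3 := conv_cat (cv_refl K gD') c1.
have sw := cv_swapr K gD gwv.
rewrite -!catA in sw.
have adj' := conv_context w2 (erefl B : fpath [::] B B) adj.
rewrite /= !shl0 in adj'.
have [gA _ _] := (convP _ _ _ _ _ _ _ _ _).1 adj'.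
have [y [r [r' [h1 h2 er]]]] := good_catP gA.
have [_ gsw] := cv_good sw; have [y' [z [z' [h3 h4 ez]]]] := good_catP gsw.
have ey' : y' = v ++ w by case: h3 gwv => _ <- _ [_ <- _]; rewrite /= shl0.
subst y'.
have ey : y = v ++ q ++ v ++ w by case: h1 h4 => _ <- _ [_ <- _].
have er1 : r = p by case: h1 gD => _ _ <- [_ _ <-].
have er2 : r' = p' by case: h2 gE => _ _ <- [_ _ <-]; rewrite ddeg_shl.
subst y r r'.
have c4 := conv_cat sw (cv_refl K h2).
have c5 := conv_cat (cv_refl K gwv) adj'.
have e0 : p' + p = 0 by rewrite -er.
rewrite /= shl0 ?cats0 in c4 c5.
rewrite !shl_cat !shl_shl -?catA ?e0 ?size_cat ?add0r ?mulr1 in c3 c4 c5.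
have c6 := conv_trans c3 (conv_trans c4 c5).
by rewrite !mul1r in c6.
Qed.

End SigmaFoam.

Section SigmaFar.
Variables (R : comPzRingType) (K : ground R) (n d : nat).
Local Notation mu := (bichar K).
Local Notation fpath := (@wpath (foam_sig d)).
Implicit Types a b : lam n d.
Local Notation ul := (@underline n d).
Local Notation spr := (schur_pres K n d).
Local Notation strans := (@tr R spr (fpr K d) (@fW n d) (fG K (n := n) (d := d))).
Local Notation feq := (@eqv R mu (fpr K d)).
Local Notation raw_lin := (@raw_lin R K n d).
Local Notation respected := (@respected R K n d).
Local Notation conv := (conv K).
Local Notation styped := (@typed R (schur_sig n d)).

Lemma strans_exists a b u v p t : styped a b u v p t -> exists t', strans a b u v p t t'.
Proof. by move=> h; apply: tr_exists; exact: h. Qed.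

(** A relation already known to be respected is turned back into a conversion between the diagrams
    of its two sides. *)
Lemma respected_conv a b c1 t1 t2 u v p c D c' D' :
  respected a (raw_lin (LS c1 (LM t1))) (raw_lin (LM t2)) ->
  styped a b u v p (sraw_of R n d t1) -> styped a b u v p (sraw_of R n d t2) ->
  ev false (sval a) t1 = Some (MkEval (sval b) u v c D) ->
  ev false (sval a) t2 = Some (MkEval (sval b) u v c' D') ->
  conv (ul a) (ul b) (fW a u) (fW a v) p (sval_ K (smul (sinvs (smul c1 c)) c')) D D'.
Proof.
move=> hr y1 y2 e1 e2.
have pr t0 : styped a b u v p (sraw_of R n d t0) ->
    prune a (sraw_of R n d t0) = sraw_of R n d t0.
  move=> y; have : `[< exists b u v p, styped a b u v p (sraw_of R n d t0) >].
    by apply/asboolP; exists b, u, v, p.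
  by case: t0 y => *; rewrite /= ifT.
have [s1 h1] := strans_exists y1; have [s2 h2] := strans_exists y2.
have := hr b u v p; rewrite /= !pr // => /(_ _ _ (tr_scale _ h1) h2) e.
have [x1 [E1 [f1 g1 q1]]] := tr_ev h1; have [x2 [E2 [f2 g2 q2]]] := tr_ev h2.
move: f1 f2; rewrite e1 e2 => -[? ?] [? ?]; subst x1 E1 x2 E2.
apply/convP; split=> //.
have z1 := good_typed K g1; have z2 := good_typed K g2.
have sc c0 c3 t : @typed R (foam_sig d) (ul a) (ul b) (fW a u) (fW a v) p t ->
    feq (ul a) (ul b) (fW a u) (fW a v) p (Scale (sval_ K c0) (Scale (sval_ K c3) t))
      (Scale (sval_ K (smul c0 c3)) t).
  move=> y; rewrite sval_mul.
  exact: eqv_law (law_scaleA _ _ _) (typed_scale _ (typed_scale _ y)) (typed_scale _ y).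
have e3 := eqv_trans (eqv_sym (eqv_trans (eqv_scale _ q1) (sc _ _ _ z1))) (eqv_trans e q2).
have e4 := eqv_trans (eqv_scale (sval_ K (sinvs (smul c1 c))) e3) (sc _ _ _ z2).
apply: eqv_trans (eqv_sym _) e4.
apply: eqv_trans (eqv_law mu (law_scaleA _ _ _) (typed_scale _ (typed_scale _ z1)) (typed_scale _ z1)) _.
rewrite sval_inv; exact: eqv_law (law_scale1 _) (typed_scale 1 z1) z1.
Qed.

Lemma moves_flip j a b : moves [:: El j] a b -> moves [:: Fl j] b a.
Proof. by rewrite !moves1 => /schur_stepP h; apply/schur_stepP. Qed.

(** The scalar X^(1+lambda_{j+1}) Y^lambda_j of the adjunction relation for E_j at [a]. *)
Definition kappa (a : seq nat) j : mscal := MSc false (~~ odd (nw a j.+1)) (odd (nw a j)) 0 0.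

(** The zigzag is not straightened again: its scalar is read off from the image of the adjunction
    relation, [rel_adj_E]. *)
Lemma adj_conv a b j : moves [:: El j] a b -> exists k,
  conv (ul a) (ul b) (web (El j) (sval a)) (web (El j) (sval a)) 0 (sval_ K k)
    ((simg false (sval b) (SEta j)).2 ++
       shl (size (web (El j) (sval a))) (simg false (sval a) (SEps j)).2) [::] /\
  seqs (smul (smul (smul (simg false (sval a) (SEps j)).1 (simg false (sval b) (SEta j)).1)
     (kappa (sval a) j)) k) sone.
Proof.
move=> m; have m' := moves_flip m.
have pm : wpath (S := schur_sig n d) [:: El j] a b by apply/spathP.
have pb : moves [:: El j; Fl j] b b := moves_trans (u := [:: El j]) m' m.
have pa : moves [:: Fl j; El j] a a := moves_trans (u := [:: Fl j]) m m'.
have ppa : wpath (S := schur_sig n d) [:: Fl j; El j] a a by apply/spathP.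
have ppb : wpath (S := schur_sig n d) [:: El j; Fl j] b b by apply/spathP.
have x1 := @ev_gen false _ _ (SEta j) (erefl (Some (sval b))) pb isT.
have x2 := @ev_gen false _ _ (SEps j) pa (erefl (Some (sval a))) isT.
have x3 := ev_id false m.
have [_ hw] : (0 < j < n)%N /\ forall k : nat, (wt a k)%:Z = (wt b k)%:Z - alpha j k.
  by move: m; rewrite moves1 => /schur_stepP.
have hj := hw j; have hj1 := hw j.+1.
have al1 : alpha j j = 1 by rewrite /alpha eqxx; lia.
have al2 : alpha j j.+1 = -1 by rewrite /alpha eqxx; lia.
rewrite al1 in hj; rewrite al2 in hj1.
have hr := @rel_adj_E R K n d a j.
rewrite -sv_adj in hr.
have y2 : styped a b [:: El j] [:: El j] 0 (sraw_of R n d (mE j)) by apply: typed_id.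
have y1 : styped a b [:: El j] [:: El j] 0
   (sraw_of R n d (MV (MH (mE j) (MG (SEps j))) (MH (MG (SEta j)) (mE j)))).
  apply: (@typed_deg R spr _ _ _ _ ((0 + eps_deg a j) + (eta_deg b j + 0))).
    by rewrite /eps_deg /eta_deg addr0 add0r; congr pair; rewrite /=; lia.
  apply: (@typed_vc R (schur_sig n d) _ _ _ ([:: El j] ++ [:: Fl j; El j])).
    apply: (@typed_hc R (schur_sig n d) a a b [:: El j] [:: El j] [:: Fl j; El j] [::]); first exact: typed_id.
    by apply: typed_gen => //; constructor.
  apply: (@typed_hc R (schur_sig n d) a b b [::] [:: El j; Fl j] [:: El j] [:: El j]); last exact: typed_id.
  by apply: typed_gen => //; constructor.
have e1 := ev_V (ev_H x3 x2) (ev_H x1 x3).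
have := @respected_conv a b _ (MV (MH (mE j) (MG (SEps j))) (MH (MG (SEta j)) (mE j))) (mE j) _ _ _ _ _ _ _ hr y1 y2 e1 x3.
rewrite /fW webw1 /= !cats0 => hc.
eexists; split; first exact: hc.
rewrite -/(kappa _ _).
case: (simg false (sval b) (SEta j)).1 => s2 u2 v2 p2 q2.
rewrite /kappa -[nw _ j]/(wt a j) -[nw _ j.+1]/(wt a j.+1) /smul /sinvs /seqs /=.
move: (odd _) (odd _) => o1 o2; apply/and4P; split.
- by case: (s2).
- by case: (u2); case: (o2).
- by case: (v2); case: (o1).
by apply/eqP; lia.
Qed.

Lemma moves_swap l l' a b : far (sidx l) (sidx l') -> moves [:: l; l'] a b ->
  exists a1 a2, [/\ moves [:: l'] a a1, moves [:: l] a1 b, moves [:: l] a a2,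
     moves [:: l'] a2 b & farw (web l (sval a)) (web l' (sval a))].
Proof.
by move=> hf /(far_square hf)[a1 [a2 [[s1 s2 s3 s4] hw]]]; exists a1, a2; split.
Qed.

(** The image of sigma is the exchange of the two webs with scalar inverse to [kappa]; this is the
    origin of the value of [SInv i j] at distant indices. *)
Lemma sigma_conv a b i j : far i j -> moves [:: Fl i; El j] a b -> exists c D k,
  [/\ ev false (sval a) (msigma i j) = Some (MkEval (sval b) [:: Fl i; El j] [:: El j; Fl i] c D),
      conv (ul a) (ul b) (web (Fl i) (sval a) ++ web (El j) (sval a))
        (web (El j) (sval a) ++ web (Fl i) (sval a)) 0 (sval_ K k) D
        (exch (web (Fl i) (sval a)) (web (El j) (sval a))) &
      seqs (smul (smul c (kappa (sval a) j)) k) sone].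
Proof.
move=> hf m; have hji : far j i by rewrite farC.
have [a1 [a2 [s1 s2 s3 s4 hwv]]] := @moves_swap (Fl i) (El j) _ _ hf m.
have m' : moves [:: El j; Fl i] a b := moves_trans (u := [:: El j]) s3 s4.
have q1 := moves_flip s1; have q2 := moves_flip s4.
have pe : moves [:: El j; Fl j] b b := moves_trans (u := [:: El j]) q2 s4.
have pa : moves [:: Fl j; El j] a a := moves_trans (u := [:: Fl j]) s1 q1.
have pt : moves [:: Fl j; Fl i] a1 a2 := moves_trans (u := [:: Fl j]) s2 q2.
have pt' := @moves_far n d (Fl j) (Fl i) _ _ hji pt.
have x1 := @ev_gen false _ _ (SEta j) (erefl (Some (sval b))) pe isT.
have x2 := @ev_gen false _ _ (SEps j) pa (erefl (Some (sval a))) isT.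
have e1 := ev_H x1 (ev_id false m).
have e2 := ev_H (ev_H (ev_id false s4) (ev_tau pt pt')) (ev_id false s1).
have e3 := ev_H (ev_id false m') x2.
have e := ev_V (ev_V e3 e2) e1.
have [k [hc hk]] := adj_conv s4.
have ee : simg false (sval a2) (SEps j) = simg false (sval a) (SEps j).
  by apply: (@simg_sact (Fl i)) s3; rewrite /= hf.
have ev_ : web (El j) (sval a2) = web (El j) (sval a) := @web_far (Fl i) (El j) _ _ hf s3.
have ew : web (Fl i) (sval a1) = web (Fl i) (sval a).
  exact: (@web_far (El j) (Fl i) _ _ hji s1).
have eq : web (Fl j) (sval a1) = web (Fl j) (sval b).
  by rewrite (@web_far (Fl i) (Fl j) _ _ hf s2).
rewrite ee ev_ in hc hk.
do 3!eexists; split; first exact: e.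
- rewrite (T_far _ hji) /= ?(s3 : sact _ _ = _) ev_ ew eq !cats0 size_cat.
  have hi0 : (0 < i)%N by have /andP[] := sact_range s3.
  have hj0 : (0 < j)%N by have /andP[] := sact_range s1.
  have w1 : wpath (S := schur_sig n d) [::] a a by [].
  have w2 : wpath (S := schur_sig n d) [::] b b by [].
  have w3 : wpath (S := schur_sig n d) [:: Fl j; El j] a a by apply/spathP.
  have w4 : wpath (S := schur_sig n d) [:: El j; Fl j] b b by apply/spathP.
  have gD := @simg_good R K n d (SEta j) b b isT w2 w4.
  have gE := @simg_good R K n d (SEps j) a a isT w3 w1.
  have wD : webw (gtgt (SEta j)) (sval b) = web (El j) (sval a) ++ web (Fl j) (sval b).
    by rewrite /= (q2 : sact _ _ = _) ev_ cats0.
  have wE : webw (gsrc (SEps j)) (sval a) = web (Fl j) (sval b) ++ web (El j) (sval a).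
    by rewrite /= (s1 : sact _ _ = _) eq cats0.
  rewrite wD in gD; rewrite wE in gE.
  have hE : farD (web (Fl i) (sval a)) (simg false (sval a) (SEps j)).2.
    apply: farD_near => //=; last by rewrite hf.
    by rewrite /gtyped pa eqxx.
  have hq : farw (web (Fl i) (sval a)) (web (Fl j) (sval b) ++ web (El j) (sval a)).
    apply/allP => x hx; rewrite all_cat (allP hwv x hx) andbT -eq.
    by rewrite -ew in hx; apply: (allP (@farw_web (Fl i) (Fl j) (sval a1) hi0 hj0 hf) x hx).
  have v1 := fpath_moves s1; have v2 := fpath_moves s4; have u1 := fpath_moves s2.
  have u2 := fpath_moves s3; have t1 := fpath_moves q2.
  rewrite ev_ in v2; rewrite ew in u1.
  exact: (sigma_foam v1 u1 u2 v2 t1 gD gE hE hq hc).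
have ek : kappa (sval a2) j = kappa (sval a) j.
  have jd : (j != i) && (j != i.+1) && (j.+1 != i) && (j.+1 != i.+1) by move: hf; rewrite /far; lia.
  case/andP: jd => /andP[/andP[n1 n2] n3] n4.
  by rewrite /kappa !(nw_sact s3).
rewrite ek in hk; rewrite (T_far _ hji).
move: hk; move: (simg false (sval a) (SEps j)).1 (simg false (sval b) (SEta j)).1 => x y.
by rewrite !smul1 !smulr1.
Qed.

Lemma smulC c c' : smul c c' = smul c' c.
Proof.
case: c c' => [s1 x1 y1 p1 q1] [s2 x2 y2 p2 q2]; rewrite /smul /=.
by rewrite addbC [x1 (+) _]addbC [y1 (+) _]addbC [(p1 + _)%N]addnC [(q1 + _)%N]addnC.
Qed.

Lemma simg_sinv_far (a : seq nat) i j : far i j -> simg false a (SInv i j) =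
  (kappa a j, exch (web (El j) a) (web (Fl i) a)).
Proof. by rewrite /far /simg => hf; rewrite !ifF //; apply/eqP; lia. Qed.

Lemma fW_pair a b l l' : far (sidx l) (sidx l') -> moves [:: l; l'] a b ->
  fW a [:: l; l'] = web l (sval a) ++ web l' (sval a).
Proof. by move=> hf m; apply: webw_far2 hf m. Qed.

Lemma rel_sinv_l_far a i j : far i j ->
  respected a (sinv R n d i j \v sigma R n d i j) (sid R n d [:: Fl i; El j]).
Proof.
move=> hf; have hji : far j i by rewrite farC.
apply: (@mono_rel R K n d a (LM (MV (MG (SInv i j)) (msigma i j))) (LM (MI [:: Fl i; El j]))
  sone sone _ _ [:: Fl i; El j] [:: Fl i; El j] (evl_one _ _ _) (evl_one _ _ _)) => // b m _.
have [c [D [k [e hc hk]]]] := sigma_conv hf m.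
have m' := @moves_far n d (Fl i) (El j) _ _ hf m.
have x := @ev_gen false _ _ (SInv i j) m' m isT.
do 4!eexists; exists 0, k; split.
- exact: ev_V x e.
- exact: ev_id.
- rewrite simg_sinv_far // (@fW_pair a b (Fl i) (El j) hf m).
  have [_ g _] := (convP _ _ _ _ _ _ _ _ _).1 hc.
  have [pw _] := good_path K g.
  have hwv : farw (web (Fl i) (sval a)) (web (El j) (sval a)).
    by have [a1 [a2 [_ _ _ _ h]]] := @moves_swap (Fl i) (El j) _ _ hf m.
  have hvw : farw (web (El j) (sval a)) (web (Fl i) (sval a)) by rewrite farwC.
  have g' := exch_good K (good_path K g).2 hvw.
  have := conv_trans (conv_cat hc (cv_refl K g')) (exch_inv K pw hwv).
  by rewrite addr0 mul1r mulr1.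
by rewrite simg_sinv_far // !smul1 [smul _ c]smulC.
Qed.

Lemma rel_sinv_r_far a i j : far i j ->
  respected a (sigma R n d i j \v sinv R n d i j) (sid R n d [:: El j; Fl i]).
Proof.
move=> hf; have hji : far j i by rewrite farC.
apply: (@mono_rel R K n d a (LM (MV (msigma i j) (MG (SInv i j)))) (LM (MI [:: El j; Fl i]))
  sone sone _ _ [:: El j; Fl i] [:: El j; Fl i] (evl_one _ _ _) (evl_one _ _ _)) => // b m' _.
have m := @moves_far n d (El j) (Fl i) _ _ hji m'.
have [c [D [k [e hc hk]]]] := sigma_conv hf m.
have x := @ev_gen false _ _ (SInv i j) m' m isT.
do 4!eexists; exists 0, k; split.
- exact: ev_V e x.
- exact: ev_id.
- rewrite simg_sinv_far // (@fW_pair a b (El j) (Fl i) hji m').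
  have [_ g _] := (convP _ _ _ _ _ _ _ _ _).1 hc.
  have hwv : farw (web (Fl i) (sval a)) (web (El j) (sval a)).
    by have [a1 [a2 [_ _ _ _ h]]] := @moves_swap (Fl i) (El j) _ _ hf m.
  have hvw : farw (web (El j) (sval a)) (web (Fl i) (sval a)) by rewrite farwC.
  have [_ pw] := good_path K g; have g' := exch_good K pw hvw.
  have := conv_trans (conv_cat (cv_refl K g') hc) (exch_inv K pw hvw).
  by rewrite addr0 !mulr1.
by rewrite simg_sinv_far // !smul1.
Qed.

Lemma braids_checked : [&& f_check f_braid_1_1_1, f_check f_braid_1_1_2, f_check f_braid_1_2_2, f_check f_braid_2_1_1, f_check f_braid_2_2_1, f_check f_braid_1_2_3, f_check f_braid_1_3_2, f_check f_braid_2_1_3, f_check f_braid_2_3_1, f_check f_braid_3_1_2, f_check f_braid_3_2_1 & true].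
Proof. by vm_compute. Qed.

Lemma rel_braid a i j k : ~~ ((i == k) && adjacent i j) -> braid_respected K a i j k.
Proof.
move=> hik.
case: (boolP (far i j && far i k)) => [/andP[h1 h2]|n1]; first exact: braid_far1.
case: (boolP (far i j && far j k)) => [/andP[h1 h2]|n2]; first exact: braid_far2.
case: (boolP (far i k && far j k)) => [/andP[h1 h2]|n3]; first exact: braid_far3.
(* No index is distant from both others, so all three lie among [m], [m + 1], [m + 2]; with the
   Serre patterns excluded, eleven remain. *)
pose m := minn i (minn j k).
have main q1 q2 q3 l fk : f_check (constant_family fk.+1 (r_braid q1 q2 q3) l) ->
    [&& 0 < fk, 0 < q1, 0 < q2, 0 < q3 & all (fun j => j \in [:: q1; q2; q3]) (iota 1 fk)]%N ->
    (i == (m + q1).-1) && (j == (m + q2).-1) && (k == (m + q3).-1) -> braid_respected K a i j k.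
  move=> hf hq /andP[/andP[/eqP ei /eqP ej] /eqP ek].
  rewrite ei ej ek; exact: (@braid_near R K n d a m (q1, q2, q3) fk l hf hq).
have [q1 [q2 [q3 /andP[hm hq]]]] : exists q1 q2 q3,
    (i == (m + q1).-1) && (j == (m + q2).-1) && (k == (m + q3).-1) && ((q1, q2, q3) \in
    [:: (1, 1, 1); (1, 1, 2); (1, 2, 2); (2, 1, 1); (2, 2, 1); (1, 2, 3); (1, 3, 2);
        (2, 1, 3); (2, 3, 1); (3, 1, 2); (3, 2, 1)]%N).
  have [x [y [z [ei ej ek em]]]] : exists x y z,
      [/\ i = m + x, j = m + y, k = m + z & [|| x == 0, y == 0 | z == 0]]%N.
    by exists (i - m)%N, (j - m)%N, (k - m)%N; rewrite /m; split; lia.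
  clear main; clearbody m; subst i j k.
  have fm u v : far (m + u) (m + v) = far u v by rewrite /far -!addnS !leq_add2l.
  rewrite !fm in n1 n2 n3; rewrite /adjacent -!addnS !eqn_add2l in hik.
  exists x.+1, y.+1, z.+1; rewrite !addnS /= !eqxx /=.
  move: n1 n2 n3 hik em; rewrite /far.
  by case: x => [|[|[|x]]]; case: y => [|[|[|y]]]; case: z => [|[|[|z]]].
have /andP[k111 /andP[k112 /andP[k122 /andP[k211 /andP[k221 /andP[k123 /andP[k132 /andP[k213 /andP[k231 /andP[k312 /andP[k321 _]]]]]]]]]]] := braids_checked.
have c111 := main 1%N 1%N 1%N _ 1%N k111 isT.
have c112 := main 1%N 1%N 2%N _ 2%N k112 isT.
have c122 := main 1%N 2%N 2%N _ 2%N k122 isT.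
have c211 := main 2%N 1%N 1%N _ 2%N k211 isT.
have c221 := main 2%N 2%N 1%N _ 2%N k221 isT.
have c123 := main 1%N 2%N 3%N _ 3%N k123 isT.
have c132 := main 1%N 3%N 2%N _ 3%N k132 isT.
have c213 := main 2%N 1%N 3%N _ 3%N k213 isT.
have c231 := main 2%N 3%N 1%N _ 3%N k231 isT.
have c312 := main 3%N 1%N 2%N _ 3%N k312 isT.
have c321 := main 3%N 2%N 1%N _ 3%N k321 isT.
rewrite !inE in hq; do ?[case/orP: hq => hq]; move: hq => /eqP[? ? ?]; subst q1 q2 q3.
all: first [exact: (c111 hm) | exact: (c112 hm) | exact: (c122 hm) | exact: (c211 hm) | exact: (c221 hm) | exact: (c123 hm) | exact: (c132 hm) | exact: (c213 hm) | exact: (c231 hm) | exact: (c312 hm) | exact: (c321 hm)].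
Qed.

End SigmaFar.

End FarSigma.
Import FarSigma.

(** * Recognition of the prescribed images *)

Module Recognition.

Section Exchange.
Variables (R : comPzRingType) (d : nat).

Lemma fslide_flat k w : [/\ wf (fslide R d k w), rsrc (fslide R d k w) = k :: w,
  rtgt (fslide R d k w) = rcons w k & flat (fslide R d k w) = slide k w].
Proof. by elim: w => //= l w [h1 h2 h3 h4]; rewrite h2 h3 h4 cats0. Qed.

Lemma fexchange_flat u v : [/\ wf (fexchange R d u v), rsrc (fexchange R d u v) = u ++ v,
  rtgt (fexchange R d u v) = v ++ u & flat (fexchange R d u v) = exch u v].
Proof.
elim: u => [|k u [h1 h2 h3 h4]] /=; first by rewrite cats0.
have [g1 g2 g3 g4] := fslide_flat k v.
by rewrite h2 h3 h4 g2 g3 g4 cats0 cat_rcons.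
Qed.

End Exchange.

Section Images.
Variables (R : comPzRingType) (K : ground R) (n d : nat).
Local Notation mu := (bichar K).
Implicit Types a b : lam n d.
Local Notation ul := (@underline n d).
Local Notation feq := (@eqv R mu (fpr K d)).
Local Notation fraw := (raw R (foam_sig d)).

Lemma foam_webE a l w : foam_web a l w -> w = web l (sval a).
Proof.
by case=> i; rewrite /wt2 /web /= -![nw (sval a) _]/(wt a _) => -[-> ->].
Qed.

Lemma odd_count (s : seq nat) : small s -> odd (count (fun x => x == 1%N) s) = odd (sumn s).
Proof.
elim: s => //= x s IH /andP[hx /IH e]; rewrite !oddD e.
by case: x hx => [|[|[|x]]].
Qed.

(** As (-XY)^2 = 1, only the parity of the number of ones counts, and it is the parity of the
    partial sum because entries are at most 2. *)
Lemma Gam_gam a i : Gam K a i = sval_ K (gam false (sval a) i).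
Proof.
have hs : small (take i (sval a)).
  by apply/allP => x /mem_take; apply: (allP (lam_small a)).
rewrite /Gam /gam addFb -odd_count //; set k := count _ _.
have e : (- (gX K * gY K)) * (- (gX K * gY K)) = 1 :> R.
  by rewrite mulrNN mulrACA gXX gYY mulr1.
rewrite -[in LHS](odd_double_half k) exprD -mul2n exprM expr2 e expr1n mulr1.
by case: (odd k); rewrite /sval_ /= ?expr0 ?expr1; ring.
Qed.

(** The prescribed values are terms while the functor is built from diagrams: equality of
    flattenings, together with the scalar, identifies them. *)
Lemma image_eqv a b g u v p c t : schur_gbd g a u v p ->
  wpath (S := schur_sig n d) u a b -> wpath (S := schur_sig n d) v a b ->
  wf t -> rsrc t = fW a u -> flat t = (simg false (sval a) g).2 ->
  sval_ K (simg false (sval a) g).1 = c ->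
  feq (ul a) (ul b) (fW a u) (fW a v) p (fG K a g) (Scale c t).
Proof.
move=> hg pu pv wt_ rt ft <-; case/schur_gbdP: hg => hok eu ev_ ep; subst u v p.
have gg := @simg_good R K n d g a b hok pu pv; rewrite -[webw (gsrc g) _]/(fW a (gsrc g)) -rt -ft in gg.
have [_ tt] := wf_typed K wt_ gg.
have [_ _ _ _ e] := flat_sound K tt (wf_mono wt_).
by rewrite /fG -ft -rt; apply: eqv_scale (eqv_sym e).
Qed.

Lemma image_eqv1 a b g u v p t : schur_gbd g a u v p ->
  wpath (S := schur_sig n d) u a b -> wpath (S := schur_sig n d) v a b ->
  wf t -> rsrc t = fW a u -> flat t = (simg false (sval a) g).2 ->
  (simg false (sval a) g).1 = sone ->
  feq (ul a) (ul b) (fW a u) (fW a v) p (fG K a g) t.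
Proof.
move=> hg pu pv wt_ rt ft ec; have := image_eqv hg pu pv wt_ rt ft (congr1 (sval_ K) ec).
rewrite sval_one => e; apply: eqv_trans (e) _; have /eqv_typed[_ y] := e.
have [_ y'] : exists c : R, @typed R (foam_sig d) (ul a) (ul b) (fW a u) (fW a v) p t.
  case/schur_gbdP: hg => hok eu ev_ ep; subst u v p.
  have gg := @simg_good R K n d g a b hok pu pv; rewrite -[webw (gsrc g) _]/(fW a (gsrc g)) -rt -ft in gg.
  by have [_ tt] := wf_typed K wt_ gg; exists 1; rewrite -rt.
exact: eqv_law (law_scale1 _) y y'.
Qed.

Lemma window2 a i x y : (0 < i < n)%N -> wt2 a i = (x, y) ->
  exists l1 l2 : seq nat, [/\ sval a = l1 ++ [:: x; y] ++ l2, (size l1 + 1)%N = i &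
    col a i = (sumn l1 + 1)%N].
Proof.
move=> hi [ex ey]; have [||l1 [a0 [l2 [ea s1 s0 _]]]] := @frame n d a i 2; try lia.
case: a0 s0 ea => [|x' [|y' [|]]] // _ ea.
have e1 := @nw_ctx l1 l2 [:: x'; y'] 1 isT; have e2 := @nw_ctx l1 l2 [:: x'; y'] 2 isT.
have c1 := @cl_ctx l1 l2 [:: x'; y'] 1 isT.
have hs : (size l1 + 1)%N = i by lia.
rewrite -ea hs -[nw _ i]/(wt a i) ex in e1.
rewrite -ea (_ : (size l1 + 2)%N = i.+1) -?[nw _ i.+1]/(wt a i.+1) ?ey in e2; last by lia.
rewrite -ea hs in c1.
by exists l1, l2; split=> //; rewrite ?[LHS]c1 // ea e1 e2.
Qed.

Lemma window3 a i x y z : (0 < i.-1)%N -> (i < n)%N -> wt3 a i = (x, y, z) ->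
  exists l1 l2 : seq nat, [/\ sval a = l1 ++ [:: x; y; z] ++ l2, (size l1 + 1)%N = i.-1,
    (size l1 + 2)%N = i & col a i = (sumn l1 + (1 + x))%N].
Proof.
move=> hi hn [ex ey ez]; have [||l1 [a0 [l2 [ea s1 s0 _]]]] := @frame n d a i.-1 3; try lia.
case: a0 s0 ea => [|x' [|y' [|z' [|]]]] // _ ea.
have e1 := @nw_ctx l1 l2 [:: x'; y'; z'] 1 isT; have e2 := @nw_ctx l1 l2 [:: x'; y'; z'] 2 isT.
have e3 := @nw_ctx l1 l2 [:: x'; y'; z'] 3 isT.
have c1 := @cl_ctx l1 l2 [:: x'; y'; z'] 2 isT.
have hs1 : (size l1 + 1)%N = i.-1 by lia.
have hs : (size l1 + 2)%N = i by lia.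
rewrite -ea hs1 -[nw _ i.-1]/(wt a i.-1) ex in e1.
rewrite -ea hs -[nw _ i]/(wt a i) ey in e2.
rewrite -ea (_ : (size l1 + 3)%N = i.+1) -?[nw _ i.+1]/(wt a i.+1) ?ez in e3; last by lia.
rewrite -ea hs in c1.
exists l1, l2; split=> //; first by rewrite ea e1 e2 e3.
by rewrite [LHS]c1 e1 /cl /nw /= addn0.
Qed.

Lemma local_image a (l1 a0 l2 : seq nat) g0 g c w0 D0 c0 : sval a = l1 ++ a0 ++ l2 ->
  ing (size a0) g0 -> g = shsg (size l1) g0 -> webw (gsrc g0) a0 = w0 ->
  simg (odd (sumn l1)) a0 g0 = (c0, D0) -> sval_ K c0 = c ->
  [/\ fW a (gsrc g) = shw (sumn l1) w0, (simg false (sval a) g).2 = shd (sumn l1) D0,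
      sval_ K (simg false (sval a) g).1 = c & (simg false (sval a) g).1 = c0].
Proof.
move=> ea hin -> ew eD ec; have /andP[h1 _] := ing_src hin.
by rewrite /fW ea gsrc_sh webw_ctx // ew simg_ctx //= eD.
Qed.

End Images.

End Recognition.
Import Recognition.

(** * Images of generators and relations, and the functor *)

Module Soundness.

Section Soundness.
Variables (R : comPzRingType) (K : ground R) (n d : nat).
Local Notation mu := (bichar K).
Implicit Types a b : lam n d.
Local Notation ul := (@underline n d).
Local Notation feq := (@eqv R mu (fpr K d)).
Local Notation strans := (@tr R (schur_pres K n d) (fpr K d) (@fW n d) (fG K (n := n) (d := d))).

Lemma letter_range w a b i : wpath (S := schur_sig n d) w a b ->
  has (fun l => sidx l == i) w -> (0 < i < n)%N.
Proof.
elim: w b => //= l w IH b [c hw /schur_stepP hs] /orP[/eqP <-|]; last exact: IH hw.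
by move/sact_range: hs; rewrite lam_size.
Qed.

Lemma image_sound a b g u v p t : foam_image K a g t -> schur_gbd g a u v p ->
  wpath (S := schur_sig n d) u a b -> wpath (S := schur_sig n d) v a b ->
  feq (ul a) (ul b) (fW a u) (fW a v) p (fG K a g) t.
Proof.
move=> h hg pu pv; have range k : has (fun l => sidx l == k) (gsrc g ++ gtgt g) -> (0 < k < n)%N.
  case/schur_gbdP: hg => _ eu ev_ _; rewrite has_cat -eu -ev_.
  by case/orP; [apply: letter_range pu|apply: letter_range pv].
have eu : u = gsrc g by case/schur_gbdP: hg.
case: h hg eu range.
- move=> i c hw hg eu range; rewrite /c.
  have hr : (0 < i < n)%N by apply: range; rewrite /= eqxx ?orbT.
  have [l1 [l2 [ea es ec]]] := window2 hr hw.
  have eg : SDot i = shsg (size l1) (SDot 1) by rewrite /= es.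
  (* Source word and diagram are computed on the window. The diagram is the same for both parities,
     so [true] stands for either; the scalar is left to unification. *)
  have [h1 h2 _ h4] := @local_image R K n d a l1 [:: 1; 0]%N l2 (SDot 1) (SDot i) _
    ltac:(let w := eval vm_compute in (webw (gsrc (SDot 1)) [:: 1; 0]%N) in exact w)
    ltac:(let D := eval vm_compute in (simg true [:: 1; 0]%N (SDot 1)).2 in exact D) _ ea isT eg
    erefl erefl erefl.
  apply: (image_eqv hg pu pv);
  (* The same alternatives serve all cases: the earlier ones settle scalars, the last one
     well-formedness, the source word and the diagram. *)
  first [ by rewrite Gam_gam
        | by rewrite Gam_gam -sv_XY -sval_mul /simg eqxx
        | by rewrite Gam_gam /simg e1 e2 e3
        | by rewrite h4 Gam_gam ea -{}es2 gam_ctx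
        | by rewrite h4 /sval_ /= ?expr0 ?expr1; ring
        | by rewrite h4
        | by rewrite ?eu ?h1 ?h2 ?ec /= ?addnS ?addn0 /= ?eqxx ].
- move=> i c hw hg eu range; rewrite /c.
  have hr : (0 < i < n)%N by apply: range; rewrite /= eqxx ?orbT.
  have [l1 [l2 [ea es ec]]] := window2 hr hw.
  have eg : SDot i = shsg (size l1) (SDot 1) by rewrite /= es.
  have [h1 h2 _ h4] := @local_image R K n d a l1 [:: 2; 0]%N l2 (SDot 1) (SDot i) _
    ltac:(let w := eval vm_compute in (webw (gsrc (SDot 1)) [:: 2; 0]%N) in exact w)
    ltac:(let D := eval vm_compute in (simg true [:: 2; 0]%N (SDot 1)).2 in exact D) _ ea isT eg
    erefl erefl erefl.
  apply: (image_eqv hg pu pv);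
  first [ by rewrite Gam_gam
        | by rewrite Gam_gam -sv_XY -sval_mul /simg eqxx
        | by rewrite Gam_gam /simg e1 e2 e3
        | by rewrite h4 Gam_gam ea -{}es2 gam_ctx
        | by rewrite h4 /sval_ /= ?expr0 ?expr1; ring
        | by rewrite h4
        | by rewrite ?eu ?h1 ?h2 ?ec /= ?addnS ?addn0 /= ?eqxx ].
- move=> i c hw hg eu range; rewrite /c.
  have hr : (0 < i < n)%N by apply: range; rewrite /= eqxx ?orbT.
  have [l1 [l2 [ea es ec]]] := window2 hr hw.
  have eg : SDot i = shsg (size l1) (SDot 1) by rewrite /= es.
  have [h1 h2 _ h4] := @local_image R K n d a l1 [:: 1; 1]%N l2 (SDot 1) (SDot i) _
    ltac:(let w := eval vm_compute in (webw (gsrc (SDot 1)) [:: 1; 1]%N) in exact w)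
    ltac:(let D := eval vm_compute in (simg true [:: 1; 1]%N (SDot 1)).2 in exact D) _ ea isT eg
    erefl erefl erefl.
  apply: (image_eqv hg pu pv);
  first [ by rewrite Gam_gam
        | by rewrite Gam_gam -sv_XY -sval_mul /simg eqxx
        | by rewrite Gam_gam /simg e1 e2 e3
        | by rewrite h4 Gam_gam ea -{}es2 gam_ctx
        | by rewrite h4 /sval_ /= ?expr0 ?expr1; ring
        | by rewrite h4
        | by rewrite ?eu ?h1 ?h2 ?ec /= ?addnS ?addn0 /= ?eqxx ].
- move=> i c hw hg eu range; rewrite /c.
  have hr : (0 < i < n)%N by apply: range; rewrite /= eqxx ?orbT.
  have [l1 [l2 [ea es ec]]] := window2 hr hw.
  have eg : SDot i = shsg (size l1) (SDot 1) by rewrite /= es.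
  have [h1 h2 _ h4] := @local_image R K n d a l1 [:: 2; 1]%N l2 (SDot 1) (SDot i) _
    ltac:(let w := eval vm_compute in (webw (gsrc (SDot 1)) [:: 2; 1]%N) in exact w)
    ltac:(let D := eval vm_compute in (simg true [:: 2; 1]%N (SDot 1)).2 in exact D) _ ea isT eg
    erefl erefl erefl.
  apply: (image_eqv hg pu pv);
  first [ by rewrite Gam_gam
        | by rewrite Gam_gam -sv_XY -sval_mul /simg eqxx
        | by rewrite Gam_gam /simg e1 e2 e3
        | by rewrite h4 Gam_gam ea -{}es2 gam_ctx
        | by rewrite h4 /sval_ /= ?expr0 ?expr1; ring
        | by rewrite h4
        | by rewrite ?eu ?h1 ?h2 ?ec /= ?addnS ?addn0 /= ?eqxx ].
- move=> i hw hg eu range.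
  have hr : (0 < i < n)%N by apply: range; rewrite /= eqxx ?orbT.
  have [l1 [l2 [ea es ec]]] := window2 hr hw.
  have eg : SEta i = shsg (size l1) (SEta 1) by rewrite /= es.
  have [h1 h2 _ h4] := @local_image R K n d a l1 [:: 1; 0]%N l2 (SEta 1) (SEta i) _
    ltac:(let w := eval vm_compute in (webw (gsrc (SEta 1)) [:: 1; 0]%N) in exact w)
    ltac:(let D := eval vm_compute in (simg true [:: 1; 0]%N (SEta 1)).2 in exact D) _ ea isT eg
    erefl erefl erefl.
  apply: (@image_eqv1 R K n d a b _ u v p _ hg pu pv);
  first [ by rewrite Gam_gam
        | by rewrite Gam_gam -sv_XY -sval_mul /simg eqxx
        | by rewrite Gam_gam /simg e1 e2 e3
        | by rewrite h4 Gam_gam ea -{}es2 gam_ctx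
        | by rewrite h4 /sval_ /= ?expr0 ?expr1; ring
        | by rewrite h4
        | by rewrite ?eu ?h1 ?h2 ?ec /= ?addnS ?addn0 /= ?eqxx ].
- move=> i c hw hg eu range; rewrite /c.
  have hr : (0 < i < n)%N by apply: range; rewrite /= eqxx ?orbT.
  have [l1 [l2 [ea es ec]]] := window2 hr hw.
  have eg : SEta i = shsg (size l1) (SEta 1) by rewrite /= es.
  have [h1 h2 _ h4] := @local_image R K n d a l1 [:: 2; 0]%N l2 (SEta 1) (SEta i) _
    ltac:(let w := eval vm_compute in (webw (gsrc (SEta 1)) [:: 2; 0]%N) in exact w)
    ltac:(let D := eval vm_compute in (simg true [:: 2; 0]%N (SEta 1)).2 in exact D) _ ea isT eg
    erefl erefl erefl.
  apply: (image_eqv hg pu pv);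
  first [ by rewrite Gam_gam
        | by rewrite Gam_gam -sv_XY -sval_mul /simg eqxx
        | by rewrite Gam_gam /simg e1 e2 e3
        | by rewrite h4 Gam_gam ea -{}es2 gam_ctx
        | by rewrite h4 /sval_ /= ?expr0 ?expr1; ring
        | by rewrite h4
        | by rewrite ?eu ?h1 ?h2 ?ec /= ?addnS ?addn0 /= ?eqxx ].
- move=> i c hw hg eu range; rewrite /c.
  have hr : (0 < i < n)%N by apply: range; rewrite /= eqxx ?orbT.
  have [l1 [l2 [ea es ec]]] := window2 hr hw.
  have eg : SEta i = shsg (size l1) (SEta 1) by rewrite /= es.
  have [h1 h2 _ h4] := @local_image R K n d a l1 [:: 1; 1]%N l2 (SEta 1) (SEta i) _
    ltac:(let w := eval vm_compute in (webw (gsrc (SEta 1)) [:: 1; 1]%N) in exact w)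
    ltac:(let D := eval vm_compute in (simg true [:: 1; 1]%N (SEta 1)).2 in exact D) _ ea isT eg
    erefl erefl erefl.
  apply: (@image_eqv1 R K n d a b _ u v p _ hg pu pv);
  first [ by rewrite Gam_gam
        | by rewrite Gam_gam -sv_XY -sval_mul /simg eqxx
        | by rewrite Gam_gam /simg e1 e2 e3
        | by rewrite h4 Gam_gam ea -{}es2 gam_ctx
        | by rewrite h4 /sval_ /= ?expr0 ?expr1; ring
        | by rewrite h4
        | by rewrite ?eu ?h1 ?h2 ?ec /= ?addnS ?addn0 /= ?eqxx ].
- move=> i c hw hg eu range; rewrite /c.
  have hr : (0 < i < n)%N by apply: range; rewrite /= eqxx ?orbT.
  have [l1 [l2 [ea es ec]]] := window2 hr hw.
  have eg : SEta i = shsg (size l1) (SEta 1) by rewrite /= es.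
  have [h1 h2 _ h4] := @local_image R K n d a l1 [:: 2; 1]%N l2 (SEta 1) (SEta i) _
    ltac:(let w := eval vm_compute in (webw (gsrc (SEta 1)) [:: 2; 1]%N) in exact w)
    ltac:(let D := eval vm_compute in (simg true [:: 2; 1]%N (SEta 1)).2 in exact D) _ ea isT eg
    erefl erefl erefl.
  apply: (image_eqv hg pu pv);
  first [ by rewrite Gam_gam
        | by rewrite Gam_gam -sv_XY -sval_mul /simg eqxx
        | by rewrite Gam_gam /simg e1 e2 e3
        | by rewrite h4 Gam_gam ea -{}es2 gam_ctx
        | by rewrite h4 /sval_ /= ?expr0 ?expr1; ring
        | by rewrite h4
        | by rewrite ?eu ?h1 ?h2 ?ec /= ?addnS ?addn0 /= ?eqxx ].
- move=> i hw hg eu range.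
  have hr : (0 < i < n)%N by apply: range; rewrite /= eqxx ?orbT.
  have [l1 [l2 [ea es ec]]] := window2 hr hw.
  have eg : SEps i = shsg (size l1) (SEps 1) by rewrite /= es.
  have [h1 h2 _ h4] := @local_image R K n d a l1 [:: 0; 1]%N l2 (SEps 1) (SEps i) _
    ltac:(let w := eval vm_compute in (webw (gsrc (SEps 1)) [:: 0; 1]%N) in exact w)
    ltac:(let D := eval vm_compute in (simg true [:: 0; 1]%N (SEps 1)).2 in exact D) _ ea isT eg
    erefl erefl erefl.
  apply: (@image_eqv1 R K n d a b _ u v p _ hg pu pv);
  first [ by rewrite Gam_gam
        | by rewrite Gam_gam -sv_XY -sval_mul /simg eqxx
        | by rewrite Gam_gam /simg e1 e2 e3
        | by rewrite h4 Gam_gam ea -{}es2 gam_ctx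
        | by rewrite h4 /sval_ /= ?expr0 ?expr1; ring
        | by rewrite h4
        | by rewrite ?eu ?h1 ?h2 ?ec /= ?addnS ?addn0 /= ?eqxx ].
- move=> i c hw hg eu range; rewrite /c.
  have hr : (0 < i < n)%N by apply: range; rewrite /= eqxx ?orbT.
  have [l1 [l2 [ea es ec]]] := window2 hr hw.
  have eg : SEps i = shsg (size l1) (SEps 1) by rewrite /= es.
  have [h1 h2 _ h4] := @local_image R K n d a l1 [:: 0; 2]%N l2 (SEps 1) (SEps i) _
    ltac:(let w := eval vm_compute in (webw (gsrc (SEps 1)) [:: 0; 2]%N) in exact w)
    ltac:(let D := eval vm_compute in (simg true [:: 0; 2]%N (SEps 1)).2 in exact D) _ ea isT eg
    erefl erefl erefl.
  apply: (@image_eqv1 R K n d a b _ u v p _ hg pu pv);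
  first [ by rewrite Gam_gam
        | by rewrite Gam_gam -sv_XY -sval_mul /simg eqxx
        | by rewrite Gam_gam /simg e1 e2 e3
        | by rewrite h4 Gam_gam ea -{}es2 gam_ctx
        | by rewrite h4 /sval_ /= ?expr0 ?expr1; ring
        | by rewrite h4
        | by rewrite ?eu ?h1 ?h2 ?ec /= ?addnS ?addn0 /= ?eqxx ].
- move=> i c hw hg eu range; rewrite /c.
  have hr : (0 < i < n)%N by apply: range; rewrite /= eqxx ?orbT.
  have [l1 [l2 [ea es ec]]] := window2 hr hw.
  have eg : SEps i = shsg (size l1) (SEps 1) by rewrite /= es.
  have [h1 h2 _ h4] := @local_image R K n d a l1 [:: 1; 1]%N l2 (SEps 1) (SEps i) _
    ltac:(let w := eval vm_compute in (webw (gsrc (SEps 1)) [:: 1; 1]%N) in exact w)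
    ltac:(let D := eval vm_compute in (simg true [:: 1; 1]%N (SEps 1)).2 in exact D) _ ea isT eg
    erefl erefl erefl.
  apply: (@image_eqv1 R K n d a b _ u v p _ hg pu pv);
  first [ by rewrite Gam_gam
        | by rewrite Gam_gam -sv_XY -sval_mul /simg eqxx
        | by rewrite Gam_gam /simg e1 e2 e3
        | by rewrite h4 Gam_gam ea -{}es2 gam_ctx
        | by rewrite h4 /sval_ /= ?expr0 ?expr1; ring
        | by rewrite h4
        | by rewrite ?eu ?h1 ?h2 ?ec /= ?addnS ?addn0 /= ?eqxx ].
- move=> i c hw hg eu range; rewrite /c.
  have hr : (0 < i < n)%N by apply: range; rewrite /= eqxx ?orbT.
  have [l1 [l2 [ea es ec]]] := window2 hr hw.
  have eg : SEps i = shsg (size l1) (SEps 1) by rewrite /= es.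
  have [h1 h2 _ h4] := @local_image R K n d a l1 [:: 1; 2]%N l2 (SEps 1) (SEps i) _
    ltac:(let w := eval vm_compute in (webw (gsrc (SEps 1)) [:: 1; 2]%N) in exact w)
    ltac:(let D := eval vm_compute in (simg true [:: 1; 2]%N (SEps 1)).2 in exact D) _ ea isT eg
    erefl erefl erefl.
  apply: (@image_eqv1 R K n d a b _ u v p _ hg pu pv);
  first [ by rewrite Gam_gam
        | by rewrite Gam_gam -sv_XY -sval_mul /simg eqxx
        | by rewrite Gam_gam /simg e1 e2 e3
        | by rewrite h4 Gam_gam ea -{}es2 gam_ctx
        | by rewrite h4 /sval_ /= ?expr0 ?expr1; ring
        | by rewrite h4
        | by rewrite ?eu ?h1 ?h2 ?ec /= ?addnS ?addn0 /= ?eqxx ].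
- move=> i c hw hg eu range; rewrite /c.
  have hr1 : (0 < i.-1 < n)%N by apply: range; rewrite /= eqxx ?orbT.
  have hr : (0 < i < n)%N by apply: range; rewrite /= eqxx ?orbT.
  have [||l1 [l2 [ea es1 es2 ec]]] := window3 _ _ hw; try lia.
  have e1 : (i.-1 == i) = false by apply/eqP; lia.
  have e2 : (i.-1 == i.+1) = false by apply/eqP; lia.
  have e3 : (i == i.-1.+1) = true by apply/eqP; lia.
  have eg : STau i i.-1 = shsg (size l1) (STau 2 1) by rewrite /= es1 es2.
  have [h1 h2 _ h4] := @local_image R K n d a l1 [:: 1; 1; 0]%N l2 (STau 2 1) (STau i i.-1) _
    ltac:(let w := eval vm_compute in (webw (gsrc (STau 2 1)) [:: 1; 1; 0]%N) in exact w)
    ltac:(let D := eval vm_compute in (simg true [:: 1; 1; 0]%N (STau 2 1)).2 in exact D) _ ea isT eg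
    erefl erefl erefl.
  apply: (@image_eqv1 R K n d a b _ u v p _ hg pu pv);
  first [ by rewrite Gam_gam
        | by rewrite Gam_gam -sv_XY -sval_mul /simg eqxx
        | by rewrite Gam_gam /simg e1 e2 e3
        | by rewrite h4 Gam_gam ea -{}es2 gam_ctx
        | by rewrite h4 /sval_ /= ?expr0 ?expr1; ring
        | by rewrite h4
        | by rewrite ?eu ?h1 ?h2 ?ec /= ?addnS ?addn0 /= ?eqxx ].
- move=> i c hw hg eu range; rewrite /c.
  have hr1 : (0 < i.-1 < n)%N by apply: range; rewrite /= eqxx ?orbT.
  have hr : (0 < i < n)%N by apply: range; rewrite /= eqxx ?orbT.
  have [||l1 [l2 [ea es1 es2 ec]]] := window3 _ _ hw; try lia.
  have e1 : (i.-1 == i) = false by apply/eqP; lia.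
  have e2 : (i.-1 == i.+1) = false by apply/eqP; lia.
  have e3 : (i == i.-1.+1) = true by apply/eqP; lia.
  have eg : STau i i.-1 = shsg (size l1) (STau 2 1) by rewrite /= es1 es2.
  have [h1 h2 _ h4] := @local_image R K n d a l1 [:: 2; 1; 0]%N l2 (STau 2 1) (STau i i.-1) _
    ltac:(let w := eval vm_compute in (webw (gsrc (STau 2 1)) [:: 2; 1; 0]%N) in exact w)
    ltac:(let D := eval vm_compute in (simg true [:: 2; 1; 0]%N (STau 2 1)).2 in exact D) _ ea isT eg
    erefl erefl erefl.
  apply: (@image_eqv1 R K n d a b _ u v p _ hg pu pv);
  first [ by rewrite Gam_gam
        | by rewrite Gam_gam -sv_XY -sval_mul /simg eqxx
        | by rewrite Gam_gam /simg e1 e2 e3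
        | by rewrite h4 Gam_gam ea -{}es2 gam_ctx
        | by rewrite h4 /sval_ /= ?expr0 ?expr1; ring
        | by rewrite h4
        | by rewrite ?eu ?h1 ?h2 ?ec /= ?addnS ?addn0 /= ?eqxx ].
- move=> i c hw hg eu range; rewrite /c.
  have hr1 : (0 < i.-1 < n)%N by apply: range; rewrite /= eqxx ?orbT.
  have hr : (0 < i < n)%N by apply: range; rewrite /= eqxx ?orbT.
  have [||l1 [l2 [ea es1 es2 ec]]] := window3 _ _ hw; try lia.
  have e1 : (i.-1 == i) = false by apply/eqP; lia.
  have e2 : (i.-1 == i.+1) = false by apply/eqP; lia.
  have e3 : (i == i.-1.+1) = true by apply/eqP; lia.
  have eg : STau i i.-1 = shsg (size l1) (STau 2 1) by rewrite /= es1 es2.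
  have [h1 h2 _ h4] := @local_image R K n d a l1 [:: 1; 1; 1]%N l2 (STau 2 1) (STau i i.-1) _
    ltac:(let w := eval vm_compute in (webw (gsrc (STau 2 1)) [:: 1; 1; 1]%N) in exact w)
    ltac:(let D := eval vm_compute in (simg true [:: 1; 1; 1]%N (STau 2 1)).2 in exact D) _ ea isT eg
    erefl erefl erefl.
  apply: (@image_eqv1 R K n d a b _ u v p _ hg pu pv);
  first [ by rewrite Gam_gam
        | by rewrite Gam_gam -sv_XY -sval_mul /simg eqxx
        | by rewrite Gam_gam /simg e1 e2 e3
        | by rewrite h4 Gam_gam ea -{}es2 gam_ctx
        | by rewrite h4 /sval_ /= ?expr0 ?expr1; ring
        | by rewrite h4
        | by rewrite ?eu ?h1 ?h2 ?ec /= ?addnS ?addn0 /= ?eqxx ].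
- move=> i c hw hg eu range; rewrite /c.
  have hr1 : (0 < i.-1 < n)%N by apply: range; rewrite /= eqxx ?orbT.
  have hr : (0 < i < n)%N by apply: range; rewrite /= eqxx ?orbT.
  have [||l1 [l2 [ea es1 es2 ec]]] := window3 _ _ hw; try lia.
  have e1 : (i.-1 == i) = false by apply/eqP; lia.
  have e2 : (i.-1 == i.+1) = false by apply/eqP; lia.
  have e3 : (i == i.-1.+1) = true by apply/eqP; lia.
  have eg : STau i i.-1 = shsg (size l1) (STau 2 1) by rewrite /= es1 es2.
  have [h1 h2 _ h4] := @local_image R K n d a l1 [:: 2; 1; 1]%N l2 (STau 2 1) (STau i i.-1) _
    ltac:(let w := eval vm_compute in (webw (gsrc (STau 2 1)) [:: 2; 1; 1]%N) in exact w)
    ltac:(let D := eval vm_compute in (simg true [:: 2; 1; 1]%N (STau 2 1)).2 in exact D) _ ea isT eg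
    erefl erefl erefl.
  apply: (@image_eqv1 R K n d a b _ u v p _ hg pu pv);
  first [ by rewrite Gam_gam
        | by rewrite Gam_gam -sv_XY -sval_mul /simg eqxx
        | by rewrite Gam_gam /simg e1 e2 e3
        | by rewrite h4 Gam_gam ea -{}es2 gam_ctx
        | by rewrite h4 /sval_ /= ?expr0 ?expr1; ring
        | by rewrite h4
        | by rewrite ?eu ?h1 ?h2 ?ec /= ?addnS ?addn0 /= ?eqxx ].
- move=> i c hw hg eu range; rewrite /c.
  have hr1 : (0 < i.-1 < n)%N by apply: range; rewrite /= eqxx ?orbT.
  have hr : (0 < i < n)%N by apply: range; rewrite /= eqxx ?orbT.
  have [||l1 [l2 [ea es1 es2 ec]]] := window3 _ _ hw; try lia.
  have e1 : (i.-1 == i) = false by apply/eqP; lia.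
  have e2 : (i.-1 == i.+1) = false by apply/eqP; lia.
  have e3 : (i == i.-1.+1) = true by apply/eqP; lia.
  have eg : STau i.-1 i = shsg (size l1) (STau 1 2) by rewrite /= es1 es2.
  have [h1 h2 _ h4] := @local_image R K n d a l1 [:: 1; 1; 0]%N l2 (STau 1 2) (STau i.-1 i) _
    ltac:(let w := eval vm_compute in (webw (gsrc (STau 1 2)) [:: 1; 1; 0]%N) in exact w)
    ltac:(let D := eval vm_compute in (simg true [:: 1; 1; 0]%N (STau 1 2)).2 in exact D) _ ea isT eg
    erefl erefl erefl.
  apply: (image_eqv hg pu pv);
  first [ by rewrite Gam_gam
        | by rewrite Gam_gam -sv_XY -sval_mul /simg eqxx
        | by rewrite Gam_gam /simg e1 e2 e3
        | by rewrite h4 Gam_gam ea -{}es2 gam_ctx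
        | by rewrite h4 /sval_ /= ?expr0 ?expr1; ring
        | by rewrite h4
        | by rewrite ?eu ?h1 ?h2 ?ec /= ?addnS ?addn0 /= ?eqxx ].
- move=> i c hw hg eu range; rewrite /c.
  have hr1 : (0 < i.-1 < n)%N by apply: range; rewrite /= eqxx ?orbT.
  have hr : (0 < i < n)%N by apply: range; rewrite /= eqxx ?orbT.
  have [||l1 [l2 [ea es1 es2 ec]]] := window3 _ _ hw; try lia.
  have e1 : (i.-1 == i) = false by apply/eqP; lia.
  have e2 : (i.-1 == i.+1) = false by apply/eqP; lia.
  have e3 : (i == i.-1.+1) = true by apply/eqP; lia.
  have eg : STau i.-1 i = shsg (size l1) (STau 1 2) by rewrite /= es1 es2.
  have [h1 h2 _ h4] := @local_image R K n d a l1 [:: 2; 1; 0]%N l2 (STau 1 2) (STau i.-1 i) _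
    ltac:(let w := eval vm_compute in (webw (gsrc (STau 1 2)) [:: 2; 1; 0]%N) in exact w)
    ltac:(let D := eval vm_compute in (simg true [:: 2; 1; 0]%N (STau 1 2)).2 in exact D) _ ea isT eg
    erefl erefl erefl.
  apply: (image_eqv hg pu pv);
  first [ by rewrite Gam_gam
        | by rewrite Gam_gam -sv_XY -sval_mul /simg eqxx
        | by rewrite Gam_gam /simg e1 e2 e3
        | by rewrite h4 Gam_gam ea -{}es2 gam_ctx
        | by rewrite h4 /sval_ /= ?expr0 ?expr1; ring
        | by rewrite h4
        | by rewrite ?eu ?h1 ?h2 ?ec /= ?addnS ?addn0 /= ?eqxx ].
- move=> i c hw hg eu range; rewrite /c.
  have hr1 : (0 < i.-1 < n)%N by apply: range; rewrite /= eqxx ?orbT.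
  have hr : (0 < i < n)%N by apply: range; rewrite /= eqxx ?orbT.
  have [||l1 [l2 [ea es1 es2 ec]]] := window3 _ _ hw; try lia.
  have e1 : (i.-1 == i) = false by apply/eqP; lia.
  have e2 : (i.-1 == i.+1) = false by apply/eqP; lia.
  have e3 : (i == i.-1.+1) = true by apply/eqP; lia.
  have eg : STau i.-1 i = shsg (size l1) (STau 1 2) by rewrite /= es1 es2.
  have [h1 h2 _ h4] := @local_image R K n d a l1 [:: 1; 1; 1]%N l2 (STau 1 2) (STau i.-1 i) _
    ltac:(let w := eval vm_compute in (webw (gsrc (STau 1 2)) [:: 1; 1; 1]%N) in exact w)
    ltac:(let D := eval vm_compute in (simg true [:: 1; 1; 1]%N (STau 1 2)).2 in exact D) _ ea isT eg
    erefl erefl erefl.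
  apply: (image_eqv hg pu pv);
  first [ by rewrite Gam_gam
        | by rewrite Gam_gam -sv_XY -sval_mul /simg eqxx
        | by rewrite Gam_gam /simg e1 e2 e3
        | by rewrite h4 Gam_gam ea -{}es2 gam_ctx
        | by rewrite h4 /sval_ /= ?expr0 ?expr1; ring
        | by rewrite h4
        | by rewrite ?eu ?h1 ?h2 ?ec /= ?addnS ?addn0 /= ?eqxx ].
- move=> i c hw hg eu range; rewrite /c.
  have hr1 : (0 < i.-1 < n)%N by apply: range; rewrite /= eqxx ?orbT.
  have hr : (0 < i < n)%N by apply: range; rewrite /= eqxx ?orbT.
  have [||l1 [l2 [ea es1 es2 ec]]] := window3 _ _ hw; try lia.
  have e1 : (i.-1 == i) = false by apply/eqP; lia.
  have e2 : (i.-1 == i.+1) = false by apply/eqP; lia.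
  have e3 : (i == i.-1.+1) = true by apply/eqP; lia.
  have eg : STau i.-1 i = shsg (size l1) (STau 1 2) by rewrite /= es1 es2.
  have [h1 h2 _ h4] := @local_image R K n d a l1 [:: 2; 1; 1]%N l2 (STau 1 2) (STau i.-1 i) _
    ltac:(let w := eval vm_compute in (webw (gsrc (STau 1 2)) [:: 2; 1; 1]%N) in exact w)
    ltac:(let D := eval vm_compute in (simg true [:: 2; 1; 1]%N (STau 1 2)).2 in exact D) _ ea isT eg
    erefl erefl erefl.
  apply: (image_eqv hg pu pv);
  first [ by rewrite Gam_gam
        | by rewrite Gam_gam -sv_XY -sval_mul /simg eqxx
        | by rewrite Gam_gam /simg e1 e2 e3
        | by rewrite h4 Gam_gam ea -{}es2 gam_ctx
        | by rewrite h4 /sval_ /= ?expr0 ?expr1; ring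
        | by rewrite h4
        | by rewrite ?eu ?h1 ?h2 ?ec /= ?addnS ?addn0 /= ?eqxx ].
- move=> i c hw hg eu range; rewrite /c.
  have hr : (0 < i < n)%N by apply: range; rewrite /= eqxx ?orbT.
  have [l1 [l2 [ea es ec]]] := window2 hr hw.
  have eg : STau i i = shsg (size l1) (STau 1 1) by rewrite /= es.
  have [h1 h2 _ h4] := @local_image R K n d a l1 [:: 2; 0]%N l2 (STau 1 1) (STau i i) _
    ltac:(let w := eval vm_compute in (webw (gsrc (STau 1 1)) [:: 2; 0]%N) in exact w)
    ltac:(let D := eval vm_compute in (simg true [:: 2; 0]%N (STau 1 1)).2 in exact D) _ ea isT eg
    erefl erefl erefl.
  apply: (image_eqv hg pu pv);
  first [ by rewrite Gam_gam
        | by rewrite Gam_gam -sv_XY -sval_mul /simg eqxx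
        | by rewrite Gam_gam /simg e1 e2 e3
        | by rewrite h4 Gam_gam ea -{}es2 gam_ctx
        | by rewrite h4 /sval_ /= ?expr0 ?expr1; ring
        | by rewrite h4
        | by rewrite ?eu ?h1 ?h2 ?ec /= ?addnS ?addn0 /= ?eqxx ].
- move=> i j u0 v0 hf /foam_webE -> /foam_webE -> hg eu _.
  have [x1 x2 _ x4] := fexchange_flat R d (web (Fl i) (sval a)) (web (Fl j) (sval a)).
  have hT : simg false (sval a) (STau i j) =
      (sone, exch (web (Fl i) (sval a)) (web (Fl j) (sval a))).
    by move: hf; rewrite /far /simg => hf; rewrite !ifF //; apply/eqP; lia.
  apply: (@image_eqv1 R K n d a b _ u v p _ hg pu pv) => //; rewrite ?hT ?x2 ?x4 //.
  by move: pu; rewrite eu => /spathP pu; rewrite /fW (webw_far2 _ pu).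
Qed.

Lemma far_or_adjacent i j : i != j -> adjacent i j \/ far i j.
Proof. by rewrite /adjacent /far => h; lia. Qed.

Lemma fG_rel a b u v p s t s' t' : rels (p := schur_pres K n d) a s t ->
  strans a b u v p s s' -> strans a b u v p t t' ->
  feq (ul a) (ul b) (fW a u) (fW a v) p s' t'.
Proof.
case=> s0 [t0 [h -> ->]]; suff : @respected R K n d a s0 t0 by apply.
case: h => {s t s' t' s0 t0}.
- by move=> i; apply: rel_dot2.
- by move=> i; apply: rel_tau2.
- by move=> i j hf; apply: rel_tau2_far.
- by move=> i j ->; apply: rel_tau2_succ.
- by move=> i j ->; apply: rel_tau2_pred.
- by move=> i j /far_or_adjacent[h|h]; [apply: rel_dtl_near|apply: rel_dtl_far].
- by move=> i j /far_or_adjacent[h|h]; [apply: rel_dtr_near|apply: rel_dtr_far].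
- by move=> i; apply: rel_nil_l.
- by move=> i; apply: rel_nil_r.
- by move=> i j k h; apply: rel_braid.
- by move=> i j ->; apply: rel_serre_succ.
- by move=> i j ->; apply: rel_serre_pred.
- by move=> i; apply: rel_adj_F.
- by move=> i; apply: rel_adj_E.
- by move=> i j /far_or_adjacent[h|h]; [apply: rel_sinv_l_near|apply: rel_sinv_l_far].
- by move=> i j /far_or_adjacent[h|h]; [apply: rel_sinv_r_near|apply: rel_sinv_r_far].
- by move=> i h1 h2; apply: rel_pos_r.
- by move=> i h1 h2; apply: rel_pos_l.
- by move=> i m h1 h2; apply: rel_pos_l_dots.
- by move=> i m h1 h2; apply: rel_pos_dots_l.
- by move=> i m m' h1 h2 h3; apply: rel_pos_dots.
- by move=> i h1 h2; apply: rel_neg_l.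
- by move=> i h1 h2; apply: rel_neg_r.
- by move=> i m h1 h2; apply: rel_neg_dots_r.
- by move=> i m h1 h2; apply: rel_neg_r_dots.
- by move=> i m m' h1 h2 h3; apply: rel_neg_dots.
Qed.

End Soundness.

End Soundness.
Import Soundness.

(* The inverse generators of GSchur, not mentioned by [foam_image], are sent to
   the entries of the inverses of the images. *)
Theorem proposition4p8 (R : comPzRingType) (K : ground R) (n d : nat) :
  exists F : gr2functor (GSchur K n d) (GFoam K d),
    [/\ (forall a : GSchur K n d, F a = underline a :> GFoam K d),
        (forall (a b : GSchur K n d) (f : hom1 a b) (l : slet) (w : seq wlet),
           sval f = [:: l] -> foam_web a l w -> sval (fhom1 F f) = w)
      & (forall (a b : GSchur K n d) (f g : hom1 a b) (p : Z2)
           (x : hom2 f g p) (s : sgen) (t : raw R (foam_sig d)),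
           represents x (@Gen R (schur_sig n d) s) ->
           foam_image K a s t -> represents (fhom2 F x) t)].
Proof.
have sf (l : slet) (a b b' : lam n d) : schur_step l a b -> schur_step l a b' -> b = b'.
  exact: step_fun.
have gf (x : sgen) (a : lam n d) u v p u' v' p' : schur_gbd x a u v p ->
    schur_gbd x a u' v' p' -> [/\ u = u', v = v' & p = p'].
  by move=> /schur_gbdP[_ -> -> ->] /schur_gbdP[_ -> -> ->].
have wc (a b : lam n d) u v : wpath (S := schur_sig n d) v a b ->
    fW a (u ++ v) = fW b u ++ fW a v.
  by move=> /spathP; apply: webw_cat.
have [F [h0 h1 h2]] := @extension R (bichar K) (schur_pres K n d) (fpr K d)
  (@underline n d) (@fW n d) (fG K (n := n) (d := d)) sf gf (fun _ => erefl) wc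
  (fun a b u => @webw_fpath n d u a b) (@fG_typed R K n d) (@fG_rel R K n d).
exists F; split=> // [a b f l w ef hw|a b f g p x s t hx hi].
  by rewrite h1 ef /fW /= cats0 (foam_webE hw).
have ht : @typed R (schur_sig n d) a b (sval f) (sval g) p (@Gen R (schur_sig n d) s).
  exact: represents_typed hx.
have [t' hs] : exists t', @tr R (schur_pres K n d) (fpr K d) (@fW n d)
    (fG K (n := n) (d := d)) a b (sval f) (sval g) p (@Gen R (schur_sig n d) s) t'.
  by apply: tr_exists; exact: ht.
have := hs => /tr_inv[hg pu pv et].
(* The only translation of a generator is [fG], and [image_sound] shows it equivalent to the
   prescribed value. *)
by apply: h2 hx hs _; rewrite et; apply: image_sound hi hg pu pv.
Qed.
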